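(* Let $p\ge2$ and assume that $W$ satisfies (A1), (A2) and (A3) (as listed in the context). Let $v_0\in L^{2}(\mathbb{T}^d)$, $F_0\in H^{1}(\mathbb{T}^d)\cap L^{p}(\mathbb{T}^d)$, and let $(v,F)$ be a weak solution (in the sense defined in the context) with initial data $(v_0,F_0)$. If $F\in L^{\infty}(0,T;H^{1}(\mathbb{T}^d))$, and either $d=2$ and $p\ge 2$, or $d=3$ and $2\le p\le 4$, then, for any $t\in[0,T]$ (with $(v,F)$ identified with its representative in $C([0,T];L^2(\mathbb{T}^d))$), $$\int\frac{|v(t)|^2}{2}+W(F(t))\,dx+\int_0^t\int|\nabla v|^2\,dx\,ds=\int\frac{|v_0|^2}{2}+W(F_0)\,dx .$$
   Context: Setting: $\mathbb{T}^d$ is the $d$-dimensional torus, $T>0$ is arbitrary but finite, $W:\mathbb{R}^{d\times d}\to\mathbb{R}$ is a stored energy and $S=DW$; $A:B=\mathrm{tr}(AB^T)$. Spatial integrals are over $\mathbb{T}^d$. The system for $v:(0,T)\times\mathbb{T}^d\to\mathbb{R}^d$, $F:(0,T)\times\mathbb{T}^d\to\mathbb{R}^{d\times d}$ is $$\partial_t v-\mathrm{div}(S(F))-\Delta v=0,\qquad \partial_t F-\nabla v=0,\qquad \mathrm{curl}\,F=0,\qquad v|_{t=0}=v_0,\quad F|_{t=0}=F_0=\nabla y_0,$$ where $(\nabla v)_{i\alpha}=\partial_\alpha v_i$, $(\mathrm{div}\,S)_i=\partial_\alpha S_{i\alpha}$. Hypotheses on $W$ (for the given $p\ge2$): (A1)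 $W\in C^2(\mathbb{R}^{d\times d};\mathbb{R})$. (A2) There is $c>0$ with $c(|F|^p-1)\le W(F)$ for all $F$. (A3) There is $C>0$ with $|W(F)|\le C(1+|F|^p)$ and $|DW(F)|\le C(1+|F|^{p-1})$ for all $F$. Weak solution: for $v_0\in L^2(\mathbb{T}^d)$, $F_0\in L^p(\mathbb{T}^d)$, a pair $(v,F)$ with $v\in L^\infty(0,T;L^2(\mathbb{T}^d))\cap L^2(0,T;H^1(\mathbb{T}^d))$ and $F\in L^\infty(0,T;L^p(\mathbb{T}^d))$ is a weak solution if (i) for all (appropriately vector/matrix valued) $\phi,\psi\in C_c^\infty([0,T);C^\infty(\mathbb{T}^d))$, $$\iint v\cdot\psi_t-S(F):\nabla\psi-\nabla v:\nabla\psi\,dx\,dt+\int v_0(x)\cdot\psi(0,x)\,dx=0,$$ $$\iint F:\phi_t+\nabla v:\phi\,dx\,dt+\int F_0(x):\phi(0,x)\,dx=0,$$ and $F(t,x)=\nabla y(t,x)$ for a.e. $(t,x)\in(0,T)\times\mathbb{T}^d$ for some $y:(0,T)\times\mathbb{T}^d\to\mathbb{R}^d$; (ii) the energy inequality holds for a.e. $t\in(0,T)$: $$\int \frac{|v|^2}{2}+W(F)\,dx+\int_0^t\int|\nabla v|^2\,dx\,ds\le\int\frac{|v_0|^2}{2}+W(F_0)\,dx.$$ *)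

(* Defs.v *)
From HB Require Import structures.
From mathcomp Require Import all_boot all_order all_algebra.
From mathcomp Require Import all_classical all_reals all_analysis.
Set Implicit Arguments.
Unset Strict Implicit.
Unset Printing Implicit Defensive.
Import Order.TTheory GRing.Theory Num.Theory.
Import numFieldNormedType.Exports.
Local Open Scope classical_set_scope.
Local Open Scope ring_scope.

(* MathComp-Analysis has neither a sigma-algebra on matrices nor a Lebesgue
   measure on R^d. Matrices get the product sigma-algebra of their entries,
   i.e. the Borel sets. *)
Definition measure_matrix_display : measure_display.
Proof. exact. Qed.

Definition matrix_cylinder (R : realType) (m n : nat) : set (set 'M[R]_(m, n)) :=
  [set B | exists i j (A : set (measurableTypeR R)), measurable A /\
             B = [set M : 'M[R]_(m, n) | A (M i j)]].
Arguments matrix_cylinder : clear implicits.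

Section matrix_measurable.
Variables (R : realType) (m n : nat).

Let mx_set0 : <<s matrix_cylinder R m n >> set0.
Proof. exact: sigma_algebra0. Qed.

Let mx_setC A :
  <<s matrix_cylinder R m n >> A -> <<s matrix_cylinder R m n >> (~` A).
Proof. exact: sigma_algebraC. Qed.

Let mx_bigcup (F : (set 'M[R]_(m, n))^nat) :
  (forall i, <<s matrix_cylinder R m n >> (F i)) ->
  <<s matrix_cylinder R m n >> (\bigcup_i F i).
Proof. exact: sigma_algebra_bigcup. Qed.

HB.instance Definition _ := @isMeasurable.Build measure_matrix_display
  'M[R]_(m, n) <<s matrix_cylinder R m n >> mx_set0 mx_setC mx_bigcup.

End matrix_measurable.

Lemma measurable_mx_entry (R : realType) (m n : nat) (i : 'I_m) (j : 'I_n) :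
  measurable_fun setT (fun M : 'M[R]_(m, n) => (M i j : measurableTypeR R)).
Proof.
move=> _ A mA; rewrite setTI; apply: sub_sigma_algebra.
by exists i, j, A.
Qed.

Lemma measurable_fun_mxP d (X : measurableType d) (R : realType) (m n : nat)
    (D : set X) (f : X -> 'M[R]_(m, n)) : measurable D ->
  measurable_fun D f <->
  forall i j, measurable_fun D (fun x => (f x i j : measurableTypeR R)).
Proof.
move=> mD; split=> [mf i j|mf].
  exact: (measurableT_comp (@measurable_mx_entry R m n i j) mf).
apply: (@measurability _ _ _ _ _ _ (matrix_cylinder R m n)) => //.
move=> _ [_ [i [j [A [mA ->]]]] <-].
exact: (mf i j mD A mA).
Qed.

Definition rV_cons (R : realType) (n : nat)
    (z : measurableTypeR R * 'rV[R]_n) : 'rV[R]_n.+1 :=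
  row_mx (const_mx z.1 : 'rV[R]_1) z.2.

Lemma measurable_rV_cons (R : realType) (n : nat) :
  measurable_fun setT (@rV_cons R n).
Proof.
apply/measurable_fun_mxP => // i j.
case: (split_ordP (j : 'I_(1 + n))) => k jk.
  rewrite (_ : (fun _ => _) = fst); first exact: measurable_fst.
  apply/funext => z; rewrite /rV_cons jk.
  by rewrite [LHS](row_mxEl (const_mx z.1) z.2) mxE.
rewrite (_ : (fun _ => _) = (fun M : 'rV[R]_n => (M i k : measurableTypeR R)) \o snd).
  exact: (measurableT_comp (@measurable_mx_entry R 1 n i k) measurable_snd).
by apply/funext => z; rewrite /rV_cons jk; exact: row_mxEr.
Qed.

HB.instance Definition _ (R : realType) (n : nat) :=
  @isMeasurableFun.Build _ _ _ _ (@rV_cons R n) (@measurable_rV_cons R n).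

(* The torus is T^d = (R/Z)^d. A measurable function on it is represented by a
   function on R^d = 'rV_d of which only the values on the unit cube matter,
   since [torus_measure] is Lebesgue measure on that cube; smooth functions on
   T^d are the smooth Z^d-periodic functions on R^d. *)
Fixpoint torus_measure (R : realType) (d : nat) : probability 'rV[R]_d R :=
  match d with
  | 0 => \d_(0 : 'rV[R]_0)
  | n.+1 => distribution (uniform_prob (@ltr01 R) \x torus_measure R n)%E
              (@rV_cons R n)
  end.

Section matrix_inner_product.
Variables (R : realType) (m n : nat).

Definition mxdot (A B : 'M[R]_(m, n)) : R := \tr (A *m B^T).

(* The canonical norm `|A| of MathComp-Analysis on matrices is the max norm. *)
Definition mxnorm (A : 'M[R]_(m, n)) : R := Num.sqrt (mxdot A A).

End matrix_inner_product.

(* In finite dimension, f is of class C^(k+1) iff all its directional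
   derivatives exist and are of class C^k. *)
Fixpoint Ck (R : realType) (V U : normedModType R) (k : nat) (f : V -> U) :
    Prop :=
  match k with
  | 0 => continuous f
  | k'.+1 => continuous f /\
      forall v, (forall x, derivable f x v) /\ Ck k' ('D_v f)
  end.

Section stored_energy.
Variables (R : realType) (d : nat).
Implicit Types (p : R) (W : 'M[R]_d -> R).

Definition stress W (F : 'M[R]_d) : 'M[R]_d :=
  \matrix_(i, j) 'D_(delta_mx i j) W F.

Definition A1 W : Prop := Ck 2 W.

Definition A2 p W : Prop :=
  exists2 c : R, 0 < c & forall F, c * (mxnorm F `^ p - 1) <= W F.

Definition A3 p W : Prop :=
  exists2 C : R, 0 < C & forall F,
    `|W F| <= C * (1 + mxnorm F `^ p) /\
    mxnorm (stress W F) <= C * (1 + mxnorm F `^ (p - 1)).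

End stored_energy.

Section torus_spaces.
Variables (R : realType) (d : nat).
Local Notation mu := (torus_measure R d).

Definition torus_smooth (U : normedModType R) (phi : 'rV[R]_d -> U) : Prop :=
  (forall k, Ck k phi) /\
  (forall x (j : 'I_d), phi (x + delta_mx 0 j) = phi x).

Section matrix_valued.
Variables (m n : nat).
Implicit Types u : 'rV[R]_d -> 'M[R]_(m, n).

Definition mx_integrable u : Prop :=
  forall i k, mu.-integrable setT (fun x => (u x i k)%:E).

Definition Lp_norm (q : R) u : \bar R :=
  ('N[mu]_(q%:E)[EFin \o (fun x => mxnorm (u x))])%E.

Definition Lp (q : R) u : Prop :=
  measurable_fun setT u /\ (Lp_norm q u < +oo)%E.

(* [D j] is the weak partial derivative of [u] in the direction [j]. *)
Definition weak_gradient u (D : 'I_d -> 'rV[R]_d -> 'M[R]_(m, n)) : Prop :=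
  [/\ mx_integrable u,
      forall j, mx_integrable (D j) &
      forall (phi : 'rV[R]_d -> R) j i k, torus_smooth phi ->
        \int[mu]_x (u x i k * 'D_(delta_mx 0 j) phi x) =
        - \int[mu]_x (D j x i k * phi x)].

(* u is in H^1 with squared H^1 norm at most M *)
Definition H1_le (M : R) u : Prop :=
  measurable_fun setT u /\
  exists D : 'I_d -> 'rV[R]_d -> 'M[R]_(m, n),
    [/\ forall j, measurable_fun setT (D j),
        weak_gradient u D &
        (\int[mu]_x (mxnorm (u x) ^+ 2 +
           \sum_(j < d) mxnorm (D j x) ^+ 2)%:E <= M%:E)%E].

Definition H1 u : Prop := exists M, H1_le M u.

End matrix_valued.
End torus_spaces.

Section time_dependent_spaces.
Variables (R : realType) (d : nat) (T : R).
Local Notation mu := (torus_measure R d).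
Local Notation leb := (@lebesgue_measure R).

Definition cylinder : set (measurableTypeR R * 'rV[R]_d) :=
  `]0, T[ `*` setT.

Section matrix_valued.
Variables (m n : nat).
Implicit Types f : R -> 'rV[R]_d -> 'M[R]_(m, n).

Definition cyl_measurable f : Prop :=
  measurable_fun cylinder (fun z => f z.1 z.2).

Definition Linf_Lp (q : R) f : Prop :=
  cyl_measurable f /\
  exists M : R, {ae leb, forall t, t \in `]0, T[ ->
    (Lp_norm q (f t) <= M%:E)%E}.

Definition Linf_H1 f : Prop :=
  cyl_measurable f /\
  exists M : R, {ae leb, forall t, t \in `]0, T[ -> H1_le M (f t)}.

Definition C_L2 f : Prop :=
  (forall t, t \in `[0, T] -> Lp 2 (f t)) /\
  (forall t, t \in `[0, T] ->
    Lp_norm 2 (fun x => f s x - f t x)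
      @[s --> within `[0, T] (nbhs t)] --> 0%E).

Definition continuous_representative f fc : Prop :=
  C_L2 fc /\
  {ae leb, forall t, t \in `]0, T[ -> {ae mu, forall x, fc t x = f t x}}.

End matrix_valued.

(* (grad u)_{ij} = \partial_j u_i for R^d-valued u : the j-th column of the
   matrix is the j-th partial derivative *)
Definition vec_weak_gradient (u : 'rV[R]_d -> 'cV[R]_d)
    (Du : 'rV[R]_d -> 'M[R]_d) : Prop :=
  weak_gradient u (fun j x => col j (Du x)).

(* v is in L^2(0,T;H^1) and Dv is its spatial gradient *)
Definition L2_H1 (v : R -> 'rV[R]_d -> 'cV[R]_d)
    (Dv : R -> 'rV[R]_d -> 'M[R]_d) : Prop :=
  [/\ cyl_measurable v, cyl_measurable Dv,
      {ae leb, forall t, t \in `]0, T[ -> vec_weak_gradient (v t) (Dv t)} &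
      (\int[leb]_(t in `]0%R, T[) \int[mu]_x
         (mxnorm (v t x) ^+ 2 + mxnorm (Dv t x) ^+ 2)%:E < +oo)%E].

(* C_c^oo([0,T); C^oo(T^d)): a function that is smooth up to t = 0 is the
   restriction of a smooth function on R * R^d. *)
Definition test_function (U : normedModType R) (psi : R * 'rV[R]_d -> U) :
    Prop :=
  [/\ forall k, Ck k psi,
      forall t x (j : 'I_d), psi (t, x + delta_mx 0 j) = psi (t, x) &
      exists2 T' : R, T' < T & forall t x, T' <= t -> psi (t, x) = 0].

Definition dt (U : normedModType R) (psi : R * 'rV[R]_d -> U) :
    R * 'rV[R]_d -> U :=
  'D_((1, 0) : R * 'rV[R]_d) psi.

Definition grad (psi : R * 'rV[R]_d -> 'cV[R]_d) (z : R * 'rV[R]_d) :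
    'M[R]_d :=
  \matrix_(i, j) ('D_((0, delta_mx 0 j) : R * 'rV[R]_d) psi z) i 0.

End time_dependent_spaces.

Section viscoelasticity.
Variables (R : realType) (d : nat) (W : 'M[R]_d -> R).
Local Notation mu := (torus_measure R d).
Local Notation leb := (@lebesgue_measure R).

Definition energy (v : 'rV[R]_d -> 'cV[R]_d) (F : 'rV[R]_d -> 'M[R]_d) :
    \bar R :=
  (\int[mu]_x (mxnorm (v x) ^+ 2 / 2 + W (F x))%:E)%E.

Definition dissipation (Dv : R -> 'rV[R]_d -> 'M[R]_d) (t : R) : \bar R :=
  (\int[leb]_(s in `]0%R, t[) \int[mu]_x (mxnorm (Dv s x) ^+ 2)%:E)%E.

(* Dv stands for the gradient of v, determined a.e. by [ws_v_L2H1]. *)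
Record weak_solution (p T : R)
    (v0 : 'rV[R]_d -> 'cV[R]_d) (F0 : 'rV[R]_d -> 'M[R]_d)
    (v : R -> 'rV[R]_d -> 'cV[R]_d) (Dv F : R -> 'rV[R]_d -> 'M[R]_d) :
    Prop := {
  ws_v_LinfL2 : Linf_Lp T 2 v ;
  ws_v_L2H1 : L2_H1 T v Dv ;
  ws_F_LinfLp : Linf_Lp T p F ;
  ws_momentum : forall psi : R * 'rV[R]_d -> 'cV[R]_d, test_function T psi ->
    \int[(leb \x mu)%E]_(z in @cylinder R d T)
      (mxdot (v z.1 z.2) (dt psi z)
       - mxdot (stress W (F z.1 z.2)) (grad psi z)
       - mxdot (Dv z.1 z.2) (grad psi z))
    + \int[mu]_x mxdot (v0 x) (psi (0, x)) = 0 ;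
  ws_strain : forall phi : R * 'rV[R]_d -> 'M[R]_d, test_function T phi ->
    \int[(leb \x mu)%E]_(z in @cylinder R d T)
      (mxdot (F z.1 z.2) (dt phi z) + mxdot (Dv z.1 z.2) (phi z))
    + \int[mu]_x mxdot (F0 x) (phi (0, x)) = 0 ;
  ws_gradient : exists y : R -> 'rV[R]_d -> 'cV[R]_d,
    cyl_measurable T y /\
    {ae leb, forall t, t \in `]0, T[ -> vec_weak_gradient (y t) (F t)} ;
  ws_energy : {ae leb, forall t, t \in `]0, T[ ->
    (energy (v t) (F t) + dissipation Dv t <= energy v0 F0)%E} }.

End viscoelasticity.

(* Main.v *)
Require Import Defs.
From mathcomp Require Import all_boot all_order all_algebra.
From mathcomp Require Import all_classical all_reals all_analysis.
From mathcomp Require Import measurable_realfun.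
From mathcomp Require Import ring lra.

(** Formally, testing the momentum equation with [v] gives
    [d/dt |v|^2 / 2 = - <S(F), grad v> - |grad v|^2], while [F_t = grad v] gives
    [d/dt W(F) = <S(F), grad v>]; the stress power cancels and only the viscous
    dissipation is left. The regularity needed to make this rigorous is
    [S(F)] in L^2 of space-time. By [A3], [|S(F)|] grows like [|F|^(p - 1)], so it
    suffices that H^1 embeds into [L^(2 (p - 1))] of the torus: this holds for
    every [p] in dimension 2 and for [p - 1 <= 3] in dimension 3. The two
    inequalities are proved on smooth functions ([moment_bounded2],
    [moment_bounded3]) by bounding a function on each line parallel to an axis by
    its mean and the mean of its derivative, combined in dimension 3 by the
    Loomis-Whitney inequality. They pass to weakly differentiable functions by
    smoothing ([moment_bound_weak]) and yield [stress_integral_bound].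

    The smoothing operators [P_n] average against the kernel
    [\prod_j ((1 + cos (2 pi (x_j - z_j))) / 2)^n], normalized. Three properties
    matter. Being a symmetric Markov kernel, it gives contractions of L^2 with
    [|P_n u - u|^2 <= 2 (|u|^2 - <u, P_n u>)], and the right-hand side, the energy
    of [u], tends to 0 ([torus_energy_vanishes]). Being a trigonometric
    polynomial, it is a finite sum [\sum_k lam_k e_k(x) e_k(z)], so [P_n u] only
    involves the coefficients [<u, e_k>], to which the weak formulation gives
    direct access. Being translation invariant, it commutes with weak derivatives
    ([derive_kernel_mean_weak]).

    For the velocity, each coefficient [<v(t), e_k>] is almost everywhere equal to
    an absolutely continuous function ([weak_coefficient]). Hence [<v, P_n v>] is
    almost everywhere the primitive of a density that converges, in L^1 in time,
    to the one expected from the formal computation; this gives the kinetic energy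
    identity at almost every time ([good_time]). The same estimate shows that the
    approximations [P_n v] are uniformly Cauchy in time, which produces the
    representative in C([0,T]; L^2) ([L2_representative]). For the strain,
    [F(t, x) = F_0(x) + \int_0^t grad v(s, x) ds] for almost all [x]
    ([weak_time_derivative]), so at fixed [x] the strain runs along an absolutely
    continuous curve, and [W(F(t, x))] obeys the chain rule
    ([stored_energy_pointwise]); integration in [x] gives [stored_energy_balance].
    Both identities extend from almost every time to every time by continuity
    ([square_norm_extend]), and [energy_balance] adds them up. *)

Set Implicit Arguments.
Unset Strict Implicit.
Unset Printing Implicit Defensive.
Import Order.TTheory GRing.Theory Num.Theory.
Import numFieldNormedType.Exports.
Local Open Scope classical_set_scope.
Local Open Scope ring_scope.

(** * Integration of real-valued functions *)

Section real_integral.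
Context d (T : measurableType d) (R : realType) (mu : {measure set T -> \bar R}).
Implicit Types f g h : T -> R.
Local Notation "'intg' f" := (mu.-integrable setT (EFin \o f))
  (at level 10, f at level 9).

Lemma intg_measurable f : intg f -> measurable_fun setT f.
Proof. by move=> /measurable_int/measurable_EFinP. Qed.

Lemma le_intg f g : measurable_fun setT f -> (forall x, `|f x| <= g x) ->
  intg g -> intg f.
Proof.
move=> mf fg; apply: le_integrable => //; first exact/measurable_EFinP.
by move=> x _ /=; rewrite lee_fin (le_trans (fg x))// ler_norm.
Qed.

Lemma intgD f g : intg f -> intg g -> intg (fun x => f x + g x).
Proof. by move=> hf hg; have := integrableD measurableT hf hg. Qed.

Lemma intgZ (a : R) f : intg f -> intg (fun x => a * f x).
Proof. by move=> hf; have := integrableZl measurableT a hf. Qed.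

Lemma intgN f : intg f -> intg (fun x => - f x).
Proof. by move=> hf; have := integrableN hf. Qed.

Lemma intgB f g : intg f -> intg g -> intg (fun x => f x - g x).
Proof. by move=> hf hg; apply: (intgD hf); exact: intgN. Qed.

Lemma intg_norm f : intg f -> intg (fun x => `|f x|).
Proof. by move=> /integrable_norm. Qed.

Lemma intg_sum (I : Type) (s : seq I) (F : I -> T -> R) :
  (forall i, intg (F i)) -> intg (fun x => \sum_(i <- s) F i x).
Proof.
move=> h; have := @integrable_sum _ _ _ mu _ measurableT _ s xpredT (fun i => EFin \o F i) (fun i _ => h i).
by apply: eq_integrable => // x _ /=; rewrite sumEFin.
Qed.

Lemma Rintegral_sum (I : Type) (s : seq I) (F : I -> T -> R) :
  (forall i, intg (F i)) ->
  \int[mu]_x (\sum_(i <- s) F i x) = \sum_(i <- s) \int[mu]_x F i x.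
Proof.
move=> h; elim: s => [|i s IH].
  by rewrite big_nil; under eq_Rintegral do rewrite big_nil; rewrite /Rintegral integral0.
rewrite big_cons -IH -RintegralD//; last exact: intg_sum.
by apply: eq_Rintegral => x _; rewrite big_cons.
Qed.

Lemma RintegralN f : intg f -> \int[mu]_x (- f x) = - \int[mu]_x f x.
Proof.
move=> hf; rewrite -mulN1r -RintegralZl//; apply: eq_Rintegral => x _.
by rewrite mulN1r.
Qed.

Lemma EFin_Rintegral f : intg f -> ((\int[mu]_x f x)%:E = \int[mu]_x (f x)%:E)%E.
Proof. by move=> hf; rewrite /Rintegral fineK//; exact: integrable_fin_num. Qed.

Lemma intg_ge0P f : measurable_fun setT f -> (forall x, 0 <= f x) ->
  intg f <-> (\int[mu]_x (f x)%:E < +oo)%E.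
Proof.
move=> mf f0.
split=> [/integrableP[_]|h]; last (apply/integrableP; split; first exact/measurable_EFinP).
- by under eq_integral do rewrite /= ger0_norm//.
- by under eq_integral do rewrite /= ger0_norm//.
Qed.

Lemma ae_eq_intg f g : measurable_fun setT g -> {ae mu, forall x, f x = g x} ->
  intg f -> intg g.
Proof.
move=> mg fg hf; apply/integrableP; split; first exact/measurable_EFinP.
have /integrableP[mf] := hf; apply: le_lt_trans; rewrite le_eqVlt; apply/orP; left.
apply/eqP/ae_eq_integral => //=.
- by apply/measurable_EFinP; exact: measurableT_comp.
- by apply/measurable_EFinP; apply: measurableT_comp => //; exact/measurable_EFinP.
- by apply: filterS fg => x -> _.
Qed.

Lemma ae_eq_Rintegral f g : measurable_fun setT f -> measurable_fun setT g ->
  {ae mu, forall x, f x = g x} -> \int[mu]_x f x = \int[mu]_x g x.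
Proof.
move=> mf mg fg; rewrite /Rintegral; congr fine.
apply: ae_eq_integral => //=; do 1?[exact/measurable_EFinP].
by apply: filterS fg => x -> _.
Qed.

Lemma ae_le_Rintegral f g : intg f -> intg g ->
  {ae mu, forall x, f x <= g x} -> \int[mu]_x f x <= \int[mu]_x g x.
Proof.
move=> hf hg fg; pose k := fun x => Num.min (f x) (g x).
have mf := intg_measurable hf; have mg := intg_measurable hg.
have mk : measurable_fun setT k by exact: measurable_minr.
have fk : {ae mu, forall x, f x = k x}.
  by apply: filterS fg => x h; rewrite /k min_l.
rewrite (ae_eq_Rintegral mf mk fk); apply: le_Rintegral => //.
  exact: ae_eq_intg hf.
by move=> x _; rewrite /k ge_min lexx orbT.
Qed.

Lemma Rintegral_le_abs f : intg f -> `|\int[mu]_x f x| <= \int[mu]_x `|f x|.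
Proof. by move=> hf; apply: le_normr_Rintegral. Qed.

Lemma Rintegral_eq0_ae f : measurable_fun setT f -> (forall x, 0 <= f x) -> intg f ->
  \int[mu]_x f x = 0 -> {ae mu, forall x, f x = 0}.
Proof.
move=> mf f0 hf h.
have : (\int[mu]_x `|(EFin \o f) x| = 0)%E.
  under eq_integral do rewrite /= ger0_norm//.
  by rewrite -EFin_Rintegral// h.
move/ae_eq_integral_abs => h1; have /h1 : measurable_fun setT (EFin \o f : T -> \bar R).
  exact/measurable_EFinP.
by move=> /(_ measurableT); apply: filterS => x /(_ I) [].
Qed.

Lemma Rdominated_cvg (F : nat -> T -> R) f g :
  (forall n, measurable_fun setT (F n)) -> measurable_fun setT f ->
  {ae mu, forall x, F n x @[n --> \oo] --> f x} -> intg g ->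
  (forall n, {ae mu, forall x, `|F n x| <= g x}) ->
  \int[mu]_x F n x @[n --> \oo] --> \int[mu]_x f x.
Proof.
move=> mF mf Ff hg Fg.
have [hf _ c] : [/\ mu.-integrable setT (EFin \o f),
  [sequence (\int[mu]_x `|(F n x)%:E - (f x)%:E|)%E]_n @ \oo --> 0%E &
  [sequence (\int[mu]_x (F n x)%:E)%E]_n @ \oo --> (\int[mu]_x (f x)%:E)%E].
  apply: (@dominated_convergence _ _ _ mu setT measurableT _ _ (EFin \o g)) => //.
  - by move=> n; exact/measurable_EFinP.
  - exact/measurable_EFinP.
  - by apply: filterS Ff => x h _; apply: cvg_EFin => //; exact: nearW.
  - have : {ae mu, forall x, forall n, `|F n x| <= g x} by apply/ae_foralln.
    by apply: filterS => x h n _; rewrite /= lee_fin.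
by apply: fine_cvg; rewrite EFin_Rintegral.
Qed.

Definition L2 f : Prop := measurable_fun setT f /\ intg (fun x => f x ^+ 2).

Lemma L2_mul f g : L2 f -> L2 g -> intg (fun x => f x * g x).
Proof.
move=> [mf hf] [mg hg].
apply: (@le_intg _ (fun x => f x ^+ 2 + g x ^+ 2)); last exact: intgD.
  exact: measurable_funM.
move=> x; rewrite ler_norml; apply/andP; split; nra.
Qed.

Lemma L2D f g : L2 f -> L2 g -> L2 (fun x => f x + g x).
Proof.
move=> hf hg; have [mf if2] := hf; have [mg ig2] := hg; split.
  exact: measurable_funD.
have -> : (fun x => (f x + g x) ^+ 2) =
    (fun x => f x ^+ 2 + 2 * (f x * g x) + g x ^+ 2) by apply/funext => x; ring.
by apply: intgD => //; apply: intgD => //; apply: intgZ; exact: L2_mul.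
Qed.

Lemma L2Z (a : R) f : L2 f -> L2 (fun x => a * f x).
Proof.
move=> [mf hf]; split; first exact: measurable_funM.
by under eq_fun do rewrite exprMn; exact: intgZ.
Qed.

Lemma L2N f : L2 f -> L2 (fun x => - f x).
Proof. by move=> /(L2Z (-1)); under eq_fun do rewrite mulN1r. Qed.

Lemma L2B f g : L2 f -> L2 g -> L2 (fun x => f x - g x).
Proof. by move=> hf /L2N; exact: L2D. Qed.

Lemma L2_0 : L2 (cst 0).
Proof.
split; first exact: measurable_cst.
under eq_fun do rewrite /= expr0n /=.
exact: integrable0.
Qed.

Lemma le_L2 f g : measurable_fun setT f -> (forall x, `|f x| <= `|g x|) -> L2 g -> L2 f.
Proof.
move=> mf fg [mg hg]; split=> //; apply: le_intg hg; first exact: measurable_funX.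
by move=> x; rewrite normrX -[leRHS]real_normK ?num_real// lerXn2r// nnegrE.
Qed.

(** Cauchy-Schwarz: the discriminant of the nonnegative quadratic polynomial
    [t |-> \int (t f + g)^2]. *)
Lemma cauchy_schwarz f g : L2 f -> L2 g ->
  (\int[mu]_x (f x * g x)) ^+ 2 <= \int[mu]_x (f x ^+ 2) * \int[mu]_x (g x ^+ 2).
Proof.
move=> hf hg; have [mf if2] := hf; have [mg ig2] := hg.
set a := \int[mu]_x (f x ^+ 2); set b := \int[mu]_x (f x * g x).
set c := \int[mu]_x (g x ^+ 2).
have a0 : 0 <= a by apply: Rintegral_ge0 => x _; exact: sqr_ge0.
have q t : 0 <= t ^+ 2 * a + 2 * t * b + c.
  have -> : t ^+ 2 * a + 2 * t * b + c =
      \int[mu]_x (t ^+ 2 * f x ^+ 2 + 2 * t * (f x * g x) + g x ^+ 2).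
    rewrite RintegralD ?RintegralD ?RintegralZl//; do ?[exact: intgZ|exact: L2_mul].
    - by apply: intgZ; exact: L2_mul.
    - by apply: intgD; [exact: intgZ|apply: intgZ; exact: L2_mul].
  apply: Rintegral_ge0 => x _.
  by rewrite (_ : _ + _ = (t * f x + g x) ^+ 2) ?sqr_ge0//; ring.
have [a00|an0] := eqVneq a 0.
  rewrite a00 mul0r; have [->|bn0] := eqVneq b 0; first by rewrite expr0n.
  have := q (- (c + 1) / (2 * b)); rewrite a00 mulr0 add0r.
  rewrite (_ : 2 * _ * b = - (c + 1)); last by field.
  by rewrite opprD addrAC addNr sub0r ler0N1.
have ap : 0 < a by rewrite lt_def an0.
have := q (- b / a).
rewrite (_ : _ + c = (a * c - b ^+ 2) / a); last by field.
by rewrite pmulr_lge0 ?invr_gt0// subr_ge0.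
Qed.


End real_integral.
Arguments L2 {d T R} mu f.
Arguments le_intg {d T R mu f} g.

Section finite_measure_integral.
Context d (T : measurableType d) (R : realType) (mu : probability T R).
Implicit Types f g : T -> R.

Lemma bounded_intg f (M : R) : measurable_fun setT f -> (forall x, `|f x| <= M) ->
  mu.-integrable setT (EFin \o f).
Proof.
move=> mf fM; apply: (@le_intg _ _ _ _ _ (cst M)) => //.
exact: finite_measure_integrable_cst.
Qed.

Lemma bounded_L2 f (M : R) : measurable_fun setT f -> (forall x, `|f x| <= M) ->
  L2 mu f.
Proof.
move=> mf fM; split=> //; apply: (@bounded_intg _ (M ^+ 2)); first exact: measurable_funX.
by move=> x; rewrite normrX lerXn2r// nnegrE (le_trans _ (fM x)).
Qed.

Lemma L2_intg f : L2 mu f -> mu.-integrable setT (EFin \o f).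
Proof.
move=> hf; have h1 : L2 mu (cst 1) by apply: (@bounded_L2 _ 1) => // x; rewrite normr1.
by have := L2_mul hf h1; under eq_fun do rewrite mulr1.
Qed.

Lemma Rintegral_prob_cst (c : R) : \int[mu]_x c = c.
Proof. by rewrite Rintegral_cst//= probability_setT mulr1. Qed.

End finite_measure_integral.

Section fubini_right.
Context d1 d2 (X : measurableType d1) (Y : measurableType d2) (R : realType).
Variables (m1 : {sigma_finite_measure set X -> \bar R}).
Variables (m2 : {sigma_finite_measure set Y -> \bar R}).

Lemma integrable_fubini_G (f : X * Y -> \bar R) :
  (m1 \x m2)%E.-integrable setT f -> m2.-integrable setT (fubini_G m1 f).
Proof.
move=> hf; have mf := measurable_int _ hf; have mG := measurable_fubini_G hf.
apply/integrableP; split=> //.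
have /(integrable21ltyP _ _ mf) := hf; apply: le_lt_trans.
apply: ge0_le_integral => //.
- exact: measurableT_comp.
- apply: (@measurable_fun_fubini_tonelli_G _ _ X Y R m1 (abse \o f)).
    exact: measurableT_comp.
  by move=> p; exact: abse_ge0.
- by move=> y _; apply: le_abse_integral => //; exact: measurable_fun_pair1.
Qed.

End fubini_right.

Section fubini_real.
Context d1 d2 (X : measurableType d1) (Y : measurableType d2) (R : realType).
Variables (m1 : {sigma_finite_measure set X -> \bar R}).
Variables (m2 : {sigma_finite_measure set Y -> \bar R}).
Variable f : X -> Y -> R.
Let fz (z : X * Y) : R := f z.1 z.2.

Lemma intg_prodP : measurable_fun setT fz ->
  (m1 \x m2)%E.-integrable setT (EFin \o fz) <->
  (\int[m1]_x \int[m2]_y `|f x y|%:E < +oo)%E.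
Proof.
move=> mf; have := @integrable12ltyP _ _ X Y R m1 m2 (EFin \o fz).
by move=> h; apply: h; exact/measurable_EFinP.
Qed.

Lemma measurable_Rintegral1 : measurable_fun setT fz ->
  (forall x y, 0 <= f x y) ->
  measurable_fun setT (fun x => \int[m2]_y f x y).
Proof.
move=> mf f0; apply: measurableT_comp => //.
apply: (@measurable_fun_fubini_tonelli_F _ _ X Y R m2 (EFin \o fz)).
- exact/measurable_EFinP.
- by move=> z; rewrite /= lee_fin; exact: f0.
Qed.

Hypothesis hf : (m1 \x m2)%E.-integrable setT (EFin \o fz).

Lemma ae_intg1 : {ae m1, forall x, m2.-integrable setT (EFin \o f x)}.
Proof. by apply: filterS (ae_integrable1 hf). Qed.

Lemma ae_intg2 : {ae m2, forall y, m1.-integrable setT (EFin \o (f ^~ y))}.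
Proof. by apply: filterS (ae_integrable2 hf). Qed.

Lemma intg_Rintegral1 : m1.-integrable setT (EFin \o (fun x => \int[m2]_y f x y)).
Proof.
have h := integrable_fubini_F hf.
have mF : measurable_fun setT (fun x => \int[m2]_y f x y).
  by apply: measurableT_comp => //; exact: measurable_fubini_F hf.
apply/integrableP; split; first exact/measurable_EFinP.
have /integrableP[mh] := h; apply: le_lt_trans.
apply: ge0_le_integral => //=.
- by apply/measurable_EFinP; exact: measurableT_comp.
- by apply: measurableT_comp.
- move=> x _; rewrite /fubini_F /Rintegral.
  by case: (\int[m2]_y _)%E => [r| |] //=; rewrite normr0 leey.
Qed.

Lemma intg_Rintegral2 : m2.-integrable setT (EFin \o (fun y => \int[m1]_x f x y)).
Proof.
have h := integrable_fubini_G hf.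
have mF : measurable_fun setT (fun y => \int[m1]_x f x y).
  by apply: measurableT_comp => //; exact: measurable_fubini_G hf.
apply/integrableP; split; first exact/measurable_EFinP.
have /integrableP[mh] := h; apply: le_lt_trans.
apply: ge0_le_integral => //=.
- by apply/measurable_EFinP; exact: measurableT_comp.
- by apply: measurableT_comp.
- move=> x _; rewrite /fubini_G /Rintegral.
  by case: (\int[m1]_y _)%E => [r| |] //=; rewrite normr0 leey.
Qed.

Lemma Rintegral_prod1 :
  \int[(m1 \x m2)%E]_z f z.1 z.2 = \int[m1]_x \int[m2]_y f x y.
Proof.
rewrite {1}/Rintegral -(integral12_prod_meas1 hf) /fubini_F.
rewrite [RHS]/Rintegral; congr fine; apply: ae_eq_integral => //.
- exact: measurable_fubini_F hf.
- by apply/measurable_EFinP/intg_measurable; exact: intg_Rintegral1.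
- apply: filterS ae_intg1 => x hx _.
  by rewrite EFin_Rintegral.
Qed.

Lemma Rintegral_prod2 :
  \int[(m1 \x m2)%E]_z f z.1 z.2 = \int[m2]_y \int[m1]_x f x y.
Proof.
rewrite {1}/Rintegral -(integral21_prod_meas1 hf) /fubini_G.
rewrite [RHS]/Rintegral; congr fine; apply: ae_eq_integral => //.
- exact: measurable_fubini_G hf.
- by apply/measurable_EFinP/intg_measurable; exact: intg_Rintegral2.
- apply: filterS ae_intg2 => x hx _.
  by rewrite EFin_Rintegral.
Qed.

Lemma Rintegral_swap :
  \int[m1]_x \int[m2]_y f x y = \int[m2]_y \int[m1]_x f x y.
Proof. by rewrite -Rintegral_prod1 Rintegral_prod2. Qed.

End fubini_real.

(** * Smooth functions and test functions on the torus *)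

Section Ck_calculus.
Variables (R : realType) (V U : normedModType R).

Lemma CkS_weaken k (f : V -> U) : Ck k.+1 f -> Ck k f.
Proof.
elim: k f => [|k IH] f; first by case.
by case=> cf df; split => // v; have [dv Dv] := df v; split => //; exact: IH.
Qed.

Lemma Ck_continuous k (f : V -> U) : Ck k f -> continuous f.
Proof. by case: k => [//|k []]. Qed.

Lemma derive_fun_eq (f : V -> U) v (g : V -> U) :
  (forall x, is_derive x v f (g x)) -> 'D_v f = g.
Proof. by move=> h; apply/funext => x; apply: derive_val. Qed.

(** An explicit formula for all directional derivatives reduces smoothness of
    order [k + 1] to smoothness of order [k] of that formula. *)
Lemma CkS k (f : V -> U) (df : V -> V -> U) :
  continuous f -> (forall v x, is_derive x v f (df v x)) ->
  (forall v, Ck k (df v)) -> Ck k.+1 f.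
Proof.
move=> cf Df Ckdf; split=> // v; split.
  by move=> x; apply: ex_derive.
by rewrite (derive_fun_eq (Df v)).
Qed.

Lemma Ck_is_derive k (f : V -> U) v x : Ck k.+1 f -> is_derive x v f ('D_v f x).
Proof. by case=> _ /(_ v)[d _]; apply: derivableP. Qed.

Lemma Ck_cst k (c : U) : Ck k (cst c : V -> U).
Proof.
elim: k c => [|k IH] c; first exact: cst_continuous.
apply: (@CkS _ _ (fun _ => cst 0)) => //.
exact: cst_continuous.
Qed.

Lemma CkD k (f g : V -> U) : Ck k f -> Ck k g -> Ck k (f \+ g).
Proof.
elim: k f g => [|k IH] f g cf cg.
  by move=> x; apply: cvgD; [exact: cf|exact: cg].
apply: (@CkS _ _ (fun v => 'D_v f \+ 'D_v g)).
- by move=> x; apply: cvgD; [case: cf => + _; apply|case: cg => + _; apply].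
- move=> v x; have h1 := Ck_is_derive v x cf; have h2 := Ck_is_derive v x cg.
  exact: is_deriveD.
- by move=> v; apply: IH; [case: cf => _ /(_ v)[]|case: cg => _ /(_ v)[]].
Qed.

Lemma is_derive_scalel (f : V -> R) (E : U) x v df :
  is_derive x v f df -> is_derive x v (fun y => f y *: E) (df *: E).
Proof.
move=> [dfx Dfx].
have : h^-1 *: (((fun y => f y *: E) \o shift x) (h *: v) - f x *: E)
    @[h --> 0^'] --> df *: E.
  rewrite -Dfx.
  under eq_fun do rewrite /= -scalerBl scalerA.
  apply: cvgZl; exact: dfx.
move=> c; split; first by apply/cvg_ex; exists (df *: E).
exact/cvg_lim.
Qed.

Lemma Ck_scalel k (f : V -> R) (E : U) : Ck k f -> Ck k (fun y => f y *: E).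
Proof.
elim: k f => [|k IH] f cf; first by move=> x; apply: cvgZl; exact: cf.
apply: (@CkS _ _ (fun v y => 'D_v f y *: E)).
- by move=> x; apply: cvgZl; case: cf => + _; apply.
- move=> v x; apply: is_derive_scalel.
  by case: cf => _ /(_ v)[d _]; apply: derivableP.
- by move=> v; apply: IH; case: cf => _ /(_ v)[].
Qed.

(** Directional derivatives are derivatives along lines, which gives access to
    the one-variable calculus. *)
Lemma is_derive_lineP (f : V -> U) a v df :
  is_derive a v f df <-> is_derive (0 : R) 1 (fun e : R => f (e *: v + a)) df.
Proof.
suff e : (fun h : R => h^-1 *: ((f \o shift a) (h *: v) - f a)) =
    (fun h : R => h^-1 *: (((fun e : R => f (e *: v + a)) \o shift 0) (h *: 1)
      - f (0 *: v + a))).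
  by split=> -[d D]; split; move: d D; rewrite /derivable /derive e.
by apply/funext => h; rewrite /= scale0r add0r addr0 /GRing.scale /= mulr1.
Qed.

End Ck_calculus.

Lemma CkM (R : realType) (V : normedModType R) k (f g : V -> R) :
  Ck k f -> Ck k g -> Ck k (f \* g).
Proof.
elim: k f g => [|k IH] f g cf cg.
  by move=> x; apply: cvgM; [exact: cf|exact: cg].
apply: (@CkS _ _ _ _ _ (fun v => (f \* 'D_v g) \+ (g \* 'D_v f))).
- by move=> x; apply: cvgM; [case: cf => + _; apply|case: cg => + _; apply].
- move=> v x; have h1 := Ck_is_derive v x cf; have h2 := Ck_is_derive v x cg.
  exact: is_deriveM.
- move=> v; apply: CkD; apply: IH.
  + exact: CkS_weaken.
  + by case: cg => _ /(_ v)[].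
  + exact: CkS_weaken.
  + by case: cf => _ /(_ v)[].
Qed.

Section affine_composition.
Variables (R : realType) (V : normedModType R).

Lemma is_derive_comp_affine (h : R -> R) (l : V -> R) (c dh : R) x v :
  (forall (a : R) x y, l (a *: x + y) = a * l x + l y) ->
  is_derive (l x + c) 1 h dh ->
  is_derive x v (fun z => h (l z + c)) (l v * dh).
Proof.
move=> lin dh1; apply/is_derive_lineP.
have -> : (fun e : R => h (l (e *: v + x) + c)) =
    (fun e : R => h (e * l v + (l x + c))).
  by apply/funext => e; rewrite lin addrA.
have d2 : is_derive (0 : R) 1 (fun e : R => e * l v + (l x + c)) (l v).
  apply: trigger_derive.
  by rewrite /GRing.scale /= mul0r !addr0 add0r mulr1.
rewrite mulrC.
have dh2 : is_derive (0 * l v + (l x + c)) 1 h dh by rewrite mul0r add0r.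
exact: (@is_derive1_comp _ h (fun e : R => e * l v + (l x + c)) _ _ _ dh2 d2).
Qed.

Lemma Ck_comp_affine k (h : R -> R) (l : V -> R) (c : R) :
  (forall (a : R) x y, l (a *: x + y) = a * l x + l y) ->
  continuous l -> Ck k h -> Ck k (fun z => h (l z + c)).
Proof.
move=> lin cl; elim: k h => [|k IH] h Ckh.
  move=> x; apply: (@continuous_comp _ _ _ (fun z => l z + c) h).
    by apply: cvgD; [exact: cl|exact: cvg_cst].
  exact: Ckh.
apply: (@CkS _ _ _ _ _ (fun v z => l v * 'D_1 h (l z + c))).
- move=> x; apply: (@continuous_comp _ _ _ (fun z => l z + c) h).
    by apply: cvgD; [exact: cl|exact: cvg_cst].
  by case: Ckh => + _; apply.
- by move=> v x; apply: is_derive_comp_affine => //; apply: Ck_is_derive Ckh.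
- have [_ /(_ 1)[_ Ch]] := Ckh.
  move=> v; apply: (@CkM _ _ _ (cst (l v))); [exact: Ck_cst|exact: (IH ('D_1 h) Ch)].
Qed.

End affine_composition.

Section trig_smooth.
Variable R : realType.

Lemma is_derive_dir (f : R -> R) (x v df : R) :
  is_derive x 1 f df -> is_derive x v f (v * df).
Proof.
move=> [d1 D1]; have /derivable1_diffP df1 := d1.
split; first exact: diff_derivable.
rewrite deriveE // -D1 deriveE //.
by rewrite -[v in LHS]mulr1 -[v * 1]/(v *: 1) linearZ.
Qed.

Lemma Ck_cos_sin k : Ck k (@cos R : R -> R) /\ Ck k (@sin R : R -> R).
Proof.
elim: k => [|k [IHc IHs]]; first by split; [exact: continuous_cos|exact: continuous_sin].
split.
- apply: (@CkS _ _ _ _ _ (fun v x : R => (- v) * sin x)).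
  + exact: continuous_cos.
  + by move=> v x; rewrite mulNr -mulrN; apply: is_derive_dir; apply: is_derive_cos.
  + by move=> v; apply: (@CkM _ _ _ (cst (- v))) => //; exact: Ck_cst.
- apply: (@CkS _ _ _ _ _ (fun v x : R => v * cos x)).
  + exact: continuous_sin.
  + by move=> v x; apply: is_derive_dir; apply: is_derive_sin.
  + by move=> v; apply: (@CkM _ _ _ (cst v)) => //; exact: Ck_cst.
Qed.

(** [flat_bump m] is the function [s |-> s^-m exp(-1/s)] extended by 0 to
    [s <= 0]. The family is closed under differentiation, which makes each
    member smooth, also at 0. *)
Definition flat_bump (m : nat) (s : R) : R :=
  if 0 < s then s^-1 ^+ m * expR (- s^-1) else 0.

Lemma flat_bump_le0 m s : s <= 0 -> flat_bump m s = 0.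
Proof. by rewrite /flat_bump ltNge => ->. Qed.

Lemma flat_bump_ge0 m s : 0 <= flat_bump m s.
Proof.
rewrite /flat_bump; case: ifPn => // s0.
by rewrite mulr_ge0 ?expR_ge0// exprn_ge0// invr_ge0 ltW.
Qed.

(** The exponential series gives [s^-(m+1) <= (m+1)! exp(1/s)]. *)
Lemma flat_bump_ub m s : flat_bump m s <= m.+1`!%:R * `|s|.
Proof.
rewrite /flat_bump; case: ifPn => s0; last by rewrite mulr_ge0.
have y0 : 0 < s^-1 by rewrite invr_gt0.
rewrite gtr0_norm// expRN ler_pdivrMr ?expR_gt0//.
have /(le_trans _) := @expR_ge1Dxn R _ m (ltW y0); move=> /(_ (s^-1 ^+ m.+1 / m.+1`!%:R)).
rewrite lerDr => /(_ ler01).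
rewrite ler_pdivrMr ?ltr0n ?fact_gt0// => h.
rewrite -mulrA [s * _]mulrC mulrA.
rewrite -ler_pdivrMr// -exprSr (le_trans h)//.
by rewrite mulrC.
Qed.

Lemma flat_bump_near0 m : flat_bump m s @[s --> 0] --> 0.
Proof.
apply: (@squeeze_cvgr _ _ _ _ (cst 0) (fun s => m.+1`!%:R * `|s|)).
- by apply: nearW => s; rewrite flat_bump_ge0 flat_bump_ub.
- exact: cvg_cst.
- rewrite -[X in _ --> X](mulr0 m.+1`!%:R); apply: cvgM; first exact: cvg_cst.
  by rewrite -[X in _ --> X](@normr0 _ R); apply: cvg_norm; exact: cvg_id.
Qed.

Lemma flat_bump_derive m (s : R) :
  is_derive s 1 (flat_bump m) (- m%:R * flat_bump m.+1 s + flat_bump m.+2 s).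
Proof.
have [s0|s0|s0] := ltrgtP s 0.
- rewrite !flat_bump_le0 ?(ltW s0)// mulr0 addr0.
  have d0 : is_derive s 1 (cst 0 : R -> R) 0 by exact: is_derive_cst.
  apply: near_eq_is_derive d0.
  by apply: filterS (lt_nbhsl s0) => t /= t0; rewrite flat_bump_le0// ltW.
- rewrite /flat_bump s0.
  apply: (@near_eq_is_derive _ _ _ (fun t : R => t^-1 ^+ m * expR (- t^-1))).
  + near=> t; rewrite ifT//; near: t; exact: lt_nbhsr.
  + have sn0 : s != 0 by rewrite gt_eqF.
    have dV : is_derive s 1 (fun t : R => t^-1) (- s^-1 ^+ 2).
      rewrite exprVn -[X in is_derive _ _ _ X]mulr1.
      exact: (@is_deriveV _ id s 1 1).
    have dE := @is_derive1_comp _ expR (fun t => - t^-1) s _ _ (is_derive_expR (- s^-1)) (is_deriveN dV).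
    have dX := @is_deriveX _ _ _ m _ _ _ dV.
    have eX : ((fun t : R => t^-1) ^+ m : R -> R) = (fun t => t^-1 ^+ m).
      apply/funext => t; elim: m {dX} => [|m IH]; first by rewrite !expr0.
      by rewrite !exprS -IH.
    rewrite eX in dX.
    have := is_deriveM dX dE.
    congr (is_derive s 1 _ _).
    rewrite /GRing.scale /=.
    case: m {dX eX} => [|m]; first by rewrite /= !expr0; ring.
    by rewrite /= !exprS; ring.
- rewrite s0 !flat_bump_le0// mulr0 addr0.
  have c : h^-1 *: ((flat_bump m \o shift 0) (h *: 1) - flat_bump m 0)
      @[h --> 0^'] --> (0 : R).
    have /continuous_withinNx c0 : {for 0, continuous (flat_bump m.+1)}.
      by rewrite /prop_for /continuous_at (flat_bump_le0 _ (lexx 0)); exact: flat_bump_near0.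
    rewrite (flat_bump_le0 _ (lexx 0)) in c0.
    apply: cvg_trans c0.
    apply: near_eq_cvg; near=> h.
    rewrite /= addr0 (flat_bump_le0 m (lexx 0)) subr0 /flat_bump /GRing.scale /= mulr1.
    by case: ifP => _; rewrite ?mulr0// exprS mulrA.
  by split; [apply/cvg_ex; exists 0|exact/cvg_lim].
Unshelve. all: by end_near. Qed.

Lemma flat_bump_continuous m : continuous (flat_bump m).
Proof.
move=> s; apply: differentiable_continuous; apply/derivable1_diffP.
by have [] := flat_bump_derive m s.
Qed.

Lemma Ck_flat_bump k m : Ck k (flat_bump m : R -> R).
Proof.
elim: k m => [|k IH] m; first exact: flat_bump_continuous.
apply: (@CkS _ _ _ _ _ (fun v s : R => v * (- m%:R * flat_bump m.+1 s + flat_bump m.+2 s))).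
- exact: flat_bump_continuous.
- by move=> v x; apply: is_derive_dir; apply: flat_bump_derive.
- move=> v; apply: (@CkM _ _ _ (cst v)); first exact: Ck_cst.
  apply: CkD => //; apply: (@CkM _ _ _ (cst (- m%:R))) => //; exact: Ck_cst.
Qed.

End trig_smooth.

Section test_functions.
Variables (R : realType).

Lemma Ck_comp_linear (V V' U : normedModType R) k (f : V' -> U)
    (l : V -> V') : (forall (a : R) x y, l (a *: x + y) = a *: l x + l y) ->
  continuous l -> Ck k f -> Ck k (f \o l).
Proof.
move=> lin cl; elim: k f => [|k IH] f Ckf.
  by move=> x; apply: continuous_comp; [exact: cl|exact: Ckf].
apply: (@CkS _ _ _ _ _ (fun v => 'D_(l v) f \o l)).
- by move=> x; apply: continuous_comp; [exact: cl|case: Ckf => + _; apply].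
- move=> v x; apply/is_derive_lineP.
  have := Ck_is_derive (l v) (l x) Ckf => /is_derive_lineP.
  congr (is_derive _ _ _ _); apply/funext => e.
  by rewrite /= lin.
- by move=> v; apply: IH; case: Ckf => _ /(_ (l v))[].
Qed.

Variable d : nat.
Implicit Types e f : 'rV[R]_d -> R.

(** Smooth functions on the torus together with bounds on the function and on
    its first derivatives; the bounds are carried along so that integrability
    never needs a compactness argument. *)
Definition bounded_smooth e : Prop :=
  [/\ torus_smooth e, exists M, forall x, `|e x| <= M &
      forall v, exists M, forall x, `|'D_v e x| <= M].

Lemma bounded_smooth_cst (c : R) : bounded_smooth (cst c).
Proof.
split; first by split => // k; exact: Ck_cst.
  by exists `|c|.
by move=> v; exists 0 => x; rewrite derive_cst normr0.
Qed.

Lemma bounded_smoothM e f :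
  bounded_smooth e -> bounded_smooth f -> bounded_smooth (e \* f).
Proof.
move=> [[ce pe] [Me be] de] [[cf pf] [Mf bf] df]; split.
- split; first by move=> k; exact: CkM.
  by move=> x j /=; rewrite pe pf.
- by exists (Me * Mf) => x /=; rewrite normrM ler_pM.
- move=> v; have [M1 b1] := de v; have [M2 b2] := df v.
  exists (Me * M2 + Mf * M1) => x.
  have := is_deriveM (Ck_is_derive v x (ce 1%N)) (Ck_is_derive v x (cf 1%N)).
  move=> /(@derive_val _ _ _ _ _ _ _) ->.
  rewrite /GRing.scale/=; apply: (le_trans (ler_normD _ _)).
  by rewrite !normrM lerD// ler_pM.
Qed.

Lemma bounded_smooth_derivable e v x : bounded_smooth e -> is_derive x v e ('D_v e x).
Proof. by move=> [[ce _] _ _]; exact: (Ck_is_derive v x (ce 1%N)). Qed.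

Lemma bounded_smooth_continuous e : bounded_smooth e -> continuous e.
Proof. by move=> [[ce _] _ _]; exact: (ce 0%N). Qed.

Lemma bounded_smooth_derive_continuous e v : bounded_smooth e -> continuous ('D_v e).
Proof. by move=> [[ce _] _ _]; have [_ /(_ v)[_]] := ce 1%N. Qed.

Section coordinate.
Variable j : 'I_d.

Definition tau_coord (x : 'rV[R]_d) : R := 2 * pi * x 0 j.

Lemma tau_coord_lin (a : R) x y :
  tau_coord (a *: x + y) = a * tau_coord x + tau_coord y.
Proof. by rewrite /tau_coord !mxE; ring. Qed.

Lemma tau_coord_continuous : continuous tau_coord.
Proof.
by move=> x; exact: (cvgM (cvg_cst _) (@coord_continuous _ _ _ _ _ x)).
Qed.

Lemma tau_coord_shift x i : tau_coord (x + delta_mx 0 i) =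
  tau_coord x + pi *+ 2 *+ (i == j).
Proof.
rewrite /tau_coord !mxE eqxx /= eq_sym.
by case: eqP => _; rewrite ?mulr0n ?mulr1n; ring.
Qed.

Lemma bounded_smooth_cos : bounded_smooth (fun x => cos (tau_coord x)).
Proof.
split.
- split=> [k|x i].
    have := Ck_comp_affine 0 tau_coord_lin tau_coord_continuous (Ck_cos_sin R k).1.
    by congr Ck; apply/funext => x; rewrite addr0.
  by rewrite tau_coord_shift; case: eqP => _; rewrite ?mulr1n ?mulr0n ?addr0// cosD2pi.
- by exists 1 => x; rewrite ler_norml cos_geN1 cos_le1.
- move=> v; exists `|tau_coord v| => x.
  have := @is_derive_comp_affine _ _ _ tau_coord 0 _ x v tau_coord_lin (is_derive_cos _).
  under eq_fun do rewrite addr0.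
  move=> /(@derive_val _ _ _ _ _ _ _) ->.
  by rewrite normrM ler_piMr// normrN ler_norml sin_geN1 sin_le1.
Qed.

Lemma bounded_smooth_sin : bounded_smooth (fun x => sin (tau_coord x)).
Proof.
split.
- split=> [k|x i].
    have := Ck_comp_affine 0 tau_coord_lin tau_coord_continuous (Ck_cos_sin R k).2.
    by congr Ck; apply/funext => x; rewrite addr0.
  by rewrite tau_coord_shift; case: eqP => _; rewrite ?mulr1n ?mulr0n ?addr0// sinD2pi.
- by exists 1 => x; rewrite ler_norml sin_geN1 sin_le1.
- move=> v; exists `|tau_coord v| => x.
  have := @is_derive_comp_affine _ _ _ tau_coord 0 _ x v tau_coord_lin (is_derive_sin _).
  under eq_fun do rewrite addr0.
  move=> /(@derive_val _ _ _ _ _ _ _) ->.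
  by rewrite normrM ler_piMr// ler_norml cos_geN1 cos_le1.
Qed.

End coordinate.

Section product_test.
Variables (U : normedModType R) (T : R) (eta : R -> R) (e : 'rV[R]_d -> R) (E : U).
Hypotheses (ceta : forall k, Ck k (eta : R -> R)) (ce : bounded_smooth e).
Hypothesis eta0 : exists2 T' : R, T' < T & forall t, T' <= t -> eta t = 0.

(** Separated test functions [eta (t) e (x) E] are the only ones that the weak
    formulation is tested with. *)
Definition product_test (z : R * 'rV[R]_d) : U := (eta z.1 * e z.2) *: E.

Let ceta2 k : Ck k (eta \o (fst : R * 'rV[R]_d -> R)).
Proof. by apply: Ck_comp_linear => // x; exact: cvg_fst. Qed.

Let ce2 k : Ck k (e \o (snd : R * 'rV[R]_d -> 'rV[R]_d)).
Proof. by apply: Ck_comp_linear => //; [move=> x; exact: cvg_snd|case: ce => -[]]. Qed.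

Lemma product_test_function : test_function T product_test.
Proof.
split.
- by move=> k; apply: (@Ck_scalel _ _ _ _ (fun z => eta z.1 * e z.2)); exact: (CkM (ceta2 k) (ce2 k)).
- by move=> t x j; rewrite /product_test /=; case: ce => -[_ ->].
- by case: eta0 => T' T'T h; exists T' => // t x /h; rewrite /product_test /= => ->; rewrite mul0r scale0r.
Qed.

Lemma derive_product_test (a : R) (w : 'rV[R]_d) z :
  'D_((a, w) : R * 'rV[R]_d) product_test z =
  (a * 'D_1 eta z.1 * e z.2 + eta z.1 * 'D_w e z.2) *: E.
Proof.
apply: derive_val; apply: is_derive_scalel.
have d1 : is_derive z ((a, w) : R * 'rV[R]_d) (eta \o fst) (a * 'D_1 eta z.1).
  apply/is_derive_lineP.
  have := is_derive_dir a (Ck_is_derive (1 : R) z.1 (ceta 1%N)) => /is_derive_lineP.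
  by congr (is_derive _ _ _ _).
have d2 : is_derive z ((a, w) : R * 'rV[R]_d) (e \o snd) ('D_w e z.2).
  apply/is_derive_lineP.
  have := bounded_smooth_derivable w z.2 ce => /is_derive_lineP.
  by congr (is_derive _ _ _ _).
have := is_deriveM d1 d2.
congr (is_derive _ _ _ _).
by rewrite /GRing.scale/=; ring.
Qed.

Lemma dt_product_test z : dt product_test z = ('D_1 eta z.1 * e z.2) *: E.
Proof. by rewrite /dt derive_product_test derive0 mulr0 addr0 mul1r. Qed.

End product_test.
End test_functions.

(** * Symmetric Markov kernels and their energies *)

Section markov_kernel.
Context d (T : measurableType d) (R : realType) (mu : probability T R).
Implicit Types (K : T * T -> R) (u w : T -> R).

(** Kernels [K (x, z) dz] of symmetric averaging operators; the averages are
    then self-adjoint contractions of L^2. *)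
Record markov_kernel K : Prop := {
  mk_measurable : measurable_fun setT K ;
  mk_ge0 : forall x z, 0 <= K (x, z) ;
  mk_bounded : exists B, forall x z, K (x, z) <= B ;
  mk_sym : forall x z, K (x, z) = K (z, x) ;
  mk_mass : forall x, (\int[mu]_z (K (x, z))%:E = 1)%E }.

(** The quadratic form of [1 - P], where [P] is the averaging operator of [K]:
    for a symmetric Markov kernel it equals [2 (|u|^2 - <u, P u>)]. *)
Definition kernel_energy K u : \bar R :=
  (\int[mu]_x \int[mu]_z (K (x, z) * (u x - u z) ^+ 2)%:E)%E.

Definition kernel_mean K u (x : T) : R := \int[mu]_z (K (x, z) * u z).

Variable K : T * T -> R.
Hypothesis mK : markov_kernel K.

Lemma mk_measurable1 x : measurable_fun setT (fun z => K (x, z)).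
Proof. exact: (measurable_fun_pair2 x (mk_measurable mK)). Qed.

Lemma mk_intg x : mu.-integrable setT (EFin \o (fun z => K (x, z))).
Proof.
apply/intg_ge0P; [exact: mk_measurable1|by move=> z; exact: mk_ge0|].
by rewrite mk_mass// ltry.
Qed.

Lemma measurable_energy_integrand u : measurable_fun setT u ->
  measurable_fun setT (fun xz : T * T => K xz * (u xz.1 - u xz.2) ^+ 2).
Proof.
move=> mu1; apply: measurable_funM; first exact: mk_measurable mK.
apply: measurable_funX; apply: measurable_funB.
  by apply: (measurableT_comp mu1); exact: measurable_fst.
by apply: (measurableT_comp mu1); exact: measurable_snd.
Qed.

Lemma measurable_energy_integrand1 u x : measurable_fun setT u ->
  measurable_fun setT (fun z => (K (x, z) * (u x - u z) ^+ 2)%:E).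
Proof.
move=> mu1; apply/measurable_EFinP.
exact: (measurable_fun_pair2 x (measurable_energy_integrand mu1)).
Qed.

Lemma energy_integrand_ge0 u x z : (0 <= (K (x, z) * (u x - u z) ^+ 2)%:E)%E.
Proof. by rewrite lee_fin mulr_ge0 ?sqr_ge0// mk_ge0. Qed.

Lemma measurable_energy_inner u : measurable_fun setT u ->
  measurable_fun setT (fun x => \int[mu]_z (K (x, z) * (u x - u z) ^+ 2)%:E)%E.
Proof.
move=> mu1.
apply: (@measurable_fun_fubini_tonelli_F _ _ T T R mu
  (fun xz => (K xz * (u xz.1 - u xz.2) ^+ 2)%:E)).
- by apply/measurable_EFinP; exact: measurable_energy_integrand.
- by move=> [x z]; exact: energy_integrand_ge0.
Qed.

Lemma kernel_energy_ge0 u : (0 <= kernel_energy K u)%E.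
Proof. by do 2 (apply: integral_ge0 => ? _); exact: energy_integrand_ge0. Qed.

Lemma mass_right (f : T -> R) : measurable_fun setT f -> (forall x, 0 <= f x) ->
  (\int[mu]_x \int[mu]_z (K (x, z) * f x)%:E = \int[mu]_x (f x)%:E)%E.
Proof.
move=> mf f0; apply: eq_integral => x _.
under eq_integral do rewrite mulrC EFinM.
rewrite ge0_integralZl//.
- by rewrite mk_mass// mule1.
- by apply/measurable_EFinP; exact: mk_measurable1.
- by move=> z _; rewrite lee_fin; exact: mk_ge0.
- by rewrite lee_fin.
Qed.

Lemma mass_left (f : T -> R) : measurable_fun setT f -> (forall x, 0 <= f x) ->
  (\int[mu]_x \int[mu]_z (K (x, z) * f z)%:E = \int[mu]_x (f x)%:E)%E.
Proof.
move=> mf f0.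
rewrite (@fubini_tonelli _ _ T T R mu mu (fun xz => (K xz * f xz.2)%:E)); last 2 first.
- apply/measurable_EFinP/measurable_funM; first exact: mk_measurable mK.
  by apply: (measurableT_comp mf); exact: measurable_snd.
- by move=> [x z]; rewrite lee_fin mulr_ge0// mk_ge0.
rewrite -mass_right//; apply: eq_integral => x _; apply: eq_integral => z _.
by rewrite /= mk_sym.
Qed.

Lemma measurable_mass_right (f : T -> R) : measurable_fun setT f -> (forall x, 0 <= f x) ->
  measurable_fun setT (fun x => \int[mu]_z (K (x, z) * f x)%:E)%E.
Proof.
move=> mf f0.
apply: (@measurable_fun_fubini_tonelli_F _ _ T T R mu (fun xz => (K xz * f xz.1)%:E)).
- apply/measurable_EFinP/measurable_funM; first exact: mk_measurable mK.
  by apply: (measurableT_comp mf); exact: measurable_fst.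
- by move=> [x z]; rewrite lee_fin mulr_ge0// mk_ge0.
Qed.

Lemma measurable_mass_left (f : T -> R) : measurable_fun setT f -> (forall x, 0 <= f x) ->
  measurable_fun setT (fun x => \int[mu]_z (K (x, z) * f z)%:E)%E.
Proof.
move=> mf f0.
apply: (@measurable_fun_fubini_tonelli_F _ _ T T R mu (fun xz => (K xz * f xz.2)%:E)).
- apply/measurable_EFinP/measurable_funM; first exact: mk_measurable mK.
  by apply: (measurableT_comp mf); exact: measurable_snd.
- by move=> [x z]; rewrite lee_fin mulr_ge0// mk_ge0.
Qed.

(** From [(a - b)^2 <= 2 a^2 + 2 b^2] and the unit mass in each variable. *)
Lemma kernel_energy_le4 u : measurable_fun setT u ->
  (kernel_energy K u <= 4%:E * \int[mu]_x (u x ^+ 2)%:E)%E.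
Proof.
move=> mu1; have mu2 : measurable_fun setT (fun x => u x ^+ 2) by exact: measurable_funX.
have u20 x : 0 <= u x ^+ 2 by exact: sqr_ge0.
have -> : (4%:E * \int[mu]_x (u x ^+ 2)%:E =
  \int[mu]_x (\int[mu]_z (K (x, z) * (2 * u x ^+ 2))%:E +
              \int[mu]_z (K (x, z) * (2 * u z ^+ 2))%:E))%E.
  have m2 : measurable_fun setT (fun x => 2 * u x ^+ 2) by exact: measurable_funM.
  have p2 x : 0 <= 2 * u x ^+ 2 by rewrite mulr_ge0.
  rewrite ge0_integralD//; last 4 first.
  - by move=> x _; apply: integral_ge0 => z _; rewrite lee_fin mulr_ge0// mk_ge0.
  - exact: (measurable_mass_right m2 p2).
  - by move=> x _; apply: integral_ge0 => z _; rewrite lee_fin mulr_ge0// mk_ge0.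
  - exact: (measurable_mass_left m2 p2).
  rewrite (mass_right m2 p2) (mass_left m2 p2).
  under [in RHS]eq_integral do rewrite EFinM.
  rewrite ge0_integralZl//; last 2 first.
  - exact/measurable_EFinP.
  - by move=> x _; rewrite lee_fin.
  have -> : (4%:E = 2%:E + 2%:E :> \bar R)%E by rewrite -EFinD; congr EFin; ring.
  by rewrite ge0_muleDl.
apply: ge0_le_integral => //.
- by move=> x _; apply: integral_ge0 => z _; exact: energy_integrand_ge0.
- exact: measurable_energy_inner.
- apply: emeasurable_funD.
  + by apply: measurable_mass_right; [exact: measurable_funM|move=> x; rewrite mulr_ge0].
  + by apply: measurable_mass_left; [exact: measurable_funM|move=> x; rewrite mulr_ge0].
- move=> x _; rewrite -ge0_integralD//; last 4 first.
  + by move=> z _; rewrite lee_fin; apply: mulr_ge0; [exact: mk_ge0|rewrite mulr_ge0].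
  + by apply/measurable_EFinP; apply: measurable_funM => //; exact: mk_measurable1.
  + by move=> z _; rewrite lee_fin; apply: mulr_ge0; [exact: mk_ge0|rewrite mulr_ge0].
  + by apply/measurable_EFinP; apply: measurable_funM => //;
      [exact: mk_measurable1|exact: measurable_funM].
  apply: ge0_le_integral => //.
  + by move=> z _; exact: energy_integrand_ge0.
  + exact: measurable_energy_integrand1.
  + apply: emeasurable_funD; apply/measurable_EFinP; apply: measurable_funM => //;
      do ?[exact: mk_measurable1|exact: measurable_funM].
  + move=> z _; rewrite -EFinD lee_fin -mulrDr ler_wpM2l ?mk_ge0//.
    by have := sqr_ge0 (u x + u z); nra.
Qed.

Lemma kernel_energyD u w : measurable_fun setT u -> measurable_fun setT w ->
  (kernel_energy K (fun x => (u x + w x)%R)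
   <= 2%:E * kernel_energy K u + 2%:E * kernel_energy K w)%E.
Proof.
move=> mu1 mw1; have muw : measurable_fun setT (fun x => u x + w x) by exact: measurable_funD.
have me (f : T -> R) : measurable_fun setT f -> measurable_fun setT
    (fun x => 2%:E * \int[mu]_z (K (x, z) * (f x - f z) ^+ 2)%:E)%E.
  by move=> mf; apply: emeasurable_funM => //; exact: measurable_energy_inner.
have e0 (f : T -> R) x : (0 <= \int[mu]_z (K (x, z) * (f x - f z) ^+ 2)%:E)%E.
  by apply: integral_ge0 => z _; exact: energy_integrand_ge0.
rewrite /kernel_energy -!ge0_integralZl//; try exact: measurable_energy_inner; try by [].
rewrite -ge0_integralD//; last 4 first.
- by move=> x _; rewrite mule_ge0.
- exact: me.
- by move=> x _; rewrite mule_ge0.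
- exact: me.
apply: ge0_le_integral => //.
- by move=> x _; exact: e0.
- exact: measurable_energy_inner.
- by apply: emeasurable_funD; exact: me.
move=> x _.
rewrite -!ge0_integralZl//; try exact: measurable_energy_integrand1;
  try (by move=> z _; exact: energy_integrand_ge0).
have mz (f : T -> R) : measurable_fun setT f -> measurable_fun setT
    (fun z => 2%:E * (K (x, z) * (f x - f z) ^+ 2)%:E)%E.
  by move=> mf; apply: emeasurable_funM => //; exact: measurable_energy_integrand1.
rewrite -ge0_integralD//; try exact: mz; try (by move=> z _; rewrite mule_ge0// energy_integrand_ge0).
apply: ge0_le_integral => //.
- by move=> z _; exact: (energy_integrand_ge0 (fun y => u y + w y)).
- exact: (measurable_energy_integrand1 _ muw).
- by apply: emeasurable_funD; exact: mz.
move=> z _; rewrite -!EFinM -EFinD lee_fin !mulrA ![2 * _]mulrC -!mulrA -mulrDr.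
rewrite ler_wpM2l ?mk_ge0//.
by have := sqr_ge0 ((u x - u z) - (w x - w z)); nra.
Qed.


Lemma mk_mul_intg f x : mu.-integrable setT (EFin \o f) ->
  mu.-integrable setT (EFin \o (fun z => K (x, z) * f z)).
Proof.
move=> hf; have [B hB] := mk_bounded mK.
apply: (le_intg (fun z => B * `|f z|)).
- by apply: measurable_funM; [exact: mk_measurable1|exact: intg_measurable hf].
- by move=> z; rewrite normrM ler_wpM2r// ger0_norm ?hB// mk_ge0.
- by apply: intgZ; exact: intg_norm.
Qed.

Lemma mk_prod_intg f : mu.-integrable setT (EFin \o f) ->
  (mu \x mu)%E.-integrable setT (EFin \o (fun xz : T * T => K xz * f xz.2)).
Proof.
move=> hf; have mf := intg_measurable hf.
have mKf : measurable_fun setT (fun xz : T * T => K xz * f xz.2).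
  apply: measurable_funM; first exact: mk_measurable mK.
  by apply: (measurableT_comp mf); exact: measurable_snd.
have e : (fun xz : T * T => K xz * f xz.2) = (fun xz => K (xz.1, xz.2) * f xz.2).
  by apply/funext => -[].
rewrite e; apply/(@intg_prodP _ _ T T R mu mu (fun x z => K (x, z) * f z)).
  by rewrite -e.
under eq_integral => x _ do under eq_integral => z _ do
  rewrite normrM (ger0_norm (mk_ge0 mK x z)).
rewrite mass_left//; last exact: measurableT_comp.
by have /integrableP[_] := hf.
Qed.

Lemma kernel_mean_intg f : mu.-integrable setT (EFin \o f) ->
  mu.-integrable setT (EFin \o kernel_mean K f).
Proof.
move=> hf; apply: (@intg_Rintegral1 _ _ T T R mu mu (fun x z => K (x, z) * f z)).
by have := mk_prod_intg hf; congr (_.-integrable _ _); apply/funext => -[].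
Qed.

Lemma Rintegral_kernel_mean f : mu.-integrable setT (EFin \o f) ->
  \int[mu]_x kernel_mean K f x = \int[mu]_x f x.
Proof.
move=> hf; rewrite /kernel_mean.
rewrite (@Rintegral_swap _ _ T T R mu mu (fun x z => K (x, z) * f z)); last first.
  by have := mk_prod_intg hf; congr (_.-integrable _ _); apply/funext => -[].
apply: eq_Rintegral => z _.
under eq_Rintegral => x _ do rewrite mulrC mk_sym//.
rewrite RintegralZl//; last exact: mk_intg.
by rewrite /Rintegral mk_mass// mulr1.
Qed.

(** Jensen's inequality, read off from the variance of [u] under the
    probability [K (x, z) dz]. *)
Lemma kernel_mean_sqr u x : L2 mu u ->
  kernel_mean K u x ^+ 2 <= kernel_mean K (fun z => u z ^+ 2) x.
Proof.
move=> hu; have [mu1 iu2] := hu; have iu := L2_intg hu.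
set m := kernel_mean K u x.
have : 0 <= \int[mu]_z (K (x, z) * (u z - m) ^+ 2).
  by apply: Rintegral_ge0 => z _; rewrite mulr_ge0 ?sqr_ge0// mk_ge0.
have -> : \int[mu]_z (K (x, z) * (u z - m) ^+ 2) =
  \int[mu]_z (K (x, z) * u z ^+ 2 + (- (2 * m) * (K (x, z) * u z) + m ^+ 2 * K (x, z))).
  by apply: eq_Rintegral => z _; ring.
have i1 := mk_mul_intg x iu2; have i2 := mk_mul_intg x iu; have i3 := mk_intg x.
rewrite RintegralD//; last by apply: intgD; exact: intgZ.
rewrite RintegralD//; [|exact: intgZ|exact: intgZ].
rewrite !RintegralZl//.
rewrite -/(kernel_mean K u x) -/m [\int[mu]_x0 K _]/Rintegral mk_mass//= mulr1.
rewrite /kernel_mean; nra.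
Qed.

Lemma kernel_mean_L2 u : L2 mu u -> L2 mu (kernel_mean K u).
Proof.
move=> hu; have [mu1 iu2] := hu.
have mP := intg_measurable (kernel_mean_intg (L2_intg hu)).
split=> //; apply: (le_intg (kernel_mean K (fun z => u z ^+ 2))).
- exact: measurable_funX.
- by move=> x; rewrite ger0_norm ?sqr_ge0//; exact: kernel_mean_sqr.
- exact: kernel_mean_intg.
Qed.

(** Jensen and the unit mass in the first variable. *)
Lemma kernel_mean_contraction u : L2 mu u ->
  \int[mu]_x (kernel_mean K u x ^+ 2) <= \int[mu]_x (u x ^+ 2).
Proof.
move=> hu; have [mu1 iu2] := hu; have [_ iP2] := kernel_mean_L2 hu.
rewrite -(Rintegral_kernel_mean iu2); apply: le_Rintegral => //.
  exact: kernel_mean_intg.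
by move=> x _; exact: kernel_mean_sqr.
Qed.

Lemma kernel_energyE u : L2 mu u -> (kernel_energy K u =
  (2 * (\int[mu]_x (u x ^+ 2) - \int[mu]_x (u x * kernel_mean K u x)))%:E)%E.
Proof.
move=> hu; have [mu1 iu2] := hu; have hP := kernel_mean_L2 hu.
have iuP := L2_mul hu hP.
rewrite /kernel_energy.
transitivity (\int[mu]_x (u x ^+ 2 + (- 2 * (u x * kernel_mean K u x)
    + kernel_mean K (fun z => u z ^+ 2) x))%:E)%E.
  apply: eq_integral => x _.
  have i1 := mk_intg x; have i2 := mk_mul_intg x (L2_intg hu); have i3 := mk_mul_intg x iu2.
  have e z : K (x, z) * (u x - u z) ^+ 2 = u x ^+ 2 * K (x, z) +
      (- (2 * u x) * (K (x, z) * u z) + K (x, z) * u z ^+ 2) by ring.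
  rewrite (eq_integral (fun z => (u x ^+ 2 * K (x, z) +
      (- (2 * u x) * (K (x, z) * u z) + K (x, z) * u z ^+ 2))%:E)); last first.
    by move=> z _; rewrite e.
  rewrite -EFin_Rintegral; last first.
    by apply: intgD; [exact: intgZ|apply: intgD => //; exact: intgZ].
  rewrite RintegralD//; [|exact: intgZ|by apply: intgD => //; exact: intgZ].
  rewrite RintegralD//; last exact: intgZ.
  rewrite !RintegralZl// {1}/Rintegral mk_mass//= mulr1.
  by rewrite /kernel_mean; congr EFin; ring.
have iPu2 := kernel_mean_intg iu2.
rewrite -EFin_Rintegral; last by apply: intgD => //; apply: intgD => //; exact: intgZ.
rewrite RintegralD//; last by apply: intgD => //; exact: intgZ.
rewrite RintegralD//; last exact: intgZ.
rewrite RintegralZl// Rintegral_kernel_mean//.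
by congr EFin; ring.
Qed.

(** Expand the square on the left and use the contraction [|P u| <= |u|]. *)
Lemma kernel_mean_sub_energy u : L2 mu u ->
  ((\int[mu]_x ((kernel_mean K u x - u x) ^+ 2))%:E <= kernel_energy K u)%E.
Proof.
move=> hu; have [mu1 iu2] := hu; have hP := kernel_mean_L2 hu; have [_ iP2] := hP.
have iuP := L2_mul hu hP.
rewrite kernel_energyE// lee_fin.
have -> : \int[mu]_x ((kernel_mean K u x - u x) ^+ 2) = \int[mu]_x
  (kernel_mean K u x ^+ 2 + (- 2 * (u x * kernel_mean K u x) + u x ^+ 2)).
  by apply: eq_Rintegral => x _; ring.
rewrite RintegralD//; last by apply: intgD => //; exact: intgZ.
rewrite RintegralD//; last exact: intgZ.
rewrite RintegralZl//.
by have := kernel_mean_contraction hu; lra.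
Qed.

End markov_kernel.
Arguments kernel_energy {d T R} mu K u.
Arguments kernel_mean {d T R} mu K u x.
Arguments markov_kernel {d T R} mu K.

(** * Products of Markov kernels *)

Section product_kernel.
Context d1 d2 (A : measurableType d1) (X : measurableType d2) (R : realType).
Variables (al : probability A R) (mu : probability X R).
Variables (K : A * A -> R) (L : X * X -> R).
Hypotheses (mK : markov_kernel al K) (mL : markov_kernel mu L).

Definition product_kernel (pq : (A * X) * (A * X)) : R :=
  K (pq.1.1, pq.2.1) * L (pq.1.2, pq.2.2).

Local Notation P := (al \x mu)%E.
Let Pp : probability (A * X)%type R := (al \x mu)%E.
Let Z := ((A * X) * (A * X))%type.

Let m1 : measurable_fun setT (fun z : Z => z.1). Proof. exact: measurable_fst. Qed.
Let m2 : measurable_fun setT (fun z : Z => z.2). Proof. exact: measurable_snd. Qed.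
Let m11 : measurable_fun setT (fun z : Z => z.1.1).
Proof. exact: (measurableT_comp measurable_fst m1). Qed.
Let m12 : measurable_fun setT (fun z : Z => z.1.2).
Proof. exact: (measurableT_comp measurable_snd m1). Qed.
Let m21 : measurable_fun setT (fun z : Z => z.2.1).
Proof. exact: (measurableT_comp measurable_fst m2). Qed.
Let m22 : measurable_fun setT (fun z : Z => z.2.2).
Proof. exact: (measurableT_comp measurable_snd m2). Qed.

Let mK2 : measurable_fun setT (fun z : Z => K (z.1.1, z.2.1)).
Proof.
apply: (measurableT_comp (mk_measurable mK)); exact: measurable_fun_pair.
Qed.

Let mL2 : measurable_fun setT (fun z : Z => L (z.1.2, z.2.2)).
Proof.
apply: (measurableT_comp (mk_measurable mL)); exact: measurable_fun_pair.
Qed.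

Let mprod : measurable_fun setT product_kernel.
Proof. exact: measurable_funM. Qed.

Lemma integral_mass1 a (h : X -> R) : measurable_fun setT h -> (forall z, 0 <= h z) ->
  (\int[P]_q (K (a, q.1) * h q.2)%:E = \int[mu]_z (h z)%:E)%E.
Proof.
move=> mh h0.
rewrite (@fubini_tonelli2 _ _ A X R al mu (fun q => (K (a, q.1) * h q.2)%:E)); last 2 first.
- apply/measurable_EFinP/measurable_funM.
    by apply: (measurableT_comp (mk_measurable1 mK a)); exact: measurable_fst.
  by apply: (measurableT_comp mh); exact: measurable_snd.
- by move=> q; rewrite lee_fin mulr_ge0// (mk_ge0 mK).
apply: eq_integral => z _; rewrite /fubini_G /=.
under eq_integral do rewrite mulrC EFinM.
rewrite ge0_integralZl//.
- by rewrite mk_mass// mule1.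
- by apply/measurable_EFinP; exact: (mk_measurable1 mK).
- by move=> b _; rewrite lee_fin ?(mk_ge0 mK) ?(mk_ge0 mL).
- by rewrite lee_fin.
Qed.

Lemma integral_mass2 x (h : A -> R) : measurable_fun setT h -> (forall a, 0 <= h a) ->
  (\int[P]_q (L (x, q.2) * h q.1)%:E = \int[al]_a (h a)%:E)%E.
Proof.
move=> mh h0.
rewrite (@fubini_tonelli1 _ _ A X R al mu (fun q => (L (x, q.2) * h q.1)%:E)); last 2 first.
- apply/measurable_EFinP/measurable_funM.
    by apply: (measurableT_comp (mk_measurable1 mL x)); exact: measurable_snd.
  by apply: (measurableT_comp mh); exact: measurable_fst.
- by move=> q; rewrite lee_fin mulr_ge0// (mk_ge0 mL).
apply: eq_integral => z _; rewrite /fubini_F /=.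
under eq_integral do rewrite mulrC EFinM.
rewrite ge0_integralZl//.
- by rewrite mk_mass// mule1.
- by apply/measurable_EFinP; exact: (mk_measurable1 mL).
- by move=> b _; rewrite lee_fin ?(mk_ge0 mK) ?(mk_ge0 mL).
- by rewrite lee_fin.
Qed.

Lemma markov_product_kernel : markov_kernel (al \x mu)%E product_kernel.
Proof.
split=> //.
- by move=> p q; rewrite /product_kernel mulr_ge0 ?(mk_ge0 mK) ?(mk_ge0 mL).
- have [B hB] := mk_bounded mK; have [C hC] := mk_bounded mL; exists (B * C) => p q.
  by rewrite /product_kernel ler_pM ?hB ?hC ?(mk_ge0 mK) ?(mk_ge0 mL).
- by move=> p q; rewrite /product_kernel /= (mk_sym mK) (mk_sym mL).
- move=> [a x]; rewrite /product_kernel /= (@integral_mass1 a (fun z => L (x, z))).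
  + by rewrite mk_mass.
  + exact: (mk_measurable1 mL).
  + by move=> z; exact: (mk_ge0 mL).
Qed.

Section product_energy.
Variable u : A * X -> R.
Hypothesis mu1 : measurable_fun setT u.

Let mua (a : A) : measurable_fun setT (fun x => u (a, x)).
Proof. exact: measurable_fun_pair2. Qed.
Let muz (z : X) : measurable_fun setT (fun a => u (a, z)).
Proof. exact: measurable_fun_pair1. Qed.

Let F1 (z : Z) : \bar R := (product_kernel z * (u z.1 - u (z.1.1, z.2.2)) ^+ 2)%:E.
Let F2 (z : Z) : \bar R := (product_kernel z * (u (z.1.1, z.2.2) - u z.2) ^+ 2)%:E.

Let mix : measurable_fun setT (fun z : Z => u (z.1.1, z.2.2)).
Proof. by apply: (measurableT_comp mu1); exact: measurable_fun_pair. Qed.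

Let mF1 : measurable_fun setT F1.
Proof.
apply/measurable_EFinP/measurable_funM => //; apply/measurable_funX/measurable_funB => //.
exact: (measurableT_comp mu1).
Qed.

Let mF2 : measurable_fun setT F2.
Proof.
apply/measurable_EFinP/measurable_funM => //; apply/measurable_funX/measurable_funB => //.
exact: (measurableT_comp mu1).
Qed.

Let pk_ge0 z : 0 <= product_kernel z.
Proof. by rewrite /product_kernel mulr_ge0 ?(mk_ge0 mK) ?(mk_ge0 mL). Qed.

Let F1_ge0 z : (0 <= F1 z)%E. Proof. by rewrite lee_fin mulr_ge0 ?sqr_ge0 ?pk_ge0. Qed.
Let F2_ge0 z : (0 <= F2 z)%E. Proof. by rewrite lee_fin mulr_ge0 ?sqr_ge0 ?pk_ge0. Qed.

Let W := ((A * X) * X)%type.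

Let mH1 : measurable_fun setT
  (fun p : A * X => \int[mu]_z (L (p.2, z) * (u p - u (p.1, z)) ^+ 2)%:E)%E.
Proof.
apply: (@measurable_fun_fubini_tonelli_F _ _ _ X R mu
  (fun w : W => (L (w.1.2, w.2) * (u w.1 - u (w.1.1, w.2)) ^+ 2)%:E)).
- have w1 : measurable_fun setT (fun w : W => w.1) by exact: measurable_fst.
  have w2 : measurable_fun setT (fun w : W => w.2) by exact: measurable_snd.
  apply/measurable_EFinP/measurable_funM.
    apply: (measurableT_comp (mk_measurable mL)); apply: measurable_fun_pair => //.
    exact: (measurableT_comp measurable_snd w1).
  apply/measurable_funX/measurable_funB; first exact: (measurableT_comp mu1).
  apply: (measurableT_comp mu1); apply: measurable_fun_pair => //.
  exact: (measurableT_comp measurable_fst w1).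
- by move=> w; rewrite lee_fin mulr_ge0 ?sqr_ge0 ?(mk_ge0 mK) ?(mk_ge0 mL).
Qed.

Let mH2 : measurable_fun setT
  (fun p : A * X => \int[al]_a (K (p.1, a) * (u p - u (a, p.2)) ^+ 2)%:E)%E.
Proof.
apply: (@measurable_fun_fubini_tonelli_F _ _ _ A R al
  (fun w : (A * X) * A => (K (w.1.1, w.2) * (u w.1 - u (w.2, w.1.2)) ^+ 2)%:E)).
- have w1 : measurable_fun setT (fun w : (A * X) * A => w.1) by exact: measurable_fst.
  have w2 : measurable_fun setT (fun w : (A * X) * A => w.2) by exact: measurable_snd.
  apply/measurable_EFinP/measurable_funM.
    apply: (measurableT_comp (mk_measurable mK)); apply: measurable_fun_pair => //.
    exact: (measurableT_comp measurable_fst w1).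
  apply/measurable_funX/measurable_funB; first exact: (measurableT_comp mu1).
  apply: (measurableT_comp mu1); apply: measurable_fun_pair => //.
  exact: (measurableT_comp measurable_snd w1).
- by move=> w; rewrite lee_fin mulr_ge0 ?sqr_ge0 ?(mk_ge0 mK) ?(mk_ge0 mL).
Qed.

Lemma measurable_slice_energy1 :
  measurable_fun setT (fun a => kernel_energy mu L (fun x => u (a, x))).
Proof.
apply: (@measurable_fun_fubini_tonelli_F _ _ A X R mu
  (fun p : A * X => \int[mu]_z (L (p.2, z) * (u p - u (p.1, z)) ^+ 2)%:E)%E) => //.
by move=> p; apply: integral_ge0 => z _; rewrite lee_fin mulr_ge0 ?sqr_ge0 ?(mk_ge0 mK) ?(mk_ge0 mL).
Qed.

Lemma measurable_slice_energy2 :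
  measurable_fun setT (fun z => kernel_energy al K (fun a => u (a, z))).
Proof.
apply: (@measurable_fun_fubini_tonelli_G _ _ A X R al
  (fun p : A * X => \int[al]_a (K (p.1, a) * (u p - u (a, p.2)) ^+ 2)%:E)%E) => //.
by move=> p; apply: integral_ge0 => z _; rewrite lee_fin mulr_ge0 ?sqr_ge0 ?(mk_ge0 mK) ?(mk_ge0 mL).
Qed.

Let int_F1 : (\int[P]_p \int[P]_q F1 (p, q) =
  \int[al]_a kernel_energy mu L (fun x => u (a, x)))%E.
Proof.
transitivity (\int[P]_p \int[mu]_z (L (p.2, z) * (u p - u (p.1, z)) ^+ 2)%:E)%E.
  apply: eq_integral => -[a x] _; rewrite /F1 /product_kernel /=.
  rewrite -(@integral_mass1 a (fun z => L (x, z) * (u (a, x) - u (a, z)) ^+ 2)).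
  - by apply: eq_integral => -[b z] _ /=; rewrite mulrA.
  - apply: measurable_funM; first exact: (mk_measurable1 mL).
    by apply/measurable_funX/measurable_funB.
  - by move=> z; rewrite mulr_ge0 ?sqr_ge0 ?(mk_ge0 mK) ?(mk_ge0 mL).
rewrite fubini_tonelli1// => p; apply: integral_ge0 => z _.
by rewrite lee_fin mulr_ge0 ?sqr_ge0 ?(mk_ge0 mK) ?(mk_ge0 mL).
Qed.

Let int_F2 : (\int[P]_p \int[P]_q F2 (p, q) =
  \int[mu]_z kernel_energy al K (fun a => u (a, z)))%E.
Proof.
transitivity (\int[P]_q \int[P]_p F2 (p, q))%E.
  exact: (@fubini_tonelli _ _ _ _ R Pp Pp F2 mF2 F2_ge0).
transitivity (\int[P]_p \int[al]_a (K (p.1, a) * (u p - u (a, p.2)) ^+ 2)%:E)%E.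
  apply: eq_integral => -[b z] _; rewrite /F2 /product_kernel /=.
  rewrite -(@integral_mass2 z (fun a => K (b, a) * (u (b, z) - u (a, z)) ^+ 2)).
  - apply: eq_integral => -[a x] _ /=; congr EFin.
    by rewrite (mk_sym mK) (mk_sym mL); ring.
  - apply: measurable_funM; first exact: (mk_measurable1 mK).
    by apply/measurable_funX/measurable_funB.
  - by move=> a; rewrite mulr_ge0 ?sqr_ge0 ?(mk_ge0 mK) ?(mk_ge0 mL).
rewrite fubini_tonelli2// => p; apply: integral_ge0 => z _.
by rewrite lee_fin mulr_ge0 ?sqr_ge0 ?(mk_ge0 mK) ?(mk_ge0 mL).
Qed.

(** Moving one coordinate at a time splits an increment of [u] over the
    product into an increment in each factor. *)
Lemma product_kernel_energy : (kernel_energy (al \x mu)%E product_kernel u <=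
  2%:E * \int[al]_a kernel_energy mu L (fun x => u (a, x)) +
  2%:E * \int[mu]_z kernel_energy al K (fun a => u (a, z)))%E.
Proof.
rewrite -int_F1 -int_F2 /kernel_energy.
have mI (F : Z -> \bar R) : measurable_fun setT F -> (forall z, 0 <= F z)%E ->
    measurable_fun setT (fun p => \int[P]_q F (p, q))%E.
  by move=> mF F0; exact: (@measurable_fun_fubini_tonelli_F _ _ _ _ R Pp F mF F0).
have I0 (F : Z -> \bar R) p : (forall z, 0 <= F z)%E -> (0 <= \int[P]_q F (p, q))%E.
  by move=> F0; exact: integral_ge0.
rewrite -!ge0_integralZl//; try exact: mI; try (by move=> p _; exact: I0).
rewrite -ge0_integralD//; last 4 first.
- by move=> p _; rewrite mule_ge0// I0.
- by apply: emeasurable_funM => //; exact: mI.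
- by move=> p _; rewrite mule_ge0// I0.
- by apply: emeasurable_funM => //; exact: mI.
have mprodE := markov_product_kernel.
apply: ge0_le_integral => //.
- by move=> p _; apply: integral_ge0 => q _; exact: (energy_integrand_ge0 mprodE).
- exact: (measurable_energy_inner mprodE).
- by apply: emeasurable_funD; apply: emeasurable_funM => //; exact: mI.
move=> p _.
have mF1p : measurable_fun setT (fun q => F1 (p, q)) by exact: measurable_fun_pair2.
have mF2p : measurable_fun setT (fun q => F2 (p, q)) by exact: measurable_fun_pair2.
rewrite -!ge0_integralZl// -ge0_integralD//; last 4 first.
- by move=> q _; rewrite mule_ge0.
- exact: emeasurable_funM.
- by move=> q _; rewrite mule_ge0.
- exact: emeasurable_funM.
apply: ge0_le_integral => //.
- by move=> q _; exact: (energy_integrand_ge0 mprodE).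
- exact: (measurable_energy_integrand1 mprodE).
- by apply: emeasurable_funD; exact: emeasurable_funM.
move=> q _; rewrite /F1 /F2 -!EFinM -EFinD lee_fin /=.
have e (k a b c : R) : 0 <= k ->
    k * (a - c) ^+ 2 <= 2 * (k * (a - b) ^+ 2) + 2 * (k * (b - c) ^+ 2).
  move=> k0; rewrite -subr_ge0 (_ : _ - _ = k * ((a - b) - (b - c)) ^+ 2).
    by rewrite mulr_ge0 ?sqr_ge0.
  by ring.
exact: e.
Qed.

End product_energy.
End product_kernel.

(** * Cosine-power kernels on the circle *)

Section unit_interval.
Variable R : realType.
Local Notation leb := (@lebesgue_measure R).
Local Notation U := (uniform_prob (@ltr01 R)).

Lemma integral_unit_interval (f : measurableTypeR R -> \bar R) : measurable_fun setT f ->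
  (\int[U]_x f x = \int[leb]_(x in `[0%R, 1%R]) f x)%E.
Proof.
have h (g : measurableTypeR R -> \bar R) : measurable_fun setT g -> (forall x, 0 <= g x)%E ->
    (\int[U]_x g x = \int[leb]_(x in `[0%R, 1%R]) g x)%E.
  by move=> mg g0; rewrite integral_uniform// subr0 invr1 mul1e.
move=> mf; rewrite integralE [RHS]integralE.
by rewrite !h//; [exact: measurable_funeneg|exact: measurable_funepos].
Qed.

Lemma unit_interval_intgP (f : measurableTypeR R -> R) : measurable_fun setT f ->
  U.-integrable setT (EFin \o f) <-> leb.-integrable `[0%R, 1%R] (EFin \o f).
Proof.
move=> mf; have mfE : measurable_fun setT (fun x : measurableTypeR R => `|(f x)%:E|%E).
  by apply/measurable_EFinP; exact: measurableT_comp.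
split=> /integrableP[_ h]; apply/integrableP; split.
- by apply/measurable_EFinP; exact: measurable_funTS.
- by rewrite -integral_unit_interval.
- exact/measurable_EFinP.
- by rewrite integral_unit_interval.
Qed.

Lemma continuous_measurable1 (f : R -> R) : continuous f ->
  measurable_fun setT (f : measurableTypeR R -> R).
Proof. exact: continuous_measurable_fun. Qed.

Lemma continuous_unit_intg (f : R -> R) : continuous f -> U.-integrable setT (EFin \o f).
Proof.
move=> cf; apply/unit_interval_intgP; first exact: continuous_measurable1.
apply: continuous_compact_integrable; first exact: segment_compact.
exact: continuous_subspaceT.
Qed.

Lemma unit_interval_FTC (F f : R -> R) : continuous f ->
  (forall x : R, is_derive x 1 F (f x)) -> \int[U]_x f x = F 1 - F 0.
Proof.
move=> cf dF; rewrite /Rintegral integral_unit_interval; last first.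
  by apply/measurable_EFinP; exact: continuous_measurable1.
have cF : continuous F.
  by move=> x; apply: differentiable_continuous; apply/derivable1_diffP; have [] := dF x.
rewrite (@continuous_FTC2 _ f F)//.
- exact: continuous_subspaceT.
- split; first by move=> x _; have [] := dF x.
  + exact: cvg_at_right_filter (cF 0).
  + exact: cvg_at_left_filter (cF 1).
- by move=> x _; rewrite derive1E; apply: derive_val.
Qed.

Definition half_cos (t : R) : R := (1 + cos t) / 2.
(** The mean of [half_cos ^ n] over a period, computed by the recursion that
    [half_cos_pow_derive] yields. *)
Definition half_cos_mass (n : nat) : R := \prod_(k < n) ((2 * k + 1)%:R / (2 * k + 2)%:R).

Lemma half_cos_ge0 t : 0 <= half_cos t.
Proof. by rewrite divr_ge0//; have := cos_geN1 t; lra. Qed.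

Lemma half_cos_le1 t : half_cos t <= 1.
Proof. by rewrite ler_pdivrMr//; have := cos_le1 t; lra. Qed.

Lemma half_cos_continuous : continuous half_cos.
Proof.
move=> t; apply: cvgMl; apply: cvgD; first exact: cvg_cst.
exact: continuous_cos.
Qed.

Lemma half_cos_massS n :
  (2 * n + 2)%:R * half_cos_mass n.+1 = (2 * n + 1)%:R * half_cos_mass n.
Proof.
rewrite /half_cos_mass big_ord_recr /= mulrCA [_%:R * (_ / _)]mulrC divfK ?pnatr_eq0 ?addn2//.
by rewrite mulrC.
Qed.

Lemma half_cos_mass_gt0 n : 0 < half_cos_mass n.
Proof.
by rewrite /half_cos_mass prodr_gt0// => k _; rewrite divr_gt0// ltr0n ?addn1 ?addn2.
Qed.

Lemma half_cos_pow_derive n (t : R) : is_derive t 1 (fun t => sin t * half_cos t ^+ n)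
  ((2 * n + 2)%:R * half_cos t ^+ n.+1 - (2 * n + 1)%:R * half_cos t ^+ n).
Proof.
have dQ : is_derive t 1 half_cos (- sin t / 2).
  apply: trigger_derive; rewrite /GRing.scale /=; ring.
have dX : is_derive t 1 (fun t => half_cos t ^+ n) (n%:R * half_cos t ^+ n.-1 * (- sin t / 2)).
  have := @is_deriveX _ _ half_cos n t 1 _ dQ.
  congr (is_derive _ _ _ _); rewrite exprfctE//.
have := is_deriveM (is_derive_sin t) dX.
congr (is_derive _ _ _ _).
have s2 : sin t ^+ 2 = 4 * half_cos t * (1 - half_cos t).
  have := cos2Dsin2 t; rewrite /half_cos; lra.
rewrite /GRing.scale /=.
have ec : cos t = 2 * half_cos t - 1 by rewrite /half_cos; field.
case: n {dX} => [|n]; first by rewrite /= !expr0 expr1 ec; ring.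
rewrite /= [X in X + _ = _](_ : _ = n.+1%:R * half_cos t ^+ n * (- (sin t ^+ 2) / 2)); last by ring.
rewrite s2 ec !exprS !natrD !natrM -[n.+1]addn1 natrD; by field.
Qed.

(** The powers of [(1 + cos) / 2] concentrate at the diagonal as [n] grows and
    are trigonometric polynomials, hence of finite rank. *)
Definition periodic_kernel n (xz : measurableTypeR R * measurableTypeR R) : R :=
  half_cos (2 * pi * xz.1 - 2 * pi * xz.2) ^+ n / half_cos_mass n.

Let angle (x z : R) : R := 2 * pi * x - 2 * pi * z.

Let angle_continuous x : continuous (angle x).
Proof.
move=> z; apply: cvgB; first exact: cvg_cst.
by apply: cvgMr; exact: cvg_id.
Qed.

Lemma half_cos_angle_continuous n x : continuous (fun z => half_cos (angle x z) ^+ n).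
Proof.
move=> z; apply: (@cvg_comp _ _ _ (angle x) (fun t => half_cos t ^+ n) _ (nbhs (angle x z))).
  exact: angle_continuous.
apply: (@cvg_comp _ _ _ half_cos (fun t => t ^+ n) _ (nbhs (half_cos (angle x z)))).
  exact: half_cos_continuous.
exact: exprn_continuous.
Qed.

(** The integral over a period of the derivative of [sin half_cos^n] is 0. *)
Lemma half_cos_mass_rec n x :
  (2 * n + 2)%:R * \int[U]_z half_cos (angle x z) ^+ n.+1 =
  (2 * n + 1)%:R * \int[U]_z half_cos (angle x z) ^+ n.
Proof.
have pi0 : pi != 0 :> R by rewrite gt_eqF// pi_gt0.
have ic k := continuous_unit_intg (@half_cos_angle_continuous k x).
pose H t := sin t * half_cos t ^+ n.
pose f z := (2 * n + 2)%:R * half_cos (angle x z) ^+ n.+1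
  - (2 * n + 1)%:R * half_cos (angle x z) ^+ n.
have cf : continuous f.
  by move=> z; apply: cvgB; apply: cvgMr; exact: half_cos_angle_continuous.
have dF (z : R) : is_derive z 1 (fun z => - (2 * pi)^-1 * H (angle x z)) (f z).
  have lin (a y w : R) : - (2 * pi) * (a *: y + w) = a * (- (2 * pi) * y) + - (2 * pi) * w.
    by rewrite /GRing.scale /=; ring.
  have dH := @is_derive_comp_affine _ _ H (fun z : R => - (2 * pi) * z) (2 * pi * x) _ z 1
    lin (half_cos_pow_derive n _).
  have dHa : is_derive z 1 (fun z : R => H (angle x z)) (- (2 * pi) * 1 * f z).
    have e y : angle x y = - (2 * pi) * y + 2 * pi * x by rewrite /angle; ring.
    by rewrite /f; under eq_fun do rewrite e; rewrite e.
  have := is_deriveZ (- (2 * pi)^-1) dHa.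
  congr (is_derive _ _ _ _).
  have c0 : 2 * pi != 0 :> R by rewrite mulf_neq0.
  by rewrite /GRing.scale /= mulr1 mulrA mulNr mulrN opprK mulVf ?mul1r.
apply/eqP; rewrite -subr_eq0 -!RintegralZl// -RintegralB//; [|exact: intgZ|exact: intgZ].
have e := unit_interval_FTC cf dF.
rewrite /f in e; rewrite e.
rewrite -mulrBr mulf_eq0 subr_eq0; apply/orP; right.
have -> : angle x 0 = angle x 1 + pi *+ 2 by rewrite /angle; ring.
by rewrite /H /half_cos sinD2pi cosD2pi.
Qed.

Lemma half_cos_mass_shift n x : \int[U]_z half_cos (angle x z) ^+ n = half_cos_mass n.
Proof.
elim: n => [|n IH].
  under eq_Rintegral do rewrite expr0.
  by rewrite Rintegral_prob_cst /half_cos_mass big_ord0.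
have := half_cos_mass_rec n x; rewrite IH -half_cos_massS.
by apply: mulfI; rewrite pnatr_eq0 addn2.
Qed.

Lemma measurable_periodic_kernel n : measurable_fun setT (periodic_kernel n).
Proof.
apply: measurable_funM => //; apply: measurable_funX.
apply: (measurableT_comp (continuous_measurable1 half_cos_continuous)).
by apply: measurable_funB; apply: measurable_funM.
Qed.

Lemma markov_periodic_kernel n : markov_kernel U (periodic_kernel n).
Proof.
have c0 := half_cos_mass_gt0 n.
split.
- exact: measurable_periodic_kernel.
- by move=> x z; apply: divr_ge0; [rewrite exprn_ge0// half_cos_ge0|exact: ltW].
- exists (half_cos_mass n)^-1 => x z; rewrite /periodic_kernel.
  have ci0 : 0 <= (half_cos_mass n)^-1 by rewrite invr_ge0 ltW.
  by rewrite ler_piMl// exprn_ile1 ?half_cos_ge0 ?half_cos_le1.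
- by move=> x z; rewrite /periodic_kernel /half_cos /= -cosN opprB.
- move=> x; have ic := continuous_unit_intg (@half_cos_angle_continuous n (x : R)).
  rewrite -EFin_Rintegral; last first.
    under eq_fun do rewrite /periodic_kernel /= mulrC.
    apply: (@intgZ _ _ _ U).
    exact: ic.
  under eq_Rintegral do rewrite /periodic_kernel /= mulrC.
  rewrite RintegralZl//.
  by rewrite half_cos_mass_shift mulVf// gt_eqF.
Qed.

(** The second moment of the kernel; its decay is what makes the kernels an
    approximate identity. *)
Lemma periodic_kernel_moment n x :
  \int[U]_z (periodic_kernel n (x, z) * (1 - half_cos (angle x z))) = (2 * n + 2)%:R^-1.
Proof.
have c0 := half_cos_mass_gt0 n.
have ic k := continuous_unit_intg (@half_cos_angle_continuous k x).
have -> : \int[U]_z (periodic_kernel n (x, z) * (1 - half_cos (angle x z))) =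
    \int[U]_z ((half_cos_mass n)^-1 * (half_cos (angle x z) ^+ n
      - half_cos (angle x z) ^+ n.+1)).
  by apply: eq_Rintegral => z _; rewrite /periodic_kernel /= exprS /angle; ring.
rewrite RintegralZl//; last exact: intgB.
rewrite RintegralB// !half_cos_mass_shift.
have h := half_cos_massS n.
have n2 : (2 * n + 2)%:R != 0 :> R by rewrite pnatr_eq0 addn2.
have -> : half_cos_mass n.+1 = (2 * n + 1)%:R * half_cos_mass n / (2 * n + 2)%:R.
  by rewrite -h mulrAC mulfV// mul1r.
have cn0 : half_cos_mass n != 0 by rewrite gt_eqF.
have -> : (2 * n + 1)%:R = (2 * n + 2)%:R - 1 :> R by rewrite !natrD; ring.
move: n2; set N := (2 * n + 2)%:R => n2; clearbody N.
by field; rewrite n2 cn0.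
Qed.

(** The cosine decreases with the distance up to 1/2 and is symmetric about it;
    as the points 0 and 1 of the circle are identified, [delta] must be at most
    [1 - x] as well. *)
Lemma half_cos_away (x delta z : R) : 0 < delta -> delta <= x -> delta <= 1 - x ->
  0 < z < 1 -> delta <= `|x - z| -> half_cos (angle x z) <= half_cos (2 * pi * delta).
Proof.
move=> d0 dx d1x /andP[z0 z1] dxz.
have pi0 := @pi_gt0 R.
rewrite /half_cos ler_pM2r// lerD2l.
have -> : cos (angle x z) = cos (2 * pi * `|x - z|).
  have -> : angle x z = 2 * pi * (x - z) by rewrite /angle; ring.
  by have [h|h] := leP 0 (x - z); rewrite ?(ger0_norm h)// (ltr0_norm h) mulrN cosN.
set s := `|x - z| in dxz *.
have s1 : s <= 1 - delta by rewrite ler_norml; apply/andP; split; lra.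
have d12 : delta <= 1 / 2 by lra.
have mono (y : R) : delta <= y -> y <= 1 / 2 -> cos (2 * pi * y) <= cos (2 * pi * delta).
  move=> dy y12; rewrite leNgt; apply/negP; rewrite ltr_cos ?in_itv/=.
  - by rewrite ltr_pM2l ?mulr_gt0// ltNge dy.
  - by apply/andP; split; nra.
  - by apply/andP; split; nra.
have [s12|s12] := lerP s (1 / 2); first exact: mono.
have -> : cos (2 * pi * s) = cos (2 * pi * (1 - s)).
  rewrite -[RHS]cosN -[RHS]cosD2pi; congr cos; ring.
by apply: mono; lra.
Qed.

Lemma half_cos_lt1 (delta : R) : 0 < delta -> delta <= 1 / 2 -> half_cos (2 * pi * delta) < 1.
Proof.
move=> d0 d12; have pi0 := @pi_gt0 R.
rewrite /half_cos ltr_pdivrMr// mul1r.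
suff : cos (2 * pi * delta) < cos 0 by rewrite cos0; lra.
rewrite ltr_cos ?in_itv/= ?lexx ?pi_ge0//; first by nra.
by apply/andP; split; nra.
Qed.

Lemma unit_interval_ae : {ae U, forall x : measurableTypeR R, 0 < x < 1}.
Proof.
exists (~` `]0, 1[%classic); split.
- by apply: measurableC; exact: measurable_itv.
- transitivity (\int[U]_x (\1_(~` `]0, 1[%classic) x)%:E)%E.
    by rewrite integral_indic ?setIT//; apply: measurableC; exact: measurable_itv.
  rewrite integral_unit_interval; last first.
    by apply/measurable_EFinP; apply: measurable_indic; apply: measurableC; exact: measurable_itv.
  rewrite integral_indic//; last by apply: measurableC; exact: measurable_itv.
  apply: (@countable_lebesgue_measure0 R).
  apply: (@sub_countable _ _ _ [set 0%R; 1%R]).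
    apply: subset_card_le => x /= []; rewrite !in_itv/=.
    move=> /negP; rewrite negb_and -!leNgt => /orP[h|h] /andP[h0 h1].
      by left; apply/eqP; rewrite eq_le h h0.
    by right; apply/eqP; rewrite eq_le h h1.
  by apply: finite_set_countable; exact: finite_set2.
- by move=> x /= h; apply: contra_not h; rewrite in_itv.
Qed.

End unit_interval.

(** * Decay of the kernel energies on the circle *)

(** Convergence to 0 phrased with upper bounds only, which suits extended-real
    sequences of energies. *)
Definition vanishes (R : realType) (a : nat -> \bar R) : Prop :=
  forall e : R, 0 < e -> \forall n \near \oo, (a n <= e%:E)%E.

Section vanishing.
Variable R : realType.
Implicit Types a b : nat -> \bar R.

Lemma vanishes_cvg a : (forall n, (0 <= a n)%E) -> vanishes a -> a n @[n --> \oo] --> 0%E.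
Proof.
move=> a0 va; apply/fine_cvgP; split.
  apply: filterS (va 1 ltr01) => n an.
  by rewrite ge0_fin_numE// (le_lt_trans an)// ltry.
apply/cvgrPdist_le => e e0; apply: filterS (va e e0) => n an.
rewrite sub0r normrN ger0_norm ?fine_ge0//.
have an_fin : a n \is a fin_num by rewrite ge0_fin_numE// (le_lt_trans an)// ltry.
by rewrite -lee_fin fineK.
Qed.

Lemma cvg_vanishes a : a n @[n --> \oo] --> 0%E -> vanishes a.
Proof.
move=> /fine_cvgP[af /cvgrPdist_le ac] e e0.
near=> n.
have an : a n \is a fin_num by near: n.
rewrite -(fineK an) lee_fin.
have : `|0 - (fine \o a) n| <= e by near: n; exact: ac.
by rewrite sub0r normrN; apply: le_trans; exact: ler_norm.
Unshelve. all: by end_near. Qed.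

Lemma vanishes_le a b : (forall n, (a n <= b n)%E) -> vanishes b -> vanishes a.
Proof.
by move=> ab vb e e0; apply: filterS (vb e e0) => n; exact: le_trans.
Qed.

Lemma vanishes2D a b : vanishes a -> vanishes b ->
  vanishes (fun n => 2%:E * a n + 2%:E * b n)%E.
Proof.
move=> va vb e e0; have e4 : 0 < e / 4 by rewrite divr_gt0.
near=> n.
have -> : (e%:E = 2%:E * (e / 4)%:E + 2%:E * (e / 4)%:E)%E.
  by rewrite -!EFinM -EFinD; congr EFin; field.
by apply: leeD; apply: lee_wpmul2l => //; near: n; [exact: va|exact: vb].
Unshelve. all: by end_near. Qed.

End vanishing.

Section energy_vanishing.
Context d (T : measurableType d) (R : realType) (mu : probability T R).
Variable K : nat -> T * T -> R.
Hypothesis mK : forall n, markov_kernel mu (K n).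

(** The energy is a quadratic form bounded by the L^2 norm, so the functions
    with vanishing energies are closed in L^2. *)
Lemma energy_vanishes_approx (u : T -> R) : measurable_fun setT u ->
  (forall e : R, 0 < e -> exists w : T -> R, [/\ measurable_fun setT w,
     vanishes (fun n => kernel_energy mu (K n) w) &
     (\int[mu]_x ((u x - w x) ^+ 2)%:E <= e%:E)%E]) ->
  vanishes (fun n => kernel_energy mu (K n) u).
Proof.
move=> mu1 h e e0; have e16 : 0 < e / 16 by rewrite divr_gt0.
have [w [mw vw hw]] := h _ e16.
have e4 : 0 < e / 4 by rewrite divr_gt0.
apply: filterS (vw _ e4) => n wn.
have muw : measurable_fun setT (fun x => u x - w x) by exact: measurable_funB.
have -> : u = (fun x => w x + (u x - w x)) by apply/funext => x; ring.
apply: (le_trans (kernel_energyD (mK n) mw muw)).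
have -> : (e%:E = 2%:E * (e / 4)%:E + 2%:E * (e / 4)%:E)%E.
  by rewrite -!EFinM -EFinD; congr EFin; field.
apply: leeD; apply: lee_wpmul2l => //.
apply: (le_trans (kernel_energy_le4 (mK n) muw)).
have -> : ((e / 4)%:E = 4%:E * (e / 16)%:E)%E.
  by rewrite -EFinM; congr EFin; field.
exact: lee_wpmul2l.
Qed.

Definition clamp (M x : R) : R := Num.max (- M) (Num.min M x).

Lemma clamp_bound M x : 0 <= M -> `|clamp M x| <= M.
Proof.
move=> M0; rewrite ler_norml /clamp le_max lexx /= ge_max ge_min lexx /= andbT; lra.
Qed.

Lemma clamp_id M x : `|x| <= M -> clamp M x = x.
Proof.
by rewrite ler_norml => /andP[h1 h2]; rewrite /clamp (min_idPr h2) (max_idPr h1).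
Qed.

Lemma clamp_lip M x y : `|clamp M x - clamp M y| <= `|x - y|.
Proof.
wlog xy : x y / x <= y.
  move=> h; have [/h//|/ltW/h] := leP x y.
  by rewrite distrC [X in _ <= X]distrC.
have cxy : clamp M x <= clamp M y.
  by rewrite /clamp; apply: le_max2 => //; apply: le_min2.
rewrite ler0_norm ?subr_le0// ler0_norm ?subr_le0// !opprB.
rewrite /clamp; case: (leP M x) => Mx; case: (leP M y) => My; try lra;
  rewrite ?maxEle; repeat case: ifP => ?; lra.
Qed.

Lemma measurable_clamp M : measurable_fun setT (clamp M : measurableTypeR R -> R).
Proof. by apply: measurable_maxr => //; apply: measurable_minr. Qed.

(** Truncations converge to [u] in L^2 by dominated convergence. *)
Lemma energy_vanishes_truncate (u : T -> R) : L2 mu u ->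
  (forall M, 0 <= M -> vanishes (fun n => kernel_energy mu (K n) (fun x => clamp M (u x)))) ->
  vanishes (fun n => kernel_energy mu (K n) u).
Proof.
move=> hu hM; have [mu1 iu2] := hu.
have mc M : measurable_fun setT (fun x => clamp M (u x)).
  exact: (measurableT_comp (measurable_clamp M) mu1).
apply: energy_vanishes_approx => // e e0.
have cv : \int[mu]_x ((u x - clamp n%:R (u x)) ^+ 2) @[n --> \oo] --> \int[mu]_x (cst 0 x).
  apply: (@Rdominated_cvg _ _ _ _ _ _ (fun x => 4 * u x ^+ 2)) => //.
  - by move=> n; apply: measurable_funX; exact: measurable_funB.
  - apply: nearW => x; apply: cvg_near_cst.
    near=> n; rewrite clamp_id ?subrr ?expr0n//.
    near: n; exact: nbhs_infty_ger.
  - exact: intgZ.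
  - move=> n; apply: nearW => x; rewrite ger0_norm ?sqr_ge0//.
    have h0 : clamp n%:R 0 = 0 by rewrite clamp_id// normr0.
    have := clamp_lip n%:R (u x) 0; rewrite h0 !subr0 => h.
    have : `|u x - clamp n%:R (u x)| <= 2 * `|u x|.
      by apply: (le_trans (ler_normB _ _)); lra.
    move=> h2; rewrite -[X in X <= _]real_normK ?num_real//.
    rewrite -[u x ^+ 2]real_normK ?num_real//.
    by have := normr_ge0 (u x - clamp n%:R (u x)); nra.
rewrite Rintegral_prob_cst in cv.
move/cvgrPdist_le : cv => /(_ e e0) [N _ /(_ N (leqnn N))] /= hN.
exists (fun x => clamp N%:R (u x)); split => //; first exact: hM.
rewrite -EFin_Rintegral; last by have [] := L2B hu (@bounded_L2 _ _ _ mu _ N%:R (mc N%:R) (fun x => clamp_bound _ (ler0n _ N))).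
rewrite lee_fin; apply: le_trans hN; rewrite sub0r normrN; exact: ler_norm.
Unshelve. all: by end_near. Qed.

End energy_vanishing.

Section periodic_energy.
Variable R : realType.
Local Notation leb := (@lebesgue_measure R).
Local Notation U := (uniform_prob (@ltr01 R)).

(** Near the diagonal [g] varies little; away from it the oscillation of [g]
    is dominated by a multiple of [1 - half_cos], whose mean is [1/(2n + 2)]. *)
Lemma periodic_energy_continuous (g : R -> R) (M : R) : continuous g ->
  (forall x, `|g x| <= M) ->
  vanishes (fun n => kernel_energy U (@periodic_kernel R n) g).
Proof.
move=> cg gM; have M0 : 0 <= M by exact: le_trans (gM 0).
have mg := continuous_measurable1 cg.
have mK := @markov_periodic_kernel R.
have g4 x z : (g x - g z) ^+ 2 <= 4 * M ^+ 2.
  have := gM x; have := gM z; rewrite !ler_norml => /andP[? ?] /andP[? ?]; nra.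
have mgx x : measurable_fun setT (fun z : measurableTypeR R => (g x - g z) ^+ 2).
  by apply: measurable_funX; exact: measurable_funB.
have ig x : U.-integrable setT (EFin \o (fun z : measurableTypeR R => (g x - g z) ^+ 2)).
  apply: (@bounded_intg _ _ _ U _ (4 * M ^+ 2)) => // z.
  by rewrite ger0_norm ?sqr_ge0.
pose h n (x : measurableTypeR R) := \int[U]_z (periodic_kernel n (x, z) * (g x - g z) ^+ 2).
have h0 n x : 0 <= h n x.
  by apply: Rintegral_ge0 => z _; rewrite mulr_ge0 ?sqr_ge0 ?(mk_ge0 (mK n)).
have h4 n x : h n x <= 4 * M ^+ 2.
  have e : \int[U]_z ((4 * M ^+ 2) * periodic_kernel n (x, z)) = 4 * M ^+ 2.
    by rewrite RintegralZl ?[\int[U]_z _]/Rintegral ?(mk_mass (mK n)) ?mulr1//; exact: (mk_intg (mK n)).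
  rewrite -[leRHS]e; apply: le_Rintegral => //.
  - exact: (mk_mul_intg (mK n)).
  - by apply: intgZ; exact: (mk_intg (mK n)).
  - by move=> z _; rewrite mulrC ler_wpM2r// (mk_ge0 (mK n)).
have mh n : measurable_fun setT (h n).
  apply: (@measurable_Rintegral1 _ _ _ _ R U
    (fun x z => periodic_kernel n (x, z) * (g x - g z) ^+ 2)).
    have := measurable_energy_integrand (mK n) mg.
    by congr (measurable_fun _ _); apply/funext => -[].
  by move=> x z; rewrite mulr_ge0 ?sqr_ge0 ?(mk_ge0 (mK n)).
have hE n : (kernel_energy U (@periodic_kernel R n) g = (\int[U]_x h n x)%:E)%E.
  rewrite EFin_Rintegral; last first.
    by apply: (@bounded_intg _ _ _ U _ (4 * M ^+ 2)) => // x; rewrite ger0_norm.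
  apply: eq_integral => x _; rewrite /h EFin_Rintegral//.
  exact: (mk_mul_intg (mK n)).
suff cv : \int[U]_x h n x @[n --> \oo] --> \int[U]_x (cst 0 x).
  rewrite Rintegral_prob_cst in cv => e e0.
  move/cvgrPdist_le : cv => /(_ e e0); apply: filterS => n; rewrite hE lee_fin.
  by rewrite sub0r normrN; apply: le_trans; exact: ler_norm.
apply: (@Rdominated_cvg _ _ _ _ _ _ (cst (4 * M ^+ 2))) => //; last 2 first.
- exact: finite_measure_integrable_cst.
- by move=> n; apply: nearW => x; rewrite ger0_norm.
apply: filterS (unit_interval_ae R) => x /andP[x0 x1].
apply/cvgrPdist_le => e e0.
have e2 : 0 < e / 2 by rewrite divr_gt0.
pose eta := Num.sqrt (e / 2).
have eta0 : 0 < eta by rewrite sqrtr_gt0.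
have /cvgrPdist_lt/(_ eta eta0)/nbhs_ballP[del /= del0 hdel] := cg x.
(* within [delta] of [x] both the modulus of continuity of [g] and the
   monotonicity of the cosine apply *)
pose delta := Num.min del (Num.min x (1 - x)).
have delta0 : 0 < delta by rewrite !lt_min del0 x0 subr_gt0.
have dx : delta <= x by rewrite !ge_min lexx orbT.
have d1x : delta <= 1 - x by rewrite !ge_min lexx !orbT.
have ddel : delta <= del by rewrite ge_min lexx.
have q1 : 0 < 1 - half_cos (2 * pi * delta) by rewrite subr_gt0 half_cos_lt1//; lra.
pose C := 4 * M ^+ 2 / (1 - half_cos (2 * pi * delta)).
have C0 : 0 <= C by apply: divr_ge0; [rewrite mulr_ge0 ?sqr_ge0|exact: ltW].
have bnd n : h n x <= e / 2 + C * (2 * n + 2)%:R^-1.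
  rewrite -(periodic_kernel_moment n x).
  have i1 : U.-integrable setT (EFin \o (fun z => periodic_kernel n (x, z)
      * (1 - half_cos (2 * pi * x - 2 * pi * z)))).
    apply: (mk_mul_intg (mK n)).
    by have := intgB (continuous_unit_intg (@cst_continuous _ _ (1 : R)))
     (continuous_unit_intg (@half_cos_angle_continuous R 1 x)).
  have e1 : e / 2 = \int[U]_z (e / 2 * periodic_kernel n (x, z)).
    by rewrite RintegralZl ?[\int[U]_z _]/Rintegral ?(mk_mass (mK n)) ?mulr1//; exact: (mk_intg (mK n)).
  rewrite [X in X + _]e1 -RintegralZl// -RintegralD//; last 2 first.
  - by apply: intgZ; exact: (mk_intg (mK n)).
  - exact: intgZ.
  apply: ae_le_Rintegral.
  - exact: (mk_mul_intg (mK n)).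
  - by apply: intgD; apply: intgZ => //; exact: (mk_intg (mK n)).
  apply: filterS (unit_interval_ae R) => z z01.
  have k0 := mk_ge0 (mK n) x z.
  rewrite [leRHS](_ : _ = periodic_kernel n (x, z) *
    (e / 2 + C * (1 - half_cos (2 * pi * x - 2 * pi * z)))); last by ring.
  rewrite ler_wpM2l//.
  have hc1 := half_cos_le1 (2 * pi * x - 2 * pi * z).
  have [xz|xz] := ltP `|x - z| delta.
    have : `|g x - g z| < eta by apply: hdel; rewrite /ball /=; exact: lt_le_trans ddel.
    move=> /ltW hgz; rewrite (@le_trans _ _ (e / 2))//.
      have <- : eta ^+ 2 = e / 2 by rewrite sqr_sqrtr// ltW.
      rewrite -[X in X <= _]real_normK ?num_real//.
      by rewrite lerXn2r// nnegrE ltW.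
    by rewrite lerDl mulr_ge0// subr_ge0.
  have := half_cos_away delta0 dx d1x z01 xz => hca.
  rewrite (@le_trans _ _ (C * (1 - half_cos (2 * pi * x - 2 * pi * z))))//; last by rewrite lerDr ltW.
  apply: (le_trans (g4 x z)).
  rewrite /C mulrAC ler_pdivlMr// ler_wpM2l ?mulr_ge0 ?sqr_ge0//; lra.
have cvC : C * (2 * n + 2)%:R^-1 @[n --> \oo] --> (0 : R).
  rewrite -(mulr0 C); apply: cvgMr.
  apply/gtr0_cvgV0; first by apply: nearW => n; rewrite ltr0n addn2.
  apply/cvgryPge => A; near=> n.
  apply: (@le_trans _ _ n%:R); last by rewrite ler_nat mul2n -addnn -addnA leq_addr.
  by near: n; exact: nbhs_infty_ger.
move/cvgrPdist_le : cvC => /(_ (e / 2) e2); apply: filterS => n.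
rewrite !sub0r !normrN ger0_norm; last by rewrite mulr_ge0// invr_ge0.
rewrite ger0_norm// => hC; apply: (le_trans (bnd n)); lra.
Unshelve. all: by end_near. Qed.

(** Bounded functions are limits in L^1 of continuous ones, and for functions
    with values in [-M, M] convergence in L^1 implies convergence in L^2. *)
Lemma periodic_energy_vanishes (u : measurableTypeR R -> R) : L2 U u ->
  vanishes (fun n => kernel_energy U (@periodic_kernel R n) u).
Proof.
move=> hu; have mK := @markov_periodic_kernel R.
apply: (energy_vanishes_truncate mK) => // M M0.
have [mu1 _] := hu.
have mw : measurable_fun setT (fun x : measurableTypeR R => clamp M (u x)).
  exact: (measurableT_comp (measurable_clamp M) mu1).
set w := (fun x => clamp M (u x)) in mw *.
have wM x : `|w x| <= M by exact: clamp_bound.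
apply: (energy_vanishes_approx mK) => // e e0.
have iw : leb.-integrable `[0, 1] (EFin \o w).
  by apply/unit_interval_intgP => //; exact: (@bounded_intg _ _ _ U _ M).
have lebE : (leb `[0%R, 1%R]%classic < +oo)%E.
  by rewrite lebesgue_measure_itv/= lte01 -EFinB ltry.
have [g [cg ig gw]] := approximation_continuous_integrable (measurable_itv _) lebE iw.
have /fine_cvgP[fing /cvgrPdist_le] := gw.
(* [2 M] bounds the oscillation; the summand 1 keeps the divisor positive *)
have M1 : 0 < 2 * M + 1 by lra.
move=> /(_ (e / (2 * M + 1)) (divr_gt0 e0 M1)) hn.
have [n [fn hn']] : exists n, (\int[leb]_(z in `[0%R, 1%R]) `|(w z - g n z)%:E| \is a fin_num)%E /\
    `|0 - fine (\int[leb]_(z in `[0%R, 1%R]) `|(w z - g n z)%:E|)%E| <= e / (2 * M + 1).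
  have [N _ hN] := filterI fing hn.
  by exists N; exact: (hN N (leqnn N)).
have cc : continuous (fun x : R => clamp M (g n x)).
  move=> x; apply/cvgrPdist_le => r r0.
  have /cvgrPdist_le/(_ r r0) := cg n x.
  by apply: filterS => y; apply: le_trans; exact: clamp_lip.
exists (fun x => clamp M (g n x)); split.
- exact: continuous_measurable1.
- by apply: (periodic_energy_continuous cc (M := M)) => x; exact: clamp_bound.
- have mgn := continuous_measurable1 (cg n).
  have mc := continuous_measurable1 cc.
  apply: (@le_trans _ _ (\int[U]_x ((2 * M + 1) * `|w x - g n x|)%:E)%E).
    apply: ge0_le_integral => //.
    + by move=> x _; rewrite lee_fin sqr_ge0.
    + by apply/measurable_EFinP; apply: measurable_funX; exact: measurable_funB.
    + apply/measurable_EFinP; apply: measurable_funM => //.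
      by apply: measurableT_comp => //; exact: measurable_funB.
    + move=> x _; rewrite lee_fin -real_normK ?num_real// expr2.
      have h1 : `|w x - clamp M (g n x)| <= `|w x - g n x|.
        by rewrite -{1}(clamp_id (wM x)); exact: clamp_lip.
      have h2 : `|w x - clamp M (g n x)| <= 2 * M + 1.
        have := wM x; have := clamp_bound (g n x) M0 => a b.
        by apply: (le_trans (ler_normB _ _)); lra.
      exact: ler_pM.
  have mabs : measurable_fun setT (fun x : measurableTypeR R => (`|w x - g n x|)%:E).
    by apply/measurable_EFinP; apply: measurableT_comp => //; exact: measurable_funB.
  under eq_integral do rewrite EFinM.
  rewrite ge0_integralZl//; last by rewrite lee_fin ltW.
  rewrite integral_unit_interval//.
  have -> : (\int[leb]_(x in `[0%R, 1%R]) (`|w x - g n x|)%:E =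
     \int[leb]_(z in `[0%R, 1%R]) `|(w z - g n z)%:E|)%E by [].
  rewrite -(fineK fn) -EFinM lee_fin mulrC -ler_pdivlMr//.
  by apply: le_trans hn'; rewrite sub0r normrN ler_norm.
Qed.

End periodic_energy.

(** * The smoothing kernel on the torus *)

Section matrix_measurability.
Variables (R : realType) (m n : nat).

(** Rational boxes are cylinder sets, and every open set is a countable union
   of them. *)
Lemma open_measurable_mx (A : set 'M[R]_(m, n)) : open A -> measurable A.
Proof.
move=> oA.
pose box (q : 'M[rat]_(m, n) * nat) : set 'M[R]_(m, n) :=
  [set M | forall i j, `|M i j - ratr (q.1 i j)| < q.2.+1%:R^-1].
have mbox q : measurable (box q).
  have -> : box q = \bigcap_(i in [set: 'I_m]) \bigcap_(j in [set: 'I_n])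
      [set M : 'M[R]_(m, n) | ball (ratr (q.1 i j) : R) q.2.+1%:R^-1 (M i j)].
    apply/seteqP; split=> M /=.
      by move=> h i _ j _ /=; rewrite /ball /= distrC; exact: h.
    by move=> h i j; have := h i I j I; rewrite /ball /= distrC.
  apply: fin_bigcap_measurable; first exact: finite_finset.
  move=> i _; apply: fin_bigcap_measurable; first exact: finite_finset.
  move=> j _; have := @measurable_mx_entry R m n i j measurableT
    (ball (ratr (q.1 i j) : R) q.2.+1%:R^-1) (measurable_ball _ _).
  by rewrite setTI.
have aux1 (a b r : R) : a - r < b -> b < a + r -> `|a - b| < r.
  by move=> h1 h2; rewrite ltr_norml; apply/andP; split; lra.
have aux2 (a b c r e : R) : `|a - c| < r -> `|b - c| < r -> r < e / 2 -> `|a - b| < e.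
  move=> h1 h2 h3; have := ler_distD c a b; rewrite [`|c - b|]distrC; lra.
have -> : A = \bigcup_(q in [set q | box q `<=` A]) box q.
  apply/seteqP; split=> [M AM|M [q /= qA Mq]]; last exact: qA.
  have /nbhs_ballP[e /= e0 eA] : nbhs M A by apply: open_nbhs_nbhs; split.
  have [k hk] : exists k, k.+1%:R^-1 < e / 2.
    have e2 : 0 < e / 2 by rewrite divr_gt0.
    near \oo => k; exists k.
    by near: k; exact: near_infty_natSinv_lt (PosNum e2).
  have k0 : (0 : R) < k.+1%:R^-1 by rewrite invr_gt0.
  have hq i j : exists q : rat, `|M i j - ratr q| < k.+1%:R^-1.
    have lt2 : M i j - k.+1%:R^-1 < M i j + k.+1%:R^-1.
      by rewrite ltrD2l (lt_trans _ k0)// oppr_lt0.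
    have [q] := rat_in_itvoo lt2.
    rewrite in_itv/= => /andP[h1 h2]; exists q.
    exact: aux1.
  pose q : 'M[rat]_(m, n) := \matrix_(i, j) xchoose (hq i j).
  have hqM i j : `|M i j - ratr (q i j)| < k.+1%:R^-1.
    by rewrite mxE; exact: (xchooseP (hq i j)).
  exists (q, k); last exact: hqM.
  move=> N /= hN; apply: eA; split=> // i j.
  by rewrite /ball /=; exact: (aux2 _ _ _ _ _ (hqM i j) (hN i j) hk).
pose boxn k := if unpickle k is Some q then if `[< box q `<=` A >] then box q else set0
  else set0.
have -> : \bigcup_(q in [set q | box q `<=` A]) box q = \bigcup_k boxn k.
  apply/seteqP; split=> M.
    move=> [q /= qA Mq]; exists (pickle q) => //.
    by rewrite /boxn pickleK asboolT.
  move=> [k _]; rewrite /boxn; case: unpickle => [q|//].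
  by case: asboolP => // qA Mq; exists q.
apply: bigcupT_measurable => k; rewrite /boxn; case: unpickle => [q|//].
by case: ifP.
Unshelve. all: by end_near. Qed.

Lemma continuous_measurable_mx (f : 'M[R]_(m, n) -> R) : continuous f ->
  measurable_fun setT (f : 'M[R]_(m, n) -> measurableTypeR R).
Proof.
move=> cf; apply: (measurability _ (RGenOpens.measurableE R)).
move=> _ [_ [a [b ->] <-]]; rewrite setTI; apply: open_measurable_mx.
by move/continuousP : cf; apply; exact: interval_open.
Qed.

End matrix_measurability.

Lemma vanishes_integral d (T : measurableType d) (R : realType)
    (mu : {measure set T -> \bar R}) (e : nat -> T -> \bar R) (g : T -> \bar R) :
  (forall n, measurable_fun setT (e n)) -> (forall n x, 0 <= e n x)%E ->
  (forall n x, e n x <= g x)%E -> mu.-integrable setT g ->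
  {ae mu, forall x, vanishes (e ^~ x)} -> vanishes (fun n => \int[mu]_x e n x)%E.
Proof.
move=> me e0 eg ig ve; apply: cvg_vanishes.
have [_ _] : [/\ mu.-integrable setT (cst 0%E),
  [sequence (\int[mu]_x `|e n x - 0|)%E]_n @ \oo --> 0%E &
  [sequence (\int[mu]_x (e n x))%E]_n @ \oo --> (\int[mu]_x (cst 0%E x))%E].
  apply: (@dominated_convergence _ _ _ mu setT measurableT e (cst 0%E) g) => //.
  - by apply: filterS ve => x vx _; exact: vanishes_cvg.
  - by apply: nearW => x n _; rewrite gee0_abs.
by rewrite integral0.
Qed.

Section torus.
Variable R : realType.
Local Notation U := (uniform_prob (@ltr01 R)).

Lemma integral_torusS d (f : 'rV[R]_d.+1 -> \bar R) : measurable_fun setT f ->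
  (forall x, 0 <= f x)%E ->
  (\int[torus_measure R d.+1]_x f x =
   \int[(uniform_prob (@ltr01 R) \x torus_measure R d)%E]_p f (rV_cons p))%E.
Proof. by move=> mf f0; rewrite /= ge0_integral_distribution. Qed.

Lemma rV_cons_surj d (x : 'rV[R]_d.+1) : exists p, x = rV_cons p.
Proof.
exists (x 0 0, \row_j x 0 (lift 0 j)); apply/rowP => j.
rewrite /rV_cons /=; case: (split_ordP (j : 'I_(1 + d))) => k ->.
  rewrite [RHS](@row_mxEl _ 1 1 d) mxE; congr (x _ _).
  by apply: val_inj; rewrite /= ord1.
rewrite [RHS](@row_mxEr _ 1 1 d) mxE; congr (x _ _).
by apply: val_inj.
Qed.

Lemma rV_cons0 d p : (@rV_cons R d p) 0 ord0 = p.1.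
Proof.
rewrite /rV_cons (_ : ord0 = lshift d (0 : 'I_1)); last exact: val_inj.
by rewrite (@row_mxEl _ 1 1 d) mxE.
Qed.

Lemma rV_consS d p (j : 'I_d) : (@rV_cons R d p) 0 (lift ord0 j) = p.2 0 j.
Proof.
rewrite /rV_cons (_ : lift ord0 j = rshift 1 j); last exact: val_inj.
by rewrite (@row_mxEr _ 1 1 d).
Qed.

Definition torus_kernel d n (xz : 'rV[R]_d * 'rV[R]_d) : R :=
  \prod_(j < d) periodic_kernel n (xz.1 0 j, xz.2 0 j).

Lemma torus_kernel_cons d n p q :
  torus_kernel n (@rV_cons R d p, @rV_cons R d q) =
  product_kernel (@periodic_kernel R n) (@torus_kernel d n) (p, q).
Proof.
rewrite /torus_kernel /product_kernel big_ord_recl /= !rV_cons0; congr (_ * _).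
by apply: eq_bigr => j _; rewrite !rV_consS.
Qed.

Lemma measurable_torus_kernel d n : measurable_fun setT (@torus_kernel d n).
Proof.
apply: measurable_prod => j _.
apply: (measurableT_comp (@measurable_periodic_kernel R n)).
apply: measurable_fun_pair.
  exact: (measurableT_comp (@measurable_mx_entry R 1 d 0 j) measurable_fst).
exact: (measurableT_comp (@measurable_mx_entry R 1 d 0 j) measurable_snd).
Qed.

Lemma torus_kernel_ge0 d n xz : 0 <= @torus_kernel d n xz.
Proof. by apply: prodr_ge0 => j _; exact: (mk_ge0 (markov_periodic_kernel R n)). Qed.

Lemma markov_torus_kernel d n : markov_kernel (torus_measure R d) (@torus_kernel d n).
Proof.
elim: d => [|d IH].
  split.
  - exact: measurable_torus_kernel.
  - by move=> x z; exact: torus_kernel_ge0.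
  - by exists 1 => x z; rewrite /torus_kernel big_ord0.
  - by move=> x z; rewrite /torus_kernel !big_ord0.
  - move=> x; under eq_integral do rewrite /torus_kernel big_ord0.
    by rewrite integral_cst//= diracE mem_setT mule1.
have mk1 := markov_periodic_kernel R n.
have mP := markov_product_kernel mk1 IH.
split.
- exact: measurable_torus_kernel.
- by move=> x z; exact: torus_kernel_ge0.
- have [B hB] := mk_bounded mP; exists B => x z.
  have [p ->] := rV_cons_surj x; have [q ->] := rV_cons_surj z.
  by rewrite torus_kernel_cons.
- move=> x z; rewrite /torus_kernel; apply: eq_bigr => j _ /=.
  exact: (mk_sym mk1).
- move=> x; have [p ->] := rV_cons_surj x.
  rewrite integral_torusS.
  + under eq_integral do rewrite torus_kernel_cons.
    by rewrite (mk_mass mP).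
  + apply/measurable_EFinP.
    exact: (measurable_fun_pair2 _ (@measurable_torus_kernel _ n)).
  + by move=> z; rewrite lee_fin torus_kernel_ge0.
Qed.

Lemma torus_energyS d n (u : 'rV[R]_d.+1 -> R) : measurable_fun setT u ->
  (kernel_energy (torus_measure R d.+1) (@torus_kernel d.+1 n) u =
   kernel_energy (uniform_prob (@ltr01 R) \x torus_measure R d)%E
     (product_kernel (@periodic_kernel R n) (@torus_kernel d n)) (u \o @rV_cons R d))%E.
Proof.
move=> mu1; have mk := markov_torus_kernel d.+1 n.
rewrite /kernel_energy integral_torusS.
- apply: eq_integral => p _; rewrite integral_torusS.
  + by apply: eq_integral => q _; rewrite torus_kernel_cons.
  + exact: (measurable_energy_integrand1 mk).
  + by move=> x; exact: (energy_integrand_ge0 mk).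
- exact: (measurable_energy_inner mk).
- by move=> x; apply: integral_ge0 => z _; exact: (energy_integrand_ge0 mk).
Qed.

(** By induction on the dimension: moving one coordinate at a time bounds the
    energy by energies of slices, and dominated convergence integrates them. *)
Lemma torus_energy_vanishes d (u : 'rV[R]_d -> R) : L2 (torus_measure R d) u ->
  vanishes (fun n => kernel_energy (torus_measure R d) (@torus_kernel d n) u).
Proof.
elim: d u => [|d IH] u hu.
  move=> e e0; apply: nearW => n; rewrite /kernel_energy.
  rewrite integral0_eq; first by rewrite lee_fin ltW.
  move=> x _; rewrite integral0_eq// => z _.
  by rewrite (thinmx0 x) (thinmx0 z) subrr expr0n mulr0.
have [mu1 iu2] := hu; have mk1 := markov_periodic_kernel R; have mkd := @markov_torus_kernel d.
pose w : measurableTypeR R * 'rV[R]_d -> R := u \o @rV_cons R d.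
have mw : measurable_fun setT w by exact: (measurableT_comp mu1 (@measurable_rV_cons R d)).
have mw2 : measurable_fun setT (fun p => w p ^+ 2) by exact: measurable_funX.
have e2 : (fun z : measurableTypeR R * 'rV[R]_d => w (z.1, z.2) ^+ 2) = (fun p => w p ^+ 2).
  by apply/funext => -[].
have iw2 : (U \x torus_measure R d)%E.-integrable setT
    (EFin \o (fun z : measurableTypeR R * 'rV[R]_d => w (z.1, z.2) ^+ 2)).
  rewrite e2; apply/intg_ge0P => //; first by move=> p; exact: sqr_ge0.
  rewrite -(@integral_torusS d (fun x => (u x ^+ 2)%:E)).
  - by apply/intg_ge0P => //; [exact: measurable_funX|move=> x; exact: sqr_ge0].
  - by apply/measurable_EFinP; exact: measurable_funX.
  - by move=> x; rewrite lee_fin sqr_ge0.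
have mwa a : measurable_fun setT (fun x => w (a, x)) by exact: measurable_fun_pair2.
have mwx x : measurable_fun setT (fun a => w (a, x)) by exact: measurable_fun_pair1.
apply: (@vanishes_le _ _ (fun n => 2%:E * \int[U]_a kernel_energy (torus_measure R d)
    (@torus_kernel d n) (fun x => w (a, x)) + 2%:E * \int[torus_measure R d]_z
    kernel_energy U (@periodic_kernel R n) (fun a => w (a, z)))%E).
  by move=> n; rewrite torus_energyS//; exact: product_kernel_energy.
have iw2' := iw2; rewrite e2 in iw2'.
apply: vanishes2D.
- apply: (@vanishes_integral _ _ _ _ _ (fun a => 4%:E * \int[torus_measure R d]_x (w (a, x) ^+ 2)%:E)%E).
  + by move=> n; exact: (measurable_slice_energy1 (mkd n)).
  + by move=> n a; exact: (kernel_energy_ge0 (mkd n)).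
  + by move=> n a; exact: (kernel_energy_le4 (mkd n)).
  + by apply: integrableZl => //; exact: (integrable_fubini_F iw2').
  + have h1 : {ae U, forall a, (torus_measure R d).-integrable setT
        (EFin \o (fun x => w (a, x) ^+ 2))} := ae_intg1 iw2.
    apply: filterS h1 => a ia; apply: IH; split; [exact: mwa|exact: ia].
- apply: (@vanishes_integral _ _ _ _ _ (fun x => 4%:E * \int[U]_a (w (a, x) ^+ 2)%:E)%E).
  + by move=> n; exact: (measurable_slice_energy2 (mk1 n)).
  + by move=> n a; exact: (kernel_energy_ge0 (mk1 n)).
  + by move=> n a; exact: (kernel_energy_le4 (mk1 n)).
  + by apply: integrableZl => //; exact: (integrable_fubini_G iw2').
  + have h2 : {ae torus_measure R d, forall x, U.-integrable setT
        (EFin \o (fun a => w (a, x) ^+ 2))} := ae_intg2 iw2.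
    apply: filterS h2 => x ix; apply: periodic_energy_vanishes; split; [exact: mwx|exact: ix].
Qed.

End torus.

(** * Finite-rank expansions and weak derivatives *)

Lemma is_derive_bigsum (R : realType) (V : normedModType R) (I : Type) (s : seq I)
    (h : I -> V -> R) (dh : I -> R) (x v : V) :
  (forall i, is_derive x v (h i) (dh i)) ->
  is_derive x v (fun y => \sum_(i <- s) h i y) (\sum_(i <- s) dh i).
Proof.
move=> hd; elim: s => [|i s IH].
  by rewrite big_nil; under eq_fun do rewrite big_nil; exact: is_derive_cst.
by rewrite big_cons; under eq_fun do rewrite big_cons; exact: is_deriveD.
Qed.

Section bounded_smooth_more.
Variables (R : realType) (d : nat).
Implicit Types e f : 'rV[R]_d -> R.

Lemma bounded_smoothD e f :
  bounded_smooth e -> bounded_smooth f -> bounded_smooth (e \+ f).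
Proof.
move=> [[ce pe] [Me be] de] [[cf pf] [Mf bf] df]; split.
- split; first by move=> k; exact: CkD.
  by move=> x j /=; rewrite pe pf.
- by exists (Me + Mf) => x /=; apply: (le_trans (ler_normD _ _)); rewrite lerD.
- move=> v; have [M1 b1] := de v; have [M2 b2] := df v.
  exists (M1 + M2) => x.
  have := is_deriveD (Ck_is_derive v x (ce 1%N)) (Ck_is_derive v x (cf 1%N)).
  move=> /(@derive_val _ _ _ _ _ _ _) ->.
  by apply: (le_trans (ler_normD _ _)); rewrite lerD.
Qed.

Lemma bounded_smoothZ (c : R) e : bounded_smooth e -> bounded_smooth (fun x => c * e x).
Proof. by move=> he; exact: (bounded_smoothM (bounded_smooth_cst d c) he). Qed.

Lemma bounded_smooth_sum (I : Type) (s : seq I) (F : I -> 'rV[R]_d -> R) :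
  (forall i, bounded_smooth (F i)) -> bounded_smooth (fun x => \sum_(i <- s) F i x).
Proof.
move=> hF; elim: s => [|i s IH].
  by under eq_fun do rewrite big_nil; exact: bounded_smooth_cst.
by under eq_fun do rewrite big_cons; exact: bounded_smoothD.
Qed.

Lemma bounded_smoothX n e : bounded_smooth e -> bounded_smooth (fun x => e x ^+ n).
Proof.
move=> he; elim: n => [|n IH].
  by under eq_fun do rewrite expr0; exact: bounded_smooth_cst.
by under eq_fun do rewrite exprS; exact: (bounded_smoothM he IH).
Qed.

Lemma bounded_smooth_measurable e : bounded_smooth e -> measurable_fun setT e.
Proof. by move=> he; apply: continuous_measurable_mx; exact: bounded_smooth_continuous. Qed.

Lemma bounded_smooth_derive_measurable e v : bounded_smooth e ->
  measurable_fun setT ('D_v e).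
Proof.
by move=> he; apply: continuous_measurable_mx; exact: bounded_smooth_derive_continuous.
Qed.

Local Notation mu := (torus_measure R d).

Lemma bounded_smooth_L2 e : bounded_smooth e -> L2 mu e.
Proof.
move=> he; have [_ [M hM] _] := he.
exact: (bounded_L2 _ (bounded_smooth_measurable he) hM).
Qed.

Lemma bounded_smooth_derive_L2 e v : bounded_smooth e -> L2 mu ('D_v e).
Proof.
move=> he; have [_ _ /(_ v)[M hM]] := he.
exact: (bounded_L2 _ (bounded_smooth_derive_measurable v he) hM).
Qed.

Lemma bounded_mul_intg (u f : 'rV[R]_d -> R) (M : R) : mu.-integrable setT (EFin \o u) ->
  measurable_fun setT f -> (forall x, `|f x| <= M) ->
  mu.-integrable setT (EFin \o (fun x => u x * f x)).
Proof.
move=> iu mf fM; apply: (le_intg (fun x => M * `|u x|)).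
- by apply: measurable_funM => //; exact: intg_measurable iu.
- by move=> x; rewrite normrM mulrC ler_wpM2r.
- by apply: intgZ; exact: intg_norm.
Qed.

Lemma bounded_smooth_mul_intg (u e : 'rV[R]_d -> R) : mu.-integrable setT (EFin \o u) ->
  bounded_smooth e -> mu.-integrable setT (EFin \o (fun x => u x * e x)).
Proof.
move=> iu he; have [_ [M hM] _] := he.
exact: bounded_mul_intg iu (bounded_smooth_measurable he) hM.
Qed.

Lemma bounded_smooth_derive_mul_intg (u e : 'rV[R]_d -> R) v :
  mu.-integrable setT (EFin \o u) ->
  bounded_smooth e -> mu.-integrable setT (EFin \o (fun x => u x * 'D_v e x)).
Proof.
move=> iu he; have [_ _ /(_ v)[M hM]] := he.
exact: bounded_mul_intg iu (bounded_smooth_derive_measurable v he) hM.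
Qed.

End bounded_smooth_more.

Definition weak_derivative (R : realType) (d : nat) (u Du : 'rV[R]_d -> R) (j : 'I_d) : Prop :=
  [/\ (torus_measure R d).-integrable setT (EFin \o u),
      (torus_measure R d).-integrable setT (EFin \o Du) &
      forall phi : 'rV[R]_d -> R, torus_smooth phi ->
        \int[torus_measure R d]_x (u x * 'D_(delta_mx 0 j) phi x) =
        - \int[torus_measure R d]_x (Du x * phi x)].

Section finite_rank.
Variables (R : realType) (d : nat).
Implicit Types L : 'rV[R]_d * 'rV[R]_d -> R.

(** A kernel that is a finite combination of squares [e (x) e] of smooth
    functions. Averages against it only involve finitely many coefficients
    [\int u e k], each of which can be tested in the weak formulation. *)
Record expansion L (I : finType) (lam : I -> R) (e : I -> 'rV[R]_d -> R) : Prop := {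
  exp_smooth : forall k, bounded_smooth (e k) ;
  exp_eq : forall x z, L (x, z) = \sum_k lam k * e k x * e k z }.

Definition finite_rank L : Prop := exists I lam e, @expansion L I lam e.

Lemma finite_rank_cst c : finite_rank (cst c).
Proof.
exists unit, (fun=> c), (fun _ => cst 1); split; first by move=> _; exact: bounded_smooth_cst.
by move=> x z; rewrite big_const card_unit /= !mulr1 addr0.
Qed.

(** Products of expansions are expansions over pairs of indices. *)
Lemma finite_rankM L1 L2 : finite_rank L1 -> finite_rank L2 ->
  finite_rank (fun xz => L1 xz * L2 xz).
Proof.
move=> [I [lam [e [se ee]]]] [J [lam' [f [sf ef]]]].
exists (I * J)%type, (fun k => lam k.1 * lam' k.2), (fun k => e k.1 \* f k.2); split.
  by move=> k; exact: bounded_smoothM.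
move=> x z; rewrite ee ef big_distrl /=.
under eq_bigr do rewrite big_distrr /=.
rewrite pair_bigA /=; apply: eq_bigr => k _ /=; ring.
Qed.

Lemma finite_rankD L1 L2 : finite_rank L1 -> finite_rank L2 ->
  finite_rank (fun xz => L1 xz + L2 xz).
Proof.
move=> [I [lam [e [se ee]]]] [J [lam' [f [sf ef]]]].
exists (I + J)%type, (fun k => match k with inl i => lam i | inr j => lam' j end),
  (fun k => match k with inl i => e i | inr j => f j end); split.
  by case.
by move=> x z; rewrite ee ef big_sumType.
Qed.

(** The addition formula [cos (a - b) = cos a cos b + sin a sin b]. *)
Lemma finite_rank_cos (j : 'I_d) :
  finite_rank (fun xz => cos (2 * pi * xz.1 0 j - 2 * pi * xz.2 0 j)).
Proof.
have -> : (fun xz : 'rV[R]_d * 'rV[R]_d => cos (2 * pi * xz.1 0 j - 2 * pi * xz.2 0 j)) =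
  (fun xz => cos (tau_coord j xz.1) * cos (tau_coord j xz.2) +
             sin (tau_coord j xz.1) * sin (tau_coord j xz.2)).
  by apply/funext => xz; rewrite cosB.
apply: finite_rankD.
- exists unit, (fun=> 1), (fun _ x => cos (tau_coord j x)); split.
    by move=> _; exact: bounded_smooth_cos.
  by move=> x z; rewrite big_const card_unit /= mul1r addr0.
- exists unit, (fun=> 1), (fun _ x => sin (tau_coord j x)); split.
    by move=> _; exact: bounded_smooth_sin.
  by move=> x z; rewrite big_const card_unit /= mul1r addr0.
Qed.

Lemma finite_rank_torus_kernel n : finite_rank (@torus_kernel R d n).
Proof.
rewrite /torus_kernel; elim: (index_enum _) => [|j s IH].
  by under eq_fun do rewrite big_nil; exact: finite_rank_cst.
under eq_fun do rewrite big_cons; apply: finite_rankM => //.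
rewrite /periodic_kernel /half_cos /=.
apply: (@finite_rankM _ (cst _)); last exact: finite_rank_cst.
elim: n {IH s} => [|n IH]; first by under eq_fun do rewrite expr0; exact: finite_rank_cst.
under eq_fun do rewrite exprS; apply: finite_rankM => //.
apply: (@finite_rankM _ (cst _)); last exact: finite_rank_cst.
apply: (@finite_rankD (cst 1)); [exact: finite_rank_cst|exact: finite_rank_cos].
Qed.

Lemma torus_kernel_translate n x z w :
  @torus_kernel R d n (x + w, z + w) = torus_kernel n (x, z).
Proof.
apply: eq_bigr => j _; rewrite /periodic_kernel /= !mxE.
by congr (half_cos _ ^+ _ / _); ring.
Qed.

Section expansion_theory.
Variables (n : nat) (I : finType) (lam : I -> R) (e : I -> 'rV[R]_d -> R).
Hypothesis hL : expansion (@torus_kernel R d n) lam e.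
Local Notation mu := (torus_measure R d).
Local Notation Pn := (kernel_mean mu (@torus_kernel R d n)).

(** Derivative of the kernel under the simultaneous translation of both
    arguments, which leaves it unchanged. *)
Lemma expansion_translate v x z :
  \sum_k lam k * 'D_v (e k) x * e k z = - \sum_k lam k * e k x * 'D_v (e k) z.
Proof.
have he k := exp_smooth hL k.
have exz : x + (z - x) = z by rewrite addrCA subrr addr0.
pose g y := \sum_k lam k * (e k y * e k (y + (z - x))).
have gE : g = cst (torus_kernel n (x, z)).
  apply/funext => y; rewrite /g /=.
  have <- : torus_kernel n (y, y + (z - x)) = torus_kernel n (x, z).
    rewrite -(torus_kernel_translate n x z (y - x)); congr torus_kernel.
    by congr pair; [rewrite addrC subrK|rewrite addrCA].
  by rewrite (exp_eq hL); apply: eq_bigr => k _; rewrite mulrA.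
have dg : is_derive x v g (\sum_k lam k * (e k x * 'D_v (e k) z + e k z * 'D_v (e k) x)).
  apply: is_derive_bigsum => k; apply: is_deriveZ.
  have d1 := bounded_smooth_derivable v x (he k).
  have d2 : is_derive x v (fun y => e k (y + (z - x))) ('D_v (e k) z).
    have := bounded_smooth_derivable v (x + (z - x)) (he k).
    move=> /is_derive_lineP h; apply/is_derive_lineP.
    move: h; rewrite exz.
    suff -> : (fun r : R => e k (r *: v + x + (z - x))) = (fun r => e k (r *: v + z)) by [].
    by apply/funext => r; rewrite -addrA exz.
  have := is_deriveM d1 d2; congr (is_derive _ _ _ _).
  by rewrite /GRing.scale /= exz.
have : 'D_v g x = 0 by rewrite gE derive_cst.
rewrite (@derive_val _ _ _ _ _ _ _ dg) => h.
apply/eqP; rewrite -subr_eq0 opprK -big_split /=; apply/eqP; rewrite -[RHS]h.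
by apply: eq_bigr => k _; ring.
Qed.

Lemma kernel_mean_expansion u : mu.-integrable setT (EFin \o u) -> forall x,
  Pn u x = \sum_k lam k * (\int[mu]_z (u z * e k z)) * e k x.
Proof.
move=> iu x; rewrite /kernel_mean.
have -> : \int[mu]_z (torus_kernel n (x, z) * u z) =
    \int[mu]_z (\sum_k (lam k * e k x) * (u z * e k z)).
  apply: eq_Rintegral => z _; rewrite (exp_eq hL) big_distrl /=.
  by apply: eq_bigr => k _; ring.
rewrite Rintegral_sum; last first.
  by move=> k; apply: intgZ; apply: bounded_smooth_mul_intg => //; exact: exp_smooth hL k.
apply: eq_bigr => k _; rewrite RintegralZl//; first by ring.
by apply: bounded_smooth_mul_intg => //; exact: exp_smooth hL k.
Qed.

Lemma kernel_mean_smooth u : mu.-integrable setT (EFin \o u) -> bounded_smooth (Pn u).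
Proof.
move=> iu; rewrite (_ : Pn u = fun x => \sum_k lam k * (\int[mu]_z (u z * e k z)) * e k x).
  by apply: bounded_smooth_sum => k; apply: bounded_smoothZ; exact: exp_smooth hL k.
by apply/funext => x; exact: kernel_mean_expansion.
Qed.

Lemma derive_kernel_mean u v : mu.-integrable setT (EFin \o u) -> forall x,
  'D_v (Pn u) x = \sum_k lam k * (\int[mu]_z (u z * e k z)) * 'D_v (e k) x.
Proof.
move=> iu x.
have -> : Pn u = (fun y => \sum_k lam k * (\int[mu]_z (u z * e k z)) * e k y).
  by apply/funext => y; exact: kernel_mean_expansion.
apply: derive_val; apply: is_derive_bigsum => k.
apply: (@is_deriveZ _ _ _ (e k) _ _ _ ('D_v (e k) x)).
by apply: bounded_smooth_derivable; exact: exp_smooth hL _.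
Qed.

(** Averaging commutes with weak differentiation, because the kernel is
    invariant under simultaneous translation of its two arguments. *)
Lemma derive_kernel_mean_weak u Du j : weak_derivative u Du j -> forall x,
  'D_(delta_mx 0 j) (Pn u) x = Pn Du x.
Proof.
move=> [iu iDu hw] x; rewrite derive_kernel_mean//.
have he k := exp_smooth hL k.
have i1 k := bounded_smooth_mul_intg iu (he k).
have i2 k := bounded_smooth_derive_mul_intg (delta_mx 0 j) iu (he k).
transitivity (\int[mu]_z (u z * \sum_k lam k * 'D_(delta_mx 0 j) (e k) x * e k z)).
  rewrite -[RHS](_ : \int[mu]_z \sum_k lam k * 'D_(delta_mx 0 j) (e k) x * (u z * e k z) = _); last first.
    by apply: eq_Rintegral => z _; rewrite big_distrr /=; apply: eq_bigr => k _; ring.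
  rewrite Rintegral_sum; last by move=> k; exact: intgZ.
  by apply: eq_bigr => k _; rewrite RintegralZl//; ring.
under eq_Rintegral => z _ do rewrite (expansion_translate (delta_mx 0 j) x z).
rewrite (kernel_mean_expansion iDu).
transitivity (\int[mu]_z \sum_k (- (lam k * e k x)) * (u z * 'D_(delta_mx 0 j) (e k) z)).
  apply: eq_Rintegral => z _; rewrite mulrN big_distrr /= -sumrN.
  by apply: eq_bigr => k _; ring.
rewrite Rintegral_sum; last by move=> k; exact: intgZ.
apply: eq_bigr => k _; rewrite RintegralZl// hw; last by case: (he k).
by ring.
Qed.

(** The coefficients [\int G d_j(e k)] of a divergence, paired with those of
    [u], become the pairing of [G] with the averaged derivative of [u]. *)
Lemma expansion_divergence u Du G j : weak_derivative u Du j ->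
  mu.-integrable setT (EFin \o G) ->
  \sum_k lam k * (\int[mu]_z (u z * e k z)) *
    (\int[mu]_z (G z * 'D_(delta_mx 0 j) (e k) z)) = \int[mu]_x (G x * Pn Du x).
Proof.
move=> hw iG; have [iu iDu _] := hw; have he k := exp_smooth hL k.
under [RHS]eq_Rintegral => x _ do rewrite -(derive_kernel_mean_weak hw) derive_kernel_mean// big_distrr /=.
rewrite Rintegral_sum; last first.
  move=> k; under eq_fun do rewrite mulrCA.
  by apply: intgZ; exact: bounded_smooth_derive_mul_intg.
apply: eq_bigr => k _; rewrite -RintegralZl//; last exact: bounded_smooth_derive_mul_intg.
by apply: eq_Rintegral => z _; ring.
Qed.

Lemma expansion_quadratic u : L2 mu u ->
  \sum_k lam k * (\int[mu]_z (u z * e k z)) ^+ 2 = \int[mu]_x (u x * Pn u x).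
Proof.
move=> hu; have iu := L2_intg hu; have he k := exp_smooth hL k.
under [RHS]eq_Rintegral => x _ do rewrite kernel_mean_expansion// big_distrr /=.
rewrite Rintegral_sum; last first.
  move=> k; under eq_fun do rewrite mulrCA.
  by apply: intgZ; exact: bounded_smooth_mul_intg.
apply: eq_bigr => k _; rewrite expr2 mulrA -RintegralZl//; last exact: bounded_smooth_mul_intg.
by apply: eq_Rintegral => z _; ring.
Qed.

End expansion_theory.
End finite_rank.

(** * Sobolev inequalities in dimensions two and three *)

Section probability_bounds.
Context d1 (X : measurableType d1) (R : realType) (m1 : probability X R).

Lemma Rintegral_bounds (f : X -> R) (M : R) : measurable_fun setT f ->
  (forall x, 0 <= f x <= M) -> 0 <= \int[m1]_x f x <= M.
Proof.
move=> mf fM; apply/andP; split; first by apply: Rintegral_ge0 => x _; have /andP[] := fM x.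
have iC : m1.-integrable setT (EFin \o (cst M : X -> R)) by exact: finite_measure_integrable_cst.
rewrite -[leRHS](Rintegral_prob_cst m1 M); apply: le_Rintegral => //.
  apply: (bounded_intg m1 mf (M := M)) => x; have /andP[? ?] := fM x; by rewrite ger0_norm.
by move=> x _; have /andP[] := fM x.
Qed.

Lemma cauchy_schwarz_sqrt (f g : X -> R) : L2 m1 f -> L2 m1 g ->
  \int[m1]_x (f x * g x) <=
  Num.sqrt (\int[m1]_x (f x ^+ 2)) * Num.sqrt (\int[m1]_x (g x ^+ 2)).
Proof.
move=> hf hg; have f0 : 0 <= \int[m1]_x (f x ^+ 2) by apply: Rintegral_ge0 => x _; exact: sqr_ge0.
rewrite -sqrtrM//; apply: (le_trans (ler_norm _)).
by rewrite -sqrtr_sqr ler_wsqrtr// cauchy_schwarz.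
Qed.

End probability_bounds.

Section bounded_fubini.
Context d1 d2 (X : measurableType d1) (Y : measurableType d2) (R : realType).
Variables (m1 : probability X R) (m2 : probability Y R).

Lemma bounded_swap (f : X -> Y -> R) (M : R) :
  measurable_fun setT (fun z : X * Y => f z.1 z.2) -> (forall x y, `|f x y| <= M) ->
  \int[m1]_x \int[m2]_y f x y = \int[m2]_y \int[m1]_x f x y.
Proof.
move=> mf fM; apply: Rintegral_swap.
exact: (@bounded_intg _ _ _ (m1 \x m2)%E _ M mf (fun z => fM z.1 z.2)).
Qed.

Lemma bounded_le_Rintegral2 (f g : X -> Y -> R) (M : R) :
  measurable_fun setT (fun z : X * Y => f z.1 z.2) ->
  measurable_fun setT (fun z : X * Y => g z.1 z.2) ->
  (forall x y, 0 <= f x y <= g x y) -> (forall x y, g x y <= M) ->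
  \int[m1]_x \int[m2]_y f x y <= \int[m1]_x \int[m2]_y g x y.
Proof.
move=> mf mg fg gM.
have f0 x y : 0 <= f x y by have /andP[] := fg x y.
have g0 x y : 0 <= g x y by have /andP[h1 h2] := fg x y; exact: le_trans h2.
have fM x y : 0 <= f x y <= M by have /andP[h1 h2] := fg x y; rewrite h1 (le_trans h2).
have gM' x y : 0 <= g x y <= M by rewrite g0 gM.
have bb d (Z : measurableType d) (m : probability Z R) (h : Z -> R) : measurable_fun setT h ->
    (forall x, 0 <= h x <= M) -> m.-integrable setT (EFin \o h).
  move=> mh hM; apply: (bounded_intg m mh (M := M)) => z.
  by have /andP[? ?] := hM z; rewrite ger0_norm.
have mf1 x : measurable_fun setT (f x) by exact: (measurable_fun_pair2 x mf).
have mg1 x : measurable_fun setT (g x) by exact: (measurable_fun_pair2 x mg).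
apply: le_Rintegral => [//|||x _].
- apply: bb; first exact: measurable_Rintegral1 mf f0.
  by move=> x; exact: Rintegral_bounds.
- apply: bb; first exact: measurable_Rintegral1 mg g0.
  by move=> x; exact: Rintegral_bounds.
- apply: le_Rintegral => //; [exact: bb|exact: bb|].
  by move=> y _; have /andP[] := fg x y.
Qed.

Lemma Rintegral_prod_split (a : X -> R) (b : Y -> R) :
  m1.-integrable setT (EFin \o a) -> m2.-integrable setT (EFin \o b) ->
  \int[m1]_x \int[m2]_y (b y * a x) = \int[m2]_y b y * \int[m1]_x a x.
Proof.
move=> ia ib; rewrite -[RHS]RintegralZl//; apply: eq_Rintegral => x _.
by rewrite -RintegralZr.
Qed.

End bounded_fubini.

Section loomis_whitney.
Context d1 d2 d3 (A : measurableType d1) (B : measurableType d2) (C : measurableType d3).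
Context (R : realType) (m1 : probability A R) (m2 : probability B R) (m3 : probability C R).
Variables (al : B -> C -> R) (be : A -> C -> R) (ga : A -> B -> R) (M : R).
Hypotheses (mal : measurable_fun setT (fun z : B * C => al z.1 z.2))
  (mbe : measurable_fun setT (fun z : A * C => be z.1 z.2))
  (mga : measurable_fun setT (fun z : A * B => ga z.1 z.2)).
Hypotheses (al0 : forall b c, 0 <= al b c <= M) (be0 : forall a c, 0 <= be a c <= M)
  (ga0 : forall a b, 0 <= ga a b <= M).

Let M0 : 0 <= M.
Proof. by have /andP[h1 h2] := al0 point point; exact: le_trans h2. Qed.

Let norm_le (x : R) : 0 <= x <= M -> `|x| <= M.
Proof. by move=> /andP[? ?]; rewrite ger0_norm. Qed.

Let sq_le (x : R) : 0 <= x <= M -> 0 <= x ^+ 2 <= M ^+ 2.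
Proof. by move=> /andP[? ?]; rewrite sqr_ge0 lerXn2r// nnegrE. Qed.

Let sqrt_le (x : R) : 0 <= x <= M ^+ 2 -> 0 <= Num.sqrt x <= M.
Proof.
move=> /andP[? h]; rewrite sqrtr_ge0 /= -[leRHS]ger0_norm// -sqrtr_sqr.
by rewrite ler_wsqrtr.
Qed.

Let measurable_sqrt_int d d' (X : measurableType d) (Y : measurableType d')
    (m : probability Y R) (f : X -> Y -> R) :
  measurable_fun setT (fun z : X * Y => f z.1 z.2) -> (forall x y, 0 <= f x y <= M) ->
  measurable_fun setT (fun x => Num.sqrt (\int[m]_y (f x y ^+ 2))).
Proof.
move=> mf f0; apply: (measurableT_comp (continuous_measurable1 (@sqrt_continuous R))).
apply: (@measurable_Rintegral1 _ _ X Y R m (fun x y => f x y ^+ 2)).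
  by apply: measurable_funX.
by move=> x y; exact: sqr_ge0.
Qed.

Let sqrt_int_bound d (Y : measurableType d) (m : probability Y R) (f : Y -> R) :
  measurable_fun setT f -> (forall y, 0 <= f y <= M) ->
  0 <= Num.sqrt (\int[m]_y (f y ^+ 2)) <= M.
Proof.
move=> mf f0; apply: sqrt_le; apply: Rintegral_bounds; first exact: measurable_funX.
by move=> y; exact: sq_le.
Qed.

(** Cauchy-Schwarz in each variable in turn. *)
Lemma loomis_whitney : \int[m1]_a \int[m2]_b \int[m3]_c (al b c * be a c * ga a b) <=
  Num.sqrt (\int[m2]_b \int[m3]_c (al b c ^+ 2)) *
  Num.sqrt (\int[m1]_a \int[m3]_c (be a c ^+ 2)) *
  Num.sqrt (\int[m1]_a \int[m2]_b (ga a b ^+ 2)).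
Proof.
have mal1 b : measurable_fun setT (al b) := measurable_fun_pair2 b mal.
have mbe1 a : measurable_fun setT (be a) := measurable_fun_pair2 a mbe.
have mga1 a : measurable_fun setT (ga a) := measurable_fun_pair2 a mga.
pose a1 b := Num.sqrt (\int[m3]_c (al b c ^+ 2)).
pose b1 a := Num.sqrt (\int[m3]_c (be a c ^+ 2)).
pose c1 a := Num.sqrt (\int[m2]_b (ga a b ^+ 2)).
have ma1 : measurable_fun setT a1 by exact: measurable_sqrt_int.
have mb1 : measurable_fun setT b1 by exact: measurable_sqrt_int.
have mc1 : measurable_fun setT c1 by exact: measurable_sqrt_int.
have a1b b : 0 <= a1 b <= M by exact: sqrt_int_bound.
have b1b a : 0 <= b1 a <= M by exact: sqrt_int_bound.
have c1b a : 0 <= c1 a <= M by exact: sqrt_int_bound.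
have LL d (Y : measurableType d) (m : probability Y R) (f : Y -> R) :
    measurable_fun setT f -> (forall y, 0 <= f y <= M) -> L2 m f.
  by move=> mf f0; apply: (bounded_L2 m mf (M := M)) => y; exact: norm_le.
have sqI d (Y : measurableType d) (m : probability Y R) (f : Y -> R) :
    Num.sqrt (\int[m]_y (f y ^+ 2)) ^+ 2 = \int[m]_y (f y ^+ 2).
  by rewrite sqr_sqrtr//; apply: Rintegral_ge0 => y _; exact: sqr_ge0.
pose La := Num.sqrt (\int[m2]_b (a1 b ^+ 2)).
have La0 : 0 <= La by exact: sqrtr_ge0.
have s1 a b : \int[m3]_c (al b c * be a c * ga a b) <= a1 b * ga a b * b1 a.
  under eq_Rintegral do rewrite mulrC.
  rewrite RintegralZl//; last by apply: L2_mul; apply: LL.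
  rewrite [leRHS](_ : _ = ga a b * (a1 b * b1 a)); last by ring.
  rewrite ler_wpM2l//; first by have /andP[] := ga0 a b.
  by apply: cauchy_schwarz_sqrt; apply: LL.
have mabc : measurable_fun setT (fun z : (A * B) * C => al z.1.2 z.2 * be z.1.1 z.2 * ga z.1.1 z.1.2).
  have z1 : measurable_fun setT (fun z : (A * B) * C => z.1) by exact: measurable_fst.
  have z2 : measurable_fun setT (fun z : (A * B) * C => z.2) by exact: measurable_snd.
  have z11 : measurable_fun setT (fun z : (A * B) * C => z.1.1) := measurableT_comp measurable_fst z1.
  have z12 : measurable_fun setT (fun z : (A * B) * C => z.1.2) := measurableT_comp measurable_snd z1.
  apply: measurable_funM; first apply: measurable_funM.
  - exact: (measurableT_comp mal (measurable_fun_pair z12 z2)).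
  - exact: (measurableT_comp mbe (measurable_fun_pair z11 z2)).
  - exact: (measurableT_comp mga (measurable_fun_pair z11 z12)).
have abc0 a b c : 0 <= al b c * be a c * ga a b <= M ^+ 3.
  have /andP[x0 x1] := al0 b c; have /andP[y0 y1] := be0 a c; have /andP[w0 w1] := ga0 a b.
  by rewrite !mulr_ge0//= !exprS expr0 mulr1 mulrA !ler_pM// mulr_ge0.
have mI : measurable_fun setT (fun z : A * B => \int[m3]_c (al z.2 c * be z.1 c * ga z.1 z.2)).
  apply: (@measurable_Rintegral1 _ _ _ C R m3 (fun (z : A * B) c => al z.2 c * be z.1 c * ga z.1 z.2)) => //.
  by move=> z c; have /andP[] := abc0 z.1 z.2 c.
have I0 a b : 0 <= \int[m3]_c (al b c * be a c * ga a b) <= M ^+ 3.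
  apply: Rintegral_bounds => //.
  exact: (measurable_fun_pair2 (a, b) mabc).
have s2 a : \int[m2]_b \int[m3]_c (al b c * be a c * ga a b) <= La * (c1 a * b1 a).
  apply: (@le_trans _ _ (\int[m2]_b (b1 a * (a1 b * ga a b)))).
    apply: le_Rintegral => //.
    - apply: (bounded_intg m2 (M := M ^+ 3)); first exact: (measurable_fun_pair2 a mI).
      by move=> b; have /andP[? ?] := I0 a b; rewrite ger0_norm.
    - by apply: intgZ; apply: L2_mul; apply: LL.
    - by move=> b _; rewrite [leRHS]mulrC; exact: s1.
  rewrite RintegralZl//; last by apply: L2_mul; apply: LL.
  rewrite [La * _]mulrA [leRHS]mulrC ler_wpM2l//; first by have /andP[] := b1b a.
  by apply: cauchy_schwarz_sqrt; apply: LL.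
have mII : measurable_fun setT (fun a => \int[m2]_b \int[m3]_c (al b c * be a c * ga a b)).
  apply: (@measurable_Rintegral1 _ _ A B R m2 (fun a b => \int[m3]_c (al b c * be a c * ga a b))) => //.
  by move=> a b; have /andP[] := I0 a b.
have II0 a : 0 <= \int[m2]_b \int[m3]_c (al b c * be a c * ga a b) <= M ^+ 3.
  by apply: Rintegral_bounds => //; exact: (measurable_fun_pair2 a mI).
apply: (@le_trans _ _ (\int[m1]_a (La * (c1 a * b1 a)))).
  apply: le_Rintegral => //.
  - apply: (bounded_intg m1 (M := M ^+ 3)) => // a.
    by have /andP[? ?] := II0 a; rewrite ger0_norm.
  - by apply: intgZ; apply: L2_mul; apply: LL.
rewrite RintegralZl//; last by apply: L2_mul; apply: LL.
rewrite -mulrA ler_pM//.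
- by apply: Rintegral_ge0 => a _; have /andP[? _] := c1b a; have /andP[? _] := b1b a; rewrite mulr_ge0.
- by rewrite /La ler_wsqrtr//; under eq_Rintegral do rewrite sqI.
- rewrite [leRHS]mulrC.
  have -> : \int[m1]_a \int[m2]_b (ga a b ^+ 2) = \int[m1]_a (c1 a ^+ 2).
    by apply: eq_Rintegral => a _; rewrite sqI.
  have -> : \int[m1]_a \int[m3]_c (be a c ^+ 2) = \int[m1]_a (b1 a ^+ 2).
    by apply: eq_Rintegral => a _; rewrite sqI.
  by apply: cauchy_schwarz_sqrt; apply: LL.
Qed.

End loomis_whitney.

Section loomis_whitney_sqrt.
Context d1 d2 d3 (A : measurableType d1) (B : measurableType d2) (C : measurableType d3).
Context (R : realType) (m1 : probability A R) (m2 : probability B R) (m3 : probability C R).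
Variables (q0 : B -> C -> R) (q1 : A -> C -> R) (q2 : A -> B -> R) (g : A -> B -> C -> R) (M : R).
Hypotheses (m0 : measurable_fun setT (fun z : B * C => q0 z.1 z.2))
  (mq1 : measurable_fun setT (fun z : A * C => q1 z.1 z.2))
  (mq2 : measurable_fun setT (fun z : A * B => q2 z.1 z.2))
  (mg : measurable_fun setT (fun z : (A * B) * C => g z.1.1 z.1.2 z.2)).
Hypotheses (b0 : forall b c, 0 <= q0 b c <= M) (b1 : forall a c, 0 <= q1 a c <= M)
  (b2 : forall a b, 0 <= q2 a b <= M).
Hypothesis gq : forall a b c,
  0 <= g a b c <= Num.sqrt (q0 b c) * Num.sqrt (q1 a c) * Num.sqrt (q2 a b).

Let sqrt_int2 d d' (X : measurableType d) (Y : measurableType d') (m : probability X R)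
    (m' : probability Y R) (q : X -> Y -> R) : (forall x y, 0 <= q x y <= M) ->
  Num.sqrt (\int[m]_x \int[m']_y (Num.sqrt (q x y) ^+ 2)) ^+ 2 = \int[m]_x \int[m']_y q x y.
Proof.
move=> q0'; have -> : \int[m]_x \int[m']_y (Num.sqrt (q x y) ^+ 2) = \int[m]_x \int[m']_y q x y.
  apply: eq_Rintegral => x _; apply: eq_Rintegral => y _.
  by rewrite sqr_sqrtr//; have /andP[] := q0' x y.
rewrite sqr_sqrtr//; apply: Rintegral_ge0 => x _; apply: Rintegral_ge0 => y _.
by have /andP[] := q0' x y.
Qed.

Lemma loomis_whitney_sqrt : (\int[m1]_a \int[m2]_b \int[m3]_c g a b c) ^+ 2 <=
  \int[m2]_b \int[m3]_c q0 b c * \int[m1]_a \int[m3]_c q1 a c * \int[m1]_a \int[m2]_b q2 a b.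
Proof.
have msq : measurable_fun setT (Num.sqrt : measurableTypeR R -> measurableTypeR R).
  exact: (continuous_measurable1 (@sqrt_continuous R)).
have sb x : 0 <= x <= M -> 0 <= Num.sqrt x <= Num.sqrt M.
  by move=> /andP[x0 xM]; rewrite sqrtr_ge0/= ler_wsqrtr.
have s0 := @sqrtr_ge0 R; pose S := Num.sqrt M.
have m0' := measurableT_comp msq m0; have m1' := measurableT_comp msq mq1.
have m2' := measurableT_comp msq mq2.
have LW := @loomis_whitney _ _ _ A B C R m1 m2 m3 (fun b c => Num.sqrt (q0 b c))
  (fun a c => Num.sqrt (q1 a c)) (fun a b => Num.sqrt (q2 a b)) S m0' m1' m2'
  (fun b c => sb _ (b0 b c)) (fun a c => sb _ (b1 a c)) (fun a b => sb _ (b2 a b)).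
pose G a b c := Num.sqrt (q0 b c) * Num.sqrt (q1 a c) * Num.sqrt (q2 a b).
have GS a b c : 0 <= G a b c <= S ^+ 3.
  have /andP[x0 x1] := sb _ (b0 b c); have /andP[y0 y1] := sb _ (b1 a c).
  have /andP[w0 w1] := sb _ (b2 a b).
  by rewrite /G !mulr_ge0//= !exprS expr0 mulr1 mulrA !ler_pM// mulr_ge0.
have gS a b c : 0 <= g a b c <= S ^+ 3.
  have /andP[x0 x1] := gq a b c; have /andP[_ y1] := GS a b c.
  by rewrite x0 (le_trans x1 y1).
have mG : measurable_fun setT (fun z : (A * B) * C => G z.1.1 z.1.2 z.2).
  have z1 : measurable_fun setT (fun z : (A * B) * C => z.1) by exact: measurable_fst.
  have z2 : measurable_fun setT (fun z : (A * B) * C => z.2) by exact: measurable_snd.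
  have z11 : measurable_fun setT (fun z : (A * B) * C => z.1.1) := measurableT_comp measurable_fst z1.
  have z12 : measurable_fun setT (fun z : (A * B) * C => z.1.2) := measurableT_comp measurable_snd z1.
  apply: measurable_funM; first apply: measurable_funM.
  - exact: (measurableT_comp m0' (measurable_fun_pair z12 z2)).
  - exact: (measurableT_comp m1' (measurable_fun_pair z11 z2)).
  - exact: (measurableT_comp m2' (measurable_fun_pair z11 z12)).
have bb (h : C -> R) : measurable_fun setT h -> (forall x, 0 <= h x <= S ^+ 3) -> m3.-integrable setT (EFin \o h).
  move=> mh hM; apply: (bounded_intg m3 mh (M := S ^+ 3)) => z.
  by have /andP[? ?] := hM z; rewrite ger0_norm.
have mgz z : measurable_fun setT (g z.1 z.2) by exact: (measurable_fun_pair2 z mg).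
have mGz z : measurable_fun setT (G z.1 z.2) by exact: (measurable_fun_pair2 z mG).
have gG : \int[m1]_a \int[m2]_b \int[m3]_c g a b c <= \int[m1]_a \int[m2]_b \int[m3]_c G a b c.
  apply: (@bounded_le_Rintegral2 _ _ A B R m1 m2 _ _ (S ^+ 3)).
  - apply: (@measurable_Rintegral1 _ _ (A * B)%type C R m3 (fun z c => g z.1 z.2 c)) => // z c.
    by have /andP[] := gS z.1 z.2 c.
  - apply: (@measurable_Rintegral1 _ _ (A * B)%type C R m3 (fun z c => G z.1 z.2 c)) => // z c.
    by have /andP[] := GS z.1 z.2 c.
  - move=> a b; apply/andP; split.
      by apply: Rintegral_ge0 => c _; have /andP[] := gS a b c.
    apply: le_Rintegral => //; [exact: bb _ (mgz (a, b)) _|exact: bb _ (mGz (a, b)) _|].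
    by move=> c _; have /andP[] := gq a b c.
  - move=> a b; have := Rintegral_bounds m3 (mGz (a, b)) (GS a b).
    by move=> /andP[].
have l0 : 0 <= \int[m1]_a \int[m2]_b \int[m3]_c g a b c.
  apply: Rintegral_ge0 => a _; apply: Rintegral_ge0 => b _; apply: Rintegral_ge0 => c _.
  by have /andP[] := gS a b c.
have r0 := le_trans l0 (le_trans gG LW).
have : (\int[m1]_a \int[m2]_b \int[m3]_c g a b c) ^+ 2 <= _ := lerXn2r 2 l0 r0 (le_trans gG LW).
by rewrite !exprMn !sqrt_int2.
Qed.

End loomis_whitney_sqrt.

Section line_bound.
Variable R : realType.
Local Notation leb := (@lebesgue_measure R).
Local Notation U := (uniform_prob (@ltr01 R)).

(** The value at [s] differs from the value at any [r] by at most the integral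
    of [|h'|]; the mean over [r] gives the bound. *)
Lemma unit_interval_sup (h h' : R -> R) : continuous h' ->
  (forall x : R, is_derive x 1 h (h' x)) -> forall s, 0 <= s <= 1 ->
  `|h s| <= \int[U]_r (`|h r| + `|h' r|).
Proof.
move=> ch dh s /andP[s0 s1].
have chh : continuous h.
  by move=> x; apply: differentiable_continuous; apply/derivable1_diffP; have [] := dh x.
have mh' := continuous_measurable1 ch.
have mah' : measurable_fun setT (fun r : measurableTypeR R => `|h' r|) by exact: measurableT_comp.
have iah' := intg_norm (continuous_unit_intg ch).
have iah := intg_norm (continuous_unit_intg chh).
have step a b : 0 <= a -> a <= b -> b <= 1 -> `|h b - h a| <= \int[U]_r `|h' r|.
  move=> a0 ab b1; have [->|/eqP aneb] := eqVneq a b.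
    by rewrite subrr normr0; apply: Rintegral_ge0.
  have altb : a < b by rewrite lt_neqAle ab andbT; apply/eqP.
  have iab : leb.-integrable `[a, b] (EFin \o h').
    apply: continuous_compact_integrable; first exact: segment_compact.
    exact: continuous_subspaceT.
  have e : (\int[leb]_(x in `[a, b]) (h' x)%:E = (h b)%:E - (h a)%:E)%E.
    apply: continuous_FTC2 => //.
    - exact: continuous_subspaceT.
    - split; first by move=> x _; have [] := dh x.
      + exact: cvg_at_right_filter (chh a).
      + exact: cvg_at_left_filter (chh b).
    - by move=> x _; rewrite derive1E; apply: derive_val.
  rewrite -lee_fin EFin_Rintegral// integral_unit_interval; last exact/measurable_EFinP.
  have -> : (`|h b - h a|%:E = `|\int[leb]_(x in `[a, b]) (h' x)%:E|)%E by rewrite e.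
  apply: (@le_trans _ _ (\int[leb]_(x in `[a, b]) `|(h' x)%:E|)%E).
    by apply: le_abse_integral => //; exact: measurable_int iab.
  apply: ge0_subset_integral => //=.
  - by apply/measurable_EFinP; exact: measurable_funTS.
  - by apply: subset_itv; rewrite bnd_simp.
have step2 r : 0 < r < 1 -> `|h s| <= `|h r| + \int[U]_r `|h' r|.
  move=> /andP[/ltW r0 /ltW r1]; have -> : h s = h r + (h s - h r) by ring.
  apply: (le_trans (ler_normD _ _)); rewrite lerD2l.
  have [rs|/ltW sr] := leP r s; first exact: step.
  by rewrite distrC; exact: step.
rewrite RintegralD//.
have iC (c : R) : U.-integrable setT (EFin \o (fun _ : measurableTypeR R => c)).
  exact: finite_measure_integrable_cst.
have e2 : \int[U]_r (`|h r| + \int[U]_r `|h' r|) = \int[U]_r `|h r| + \int[U]_r `|h' r|.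
  by rewrite RintegralD// Rintegral_prob_cst.
rewrite -e2 -(Rintegral_prob_cst U `|h s|).
apply: ae_le_Rintegral => //; first exact: intgD.
by apply: filterS (unit_interval_ae R) => r; exact: step2.
Qed.

End line_bound.

Section torus_iterated.
Variable R : realType.
Local Notation U := (uniform_prob (@ltr01 R)).

Lemma Rintegral_torusS d (f : 'rV[R]_d.+1 -> R) (M : R) : measurable_fun setT f ->
  (forall x, `|f x| <= M) ->
  \int[torus_measure R d.+1]_x f x =
  \int[U]_a \int[torus_measure R d]_y f (rV_cons (a, y)).
Proof.
move=> mf fM.
have mfc : measurable_fun setT (f \o @rV_cons R d).
  exact: (measurableT_comp mf (@measurable_rV_cons R d)).
have ib := @bounded_intg _ _ _ (U \x torus_measure R d)%E _ M mfc (fun p => fM (rV_cons p)).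
transitivity (\int[(U \x torus_measure R d)%E]_p (f \o @rV_cons R d) (p.1, p.2)).
  rewrite /Rintegral; congr fine.
  by rewrite /= integral_distribution//; exact/measurable_EFinP.
apply: (@Rintegral_prod1 _ _ _ _ _ U (torus_measure R d)
  (fun a y => (f \o @rV_cons R d) (a, y))).
by move: ib; congr (_.-integrable _ _); apply/funext => -[].
Qed.

Lemma Rintegral_torus0 (f : 'rV[R]_0 -> R) : measurable_fun setT f ->
  \int[torus_measure R 0]_x f x = f 0.
Proof.
move=> mf; rewrite /Rintegral /= integral_dirac// ?diracE ?mem_setT ?mul1e//.
exact/measurable_EFinP.
Qed.

Lemma rV_consD d (a b : R) (y z : 'rV[R]_d) :
  rV_cons (a + b, y + z) = rV_cons (a, y) + rV_cons (b, z) :> 'rV[R]_d.+1.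
Proof.
apply/rowP => j; rewrite [RHS]mxE; case: (unliftP ord0 j) => [k ->|->].
  rewrite !rV_consS; move: (k : (fun n => ordinal n) d) => {}k; by rewrite mxE.
by rewrite !rV_cons0.
Qed.

Lemma rV_consZ d (c a : R) (y : 'rV[R]_d) :
  rV_cons (c * a, c *: y) = c *: rV_cons (a, y) :> 'rV[R]_d.+1.
Proof.
apply/rowP => j; rewrite [RHS]mxE; case: (unliftP ord0 j) => [k ->|->].
  rewrite !rV_consS; move: (k : (fun n => ordinal n) d) => {}k; by rewrite mxE.
by rewrite !rV_cons0.
Qed.

Lemma rV_cons_delta0 d : rV_cons (1, 0) = delta_mx 0 ord0 :> 'rV[R]_d.+1.
Proof.
apply/rowP => j; rewrite [RHS]mxE; case: (unliftP ord0 j) => [k ->|->].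
  by rewrite rV_consS mxE eqxx.
by rewrite rV_cons0 !eqxx.
Qed.

Lemma rV_cons_deltaS d (j : 'I_d) :
  rV_cons (0, delta_mx 0 j) = delta_mx 0 (lift ord0 j) :> 'rV[R]_d.+1.
Proof.
apply/rowP => i; rewrite [RHS]mxE; case: (unliftP ord0 i) => [k ->|->].
  by rewrite rV_consS mxE !eqxx /= (inj_eq (@lift_inj _ ord0)).
by rewrite rV_cons0 eqxx /=.
Qed.

Lemma line_derive d (f : 'rV[R]_d -> R) (x v : 'rV[R]_d) (t : R) : bounded_smooth f ->
  is_derive t 1 (fun s : R => f (s *: v + x)) ('D_v f (t *: v + x)).
Proof.
move=> hf; have := bounded_smooth_derivable v (t *: v + x) hf.
move=> /is_derive_lineP h; apply/is_derive_lineP; move: h.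
by congr (is_derive _ _ _ _); apply/funext => s; rewrite addrA scalerDl /GRing.scale /= mulr1.
Qed.

Lemma line_continuous d (f : 'rV[R]_d -> R) (x v : 'rV[R]_d) : continuous f ->
  continuous (fun s : R => f (s *: v + x)).
Proof.
move=> cf s; apply: (@cvg_comp _ _ _ (fun r : R => r *: v + x) f _ (nbhs (s *: v + x))).
  by apply: cvgD; [apply: cvgZl; exact: cvg_id|exact: cvg_cst].
exact: cf.
Qed.

Lemma torus_periodic_int d (f : 'rV[R]_d -> R) (j : 'I_d) (x : 'rV[R]_d) (z : int) :
  bounded_smooth f -> f (x + z%:~R *: delta_mx 0 j) = f x.
Proof.
move=> [[_ pf] _ _].
have pn (n : nat) y : f (y + n%:R *: delta_mx 0 j) = f y.
  elim: n y => [|n IH] y; first by rewrite scale0r addr0.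
  by rewrite mulrSr scalerDl scale1r addrA pf IH.
case: z => n; first exact: pn.
by rewrite NegzE mulrNz scaleNr -[LHS](pn n.+1) subrK.
Qed.

(** By periodicity the point may be moved into the unit interval of its line. *)
Lemma line_sup d (f : 'rV[R]_d -> R) (j : 'I_d) (x : 'rV[R]_d) (t : R) :
  bounded_smooth f ->
  `|f (t *: delta_mx 0 j + x)| <= \int[U]_r (`|f (r *: delta_mx 0 j + x)| +
     `|'D_(delta_mx 0 j) f (r *: delta_mx 0 j + x)|).
Proof.
move=> hf.
have -> : f (t *: delta_mx 0 j + x) = f ((t - (Num.floor t)%:~R) *: delta_mx 0 j + x).
  rewrite -[RHS](torus_periodic_int j _ (Num.floor t) hf); congr f.
  by rewrite addrAC -scalerDl subrK.
apply: (@unit_interval_sup R (fun r => f (r *: delta_mx 0 j + x))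
  (fun r => 'D_(delta_mx 0 j) f (r *: delta_mx 0 j + x))) => //.
- have cD := bounded_smooth_derive_continuous (v := delta_mx 0 j) hf.
  by move: (@line_continuous _ _ x (delta_mx 0 j) cD).
- by move=> r; exact: line_derive.
- by have := ge_floor t; have := lt_succ_floor t; rewrite intrD; lra.
Qed.

Lemma derive_power d (f : 'rV[R]_d -> R) n v x : bounded_smooth f ->
  'D_v (fun y => f y ^+ n.+1) x = n.+1%:R * f x ^+ n * 'D_v f x.
Proof.
move=> hf; have hx := bounded_smooth_derivable v x hf.
suff : is_derive x v (fun y => f y ^+ n.+1) (n.+1%:R * f x ^+ n * 'D_v f x).
  by move=> h; apply: derive_val.
elim: n => [|n IH].
  have -> : (fun y => f y ^+ 1) = f by apply/funext => y; rewrite expr1.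
  by rewrite expr0 !mul1r.
have -> : (fun y => f y ^+ n.+2) = f \* (fun y => f y ^+ n.+1).
  by apply/funext => y /=; rewrite exprS.
have := is_deriveM hx IH; congr (is_derive _ _ _ _).
by rewrite /GRing.scale/= [f x ^+ n.+1]exprS [n.+2%:R]mulrSr; ring.
Qed.

End torus_iterated.

Section low_dimension.
Variable R : realType.
Local Notation U := (uniform_prob (@ltr01 R)).
Local Notation e0 := (delta_mx 0 ord0).
Local Notation e1 := (delta_mx 0 (lift ord0 ord0)).
Local Notation e2 := (delta_mx 0 (lift ord0 (lift ord0 ord0))).

Lemma rV_cons2 (a b : R) : rV_cons (a, rV_cons (b, 0 : 'rV_0)) = a *: e0 + b *: e1.
Proof.
by rewrite -!(rV_cons_delta0, rV_cons_deltaS, rV_consZ, rV_consD) !(mulr0, mulr1, scaler0, addr0, add0r).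
Qed.

Lemma rV_cons3 (a b c : R) :
  rV_cons (a, rV_cons (b, rV_cons (c, 0 : 'rV_0))) = a *: e0 + (b *: e1 + c *: e2).
Proof.
by rewrite -!(rV_cons_delta0, rV_cons_deltaS, rV_consZ, rV_consD) !(mulr0, mulr1, scaler0, addr0, add0r).
Qed.

Lemma measurable_rV_cons_comp (dX : measure_display) (X : measurableType dX) n (a : X -> R) (b : X -> 'rV[R]_n) :
  measurable_fun setT (a : X -> measurableTypeR R) -> measurable_fun setT b -> measurable_fun setT (fun x => rV_cons (a x, b x)).
Proof.
move=> ma mb; apply: (measurableT_comp (@measurable_rV_cons R n)).
exact: measurable_fun_pair.
Qed.

Lemma torus2 (f : 'rV[R]_2 -> R) (M : R) : continuous f -> (forall x, `|f x| <= M) ->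
  \int[torus_measure R 2]_x f x = \int[U]_a \int[U]_b f (a *: e0 + b *: e1).
Proof.
move=> cf fM; have mf := continuous_measurable_mx cf.
rewrite (Rintegral_torusS mf fM); apply: eq_Rintegral => a _.
have mfa : measurable_fun setT (fun y => f (rV_cons (a, y))).
  exact: (measurable_fun_pair2 a (measurableT_comp mf (@measurable_rV_cons R _))).
rewrite (Rintegral_torusS (M := M) mfa)//; apply: eq_Rintegral => b _.
rewrite Rintegral_torus0; last first.
  exact: (measurable_fun_pair2 b (measurableT_comp mfa (@measurable_rV_cons R _))).
by rewrite rV_cons2.
Qed.

Lemma torus3 (f : 'rV[R]_3 -> R) (M : R) : continuous f -> (forall x, `|f x| <= M) ->
  \int[torus_measure R 3]_x f x =
  \int[U]_a \int[U]_b \int[U]_c f (a *: e0 + (b *: e1 + c *: e2)).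
Proof.
move=> cf fM; have mf := continuous_measurable_mx cf.
rewrite (Rintegral_torusS mf fM); apply: eq_Rintegral => a _.
have mfa : measurable_fun setT (fun y => f (rV_cons (a, y))).
  exact: (measurable_fun_pair2 a (measurableT_comp mf (@measurable_rV_cons R _))).
rewrite (Rintegral_torusS (M := M) mfa)//; apply: eq_Rintegral => b _.
have mfb : measurable_fun setT (fun y => f (rV_cons (a, rV_cons (b, y)))).
  exact: (measurable_fun_pair2 b (measurableT_comp mfa (@measurable_rV_cons R _))).
rewrite (Rintegral_torusS (M := M) mfb)//; apply: eq_Rintegral => c _.
rewrite Rintegral_torus0; last first.
  exact: (measurable_fun_pair2 c (measurableT_comp mfb (@measurable_rV_cons R _))).
by rewrite rV_cons3.
Qed.

(** Its mean along a line parallel to the axis [j] bounds [h] on that line. *)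
Definition axis_density d (h : 'rV[R]_d -> R) (j : 'I_d) x : R :=
  `|h x| + `|'D_(delta_mx 0 j) h x|.

Lemma axis_density_continuous d (h : 'rV[R]_d -> R) j : bounded_smooth h ->
  continuous (axis_density h j).
Proof.
move=> hh x; have c1 := bounded_smooth_continuous hh.
have c2 := bounded_smooth_derive_continuous (v := delta_mx 0 j) hh.
exact: (cvgD (cvg_norm (c1 x)) (cvg_norm (c2 x))).
Qed.

Lemma axis_density_bounded d (h : 'rV[R]_d -> R) : bounded_smooth h ->
  exists M, forall j x, 0 <= axis_density h j x <= M.
Proof.
move=> [_ [M hM] /(_ (delta_mx 0 _)) dM].
pose N j := projT1 (cid (dM j)); exists (M + \sum_j N j) => j x.
have NP i y : `|'D_(delta_mx 0 i) h y| <= N i by exact: (projT2 (cid (dM i))).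
rewrite addr_ge0//= lerD//; apply: (le_trans (NP j x)).
rewrite (bigD1 j)//= lerDl; apply: sumr_ge0 => i _; exact: le_trans (NP i x).
Qed.


(** [h^2] is at most the product of the means of the densities along the two
    lines through a point, and each of these means depends on one coordinate. *)
Lemma sobolev2 (h : 'rV[R]_2 -> R) : bounded_smooth h ->
  \int[torus_measure R 2]_x (h x ^+ 2) <=
  \int[torus_measure R 2]_x axis_density h ord0 x *
  \int[torus_measure R 2]_x axis_density h (lift ord0 ord0) x.
Proof.
move=> hh; have [M AM] := axis_density_bounded hh.
have cA j : continuous (axis_density h j) by exact: axis_density_continuous.
have nA j x : `|axis_density h j x| <= M by have /andP[? ?] := AM j x; rewrite ger0_norm.
have mp : measurable_fun setT (fun z : measurableTypeR R * measurableTypeR R =>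
    z.1 *: e0 + z.2 *: e1 : 'rV[R]_2).
  under eq_fun do rewrite -rV_cons2.
  by do !apply: measurable_rV_cons_comp; first [exact: measurable_fst|exact: measurable_snd|exact: measurable_cst].
have mc (f : 'rV[R]_2 -> R) : continuous f -> measurable_fun setT (fun z : measurableTypeR R * measurableTypeR R =>
    f (z.1 *: e0 + z.2 *: e1) : R).
  by move=> cf; exact: (measurableT_comp (continuous_measurable_mx cf) mp).
have mc1 (f : 'rV[R]_2 -> R) a : continuous f -> measurable_fun setT (fun b : measurableTypeR R => f (a *: e0 + b *: e1) : R).
  by move=> cf; exact: (measurable_fun_pair2 a (mc f cf)).
have mc2 (f : 'rV[R]_2 -> R) b : continuous f -> measurable_fun setT (fun a : measurableTypeR R => f (a *: e0 + b *: e1) : R).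
  by move=> cf; exact: (measurable_fun_pair1 b (mc f cf)).
pose a0 a := \int[U]_b axis_density h (lift ord0 ord0) (a *: e0 + b *: e1).
pose a1 b := \int[U]_a axis_density h ord0 (a *: e0 + b *: e1).
have b0 a : 0 <= a0 a <= M by apply: Rintegral_bounds => //; exact: mc1.
have b1 b : 0 <= a1 b <= M by apply: Rintegral_bounds => //; exact: mc2.
have h0 a b : `|h (a *: e0 + b *: e1)| <= a0 a.
  have -> : a0 a = \int[U]_r axis_density h (lift ord0 ord0) (r *: e1 + a *: e0).
    by apply: eq_Rintegral => r _; rewrite addrC.
  by rewrite addrC; exact: (line_sup _ _ _ hh).
have h1 a b : `|h (a *: e0 + b *: e1)| <= a1 b by exact: (line_sup _ _ _ hh).
have m0 : measurable_fun setT (a0 : measurableTypeR R -> R).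
  apply: (@measurable_Rintegral1 _ _ (measurableTypeR R) (measurableTypeR R) R U (fun a b => axis_density h (lift ord0 ord0) (a *: e0 + b *: e1))).
    exact: mc.
  by move=> a b; have /andP[] := AM (lift ord0 ord0) (a *: e0 + b *: e1).
have m1 : measurable_fun setT (a1 : measurableTypeR R -> R).
  apply: (@measurable_Rintegral1 _ _ (measurableTypeR R) (measurableTypeR R) R U (fun b a => axis_density h ord0 (a *: e0 + b *: e1))).
    exact: (measurableT_comp (mc _ (cA ord0)) (measurable_fun_pair measurable_snd measurable_fst)).
  by move=> b a; have /andP[] := AM ord0 (a *: e0 + b *: e1).
have i0 : U.-integrable setT (EFin \o (a0 : measurableTypeR R -> R)).
  by apply: (bounded_intg U m0 (M := M)) => a; have /andP[? ?] := b0 a; rewrite ger0_norm.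
have i1 : U.-integrable setT (EFin \o (a1 : measurableTypeR R -> R)).
  by apply: (bounded_intg U m1 (M := M)) => a; have /andP[? ?] := b1 a; rewrite ger0_norm.
have h2 x : `|h x ^+ 2| <= M ^+ 2.
  rewrite normrX lerXn2r ?nnegrE//; first exact: le_trans (nA ord0 x).
  by have /andP[_] := AM ord0 x; apply: le_trans; rewrite lerDl.
have ch2 : continuous (fun x => h x ^+ 2).
  exact: (bounded_smooth_continuous (bounded_smoothX 2 hh)).
rewrite (torus2 ch2 h2).
have E0 : \int[torus_measure R 2]_x axis_density h ord0 x = \int[U]_b a1 b.
  rewrite (torus2 (cA ord0) (nA ord0)).
  exact: (@bounded_swap _ _ (measurableTypeR R) (measurableTypeR R) R U U
    (fun a b => axis_density h ord0 (a *: e0 + b *: e1)) M (mc _ (cA ord0)) (fun a b => nA ord0 _)).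
have E1 : \int[torus_measure R 2]_x axis_density h (lift ord0 ord0) x = \int[U]_a a0 a.
  exact: (torus2 (cA (lift ord0 ord0)) (nA (lift ord0 ord0))).
rewrite (congr2 (@GRing.mul R) E0 E1).
rewrite -(Rintegral_prod_split i0 i1).
have hab a b : h (a *: e0 + b *: e1) ^+ 2 <= a1 b * a0 a.
  rewrite -[leLHS]real_normK ?num_real// expr2.
  exact: (ler_pM (normr_ge0 _) (normr_ge0 _) (h1 a b) (h0 a b)).
apply: (@bounded_le_Rintegral2 _ _ _ _ R U U (fun a b => h (a *: e0 + b *: e1) ^+ 2)
  (fun a b => a1 b * a0 a) (M * M)).
- exact: (mc _ ch2).
- apply: measurable_funM; first exact: (measurableT_comp m1 measurable_snd).
  exact: (measurableT_comp m0 measurable_fst).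
- by move=> a b; rewrite sqr_ge0/=; exact: hab.
- move=> a b; have /andP[x0 x1] := b0 a; have /andP[y0 y1] := b1 b.
  exact: (ler_pM y0 x0 y1 x1).
Qed.

(** [|h|] is bounded by each of the three means along lines through a point,
    each a function of two coordinates: [|f|^3 = |h|^(3/2)] is then at most the
    product of their square roots, the situation of Loomis and Whitney. *)
Lemma sobolev3 (h f : 'rV[R]_3 -> R) : bounded_smooth h -> bounded_smooth f ->
  (forall x, f x ^+ 2 = `|h x|) ->
  (\int[torus_measure R 3]_x (`|f x| ^+ 3)) ^+ 2 <=
  \int[torus_measure R 3]_x axis_density h ord0 x *
  \int[torus_measure R 3]_x axis_density h (lift ord0 ord0) x *
  \int[torus_measure R 3]_x axis_density h (lift ord0 (lift ord0 ord0)) x.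
Proof.
move=> hh hf fh; have [M AM] := axis_density_bounded hh.
have cA j : continuous (axis_density h j) by exact: axis_density_continuous.
have nA j x : `|axis_density h j x| <= M by have /andP[? ?] := AM j x; rewrite ger0_norm.
pose X := measurableTypeR R.
have M0 : 0 <= M by have /andP[] := AM ord0 0; exact: le_trans.
have mp : measurable_fun setT (fun z : X * X * X => z.1.1 *: e0 + (z.1.2 *: e1 + z.2 *: e2) : 'rV[R]_3).
  under eq_fun do rewrite -rV_cons3.
  have z1 : measurable_fun setT (fun z : X * X * X => z.1) by exact: measurable_fst.
  do !apply: measurable_rV_cons_comp.
  - exact: (measurableT_comp measurable_fst z1).
  - exact: (measurableT_comp measurable_snd z1).
  - exact: measurable_snd.
  - exact: measurable_cst.
pose pt a b c : 'rV[R]_3 := a *: e0 + (b *: e1 + c *: e2).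
have mc (d : measure_display) (Y : measurableType d) (g : 'rV[R]_3 -> R) (a b c : Y -> X) : continuous g ->
    measurable_fun setT a -> measurable_fun setT b -> measurable_fun setT c ->
    measurable_fun setT (fun y => g (pt (a y) (b y) (c y))).
  move=> cf ma mb mc.
  have mabc := measurable_fun_pair (measurable_fun_pair ma mb) mc.
  exact: (measurableT_comp (measurableT_comp (continuous_measurable_mx cf) mp) mabc).
have mid : measurable_fun setT (id : X -> X) by exact: measurable_id.
have mk (r : R) (d : measure_display) (Y : measurableType d) : measurable_fun setT (fun _ : Y => r : X) by exact: measurable_cst.
pose q0 b c := \int[U]_a axis_density h ord0 (pt a b c).
pose q1 a c := \int[U]_b axis_density h (lift ord0 ord0) (pt a b c).
pose q2 a b := \int[U]_c axis_density h (lift ord0 (lift ord0 ord0)) (pt a b c).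
have b0 b c : 0 <= q0 b c <= M by apply: Rintegral_bounds => //; exact: mc.
have b1 a c : 0 <= q1 a c <= M by apply: Rintegral_bounds => //; exact: mc.
have b2 a b : 0 <= q2 a b <= M by apply: Rintegral_bounds => //; exact: mc.
have h0 a b c : `|h (pt a b c)| <= q0 b c by exact: (line_sup _ _ _ hh).
have h1 a b c : `|h (pt a b c)| <= q1 a c.
  have -> : q1 a c = \int[U]_r axis_density h (lift ord0 ord0) (r *: e1 + (a *: e0 + c *: e2)).
    by apply: eq_Rintegral => r _; rewrite /pt addrCA.
  by rewrite /pt addrCA; exact: (line_sup _ _ _ hh).
have h2 a b c : `|h (pt a b c)| <= q2 a b.
  have -> : q2 a b = \int[U]_r axis_density h (lift ord0 (lift ord0 ord0)) (r *: e2 + (a *: e0 + b *: e1)).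
    by apply: eq_Rintegral => r _; rewrite /pt addrA addrC.
  by rewrite /pt addrA addrC; exact: (line_sup _ _ _ hh).
have mf : measurable_fun setT (fst : X * X -> X) by exact: measurable_fst.
have ms : measurable_fun setT (snd : X * X -> X) by exact: measurable_snd.
have mff : measurable_fun setT (fun z : (X * X) * X => z.1.1) := measurableT_comp mf measurable_fst.
have mfs : measurable_fun setT (fun z : (X * X) * X => z.1.2) := measurableT_comp ms measurable_fst.
have mss : measurable_fun setT (snd : (X * X) * X -> X) by exact: measurable_snd.
have m0 : measurable_fun setT (fun z : X * X => q0 z.1 z.2).
  apply: (@measurable_Rintegral1 _ _ (X * X)%type X R U (fun z a => axis_density h ord0 (pt a z.1 z.2))).
    exact: mc.
  by move=> z a; have /andP[] := AM ord0 (pt a z.1 z.2).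
have m1 : measurable_fun setT (fun z : X * X => q1 z.1 z.2).
  apply: (@measurable_Rintegral1 _ _ (X * X)%type X R U (fun z b => axis_density h (lift ord0 ord0) (pt z.1 b z.2))).
    exact: mc.
  by move=> z b; have /andP[] := AM (lift ord0 ord0) (pt z.1 b z.2).
have m2 : measurable_fun setT (fun z : X * X => q2 z.1 z.2).
  apply: (@measurable_Rintegral1 _ _ (X * X)%type X R U (fun z c => axis_density h (lift ord0 (lift ord0 ord0)) (pt z.1 z.2 c))).
    exact: mc.
  by move=> z c; have /andP[] := AM (lift ord0 (lift ord0 ord0)) (pt z.1 z.2 c).
have sq a b c : `|f (pt a b c)| ^+ 3 <= Num.sqrt (q0 b c) * Num.sqrt (q1 a c) * Num.sqrt (q2 a b).
  have -> : `|f (pt a b c)| = Num.sqrt `|h (pt a b c)| by rewrite -fh sqrtr_sqr.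
  have s0 := @sqrtr_ge0 R; rewrite !exprS expr0 mulr1 mulrA.
  apply: (ler_pM (mulr_ge0 (s0 _) (s0 _)) (s0 _) _ (ler_wsqrtr (h2 a b c))).
  exact: (ler_pM (s0 _) (s0 _) (ler_wsqrtr (h0 a b c)) (ler_wsqrtr (h1 a b c))).
have E0 : \int[torus_measure R 3]_x axis_density h ord0 x = \int[U]_b \int[U]_c q0 b c.
  rewrite (torus3 (cA ord0) (nA ord0)).
  transitivity (\int[U]_b \int[U]_a \int[U]_c axis_density h ord0 (pt a b c)).
    apply: (@bounded_swap _ _ X X R U U (fun a b => \int[U]_c axis_density h ord0 (pt a b c)) M).
      apply: (@measurable_Rintegral1 _ _ (X * X)%type X R U (fun z c => axis_density h ord0 (pt z.1 z.2 c))).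
        exact: (mc _ _ _ _ _ _ (cA ord0) mff mfs mss).
      by move=> z c; have /andP[] := AM ord0 (pt z.1 z.2 c).
    move=> a b; have /andP[? ?] : 0 <= \int[U]_c axis_density h ord0 (pt a b c) <= M.
      by apply: Rintegral_bounds => [|c]; [exact: (mc _ _ _ _ _ _ (cA ord0) (mk a _ _) (mk b _ _) mid)|exact: AM].
    by rewrite ger0_norm.
  apply: eq_Rintegral => b _.
  apply: (@bounded_swap _ _ X X R U U (fun a c => axis_density h ord0 (pt a b c)) M).
    exact: (mc _ _ _ _ _ _ (cA ord0) mf (mk b _ _) ms).
  by move=> a c; exact: nA.
have E1 : \int[torus_measure R 3]_x axis_density h (lift ord0 ord0) x = \int[U]_a \int[U]_c q1 a c.
  rewrite (torus3 (cA (lift ord0 ord0)) (nA (lift ord0 ord0))).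
  apply: eq_Rintegral => a _.
  apply: (@bounded_swap _ _ X X R U U (fun b c => axis_density h (lift ord0 ord0) (pt a b c)) M).
    exact: (mc _ _ _ _ _ _ (cA (lift ord0 ord0)) (mk a _ _) mf ms).
  by move=> b c; exact: nA.
have E2 : \int[torus_measure R 3]_x axis_density h (lift ord0 (lift ord0 ord0)) x = \int[U]_a \int[U]_b q2 a b.
  exact: (torus3 (cA (lift ord0 (lift ord0 ord0))) (nA (lift ord0 (lift ord0 ord0)))).
rewrite (congr2 (@GRing.mul R) (congr2 (@GRing.mul R) E0 E1) E2).
have f0 : continuous (fun x => `|f x| ^+ 3).
  move=> x; have -> : (fun x => `|f x| ^+ 3) = (fun x => `|f x * f x * f x|).
    by apply/funext => y; rewrite !normrM !exprS expr0 mulr1 mulrA.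
  have hf3 := bounded_smoothM (bounded_smoothM hf hf) hf.
  have cf3 := bounded_smooth_continuous hf3; exact: (cvg_norm (cf3 x)).
have [N fN] : exists N, forall x, `|f x| <= N by case: hf.
have N0 : 0 <= N by exact: (le_trans (normr_ge0 (f 0)) (fN 0)).
have f3 x : 0 <= `|f x| ^+ 3 <= N ^+ 3.
  by rewrite exprn_ge0//= lerXn2r// nnegrE.
have f3' x : `|(`|f x| ^+ 3)| <= N ^+ 3 by have /andP[? ?] := f3 x; rewrite ger0_norm.
have cf : continuous f by exact: bounded_smooth_continuous.
rewrite (torus3 f0 f3').
apply: (@loomis_whitney_sqrt _ _ _ X X X R U U U q0 q1 q2 (fun a b c => `|f (pt a b c)| ^+ 3) M m0 m1 m2 _ b0 b1 b2).
  exact: (mc _ _ _ _ _ _ f0 mff mfs mss).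
by move=> a b c; rewrite sq andbT exprn_ge0.
Qed.

End low_dimension.

(** * Moments of weakly differentiable functions *)

Section fatou_bound.
Context d (T : measurableType d) (R : realType) (mu : {measure set T -> \bar R}).

Lemma fatou_bound (F : nat -> T -> \bar R) (f : T -> \bar R) (C : \bar R) :
  (forall n, measurable_fun setT (F n)) -> (forall n x, (0 <= F n x)%E) ->
  measurable_fun setT f -> {ae mu, forall x, F n x @[n --> \oo] --> f x} ->
  (forall n, (\int[mu]_x F n x <= C)%E) -> (\int[mu]_x f x <= C)%E.
Proof.
move=> mF F0 mf Ff FC.
have -> : (\int[mu]_x f x = \int[mu]_x limn_einf (F ^~ x))%E.
  apply: ae_eq_integral => //; first apply: measurableT_comp => //.
    apply: (measurable_fun_limn_esup (f := fun n x => (- F n x)%E)) => n.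
    exact: measurableT_comp.
  by apply: filterS Ff => x Ffx _; have [-> _] := cvg_limn_einf_sup Ffx.
apply: (le_trans (fatou mu measurableT mF (fun n x _ => F0 n x))).
rewrite limn_einf_lim; apply: lime_le; first exact: is_cvg_einfs.
apply: nearW => n; apply: le_trans (FC n); apply: ereal_inf_lbound.
by exists n => /=.
Qed.

End fatou_bound.

Section smooth_moments.
Variable R : realType.

(** Product rule, and Cauchy-Schwarz against the H^1 norm of [f]. *)
Lemma axis_density_power d (f : 'rV[R]_d -> R) (j : 'I_d) n (M : R) : bounded_smooth f ->
  \int[torus_measure R d]_x (f x ^+ 2) <= M ^+ 2 ->
  \int[torus_measure R d]_x ('D_(delta_mx 0 j) f x ^+ 2) <= M ^+ 2 -> 0 <= M ->
  \int[torus_measure R d]_x axis_density (fun y => f y ^+ n.+1) j x <=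
  n.+2%:R * M * Num.sqrt (\int[torus_measure R d]_x ((f x ^+ n) ^+ 2)).
Proof.
move=> hf fM DM M0; set mu := torus_measure R d.
have nL2 g : L2 mu g -> L2 mu (fun x => `|g x|).
  move=> hg; apply: (le_L2 _ _ hg); first by apply: measurableT_comp => //; case: hg.
  by move=> x; rewrite normr_id.
have hf2 := nL2 _ (bounded_smooth_L2 hf).
have hD2 := nL2 _ (bounded_smooth_derive_L2 (delta_mx 0 j) hf).
have hn2 := nL2 _ (bounded_smooth_L2 (bounded_smoothX n hf)).
have e : (fun x => axis_density (fun y => f y ^+ n.+1) j x) =
    (fun x => `|f x ^+ n| * `|f x| + n.+1%:R * (`|f x ^+ n| * `|'D_(delta_mx 0 j) f x|)).
  apply/funext => x; rewrite /axis_density derive_power// !normrM [in LHS]exprSr normrM.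
  by rewrite [`|n.+1%:R|]ger0_norm// mulrA.
have -> : \int[mu]_x axis_density (fun y => f y ^+ n.+1) j x =
    \int[mu]_x (`|f x ^+ n| * `|f x| + n.+1%:R * (`|f x ^+ n| * `|'D_(delta_mx 0 j) f x|)).
  by rewrite e.
rewrite RintegralD//; [|exact: L2_mul|by apply: intgZ; exact: L2_mul].
rewrite RintegralZl//; last exact: L2_mul.
set I := \int[mu]_x ((f x ^+ n) ^+ 2).
have cs g : L2 mu (fun x => `|g x|) -> \int[mu]_x (g x ^+ 2) <= M ^+ 2 ->
    \int[mu]_x (`|f x ^+ n| * `|g x|) <= Num.sqrt I * M.
  move=> hg gM; apply: (le_trans (cauchy_schwarz_sqrt hn2 hg)).
  have -> : \int[mu]_x (`|f x ^+ n| ^+ 2) = I.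
    by apply: eq_Rintegral => x _; rewrite real_normK ?num_real.
  have -> : \int[mu]_x (`|g x| ^+ 2) = \int[mu]_x (g x ^+ 2).
    by apply: eq_Rintegral => x _; rewrite real_normK ?num_real.
  rewrite ler_wpM2l ?sqrtr_ge0//.
  by rewrite -[leRHS]ger0_norm// -sqrtr_sqr ler_wsqrtr.
have h1 := cs _ hf2 fM; have h2 := cs _ hD2 DM.
have h3 : n.+1%:R * \int[mu]_x (`|f x ^+ n| * `|'D_(delta_mx 0 j) f x|) <=
    n.+1%:R * (Num.sqrt I * M) by rewrite ler_wpM2l.
apply: (le_trans (lerD h1 h3)).
rewrite [n.+2%:R]mulrSr mulrDl mul1r mulrDl addrC lerD//.
  by rewrite [Num.sqrt I * M]mulrC mulrA.
by rewrite mulrC.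
Qed.

(** The embedding of H^1 into [L^(2 m)], stated for smooth functions and with a
    bound that depends on the H^1 norm alone. *)
Definition moment_bounded d m : Prop := forall M : R, 0 <= M -> exists C : R,
  forall f : 'rV[R]_d -> R, bounded_smooth f ->
    \int[torus_measure R d]_x (f x ^+ 2) <= M ^+ 2 ->
    (forall j, \int[torus_measure R d]_x ('D_(delta_mx 0 j) f x ^+ 2) <= M ^+ 2) ->
    \int[torus_measure R d]_x ((f x ^+ m) ^+ 2) <= C.

(** Apply the two-dimensional inequality to [f^(m+1)]: each density is bounded
    through the previous moment, so the moments grow by a factor per step. *)
Lemma moment_bounded2 m : moment_bounded 2 m.
Proof.
move=> M M0; exists (((m.+1)`!%:R * M ^+ m) ^+ 2) => f hf fM DM.
elim: m => [|m IH].
  have -> : \int[torus_measure R 2]_x ((f x ^+ 0) ^+ 2) = \int[torus_measure R 2]_x 1.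
    by apply: eq_Rintegral => x _; rewrite expr0 expr1n.
  by rewrite Rintegral_prob_cst factS fact0 expr0 !mulr1 expr1n.
apply: (le_trans (sobolev2 (bounded_smoothX m.+1 hf))).
set I := \int[torus_measure R 2]_x ((f x ^+ m) ^+ 2) in IH *.
have I0 : 0 <= I by apply: Rintegral_ge0 => x _; exact: sqr_ge0.
have A j := axis_density_power m hf fM (DM j) M0.
have A0 j : 0 <= \int[torus_measure R 2]_x axis_density (fun y => f y ^+ m.+1) j x.
  by apply: Rintegral_ge0 => x _; rewrite addr_ge0.
apply: (le_trans (ler_pM (A0 _) (A0 _) (A _) (A _))).
rewrite mulrACA -!expr2 sqr_sqrtr// factS natrM -/I [M ^+ m.+1]exprS.
rewrite (_ : (m.+2%:R * (m.+1)`!%:R * (M * M ^+ m)) = (m.+2%:R * M) * ((m.+1)`!%:R * M ^+ m)); last by ring.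
by rewrite [leRHS]exprMn ler_wpM2l// sqr_ge0.
Qed.

(** The three-dimensional inequality for [h = f^4] bounds the square of the
    sixth moment [I] by [(5 M sqrt I)^3], and [I <= (5 M)^6] follows. *)
Lemma moment_bounded3 : moment_bounded 3 3.
Proof.
move=> M M0; exists ((5 * M) ^+ 6) => f hf fM DM.
set I := \int[torus_measure R 3]_x ((f x ^+ 3) ^+ 2).
have I0 : 0 <= I by apply: Rintegral_ge0 => x _; exact: sqr_ge0.
have A j := axis_density_power 3 hf fM (DM j) M0.
have A0 j : 0 <= \int[torus_measure R 3]_x axis_density (fun y => f y ^+ 4) j x.
  by apply: Rintegral_ge0 => x _; rewrite addr_ge0.
have f24 x : (f x ^+ 2) ^+ 2 = `|f x ^+ 4|.
  by rewrite -exprM ger0_norm// (exprM _ 2 2) sqr_ge0.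
have := sobolev3 (bounded_smoothX 4 hf) (bounded_smoothX 2 hf) f24.
have -> : \int[torus_measure R 3]_x (`|f x ^+ 2| ^+ 3) = I.
  by apply: eq_Rintegral => x _; rewrite ger0_norm ?sqr_ge0// -!exprM.
move=> h; have {}h := le_trans h (ler_pM (mulr_ge0 (A0 _) (A0 _)) (A0 _)
  (ler_pM (A0 _) (A0 _) (A _) (A _)) (A _)).
set s := Num.sqrt I in h.
have s0 : 0 <= s by exact: sqrtr_ge0.
have Is : I = s ^+ 2 by rewrite sqr_sqrtr.
move: h; rewrite Is; set K := 5 * M.
have K0 : 0 <= K by rewrite mulr_ge0.
move=> h; have [->|sn0] := eqVneq s 0; first by rewrite expr0n/= exprn_ge0.
have sp : 0 < s by rewrite lt_neqAle eq_sym sn0.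
have : s * s ^+ 3 <= K ^+ 3 * s ^+ 3.
  have -> : s * s ^+ 3 = (s ^+ 2) ^+ 2 by ring.
  by apply: (le_trans h); rewrite le_eqVlt; apply/orP; left; apply/eqP; rewrite /K; ring.
rewrite ler_pM2r ?exprn_gt0// => sK.
by rewrite (exprM _ 3 2) lerXn2r// nnegrE// exprn_ge0.
Qed.

End smooth_moments.

Section sobolev_moments.
Variables (R : realType) (d m : nat).
Local Notation mu := (torus_measure R d).

Lemma power_lipschitz (K : R) n : 0 <= K -> exists2 L : R, 0 <= L &
  forall a b : R, `|a| <= K -> `|b| <= K -> `|a ^+ n - b ^+ n| <= L * `|a - b|.
Proof.
move=> K0; elim: n => [|n [L L0 IH]].
  by exists 0 => // a b _ _; rewrite !expr0 subrr normr0 mul0r.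
exists (K * L + K ^+ n) => [|a b aK bK]; first by rewrite addr_ge0 ?mulr_ge0// exprn_ge0.
have -> : a ^+ n.+1 - b ^+ n.+1 = a * (a ^+ n - b ^+ n) + (a - b) * b ^+ n.
  by rewrite !exprS; ring.
apply: (le_trans (ler_normD _ _)); rewrite !normrM mulrDl lerD//.
  by rewrite -mulrA ler_pM// IH.
by rewrite mulrC ler_wpM2r// normrX lerXn2r// nnegrE.
Qed.

(** The moment bound passes from the smoothed functions [P_n u] to [u]: the
    truncated moments are Lipschitz in L^2, and Fatou removes the truncation. *)
Lemma moment_bound_weak (M : R) : moment_bounded R d m -> 0 <= M ->
  exists C : R, forall (u : 'rV[R]_d -> R) (Du : 'I_d -> 'rV[R]_d -> R),
  L2 mu u -> (forall j, L2 mu (Du j)) -> (forall j, weak_derivative u (Du j) j) ->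
  \int[mu]_x (u x ^+ 2) <= M ^+ 2 -> (forall j, \int[mu]_x (Du j x ^+ 2) <= M ^+ 2) ->
  (\int[mu]_x ((u x ^+ m) ^+ 2)%:E <= C%:E)%E.
Proof.
move=> mb M0; have [C hC] := mb M M0; exists C => u Du hu hDu wD uM DM.
have [mu1 iu2] := hu; have iu := L2_intg hu.
pose P n := kernel_mean mu (@torus_kernel R d n) u.
have mK n := markov_torus_kernel R d n.
have PC n : \int[mu]_x ((P n x ^+ m) ^+ 2) <= C.
  have [I [lam [e hL]]] := finite_rank_torus_kernel R d n.
  have sP : bounded_smooth (P n) by apply: (kernel_mean_smooth hL).
  apply: hC; first exact: sP.
    exact: le_trans (kernel_mean_contraction (mK n) hu) uM.
  move=> j; have -> : \int[mu]_x ('D_(delta_mx 0 j) (P n) x ^+ 2) =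
      \int[mu]_x (kernel_mean mu (@torus_kernel R d n) (Du j) x ^+ 2).
    by apply: eq_Rintegral => x _; have -> := derive_kernel_mean_weak hL (wD j) x.
  exact: le_trans (kernel_mean_contraction (mK n) (hDu j)) (DM j).
have hP n : L2 mu (P n) by exact: (kernel_mean_L2 (mK n) hu).
have mc K (f : 'rV[R]_d -> R) : measurable_fun setT f -> measurable_fun setT (fun x => clamp K (f x)).
  by move=> mf; exact: (measurableT_comp (measurable_clamp K) mf).
(* truncation makes the power Lipschitz, so that L^2 convergence suffices *)
have trunc (K : nat) : \int[mu]_x ((clamp K%:R (u x) ^+ m) ^+ 2) <= C.
  have K0 : 0 <= K%:R :> R by [].
  have [L L0 hL] := power_lipschitz (m * 2) K0.
  have ic f : measurable_fun setT f -> mu.-integrable setT (EFin \o (fun x => (clamp K%:R (f x) ^+ m) ^+ 2)).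
    move=> mf; apply: (bounded_intg mu (M := K%:R ^+ (m * 2))).
      by apply: measurable_funX; apply: measurable_funX; exact: mc.
    by move=> x; rewrite -exprM normrX lerXn2r ?nnegrE// clamp_bound.
  apply/ler_addgt0Pr => eps eps0.
  have e1 : 0 < (eps / (L + 1)) ^+ 2 by rewrite exprn_gt0// divr_gt0// ltr_wpDl.
  have [n _ /(_ n (leqnn n)) En] := torus_energy_vanishes hu e1.
  have dn : \int[mu]_x ((P n x - u x) ^+ 2) <= (eps / (L + 1)) ^+ 2.
    by rewrite -lee_fin; apply: le_trans En; exact: kernel_mean_sub_energy.
  have hB := L2B (hP n) hu.
  have iB := intg_norm (L2_intg hB).
  have d1 : \int[mu]_x `|P n x - u x| <= eps / (L + 1).
    have c0 : 0 <= eps / (L + 1) by rewrite divr_ge0 ?ltW// ltr_wpDl.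
    have hB' : L2 mu (fun x => `|P n x - u x|).
      apply: (le_L2 _ _ hB); first exact: intg_measurable iB.
      by move=> x; rewrite normr_id.
    have h1 : L2 mu (cst 1 : _ -> R) by apply: (@bounded_L2 _ _ _ mu _ 1) => // x; rewrite normr1.
    have := cauchy_schwarz_sqrt hB' h1.
    have -> : \int[mu]_x (`|P n x - u x| * cst 1 x) = \int[mu]_x `|P n x - u x|.
      by apply: eq_Rintegral => x _; rewrite /= mulr1.
    have -> : \int[mu]_x (cst 1 x ^+ 2) = 1 :> R.
      rewrite -[RHS](Rintegral_prob_cst mu 1); apply: eq_Rintegral => x _.
      by rewrite /= expr1n.
    rewrite sqrtr1 mulr1 => h; apply: (le_trans h).
    rewrite -[leRHS]ger0_norm// -sqrtr_sqr ler_wsqrtr//; apply: le_trans dn.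
    by rewrite le_eqVlt; apply/orP; left; apply/eqP/eq_Rintegral => x _; rewrite real_normK ?num_real.
  have pt x : (clamp K%:R (u x) ^+ m) ^+ 2 <= (P n x ^+ m) ^+ 2 + L * `|P n x - u x|.
    have := hL _ _ (clamp_bound (u x) K0) (clamp_bound (P n x) K0).
    rewrite !(exprM _ m 2) => h.
    have h2 : (clamp K%:R (P n x) ^+ m) ^+ 2 <= (P n x ^+ m) ^+ 2.
      rewrite -[leLHS]real_normK ?num_real// -[leRHS]real_normK ?num_real// !normrX.
      rewrite lerXn2r ?nnegrE ?exprn_ge0// lerXn2r ?nnegrE//.
      have [hx|hx] := leP `|P n x| K%:R; first by rewrite clamp_id.
      by apply: le_trans (ltW hx); exact: clamp_bound.
    have h3 : L * `|clamp K%:R (u x) - clamp K%:R (P n x)| <= L * `|P n x - u x|.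
      by apply: (ler_wpM2l L0); rewrite [leRHS]distrC; exact: clamp_lip.
    have := ler_norm ((clamp K%:R (u x) ^+ m) ^+ 2 - (clamp K%:R (P n x) ^+ m) ^+ 2).
    by lra.
  have iPm : mu.-integrable setT (EFin \o (fun x => (P n x ^+ m) ^+ 2)).
    have [I [lam [e hLe]]] := finite_rank_torus_kernel R d n.
    have := bounded_smooth_L2 (bounded_smoothX m (kernel_mean_smooth hLe iu)).
    by case.
  apply: (@le_trans _ _ (\int[mu]_x ((P n x ^+ m) ^+ 2 + L * `|P n x - u x|))).
    apply: le_Rintegral => //; first exact: ic.
    by apply: intgD => //; exact: intgZ.
  rewrite RintegralD//; last exact: intgZ.
  rewrite RintegralZl// lerD//.
  apply: (@le_trans _ _ (L * (eps / (L + 1)))); first by rewrite ler_wpM2l.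
  rewrite mulrA ler_pdivrMr ?ltr_wpDl// mulrC ler_wpM2l ?ltW//; lra.
have mcm (K : nat) : measurable_fun setT (fun x => (clamp K%:R (u x) ^+ m) ^+ 2).
  by apply: measurable_funX; apply: measurable_funX; exact: mc.
apply: (@fatou_bound _ _ R mu (fun (K : nat) x => ((clamp K%:R (u x) ^+ m) ^+ 2)%:E)).
- by move=> K; apply/measurable_EFinP.
- by move=> K x; rewrite lee_fin sqr_ge0.
- by apply/measurable_EFinP; apply: measurable_funX; exact: measurable_funX.
- apply: nearW => x; apply: cvg_near_cst; near=> K.
  rewrite clamp_id//; near: K.
  exists (Num.bound `|u x|) => // K /= hK.
  by apply: (le_trans (ltW (archi_boundP (normr_ge0 _)))); rewrite ler_nat.
- move=> K; rewrite -EFin_Rintegral ?lee_fin//; apply: (bounded_intg mu (mcm K) (M := K%:R ^+ (m * 2))).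
  by move=> x; rewrite -exprM normrX lerXn2r ?nnegrE// clamp_bound.
Unshelve. all: by end_near.
Qed.

End sobolev_moments.

(** * Primitives, the chain rule and weak derivatives in time *)

Section primitive.
Variable R : realType.
Local Notation leb := (@lebesgue_measure R).
Local Notation X := (measurableTypeR R).
Local Notation intg g := (leb.-integrable setT (EFin \o (g : X -> R))).
Implicit Types (g q : X -> R) (a b t : R).

(** The primitive is taken from [-oo], so that it is additive and continuous
    without any restriction on [t]. *)
Definition prim (g : X -> R) (t : R) : R := \int[leb]_s ((s <= t)%R%:R * g s).

Lemma measurable_le_indicator t : measurable_fun setT (fun s : X => (s <= t)%R%:R : R).
Proof.
have -> : (fun s : X => (s <= t)%R%:R : R) = \1_[set` `]-oo, t]].
  by apply/funext => s; rewrite indicE mem_setE in_itv/=.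
exact: measurable_indic.
Qed.

Lemma indicator_intg g t : intg g -> intg (fun s => (s <= t)%R%:R * g s).
Proof.
move=> ig; apply: (le_intg (fun s => `|g s|)); last exact: intg_norm.
  by apply: measurable_funM; [exact: measurable_le_indicator|exact: intg_measurable ig].
by move=> s; case: (s <= t); rewrite ?mul1r// mul0r normr0.
Qed.

Lemma prim_sub g a b : intg g -> a <= b ->
  prim g b - prim g a = \int[leb]_s ((a < s <= b)%R%:R * g s).
Proof.
move=> ig ab; rewrite /prim -RintegralB//; [|exact: indicator_intg..].
apply: eq_Rintegral => s _; rewrite -mulrBl; congr (_ * _).
have [sa|sa] := leP s a; first by rewrite (le_trans sa ab) subrr.
by rewrite subr0.
Qed.

Lemma interval_intg g a b : intg g -> intg (fun s => (a < s <= b)%R%:R * g s).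
Proof.
move=> ig; have [ab|ba] := leP a b; last first.
  have -> : (fun s : X => (a < s <= b)%R%:R * g s) = cst 0.
    apply/funext => s; have [h1|h1] := ltP a s; rewrite ?mul0r//= leNgt (lt_trans ba h1) mul0r//.
  exact: integrable0.
have := intgB (indicator_intg b ig) (indicator_intg a ig).
congr (_.-integrable _ _); apply/funext => s /=; congr EFin.
rewrite -mulrBl; congr (_ * _).
have [sa|sa] := leP s a; first by rewrite (le_trans sa ab) subrr.
by rewrite subr0.
Qed.

Lemma prim_le g q a b : intg g -> intg q -> a <= b -> (forall s, a < s <= b -> g s <= q s) ->
  prim g b - prim g a <= prim q b - prim q a.
Proof.
move=> ig iq ab h; rewrite !prim_sub//; apply: le_Rintegral => //; [exact: interval_intg..|].
by move=> s _; have [/h gq|] := boolP (a < s <= b); rewrite ?mul1r// !mul0r.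
Qed.

Lemma prim_norm g a b : intg g -> a <= b ->
  `|prim g b - prim g a| <= prim (fun s => `|g s|) b - prim (fun s => `|g s|) a.
Proof.
move=> ig ab; rewrite !prim_sub//; last exact: intg_norm.
apply: (le_trans (Rintegral_le_abs (interval_intg a b ig))).
rewrite le_eqVlt; apply/orP; left; apply/eqP/eq_Rintegral => s _.
by rewrite normrM ger0_norm.
Qed.

Lemma primD g q t : intg g -> intg q -> prim (fun s => g s + q s) t = prim g t + prim q t.
Proof.
move=> ig iq; rewrite /prim -RintegralD//; [|exact: indicator_intg..].
by apply: eq_Rintegral => s _; rewrite mulrDr.
Qed.

Lemma primZ c g t : intg g -> prim (fun s => c * g s) t = c * prim g t.
Proof.
move=> ig; rewrite /prim -RintegralZl//; last exact: indicator_intg.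
by apply: eq_Rintegral => s _; rewrite mulrCA.
Qed.

Lemma primN g t : intg g -> prim (fun s => - g s) t = - prim g t.
Proof.
move=> ig; rewrite -mulN1r -primZ//; congr (prim _ t).
by apply/funext => s; rewrite mulN1r.
Qed.

Lemma primB g q t : intg g -> intg q -> prim (fun s => g s - q s) t = prim g t - prim q t.
Proof. by move=> ig iq; rewrite primD ?primN//; exact: intgN. Qed.

Lemma prim_sum (I : Type) (r : seq I) (G : I -> X -> R) t : (forall i, intg (G i)) ->
  prim (fun s => \sum_(i <- r) G i s) t = \sum_(i <- r) prim (G i) t.
Proof.
move=> iG; rewrite /prim -Rintegral_sum; last by move=> i; exact: indicator_intg.
by apply: eq_Rintegral => s _; rewrite big_distrr.
Qed.

Lemma prim_eq0 g t : (forall s, s <= t -> g s = 0) -> prim g t = 0.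
Proof.
move=> g0; rewrite /prim (_ : (fun s => _) = cst 0) ?Rintegral0//.
  by rewrite /Rintegral integral0.
by apply/funext => s; case: (leP s t) => [/g0->|_]; rewrite ?mulr0 ?mul0r.
Qed.

Lemma prim_abs_continuous g : intg g -> forall e, 0 < e -> exists2 dl : R, 0 < dl &
  forall a b, a <= b -> b - a < dl ->
    prim (fun s => `|g s|) b - prim (fun s => `|g s|) a < e.
Proof.
move=> ig e e0; have [dl [dl0 h]] := integral_normr_continuous ig e0.
exists dl => // a b ab bad; rewrite prim_sub//; last exact: intg_norm.
have {}h : forall A : set X, measurable A -> (leb A < dl%:E)%E -> \int[leb]_(x in A) `|g x| < e := h.
have := h `]a, b]%classic (measurable_itv _).
rewrite lebesgue_measure_itv/= lte_fin.
have -> : (\int[leb]_(x in `]a, b]) `|g x|) = \int[leb]_s ((a < s <= b)%R%:R * `|g s|).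
  rewrite Rintegral_mkcond; apply: eq_Rintegral => s _.
  by rewrite patchE mem_setE in_itv/=; case: ifP => _; rewrite ?mul1r ?mul0r.
apply; case: ifPn; first by rewrite lte_fin.
by rewrite lte_fin.
Qed.

Lemma prim_continuous g : intg g -> continuous (prim g).
Proof.
move=> ig t; apply/cvgrPdist_lt => e e0.
have [dl dl0 h] := prim_abs_continuous ig e0.
near=> s; have [st|/ltW ts] := leP s t.
  apply: (le_lt_trans (prim_norm ig st)); apply: h => //.
  by rewrite -[ltLHS]ger0_norm ?subr_ge0//; near: s; exact: (cvgr_dist_lt _ dl0).
rewrite distrC; apply: (le_lt_trans (prim_norm ig ts)); apply: h => //.
rewrite -[ltLHS]ger0_norm ?subr_ge0// distrC; near: s; exact: (cvgr_dist_lt _ dl0).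
Unshelve. all: by end_near. Qed.

(** Over a fine partition the errors add up to an arbitrarily small multiple of
    the integral of the fixed density. *)
Lemma increments_prim (H : R -> R) q m T : intg q -> intg m -> 0 <= T ->
  (forall e, 0 < e -> exists2 dl : R, 0 < dl & forall a b, 0 <= a -> a <= b -> b <= T ->
     b - a < dl ->
     `|(H b - H a) - (prim q b - prim q a)| <= e * (prim m b - prim m a)) ->
  H T - H 0 = prim q T - prim q 0.
Proof.
move=> iq im T0 h; apply/eqP; rewrite -subr_eq0 -normr_le0; apply/ler_addgt0Pr => e e0.
rewrite add0r; pose D := `|prim m T - prim m 0|; have D0 : 0 <= D by exact: normr_ge0.
have e1 : 0 < e / (D + 1) by rewrite divr_gt0// ltr_wpDl.
have [dl dl0 hd] := h _ e1.
pose N := (Num.bound (T / dl)).+1.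
have Ndl : T / N%:R < dl.
  rewrite ltr_pdivrMr ?ltr0n// mulrC -ltr_pdivrMr//.
  by apply: (lt_trans (archi_boundP (divr_ge0 T0 (ltW dl0)))); rewrite ltr_nat.
pose a k : R := T * k%:R / N%:R.
have a0 : a 0 = 0 by rewrite /a mulr0 mul0r.
have aN : a N = T by rewrite /a mulfK// pnatr_eq0.
have astep k : a k.+1 - a k = T / N%:R by rewrite /a -natr1; field; rewrite pnatr_eq0.
have amono k : a k <= a k.+1 by rewrite -subr_ge0 astep divr_ge0.
have age0 k : 0 <= a k by rewrite /a divr_ge0// mulr_ge0.
have aleT k : (k <= N)%N -> a k <= T.
  move=> kN; rewrite /a ler_pdivrMr ?ltr0n// ler_wpM2l// ler_nat//.
(* telescoping over the partition of [0, T] into N equal steps *)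
have key k : (k <= N)%N -> `|(H (a k) - H 0) - (prim q (a k) - prim q 0)|
    <= e / (D + 1) * (prim m (a k) - prim m 0).
  elim: k => [_|k IH kN]; first by rewrite a0 !subrr normr0 mulr0.
  have := hd _ _ (age0 k) (amono k) (aleT _ kN); rewrite astep => /(_ Ndl) h1.
  have -> : H (a k.+1) - H 0 - (prim q (a k.+1) - prim q 0) =
      (H (a k) - H 0 - (prim q (a k) - prim q 0)) +
      (H (a k.+1) - H (a k) - (prim q (a k.+1) - prim q (a k))) by ring.
  apply: (le_trans (ler_normD _ _)).
  have -> : prim m (a k.+1) - prim m 0 = (prim m (a k) - prim m 0) +
      (prim m (a k.+1) - prim m (a k)) by ring.
  by rewrite mulrDr lerD// IH// ltnW.
have := key N (leqnn N); rewrite aN => h1; apply: (le_trans h1).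
have h2 : prim m T - prim m 0 <= D by exact: ler_norm.
apply: (@le_trans _ _ (e / (D + 1) * D)); first by rewrite ler_wpM2l// ltW.
by rewrite mulrAC ler_pdivrMr ?ltr_wpDl// ler_wpM2l ?ltW//; lra.
Qed.

End primitive.

Section chain_rule.
Variables (R : realType) (V : normedModType R) (I : finType).
Variables (E : I -> V) (G : V -> R) (DG : I -> V -> R).
Hypothesis dG : forall k x, is_derive x (E k) G (DG k x).
Hypothesis cDG : forall k, continuous (DG k).
Local Notation leb := (@lebesgue_measure R).
Local Notation X := (measurableTypeR R).
Local Notation intg g := (leb.-integrable setT (EFin \o (g : X -> R))).

(** The mean value theorem along the line through [x] in the direction [E k]. *)
Lemma directional_mvt k x (h : R) : exists2 c : R, `|c| <= `|h| &
  G (h *: E k + x) - G x = DG k (c *: E k + x) * h.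
Proof.
pose psi (r : R) := G (r *: E k + x).
have dpsi (r : R) : is_derive r 1 psi (DG k (r *: E k + x)).
  have /is_derive_lineP hr := dG k (r *: E k + x); apply/is_derive_lineP; move: hr.
  by congr (is_derive _ _ _ _); apply/funext => s; rewrite /psi addrA scalerDl /GRing.scale /= mulr1.
have cpsi a b : {within `[a, b], continuous psi}.
  apply: continuous_subspaceT => r; apply: differentiable_continuous.
  by apply/derivable1_diffP; have [] := dpsi r.
have psi0 : psi 0 = G x by rewrite /psi scale0r add0r.
have [h0|/ltW h0] := leP 0 h.
  have [c] := MVT_segment h0 (fun r _ => dpsi r) (cpsi 0 h).
  rewrite in_itv/= => /andP[c0 ch]; rewrite psi0 subr0 => e; exists c => //.
  by rewrite !ger0_norm.
have [c] := MVT_segment h0 (fun r _ => dpsi r) (cpsi h 0).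
rewrite in_itv/= => /andP[hc c0]; rewrite psi0 sub0r => e; exists c.
  by rewrite !ler0_norm// lerN2.
by rewrite -/(psi h) -[LHS]opprB e mulrN opprK.
Qed.

(** Move along one direction at a time; every intermediate point stays within
    [r] of [x0], where the partial derivatives are nearly constant. *)
Lemma partial_increments (x0 : V) (r eps : R) (h : I -> R) : 0 <= eps ->
  (forall k y, `|y - x0| <= r -> `|DG k y - DG k x0| <= eps) ->
  forall (s : seq I) x, `|x - x0| + \sum_(k <- s) `|h k| * `|E k| <= r ->
  `|G (\sum_(k <- s) h k *: E k + x) - G x - \sum_(k <- s) h k * DG k x0| <=
    eps * \sum_(k <- s) `|h k|.
Proof.
move=> eps0 hD; elim=> [|k s IH] x.
  by rewrite !big_nil add0r subrr subrr normr0 mulr0.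
rewrite !big_cons => hr.
have [c ch e] := directional_mvt k x (h k).
have nx : `|h k *: E k + x - x0| <= `|x - x0| + `|h k| * `|E k|.
  by rewrite -addrA addrC (le_trans (ler_normD _ _))// lerD// normrZ.
have := IH (h k *: E k + x).
move=> /(_ (le_trans (lerD nx (lexx _)) _)); rewrite -[X in X <= r]addrA => /(_ hr) h1.
have h2 : `|G (h k *: E k + x) - G x - h k * DG k x0| <= eps * `|h k|.
  rewrite e [DG _ _ * _]mulrC -mulrBr normrM mulrC ler_wpM2r//; apply: hD.
  rewrite -addrA addrC (le_trans (ler_normD _ _))// normrZ.
  apply: le_trans hr; rewrite lerD// -[leLHS]addr0 lerD//; first exact: ler_wpM2r.
  by apply: sumr_ge0 => i _; rewrite mulr_ge0.
rewrite mulrDr; apply: le_trans (lerD h2 h1).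
rewrite (_ : _ - _ = (G (h k *: E k + x) - G x - h k * DG k x0) +
  (G (\sum_(j <- s) h j *: E j + (h k *: E k + x)) - G (h k *: E k + x)
   - \sum_(j <- s) h j * DG j x0)); first exact: ler_normD.
rewrite (_ : h k *: E k + \sum_(j <- s) h j *: E j + x =
  \sum_(j <- s) h j *: E j + (h k *: E k + x)); last by rewrite addrA [h k *: _ + _]addrC.
by ring.
Qed.

Variables (A : V) (B : I -> X -> R) (T : R).
Hypothesis iB : forall k, intg (B k).
Let gam t := \sum_k prim (B k) t *: E k + A.

Lemma curve_continuous : continuous gam.
Proof.
move=> t; apply: cvgD; last exact: cvg_cst.
elim: (index_enum I) => [|k s IH].
  by under eq_fun do rewrite big_nil; rewrite big_nil; exact: cvg_cst.
under eq_fun do rewrite big_cons; rewrite big_cons; apply: cvgD => //.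
by apply: cvgZl; exact: (prim_continuous (iB k)).
Qed.

(** Uniform continuity of the partial derivatives near the arc, by compactness
    of the time interval. *)
Lemma curve_modulus (e : R) : 0 < e -> exists2 r : R, 0 < r &
  forall t, 0 <= t <= T -> forall k y, `|y - gam t| <= r -> `|DG k y - DG k (gam t)| <= e.
Proof.
move=> e0; have e2 : 0 < e / 2 by rewrite divr_gt0.
pose P (r t : R) := forall k y, `|y - gam t| <= r -> `|DG k y - DG k (gam t)| <= e.
have near_gam (t rho : R) : 0 < rho -> \forall s \near t, `|gam t - gam s| < rho.
  by move: (@curve_continuous t) => /cvgrPdist_lt; exact.
have near_P (t : R) : \forall s \near t & r \near 0%R^'+, P r s.
  have : \forall y \near gam t, forall k, `|DG k (gam t) - DG k y| <= e / 2.
    apply: filter_forall => k; move: (@cDG k (gam t)) => /cvgrPdist_le; exact.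
  move=> /nbhs_ballP[rho rho0 hrho].
  have rho2 : 0 < rho / 2 by rewrite divr_gt0.
  near=> s r => /= => k y yr.
  have g1 : `|gam t - gam s| < rho / 2 by near: s; exact: near_gam.
  have rr : r < rho / 2 by near: r; exact: nbhs_right_lt.
  have y1 : `|gam t - y| < rho.
    rewrite (_ : gam t - y = (gam t - gam s) + (gam s - y)); last by rewrite addrA subrK.
    apply: (le_lt_trans (ler_normD _ _)); rewrite [ltRHS]splitr ltr_leD//.
    by rewrite distrC (le_trans yr)// ltW.
  have y2 : `|gam t - gam s| < rho by apply: (lt_trans g1); rewrite ltr_pdivrMr//; lra.
  have {}hrho z : `|gam t - z| < rho -> forall k, `|DG k (gam t) - DG k z| <= e / 2.
    by move=> hz; apply: hrho; rewrite -ball_normE.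
  have h1 := hrho _ y1 k; have h2 := hrho _ y2 k.
  rewrite (_ : DG k y - DG k (gam s) = (DG k (gam t) - DG k (gam s)) - (DG k (gam t) - DG k y)); last by ring.
  by apply: (le_trans (ler_normB _ _)); rewrite [leRHS]splitr; exact: lerD.
have covT : near_covering `[0, T]%classic by apply/compact_near_coveringP; exact: segment_compact.
have : \forall r \near 0%R^'+, `[0, T]%classic `<=` P r.
  by apply: covT => t _; exact: near_P.
move=> hr; near (0:R)^'+ => r; exists r => [//|t t0T].
have hr' : `[0, T]%classic `<=` P r by near: r.
by apply: hr'; rewrite /= in_itv/=.
Unshelve. all: by end_near.
Qed.

Let q s := \sum_k B k s * DG k (gam s).

Lemma curve_diff a b : gam b = \sum_k (prim (B k) b - prim (B k) a) *: E k + gam a.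
Proof.
rewrite /gam addrA -big_split/=; congr (_ + _); apply: eq_bigr => k _.
by rewrite -scalerDl subrK.
Qed.

(** Over a short interval the partial derivatives are nearly constant near the
    curve, so the increment of [G] and that of the primitive differ by a small
    multiple of the variation of the curve, as [increments_prim] requires. *)
Lemma chain_rule : (forall k, intg (fun s => B k s * DG k (gam s))) -> 0 <= T ->
  G (gam T) - G (gam 0) = prim q T - prim q 0.
Proof.
move=> iBD T0; pose m s := \sum_k `|B k s|; pose M s := \sum_k `|B k s| * `|E k|.
have iB' k : intg (fun s => `|B k s|) by apply: intg_norm; exact: iB.
have im : intg m by apply: intg_sum => k; exact: iB'.
have iM : intg M.
  by apply: intg_sum => k; under eq_fun do rewrite mulrC; exact: (intgZ _ (iB' k)).
have iq : intg q by exact: intg_sum.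
apply: (@increments_prim R (G \o gam) q m T iq im T0) => e e0.
have e2 : 0 < e / 2 by rewrite divr_gt0.
have [r r0 hr] := curve_modulus e2.
have [dl dl0 hdl] := prim_abs_continuous iM r0.
exists dl => // a b a0 ab bT bad /=.
pose h k := prim (B k) b - prim (B k) a.
have small c : a <= c -> c <= b -> \sum_k `|prim (B k) c - prim (B k) a| * `|E k| <= r.
  move=> ac cb; apply: (@le_trans _ _ (prim M c - prim M a)).
    have -> : prim M c - prim M a = \sum_k (prim (fun s => `|B k s|) c - prim (fun s => `|B k s|) a) * `|E k|.
      rewrite /M !prim_sum -?sumrB; last 2 first.
      - by move=> k; under eq_fun do rewrite mulrC; exact: (intgZ _ (iB' k)).
      - by move=> k; under eq_fun do rewrite mulrC; exact: (intgZ _ (iB' k)).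
      apply: eq_bigr => k _; rewrite mulrBl.
      by congr (_ - _); rewrite mulrC -primZ//; congr (prim _ _); apply/funext => s; rewrite mulrC.
    by apply: ler_sum => k _; rewrite ler_wpM2r// prim_norm.
  apply: ltW; apply: le_lt_trans (hdl a c ac (le_lt_trans (lerB cb (lexx a)) bad)).
  apply: prim_le => //; first exact: intg_norm.
  by move=> s _; exact: ler_norm.
have mono : \sum_k `|h k| <= prim m b - prim m a.
  rewrite /m !prim_sum// -sumrB; apply: ler_sum => k _; exact: prim_norm.
have aT : 0 <= a <= T by rewrite a0 (le_trans ab).
have st1 : `|G (gam b) - G (gam a) - \sum_k h k * DG k (gam a)| <= e / 2 * (prim m b - prim m a).
  rewrite (curve_diff a b).
  apply: (le_trans (partial_increments (r := r) (ltW e2) _ _)).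
  - by move=> k y; exact: hr.
  - by rewrite subrr normr0 add0r; exact: small.
  - by rewrite ler_wpM2l// ltW.
pose w s := \sum_k B k s * DG k (gam a).
have iw : intg w by apply: intg_sum => k; under eq_fun do rewrite mulrC; exact: intgZ.
have st2 : `|\sum_k h k * DG k (gam a) - (prim q b - prim q a)| <= e / 2 * (prim m b - prim m a).
  have -> : \sum_k h k * DG k (gam a) - (prim q b - prim q a) =
      prim (fun s => w s - q s) b - prim (fun s => w s - q s) a.
    rewrite (primB b iw iq) (primB a iw iq).
    have pw t : prim w t = \sum_k prim (B k) t * DG k (gam a).
      rewrite /w prim_sum; last by move=> k; under eq_fun do rewrite mulrC; exact: intgZ.
      apply: eq_bigr => k _; rewrite mulrC -primZ//; congr (prim _ _).
      by apply/funext => s; rewrite mulrC.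
    rewrite !pw (_ : \sum_k h k * _ = \sum_k prim (B k) b * DG k (gam a) -
      \sum_k prim (B k) a * DG k (gam a)); first by ring.
    by rewrite -sumrB; apply: eq_bigr => k _; rewrite mulrBl.
  have iwq : intg (fun s => w s - q s) by exact: intgB.
  apply: (le_trans (prim_norm iwq ab)).
  have -> : e / 2 * (prim m b - prim m a) =
      prim (fun s => e / 2 * m s) b - prim (fun s => e / 2 * m s) a by rewrite (primZ _ b im) (primZ _ a im) mulrBr.
  apply: prim_le => //; [exact: intg_norm|exact: intgZ|].
  move=> s /andP[a_s sb]; rewrite /w /q /m -sumrB mulr_sumr.
  apply: (le_trans (ler_norm_sum _ _ _)); apply: ler_sum => k _.
  rewrite -mulrBr normrM mulrC ler_wpM2r// distrC; apply: hr => //.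
  rewrite (curve_diff a s) addrK; apply: (le_trans (ler_norm_sum _ _ _)).
  apply: le_trans (small s (ltW a_s) sb); apply: ler_sum => i _; by rewrite normrZ.
rewrite (_ : _ - _ = (G (gam b) - G (gam a) - \sum_k h k * DG k (gam a)) +
  (\sum_k h k * DG k (gam a) - (prim q b - prim q a))); last by rewrite /comp; ring.
apply: (le_trans (ler_normD _ _)); apply: (le_trans (lerD st1 st2)).
by rewrite -mulrDl -splitr.
Qed.

(** The partial derivatives are bounded on the compact arc. *)
Lemma chain_rule_intg : 0 <= T -> (forall k s, ~~ (0 <= s <= T) -> B k s = 0) ->
  forall k, intg (fun s => B k s * DG k (gam s)).
Proof.
move=> T0 B0 k.
have cD : continuous (fun s : R => DG k (gam s)).
  move=> s; apply: (@cvg_comp _ _ _ gam (DG k) _ (nbhs (gam s))); first exact: curve_continuous.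
  exact: cDG.
have [c _ hc] : exists2 c, c \in `[0, T]%R & forall t, t \in `[0, T]%R -> `|DG k (gam t)| <= `|DG k (gam c)|.
  apply: (@EVT_max R (fun t => `|DG k (gam t)|) 0 T T0).
  by apply: continuous_subspaceT => s; apply: cvg_norm; exact: cD.
apply: (le_intg (fun s => `|DG k (gam c)| * `|B k s|)).
- apply: measurable_funM; first exact: intg_measurable (iB k).
  exact: continuous_measurable1.
- move=> s; rewrite normrM mulrC.
  have [sT|/B0 ->] := boolP (0 <= s <= T); last by rewrite normr0 !mulr0.
  by rewrite ler_wpM2r// hc// in_itv.
- by apply: intgZ; apply: intg_norm; exact: iB.
Qed.

End chain_rule.

Section time_primitive.
Variable R : realType.
Local Notation leb := (@lebesgue_measure R).
Local Notation X := (measurableTypeR R).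
Local Notation intg g := (leb.-integrable setT (EFin \o (g : X -> R))).

(** The chain rule for the square of an absolutely continuous function. *)
Lemma primitive_sqr (al0 T : R) (a : X -> R) : intg a -> 0 <= T ->
  (forall s, ~~ (0 <= s <= T) -> a s = 0) ->
  intg (fun s => a s * (al0 + prim a s)) /\
  forall t, 0 <= t -> (al0 + prim a t) ^+ 2 - (al0 + prim a 0) ^+ 2 =
    2 * (prim (fun s => a s * (al0 + prim a s)) t - prim (fun s => a s * (al0 + prim a s)) 0).
Proof.
move=> ia T0 a0.
pose E (_ : unit) : R^o := 1; pose G (x : R^o) : R := x ^+ 2; pose DG (_ : unit) (x : R^o) : R := 2 * x.
have dG k x : is_derive x (E k) G (DG k x).
  have -> : G = ((fun y : R^o => (y : R)) \* (fun y : R^o => (y : R))) by apply/funext => y; rewrite /G expr2.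
  have h := @is_derive_id R R^o x (E k).
  have := is_deriveM h h; congr (is_derive _ _ _ _).
  by rewrite /DG /E /GRing.scale/=; ring.
have cDG k : continuous (DG k).
  by move=> x; apply: cvgM; [exact: cvg_cst|exact: cvg_id].
pose B (_ : unit) := a.
have gamE t : \sum_(k : unit) prim (B k) t *: E k + (al0 : R^o) = al0 + prim a t.
  by rewrite (big_pred1 tt)=> [|[]//]; rewrite /E /GRing.scale/= mulr1 addrC.
have iD := @chain_rule_intg R R^o unit E DG cDG al0 B T (fun _ => ia) T0 (fun _ => a0) tt.
have iD' : intg (fun s => a s * (al0 + prim a s)).
  have := intgZ 2^-1 iD; congr (_.-integrable _ _); apply/funext => s /=; congr EFin.
  by rewrite gamE /DG /B; field.
split=> // t t0.
have := @chain_rule R R^o unit E G DG dG cDG al0 B t (fun _ => ia) _ t0; rewrite !gamE.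
have qE s : \sum_(k : unit) B k s * DG k (\sum_(k : unit) prim (B k) s *: E k + (al0 : R^o)) =
    2 * (a s * (al0 + prim a s)).
  by rewrite (big_pred1 tt)=> [|[]//]; rewrite gamE /DG /B; ring.
move=> /(_ (fun k : unit => match k with tt => iD end)) e; apply: (etrans e).
rewrite (_ : (fun s => _) = (fun s => 2 * (a s * (al0 + prim a s)))); last by apply/funext => s; rewrite qE.
by rewrite !primZ ?mulrBr.
Qed.

(** [theta y = (1 + 1/y) exp(-1/y)] for [y > 0] is the derivative of
    [y exp(-1/y)]; it lies between 0 and 1. *)
Definition theta (y : R) : R := flat_bump 0 y + y * flat_bump 2 y.

Lemma theta_le0 y : y <= 0 -> theta y = 0.
Proof. by move=> y0; rewrite /theta !flat_bump_le0// mulr0 addr0. Qed.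

Lemma theta_gt0 y : 0 < y -> theta y = expR (- y^-1) * (1 + y^-1).
Proof.
by move=> y0; rewrite /theta /flat_bump y0; field; rewrite gt_eqF.
Qed.

Lemma theta_bound y : 0 <= theta y <= 1.
Proof.
have [y0|y0] := leP y 0; first by rewrite theta_le0// lexx ler01.
have z0 : 0 < y^-1 by rewrite invr_gt0.
rewrite theta_gt0// mulr_ge0 ?expR_ge0//=; last by rewrite addr_ge0// ltW.
by rewrite expRN mulrC ler_pdivrMr ?expR_gt0// mul1r expR_ge1Dx.
Qed.

Lemma flat_bump0_bound (y : R) : 0 <= flat_bump 0 y <= 1.
Proof.
rewrite flat_bump_ge0/= /flat_bump expr0 mul1r; case: ifP => // y0.
by rewrite -expR0 ler_expR oppr_le0 invr_ge0 ltW.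
Qed.

Lemma flat_bump0_limit (s : R) : flat_bump 0 (k.+1%:R * s) @[k --> \oo] --> ((0 < s)%R%:R : R).
Proof.
have [s0|s0] := leP s 0.
  apply: cvg_near_cst; apply: nearW => k; rewrite flat_bump_le0//.
  by rewrite mulr_ge0_le0.
have z : (k.+1%:R * s)^-1 @[k --> \oo] --> (0 : R).
  rewrite -[X in _ --> X](mul0r s^-1); under eq_fun do rewrite invfM.
  by apply: cvgMl; exact: cvg_harmonic.
have : expR (- (k.+1%:R * s)^-1) @[k --> \oo] --> expR (- (0 : R)).
  by apply: continuous_cvg; [exact: continuous_expR|exact: cvgN].
rewrite oppr0 expR0; apply: cvg_trans; apply: near_eq_cvg; apply: nearW => k.
by rewrite /flat_bump mulr_gt0 ?ltr0n// expr0 mul1r.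
Qed.

Lemma theta_limit (s : R) : theta (k.+1%:R * s) @[k --> \oo] --> ((0 < s)%R%:R : R).
Proof.
have [s0|s0] := leP s 0.
  apply: cvg_near_cst; apply: nearW => k; rewrite theta_le0//.
  by rewrite mulr_ge0_le0.
have z : (k.+1%:R * s)^-1 @[k --> \oo] --> (0 : R).
  rewrite -[X in _ --> X](mul0r s^-1); under eq_fun do rewrite invfM.
  by apply: cvgMl; exact: cvg_harmonic.
have : expR (- (k.+1%:R * s)^-1) * (1 + (k.+1%:R * s)^-1) @[k --> \oo] --> expR (- (0 : R)) * (1 + 0).
  apply: cvgM; first by apply: continuous_cvg; [exact: continuous_expR|exact: cvgN].
  by apply: cvgD => //; exact: cvg_cst.
rewrite oppr0 expR0 mul1r addr0; apply: cvg_trans; apply: near_eq_cvg; apply: nearW => k.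
by rewrite theta_gt0// mulr_gt0 ?ltr0n.
Qed.

(** Test functions in time: smooth approximations of [t |-> max (b - t) 0]. *)
Definition ramp (b : R) (n : nat) (t : R) : R := (b - t) * flat_bump 0 (n.+1%:R * (b - t)).

Let bump (N s : R) : R := s * flat_bump 0 (N * s + 0).

Let mul_lin (N a x y : R) : N * (a *: x + y) = a * (N * x) + N * y.
Proof. by rewrite /GRing.scale/=; ring. Qed.

Let neg_lin (a x y : R) : - (a *: x + y) = a * - x + - y.
Proof. by rewrite /GRing.scale/=; ring. Qed.

Let rampE b n : ramp b n = (fun t => bump n.+1%:R (- t + b)).
Proof. by apply/funext => t; rewrite /ramp /bump addr0 [- t + b]addrC. Qed.

Lemma Ck_id (V : normedModType R) k : Ck k (@id V).
Proof.
case: k => [|k]; first by move=> x; exact: cvg_id.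
apply: (@CkS _ _ _ _ _ (fun v _ => v)); first by move=> x; exact: cvg_id.
by move=> v; exact: Ck_cst.
Qed.

Lemma Ck_ramp b n k : Ck k (ramp b n).
Proof.
rewrite rampE; apply: (Ck_comp_affine (h := bump n.+1%:R) (l := fun t : R => - t) b neg_lin).
  by move=> x; apply: cvgN; exact: cvg_id.
apply: (@CkM _ _ k id (fun s : R => flat_bump 0 (n.+1%:R * s + 0))); first exact: Ck_id.
apply: (Ck_comp_affine 0 (mul_lin n.+1%:R)); last exact: Ck_flat_bump.
by move=> x; apply: cvgM; [exact: cvg_cst|exact: cvg_id].
Qed.

Lemma derive_ramp b n t : 'D_1 (ramp b n) t = - theta (n.+1%:R * (b - t)).
Proof.
suff h : is_derive t 1 (ramp b n) (- theta (n.+1%:R * (b - t))) by apply: derive_val.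
rewrite rampE; set s := - t + b.
have hb : is_derive s 1 (bump n.+1%:R) (theta (n.+1%:R * s)).
  have h1 := @is_derive_comp_affine _ _ (flat_bump 0) _ 0 _ s 1 (mul_lin n.+1%:R)
    (flat_bump_derive 0 (n.+1%:R * s + 0)).
  have := is_deriveM (@is_derive_id R R^o s 1) h1; congr (is_derive _ _ _ _).
  by rewrite /theta /GRing.scale/= !addr0; ring.
have := @is_derive_comp_affine _ _ _ (fun t : R => - t) b _ t 1 neg_lin hb.
by congr (is_derive _ _ _ _); rewrite mulN1r /s addrC.
Qed.

Lemma prim_itv (g : X -> R) t : prim g t = \int[leb]_(s in `]-oo, t]) g s.
Proof.
rewrite Rintegral_mkcond; apply: eq_Rintegral => s _.
by rewrite patchE mem_setE in_itv/=; case: ifP => _; rewrite ?mul1r ?mul0r.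
Qed.

Lemma prim_derive (g : X -> R) : intg g -> {ae leb, forall t : X, is_derive (t : R) 1 (prim g) (g t)}.
Proof.
move=> ig.
have ig' y : leb.-integrable `]-oo, y] (EFin \o g) by apply: integrableS ig.
have lg : locally_integrable [set: R] g.
  by have := @integrable_locally R g setT measurableT ig; rewrite patch_setT.
pose H (x : R) := \int[leb]_(u in `]-oo, x]) g u.
have h : {ae leb, forall t : X, derivable H (t : R) 1 /\ derive1 H t = g t} := FTC1Ny ig' lg.
apply: filterS h => t [].
have -> : H = prim g.
  by apply/funext => x; rewrite prim_itv.
by move=> h1 h2; split=> //; rewrite -derive1E.
Qed.

Lemma lt_indicator_intg (g : X -> R) t : intg g -> intg (fun s => (s < t)%R%:R * g s).
Proof.
move=> ig; apply: (le_intg (fun s => `|g s|)); last exact: intg_norm.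
  apply: measurable_funM; last exact: intg_measurable ig.
  have -> : (fun s : X => (s < t)%R%:R : R) = \1_[set` `]-oo, t[].
    by apply/funext => s; rewrite indicE mem_setE in_itv/=.
  exact: measurable_indic.
by move=> s; case: (s < t); rewrite ?mul1r// mul0r normr0.
Qed.

Lemma ae_neq (t : R) : {ae leb, forall s : X, s != t}.
Proof.
exists [set t]; split; [exact: measurable_set1|exact: lebesgue_measure_set1|].
by move=> s /= /negP; rewrite negbK => /eqP.
Qed.

Lemma prim_lt (g : X -> R) t : intg g -> \int[leb]_s ((s < t)%R%:R * g s) = prim g t.
Proof.
move=> ig; apply: ae_eq_Rintegral.
- exact: intg_measurable (lt_indicator_intg t ig).
- exact: intg_measurable (indicator_intg t ig).
- by apply: filterS (ae_neq t) => s st; rewrite lt_neqAle st.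
Qed.

(** Tested with ramps vanishing after [b], the equation gives an identity for
    the primitive of [f] at every [b]; almost everywhere it can be
    differentiated in [b] by the Lebesgue differentiation theorem. *)
Lemma time_primitive (f g : X -> R) (f0 T : R) : intg f -> intg g ->
  (forall s, ~~ (0 < s < T) -> f s = 0) -> (forall s, ~~ (0 < s < T) -> g s = 0) ->
  (forall eta : R -> R, (forall k, Ck k eta) ->
    (exists2 T' : R, T' < T & forall t, T' <= t -> eta t = 0) ->
    \int[leb]_s (f s * 'D_1 eta s + g s * eta s) + f0 * eta 0 = 0) ->
  {ae leb, forall t : X, 0 < t < T -> f t = f0 + prim g t}.
Proof.
move=> if_ ig fT gT weak.
have isg : intg (fun s : X => (s : R) * g s).
  apply: (le_intg (fun s => T * `|g s|)).
  - by apply: measurable_funM; [exact: measurable_id|exact: intg_measurable ig].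
  - move=> s; have [/andP[s0 sT]|/gT ->] := boolP (0 < s < T); last by rewrite !mulr0 normr0 mulr0.
    by rewrite normrM ler_wpM2r// gtr0_norm// ltW.
  - by apply: intgZ; exact: intg_norm.
(* the limit of the equation tested with the ramps *)
have ident b : 0 < b < T -> prim f b = f0 * b + b * prim g b - prim (fun s => s * g s) b.
  move=> /andP[b0 bT].
  pose F n s := f s * - theta (n.+1%:R * (b - s)) + g s * ramp b n s.
  pose Fl s := f s * - ((s < b)%R%:R) + g s * ((b - s) * (s < b)%R%:R).
  have Fn n : \int[leb]_s F n s = - f0 * ramp b n 0.
    have := weak (ramp b n) (Ck_ramp b n).
    move=> /(_ _)/wrap[|h].
      exists b => // t bt; rewrite /ramp flat_bump_le0 ?mulr0//.
      by rewrite mulr_ge0_le0// subr_le0.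
    apply/eqP; rewrite mulNr -addr_eq0; apply/eqP; rewrite -[RHS]h; congr (_ + _).
    by apply: eq_Rintegral => s _; rewrite /F derive_ramp.
  have mth n : measurable_fun setT (fun s : X => theta (n.+1%:R * (b - s))).
    have -> : (fun s : X => theta (n.+1%:R * (b - s))) = (fun s => - 'D_1 (ramp b n) s).
      by apply/funext => s; rewrite derive_ramp opprK.
    have [_ /(_ 1)[_ c]] := Ck_ramp b n 1.
    apply: measurableT_comp => //; exact: (continuous_measurable1 c).
  have mrp n : measurable_fun setT (ramp b n : X -> R).
    exact: (continuous_measurable1 (Ck_ramp b n 0)).
  have c1 : \int[leb]_s F n s @[n --> \oo] --> \int[leb]_s Fl s.
    apply: (Rdominated_cvg (g := fun s => `|f s| + (b + T) * `|g s|)).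
    - move=> n; apply: measurable_funD; apply: measurable_funM => //.
      + exact: intg_measurable if_.
      + exact: measurableT_comp.
      + exact: intg_measurable ig.
    - have mb : measurable_fun setT (fun s : X => (s < b)%R%:R : R).
        have -> : (fun s : X => (s < b)%R%:R : R) = \1_[set` `]-oo, b[].
          by apply/funext => s; rewrite indicE mem_setE in_itv/=.
        exact: measurable_indic.
      apply: measurable_funD; apply: measurable_funM.
      + exact: intg_measurable if_.
      + exact: measurableT_comp.
      + exact: intg_measurable ig.
      + by apply: measurable_funM => //; apply: measurable_funB => //; exact: measurable_id.
    - apply: nearW => s; apply: cvgD; apply: cvgM; try exact: cvg_cst.
        apply: cvgN; rewrite -(subr_gt0 s b); exact: theta_limit.
      apply: cvgM; first exact: cvg_cst.
      rewrite -(subr_gt0 s b); exact: flat_bump0_limit.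
    - by apply: intgD; [exact: intg_norm|apply: intgZ; exact: intg_norm].
    - move=> n; apply: nearW => s.
      have /andP[t0 t1] := theta_bound (n.+1%:R * (b - s)).
      have /andP[u0 u1] := flat_bump0_bound (n.+1%:R * (b - s)).
      apply: (le_trans (ler_normD _ _)); apply: lerD.
        by rewrite normrM normrN [X in _ * X]ger0_norm// ler_piMr.
      have [/andP[s0 sT]|/gT ->] := boolP (0 < s < T); last by rewrite mul0r normr0 mulr0.
      rewrite normrM mulrC ler_wpM2r// /ramp normrM [X in _ * X]ger0_norm//.
      apply: (@le_trans _ _ `|b - s|); first by rewrite ler_piMr.
      by apply: (le_trans (ler_normB _ _)); rewrite !gtr0_norm// lerD// ltW.
  have c2 : - f0 * ramp b n 0 @[n --> \oo] --> - f0 * (b * 1).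
    apply: cvgM; first exact: cvg_cst.
    rewrite /ramp; under eq_fun do rewrite subr0.
    apply: cvgM; first exact: cvg_cst.
    by have := @flat_bump0_limit b; rewrite b0.
  have e : \int[leb]_s Fl s = - f0 * (b * 1).
    have c2' : \int[leb]_s F n s @[n --> \oo] --> - f0 * (b * 1) by under eq_fun do rewrite Fn.
    exact: (cvg_unique (@Rhausdorff R) c1 c2').
  have i1 : intg (fun s => (s < b)%R%:R * f s) by exact: lt_indicator_intg.
  have i2 : intg (fun s => (s < b)%R%:R * g s) by exact: lt_indicator_intg.
  have i3 : intg (fun s => (s < b)%R%:R * (s * g s)) by exact: lt_indicator_intg.
  rewrite -(prim_lt b if_) -(prim_lt b ig) -(prim_lt b isg).
  have : \int[leb]_s Fl s = (- (\int[leb]_s ((s < b)%R%:R * f s))) +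
     (b * \int[leb]_s ((s < b)%R%:R * g s) - \int[leb]_s ((s < b)%R%:R * (s * g s))).
    rewrite -RintegralN// -RintegralZl// -RintegralB//; last exact: intgZ.
    rewrite -RintegralD//; [|exact: intgN|by apply: intgB => //; exact: intgZ].
    by apply: eq_Rintegral => s _; rewrite /Fl; ring.
  by rewrite e mulr1; lra.
have := prim_derive if_; have := prim_derive ig; have := prim_derive isg.
apply: filterS3 => t d3 d2 d1 /andP[t0 tT].
have near_t : \forall s \near t, 0 < s < T.
  near=> s; apply/andP; split; near: s; [exact: lt_nbhsr|exact: lt_nbhsl].
have dr : is_derive t 1 (fun b : R => f0 * b + b * prim g b - prim (fun s => s * g s) b) (f0 + prim g t).
  have hid := @is_derive_id R R^o t 1.
  have := is_deriveB (is_deriveD (is_deriveZ f0 hid) (is_deriveM hid d2)) d3.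
  by congr (is_derive _ _ _ _); rewrite /GRing.scale/=; ring.
have d1' : is_derive t 1 (prim f) (f0 + prim g t).
  apply: near_eq_is_derive dr.
  by apply: filterS near_t => s /ident.
by rewrite -(@derive_val _ _ _ _ _ _ _ d1) -(@derive_val _ _ _ _ _ _ _ d1').
Unshelve. all: by end_near. Qed.

End time_primitive.

(** * Square integrable functions on a space-time slab *)

Section slab_functions.
Context (R : realType) d (Y : measurableType d) (mu : probability Y R) (T : R).
Local Notation leb := (@lebesgue_measure R).
Local Notation X := (measurableTypeR R).
Local Notation Q := (leb \x mu)%E.

(** Square integrable functions supported in the time interval, all of whose
    slices are square integrable. Demanding this of every slice instead of
    almost every one keeps exceptional sets out of the later arguments. *)
Record slab (f : X -> Y -> R) : Prop := {
  slab_measurable : measurable_fun setT (fun z : X * Y => f z.1 z.2) ;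
  slab_supp : forall t y, ~~ (0 < t < T) -> f t y = 0 ;
  slab_L2t : forall t, L2 mu (f t) ;
  slab_L2y : forall y, L2 leb (f ^~ y) ;
  slab_L2 : L2 Q (fun z : X * Y => f z.1 z.2) }.

Lemma measurable_slab_indicator (a b : R) :
  measurable_fun setT (fun s : X => (a < s < b)%R%:R : R).
Proof.
have -> : (fun s : X => (a < s < b)%R%:R : R) = \1_[set` `]a, b[].
  by apply/funext => s; rewrite indicE mem_setE in_itv/=.
exact: measurable_indic.
Qed.

Lemma slab_indicator_intg (a b : R) : leb.-integrable setT (EFin \o (fun s : X => (a < s < b)%R%:R : R)).
Proof.
apply/intg_ge0P => //; first exact: measurable_slab_indicator.
have -> : (\int[leb]_s ((a < s < b)%R%:R)%:E = \int[leb]_s (\1_[set` `]a, b[] s)%:E)%E.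
  by apply: eq_integral => s _; rewrite indicE mem_setE in_itv/=.
rewrite integral_indic// setIT.
suff : (leb `]a, b[%classic < +oo)%E by [].
by rewrite lebesgue_measure_itv/=; case: ifP => _; rewrite ltry.
Qed.

Lemma le_slab_indicator (t r : R) : (~~ (0 < t < T) -> r = 0) ->
  `|r| <= (0 < t < T)%R%:R + r ^+ 2.
Proof.
case: (0 < t < T) => /= h; last by rewrite h// normr0 expr0n/= addr0.
have := sqr_ge0 (`|r| - 1); rewrite -[r ^+ 2]real_normK ?num_real//.
have := normr_ge0 r; set x := `|r|; nra.
Qed.

Lemma slab_intg_supp (f : X -> Y -> R) : measurable_fun setT (fun z : X * Y => f z.1 z.2) ->
  (forall t y, ~~ (0 < t < T) -> f t y = 0) -> L2 Q (fun z : X * Y => f z.1 z.2) ->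
  Q.-integrable setT (EFin \o (fun z : X * Y => f z.1 z.2)).
Proof.
move=> mf fT [_ f2]; pose ind (z : X * Y) : R := (0 < z.1 < T)%R%:R.
have mi : measurable_fun setT ind.
  exact: (measurableT_comp (@measurable_slab_indicator 0 T) measurable_fst).
have ii : Q.-integrable setT (EFin \o ind).
  apply/(@intg_prodP _ _ X Y R leb mu (fun t _ => (0 < t < T)%R%:R)) => //.
  have /intg_ge0P h := slab_indicator_intg 0 T.
  have := h (measurable_slab_indicator 0 T) (fun t => ler0n _ _); apply: le_lt_trans.
  apply: ge0_le_integral => //.
  - by move=> t _; apply: integral_ge0.
  - apply: (@measurable_fun_fubini_tonelli_F _ _ X Y R mu (fun z : X * Y => `|ind z|%:E)).
      by apply/measurable_EFinP; exact: measurableT_comp.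
    by move=> z; rewrite lee_fin.
  - by apply/measurable_EFinP; exact: measurable_slab_indicator.
  - move=> t _; rewrite integral_cst//= probability_setT mule1.
    by rewrite lee_fin ger0_norm.
apply: (le_intg (fun z => ind z + f z.1 z.2 ^+ 2)) => //; last exact: intgD.
by move=> z; apply: le_slab_indicator; exact: fT.
Qed.

Lemma slab_intg f : slab f -> Q.-integrable setT (EFin \o (fun z : X * Y => f z.1 z.2)).
Proof. by case=> mf fT _ _ f2; exact: slab_intg_supp. Qed.

Lemma slab_intgY f y : slab f -> leb.-integrable setT (EFin \o (f ^~ y)).
Proof.
move=> hf; have [mf f2] := slab_L2y hf y.
apply: (le_intg (fun t : X => (0 < t < T)%R%:R + f t y ^+ 2)) => //.
  by move=> t; apply: le_slab_indicator; exact: (slab_supp hf).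
by apply: intgD => //; exact: slab_indicator_intg.
Qed.

Lemma slab_intgt f t : slab f -> mu.-integrable setT (EFin \o f t).
Proof. by move=> hf; exact: L2_intg (slab_L2t hf t). Qed.

Lemma slabD f g : slab f -> slab g -> slab (fun t y => f t y + g t y).
Proof.
move=> hf hg; split.
- by apply: measurable_funD; [exact: slab_measurable hf|exact: slab_measurable hg].
- by move=> t y tT; rewrite (slab_supp hf)// (slab_supp hg)// addr0.
- by move=> t; exact: L2D (slab_L2t hf t) (slab_L2t hg t).
- by move=> y; exact: L2D (slab_L2y hf y) (slab_L2y hg y).
- exact: L2D (slab_L2 hf) (slab_L2 hg).
Qed.

Lemma slab_mul_intg f g : slab f -> slab g ->
  Q.-integrable setT (EFin \o (fun z : X * Y => f z.1 z.2 * g z.1 z.2)).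
Proof. by move=> hf hg; exact: L2_mul (slab_L2 hf) (slab_L2 hg). Qed.

(** Both families of exceptional slices are null, and the function is set to 0
    on them. *)
Lemma tame (f : X -> Y -> R) : measurable_fun (`]0, T[%classic `*` setT) (fun z : X * Y => f z.1 z.2) ->
  (\int[leb]_(t in `]0%R, T[) \int[mu]_y (f t y ^+ 2)%:E < +oo)%E ->
  exists g, [/\ slab g,
    {ae leb, forall t : X, 0 < t < T -> {ae mu, forall y, g t y = f t y}} &
    {ae Q, forall z : X * Y, 0 < z.1 < T -> g z.1 z.2 = f z.1 z.2}].
Proof.
move=> mf f2.
have mcyl : measurable (`]0, T[%classic `*` setT : set (X * Y)).
  by apply: measurableX => //; exact: measurable_itv.
pose p (t : X) y := if (0 < t < T)%R then f t y else 0.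
have pE : (fun z : X * Y => p z.1 z.2) = (fun z : X * Y => f z.1 z.2) \_ (`]0, T[%classic `*` setT).
  apply/funext => -[t y]; rewrite patchE /p /=; case: ifPn => h; case: ifPn => //.
    by move/negP; case; apply/mem_set; split => //=; rewrite in_itv.
  by move/set_mem => [/=]; rewrite in_itv/= (negbTE h).
have mp : measurable_fun setT (fun z : X * Y => p z.1 z.2).
  by rewrite pE; exact: ((measurable_restrictT _ mcyl).1 mf).
have pT t y : ~~ (0 < t < T) -> p t y = 0 by rewrite /p => /negbTE ->.
have mp2 : measurable_fun setT (fun z : X * Y => p z.1 z.2 ^+ 2) by exact: measurable_funX.
have p20 t y : 0 <= p t y ^+ 2 by exact: sqr_ge0.
have int_p : (\int[leb]_t \int[mu]_y (p t y ^+ 2)%:E < +oo)%E.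
  move: f2; rewrite integral_mkcond; apply: le_lt_trans.
  rewrite le_eqVlt; apply/orP; left; apply/eqP; apply: eq_integral => t _.
  rewrite patchE mem_setE in_itv/= /p; case: ifP => // _.
  by rewrite expr0n/= integral0.
have p2Q : Q.-integrable setT (EFin \o (fun z : X * Y => p z.1 z.2 ^+ 2)).
  apply/(@intg_prodP _ _ X Y R leb mu (fun t y => p t y ^+ 2) mp2).
  by under eq_integral do under eq_integral do rewrite ger0_norm//.
pose At := [set t : X | (\int[mu]_y (p t y ^+ 2)%:E < +oo)%E].
pose By := [set y : Y | (\int[leb]_t (p t y ^+ 2)%:E < +oo)%E].
have mp2E : measurable_fun setT (fun z : X * Y => (p z.1 z.2 ^+ 2)%:E) by exact/measurable_EFinP.
have mIt : measurable_fun setT (fun t => \int[mu]_y (p t y ^+ 2)%:E)%E.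
  by apply: (@measurable_fun_fubini_tonelli_F _ _ X Y R mu _ mp2E) => z; rewrite lee_fin.
have mIy : measurable_fun setT (fun y => \int[leb]_t (p t y ^+ 2)%:E)%E.
  by apply: (@measurable_fun_fubini_tonelli_G _ _ X Y R leb _ mp2E) => z; rewrite lee_fin.
have mAt : measurable At.
  by rewrite /At -[X in measurable X]setTI; exact: (emeasurable_fun_infty_o measurableT mIt).
have mBy : measurable By.
  by rewrite /By -[X in measurable X]setTI; exact: (emeasurable_fun_infty_o measurableT mIy).
have aeA : {ae leb, forall t : X, At t}.
  have h := @ae_intg1 _ _ X Y R leb mu (fun t y => p t y ^+ 2) p2Q; have {}h : {ae leb, forall t : X, mu.-integrable setT (EFin \o (fun y => p t y ^+ 2))} := h.
  apply: filterS h => t /(intg_ge0P _) h; apply: h => //.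
  exact: (measurable_fun_pair2 t mp2).
have aeB : {ae mu, forall y, By y}.
  have h := @ae_intg2 _ _ X Y R leb mu (fun t y => p t y ^+ 2) p2Q; have {}h : {ae mu, forall y, leb.-integrable setT (EFin \o (fun t : X => p t y ^+ 2))} := h.
  apply: filterS h => y /(intg_ge0P _) h; apply: h => //.
  exact: (measurable_fun_pair1 y mp2).
pose g (t : X) y := p t y * (\1_At t * \1_By y).
have mg : measurable_fun setT (fun z : X * Y => g z.1 z.2).
  apply: measurable_funM => //; apply: measurable_funM.
    exact: (measurableT_comp (measurable_indic mAt) measurable_fst).
  exact: (measurableT_comp (measurable_indic mBy) measurable_snd).
have gp t y : `|g t y| <= `|p t y|.
  rewrite /g !indicE; case: (_ \in _); case: (_ \in _); rewrite ?mulr1 ?mulr0 ?normr0//.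
exists g; split; first split => //.
- by move=> t y tT; rewrite /g pT// mul0r.
- move=> t; have mgt : measurable_fun setT (g t) := measurable_fun_pair2 t mg.
  have [tA|tA] := pselect (At t).
    apply: (le_L2 mgt (gp t)); split; first exact: (measurable_fun_pair2 t mp).
    by apply/intg_ge0P => //; exact: (measurable_fun_pair2 t mp2).
  have -> : g t = cst 0 by apply/funext => y; rewrite /g indicE memNset// mul0r mulr0.
  exact: L2_0.
- move=> y; have mgy : measurable_fun setT (g ^~ y) := measurable_fun_pair1 y mg.
  have [yB|yB] := pselect (By y).
    apply: (le_L2 mgy (fun t => gp t y)); split; first exact: (measurable_fun_pair1 y mp).
    by apply/intg_ge0P => //; exact: (measurable_fun_pair1 y mp2).
  have -> : g ^~ y = cst 0 by apply/funext => t; rewrite /g !indicE [y \in _]memNset// mulr0 mulr0.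
  exact: L2_0.
- by apply: (le_L2 mg (fun z => gp z.1 z.2)); split.
- apply: filterS aeA => t tA tT; apply: filterS aeB => y yB.
  by rewrite /g !indicE !mem_set// mulr1 mulr1 /p tT.
- move: aeA => [NA [mNA NA0 sA]]; move: aeB => [NB [mNB NB0 sB]].
  have nA : Q.-negligible (NA `*` setT).
    exists (NA `*` setT); split => //; first exact: measurableX.
    by apply: (etrans (@product_measure1E _ _ X Y R leb mu _ _ mNA measurableT)); rewrite [X in (X * _)%E]NA0 mul0e.
  have nB : Q.-negligible (setT `*` NB).
    exists (setT `*` NB); split => //; first exact: measurableX.
    by apply: (etrans (@product_measure1E _ _ X Y R leb mu _ _ measurableT mNB)); rewrite [X in (_ * X)%E]NB0 mule0.
  apply: negligibleS (negligibleU nA nB) => -[t y] /= h.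
  have [tA|tA] := pselect (At t); last by left; split => //; exact: sA.
  have [yB|yB] := pselect (By y); last by right; split => //; exact: sB.
  by exfalso; apply: h => tT; rewrite /g !indicE !mem_set// mulr1 mulr1 /p tT.
Qed.

End slab_functions.

(** * Time primitives of space-time functions *)

Section slab_primitive.
Context (R : realType) d (Y : measurableType d) (mu : probability Y R) (T : R).
Local Notation leb := (@lebesgue_measure R).
Local Notation X := (measurableTypeR R).
Local Notation Q := (leb \x mu)%E.

(** Split into two nonnegative parts, for which the primitive is a parametric
    integral of a nonnegative function. *)
Lemma measurable_prim (w : X -> Y -> R) : slab mu T w ->
  measurable_fun setT (fun z : X * Y => prim (w ^~ z.2) z.1).
Proof.
move=> hw; have mw := slab_measurable hw.
have part (u : X -> Y -> R) : measurable_fun setT (fun z : X * Y => u z.1 z.2) ->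
    (forall t y, 0 <= u t y) ->
    measurable_fun setT (fun z : X * Y => prim (u ^~ z.2) z.1).
  move=> mu_ u0.
  apply: (@measurable_Rintegral1 _ _ (X * Y)%type X R leb (fun z s => (s <= z.1)%R%:R * u s z.2)).
    have m1 : measurable_fun setT (fun v : (X * Y) * X => v.2) by exact: measurable_snd.
    have m2 : measurable_fun setT (fun v : (X * Y) * X => v.1) by exact: measurable_fst.
    have m21 : measurable_fun setT (fun v : (X * Y) * X => v.1.1) := measurableT_comp measurable_fst m2.
    have m22 : measurable_fun setT (fun v : (X * Y) * X => v.1.2) := measurableT_comp measurable_snd m2.
    rewrite (_ : (fun v : (X * Y) * X => _) = (fun v => if v.2 <= v.1.1 then u v.2 v.1.2 else 0)); last first.
      by apply/funext => v; case: ifP => _; rewrite ?mul1r ?mul0r.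
    apply: measurable_fun_ifT; first exact: measurable_fun_ler.
      exact: (measurableT_comp mu_ (measurable_fun_pair m1 m22)).
    exact: measurable_cst.
  by move=> z s; rewrite mulr_ge0.
have h1 := part (fun t y => `|w t y| + w t y).
have h2 := part (fun t y => `|w t y| - w t y).
have -> : (fun z : X * Y => prim (w ^~ z.2) z.1) = (fun z => 2^-1 *
   (prim (fun s => `|w s z.2| + w s z.2) z.1 - prim (fun s => `|w s z.2| - w s z.2) z.1)).
  apply/funext => z; have iw := slab_intgY z.2 hw; have inw := intg_norm iw.
  by rewrite primD// primB//; field.
apply: measurable_funM => //; apply: measurable_funB.
- apply: h1; first by apply: measurable_funD => //; exact: measurableT_comp.
  by move=> t y; have := ler_norm (- w t y); rewrite normrN; lra.
- apply: h2; first by apply: measurable_funB => //; exact: measurableT_comp.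
  by move=> t y; have := ler_norm (w t y); lra.
Qed.

Section prim_swap.
Variable h : X -> Y -> R.
Hypothesis ih : Q.-integrable setT (EFin \o (fun z : X * Y => h z.1 z.2)).

Let cut_intg t : Q.-integrable setT (EFin \o (fun z : X * Y => (z.1 <= t)%R%:R * h z.1 z.2)).
Proof.
apply: (le_intg (fun z : X * Y => `|h z.1 z.2|)); last exact: intg_norm.
  apply: measurable_funM; last exact: intg_measurable ih.
  exact: (measurableT_comp (measurable_le_indicator t) measurable_fst).
by move=> z; case: (_ <= t); rewrite ?mul1r// mul0r normr0.
Qed.

Lemma prim_intg t : mu.-integrable setT (EFin \o (fun y => prim (h ^~ y) t)).
Proof. exact: (@intg_Rintegral2 _ _ X Y R leb mu (fun s y => (s <= t)%R%:R * h s y) (cut_intg t)). Qed.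

Lemma prim_swap t : \int[mu]_y prim (h ^~ y) t = prim (fun s => \int[mu]_y h s y) t.
Proof.
rewrite /prim -(@Rintegral_swap _ _ X Y R leb mu (fun s y => (s <= t)%R%:R * h s y) (cut_intg t)).
apply: eq_Rintegral => s _; case: (s <= t).
  by rewrite mul1r; apply: eq_Rintegral => y _; rewrite mul1r.
rewrite mul0r; under eq_Rintegral do rewrite mul0r.
by rewrite /Rintegral integral0.
Qed.

End prim_swap.

Lemma prim0 (w : X -> Y -> R) y t : slab mu T w -> t <= 0 -> prim (w ^~ y) t = 0.
Proof.
move=> hw t0; apply: prim_eq0 => s st; apply: (slab_supp hw).
by rewrite negb_and -leNgt (le_trans st t0).
Qed.

(** Cauchy-Schwarz against the indicator of the interval. *)
Lemma prim_increment_sqr (w : X -> Y -> R) a b y : slab mu T w -> a <= b ->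
  (prim (w ^~ y) b - prim (w ^~ y) a) ^+ 2 <= (b - a) * \int[leb]_s (w s y ^+ 2).
Proof.
move=> hw ab; rewrite prim_sub//; last exact: slab_intgY hw.
pose I (s : X) : R := (a < s <= b)%R%:R.
have IE : I = \1_[set` `]a, b]].
  by apply/funext => s; rewrite /I indicE mem_setE in_itv/=.
have mI : measurable_fun setT I by rewrite IE; exact: measurable_indic.
have I2 : (fun s => I s ^+ 2) = I.
  by apply/funext => s; rewrite /I; case: (_ && _); rewrite ?expr1n// expr0n.
have lab : leb `]a, b]%classic = (b - a)%:E.
  rewrite lebesgue_measure_itv/= lte_fin; case: ltP => // ba.
  by rewrite (@le_anti _ _ a b) ?subrr// ab ba.
have intI : (\int[leb]_s (I s)%:E = (b - a)%:E)%E.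
  rewrite IE (integral_indic leb) ?setIT//; exact: lab.
have iI : leb.-integrable setT (EFin \o I).
  by apply/intg_ge0P => //; rewrite intI ltry.
have hI : L2 leb I by split => //; rewrite I2.
have := cauchy_schwarz hI (slab_L2y hw y); rewrite I2.
have -> : \int[leb]_s I s = b - a by rewrite /Rintegral intI.
by [].
Qed.

Lemma prim_L2 (w : X -> Y -> R) a b : slab mu T w -> a <= b ->
  L2 mu (fun y => prim (w ^~ y) b - prim (w ^~ y) a) /\
  \int[mu]_y ((prim (w ^~ y) b - prim (w ^~ y) a) ^+ 2) <=
    (b - a) * \int[Q]_z (w z.1 z.2 ^+ 2).
Proof.
move=> hw ab; have mp := measurable_prim hw.
have m1 t : measurable_fun setT (fun y => prim (w ^~ y) t) := measurable_fun_pair2 t mp.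
have [_ w2] := slab_L2 hw.
have i2 := @intg_Rintegral2 _ _ X Y R leb mu (fun s y => w s y ^+ 2) w2.
have md : measurable_fun setT (fun y => prim (w ^~ y) b - prim (w ^~ y) a) by exact: measurable_funB.
have h : L2 mu (fun y => prim (w ^~ y) b - prim (w ^~ y) a).
  split=> //; apply: (le_intg (fun y => (b - a) * \int[leb]_s (w s y ^+ 2))).
  - exact: measurable_funX.
  - by move=> y; rewrite ger0_norm ?sqr_ge0//; exact: prim_increment_sqr.
  - exact: intgZ.
split=> //; rewrite (@Rintegral_prod2 _ _ X Y R leb mu (fun s y => w s y ^+ 2) w2).
rewrite -RintegralZl//; apply: le_Rintegral => //; first by case: h.
  exact: intgZ.
by move=> y _; exact: prim_increment_sqr.
Qed.

Lemma prim_L2_0 (w : X -> Y -> R) t : slab mu T w -> L2 mu (fun y => prim (w ^~ y) t).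
Proof.
move=> hw; have [t0|/ltW t0] := leP t 0.
  have -> : (fun y => prim (w ^~ y) t) = cst 0 by apply/funext => y; rewrite (prim0 _ hw).
  exact: L2_0.
have [h _] := prim_L2 hw t0.
by move: h; congr (L2 mu _); apply/funext => y; rewrite [X in _ - X](prim0 _ hw)// subr0.
Qed.

(** Testing with [eta (t) e (x)] leaves a scalar weak equation in time for the
    coefficient against the profile [e]. *)
Lemma weak_coefficient (f h : X -> Y -> R) (e : Y -> R) (M c : R) :
  slab mu T f -> measurable_fun setT e -> (forall y, `|e y| <= M) ->
  Q.-integrable setT (EFin \o (fun z : X * Y => h z.1 z.2)) ->
  (forall t y, ~~ (0 < t < T) -> h t y = 0) ->
  (forall eta : R -> R, (forall k, Ck k eta) ->
    (exists2 T' : R, T' < T & forall t, T' <= t -> eta t = 0) ->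
    \int[Q]_z (f z.1 z.2 * ('D_1 eta z.1 * e z.2) + h z.1 z.2 * eta z.1) + c * eta 0 = 0) ->
  0 < T ->
  {ae leb, forall t : X, 0 < t < T ->
    \int[mu]_y (f t y * e y) = c + prim (fun s => \int[mu]_y h s y) t}.
Proof.
move=> hf me eM ih hT weak T0.
have M0 : 0 <= M by apply: le_trans (eM point).
have mfe : measurable_fun setT (fun z : X * Y => f z.1 z.2 * e z.2).
  by apply: measurable_funM; [exact: slab_measurable hf|exact: (measurableT_comp me measurable_snd)].
have ife : Q.-integrable setT (EFin \o (fun z : X * Y => f z.1 z.2 * e z.2)).
  apply: (le_intg (fun z => M * `|f z.1 z.2|)) => //.
    by move=> z; rewrite normrM mulrC ler_wpM2r.
  by apply: intgZ; apply: intg_norm; exact: slab_intg hf.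
have bnd (u : X -> Y -> R) (phi : R -> R) : Q.-integrable setT (EFin \o (fun z : X * Y => u z.1 z.2)) ->
    (forall t y, ~~ (0 < t < T) -> u t y = 0) -> continuous phi ->
    Q.-integrable setT (EFin \o (fun z : X * Y => u z.1 z.2 * phi z.1)).
  move=> iu uT cphi.
  have [s _ hs] : exists2 s, s \in `[0, T]%R & forall t, t \in `[0, T]%R -> `|phi t| <= `|phi s|.
    apply: (@EVT_max R (fun t => `|phi t|) 0 T (ltW T0)).
    by apply: continuous_subspaceT => r; apply: cvg_norm; exact: cphi.
  apply: (le_intg (fun z => `|phi s| * `|u z.1 z.2|)).
  - apply: measurable_funM; first exact: intg_measurable iu.
    exact: (measurableT_comp (continuous_measurable1 cphi) measurable_fst).
  - move=> z; rewrite normrM mulrC.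
    have [/andP[z0 zT]|/uT ->] := boolP (0 < z.1 < T); last by rewrite normr0 !mulr0.
    by rewrite ler_wpM2r// hs// in_itv/= !ltW.
  - by apply: intgZ; exact: intg_norm.
have ift := @intg_Rintegral1 _ _ X Y R leb mu (fun t y => f t y * e y) ife.
have iht := @intg_Rintegral1 _ _ X Y R leb mu h ih.
apply: (time_primitive (f := fun t => \int[mu]_y (f t y * e y)) ift iht).
- move=> s sT; under eq_Rintegral do rewrite (slab_supp hf)// mul0r.
  by rewrite /Rintegral integral0.
- by move=> s sT; under eq_Rintegral do rewrite hT//; rewrite /Rintegral integral0.
move=> eta ceta eta0; rewrite -[RHS](weak eta ceta eta0); congr (_ + _).
have [_ /(_ 1)[_ cD]] := ceta 1%N.
have feT t y : ~~ (0 < t < T) -> f t y * e y = 0 by move=> tT; rewrite (slab_supp hf)// mul0r.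
have i1 := bnd (fun t y => f t y * e y) _ ife feT cD.
have i2 := bnd h eta ih hT (ceta 0%N).
rewrite (_ : (fun z : X * Y => _) = (fun z : X * Y =>
  f z.1 z.2 * e z.2 * 'D_1 eta z.1 + h z.1 z.2 * eta z.1)); last first.
  by apply/funext => z; ring.
rewrite [RHS](@Rintegral_prod1 _ _ X Y R leb mu (fun t y => f t y * e y * 'D_1 eta t + h t y * eta t));
  last exact: (intgD i1 i2).
have a1 := @ae_intg1 _ _ X Y R leb mu (fun t y => f t y * e y) ife.
have a2 := @ae_intg1 _ _ X Y R leb mu h ih.
have {}a1 : {ae leb, forall t : X, mu.-integrable setT (EFin \o (fun y => f t y * e y))} := a1.
have {}a2 : {ae leb, forall t : X, mu.-integrable setT (EFin \o (h t))} := a2.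
have i12 := @intg_Rintegral1 _ _ X Y R leb mu (fun t y => f t y * e y * 'D_1 eta t + h t y * eta t) (intgD i1 i2).
apply: ae_eq_Rintegral.
- apply: measurable_funD; apply: measurable_funM.
  + exact: intg_measurable ift.
  + exact: continuous_measurable1 cD.
  + exact: intg_measurable iht.
  + exact: continuous_measurable1 (ceta 0%N).
- exact: intg_measurable i12.
- move: a1 a2; apply: filterS2 => t b1 b2.
  rewrite RintegralD//; last 2 first.
  + by under eq_fun do rewrite mulrC; exact: intgZ.
  + by under eq_fun do rewrite mulrC; exact: intgZ.
  by rewrite !RintegralZr.
Qed.

End slab_primitive.

(** * Smooth modes and the equation for the strain *)

Section torus_expansions.
Variables (R : realType) (d : nat).
Local Notation mu := (torus_measure R d).

(** A choice of expansion of each kernel, so that frequencies, weights and modes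
    can be referred to as functions of [n]. *)
Definition torus_expansion n : {I : finType & {lam : I -> R &
  {e : I -> 'rV[R]_d -> R | expansion (@torus_kernel R d n) lam e}}}.
Proof.
have [I h] := cid (finite_rank_torus_kernel R d n).
have [lam h2] := cid h; have [e h3] := cid h2.
by exists I, lam, e.
Qed.

Definition freq n : finType := projT1 (torus_expansion n).
Definition weight n : freq n -> R := projT1 (projT2 (torus_expansion n)).
Definition mode n : freq n -> 'rV[R]_d -> R := projT1 (projT2 (projT2 (torus_expansion n))).

Lemma modeP n : expansion (@torus_kernel R d n) (@weight n) (@mode n).
Proof. exact: (projT2 (projT2 (projT2 (torus_expansion n)))). Qed.

Lemma mode_smooth n k : bounded_smooth (@mode n k).
Proof. exact: (exp_smooth (modeP n) k). Qed.

(** If all coefficients vanish then so do all means [P_n u], which approximate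
    [u]. *)
Lemma modes_total (u : 'rV[R]_d -> R) : L2 mu u ->
  (forall n k, \int[mu]_x (u x * @mode n k x) = 0) -> {ae mu, forall x, u x = 0}.
Proof.
move=> hu h; have iu := L2_intg hu; have [mu1 iu2] := hu.
have P0 n x : kernel_mean mu (@torus_kernel R d n) u x = 0.
  rewrite (kernel_mean_expansion (modeP n) iu); apply: big1 => k _.
  by rewrite h mulr0 mul0r.
have small e : 0 < e -> \int[mu]_x (u x ^+ 2) <= e.
  move=> e0; have [n _ /(_ n (leqnn n)) En] := torus_energy_vanishes hu e0.
  rewrite -lee_fin; apply: le_trans En.
  apply: le_trans (kernel_mean_sub_energy (markov_torus_kernel R d n) hu).
  rewrite lee_fin le_eqVlt; apply/orP; left; apply/eqP/eq_Rintegral => x _.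
  by rewrite P0 sub0r sqrrN.
have u0 : \int[mu]_x (u x ^+ 2) = 0.
  apply/eqP; rewrite eq_le; apply/andP; split; last by apply: Rintegral_ge0 => x _; exact: sqr_ge0.
  by apply/ler_addgt0Pr => e e0; rewrite add0r; exact: small.
have := Rintegral_eq0_ae (measurable_funX 2 mu1) (fun x => sqr_ge0 (u x)) iu2 u0.
by apply: filterS => x /eqP; rewrite sqrf_eq0 => /eqP.
Qed.

End torus_expansions.

Section strain_equation.
Variables (R : realType) (d : nat) (T : R).
Local Notation mu := (torus_measure R d).
Local Notation leb := (@lebesgue_measure R).
Local Notation X := (measurableTypeR R).
Local Notation Q := (leb \x mu)%E.
Hypothesis T0 : 0 < T.

Definition time_test (eta : R -> R) : Prop :=
  (forall k, Ck k eta) /\ (exists2 T' : R, T' < T & forall t, T' <= t -> eta t = 0).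

(** Both sides have the same coefficients against every mode. *)
Lemma weak_time_derivative (f w : X -> 'rV[R]_d -> R) (f0 : 'rV[R]_d -> R) :
  slab mu T f -> slab mu T w -> L2 mu f0 ->
  (forall eta e, time_test eta -> bounded_smooth e ->
    \int[Q]_z (f z.1 z.2 * ('D_1 eta z.1 * e z.2) + w z.1 z.2 * e z.2 * eta z.1)
    + (\int[mu]_x (f0 x * e x)) * eta 0 = 0) ->
  {ae leb, forall t : X, 0 < t < T ->
    {ae mu, forall x, f t x = f0 x + prim (w ^~ x) t}}.
Proof.
move=> hf hw hf0 weak.
have coef e : bounded_smooth e -> {ae leb, forall t : X, 0 < t < T ->
    \int[mu]_x ((f t x - (f0 x + prim (w ^~ x) t)) * e x) = 0}.
  move=> he; have [_ [M eM] _] := he; have me := bounded_smooth_measurable he.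
  have iwe : Q.-integrable setT (EFin \o (fun z : X * 'rV[R]_d => w z.1 z.2 * e z.2)).
    apply: (le_intg (fun z => M * `|w z.1 z.2|)).
    - by apply: measurable_funM; [exact: slab_measurable hw|exact: (measurableT_comp me measurable_snd)].
    - by move=> z; rewrite normrM mulrC ler_wpM2r.
    - by apply: intgZ; apply: intg_norm; exact: slab_intg hw.
  have h := @weak_coefficient R _ _ mu T f (fun t x => w t x * e x) e M
    (\int[mu]_x (f0 x * e x)) hf me eM iwe.
  have {}h := h (fun t y tT => etrans (congr1 (fun r => r * e y) (slab_supp hw y tT)) (mul0r (e y))).
  have {}h := h (fun eta c0 c1 => weak eta e (conj c0 c1) he) T0.
  apply: filterS h => t h tT.
  have hp := prim_L2_0 t hw.
  have i1 : mu.-integrable setT (EFin \o (fun x => f t x * e x)).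
    by apply: bounded_smooth_mul_intg => //; exact: slab_intgt hf.
  have i2 : mu.-integrable setT (EFin \o (fun x => f0 x * e x)).
    by apply: bounded_smooth_mul_intg => //; exact: L2_intg.
  have i3 : mu.-integrable setT (EFin \o (fun x => prim (w ^~ x) t * e x)).
    by apply: bounded_smooth_mul_intg => //; exact: L2_intg.
  transitivity (\int[mu]_x (f t x * e x - (f0 x * e x + prim (w ^~ x) t * e x))).
    by apply: eq_Rintegral => x _; ring.
  rewrite RintegralB//; last exact: intgD.
  rewrite RintegralD// h//.
  have -> : \int[mu]_x (prim (w ^~ x) t * e x) = prim (fun s => \int[mu]_x (w s x * e x)) t.
    rewrite -(prim_swap iwe t); apply: eq_Rintegral => x _.
    rewrite mulrC -primZ; last exact: slab_intgY hw.
    by congr (prim _ t); apply/funext => s; rewrite mulrC.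
  by rewrite subrr.
have : {ae leb, forall t : X, forall n k, 0 < t < T ->
    \int[mu]_x ((f t x - (f0 x + prim (w ^~ x) t)) * @mode R d n k x) = 0}.
  apply/ae_foralln => n; apply: filter_forall => k.
  exact: coef (mode_smooth _).
apply: filterS => t h tT.
have hd : L2 mu (fun x => f t x - (f0 x + prim (w ^~ x) t)).
  by apply: L2B; [exact: slab_L2t hf t|apply: L2D => //; exact: (prim_L2_0 t hw)].
have := modes_total hd (fun n k => h n k tT).
by apply: filterS => x /eqP; rewrite subr_eq0 => /eqP.
Qed.

End strain_equation.

(** * The kinetic energy identity *)

Section good_times.
Variable R : realType.
Local Notation leb := (@lebesgue_measure R).
Local Notation X := (measurableTypeR R).

(** A null set contains no interval. *)
Lemma ae_dense (P : X -> Prop) (T t dl : R) : {ae leb, forall s, P s} -> 0 < T ->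
  0 <= t <= T -> 0 < dl -> exists s : R, [/\ 0 < s < T, `|s - t| < dl & P s].
Proof.
move=> [N [mN N0 sN]] T0 /andP[t0 tT] dl0; apply: contrapT => nex.
pose a := Num.max 0 (t - dl); pose b := Num.min T (t + dl).
have ab : a < b by rewrite /a /b lt_min !gt_max T0/=; apply/and3P; split; lra.
have sub : (`]a, b[%classic : set X) `<=` N.
  move=> s; rewrite /= in_itv/= /a /b lt_min gt_max => /andP[/andP[s0 s1] /andP[s2 s3]].
  apply: sN => /= Ps; apply: nex; exists s; split => //; first by rewrite s0.
  by rewrite ltr_norml; apply/andP; split; lra.
have mab : measurable (`]a, b[%classic : set X) by exact: measurable_itv.
have : (leb (`]a, b[%classic : set X) <= leb N)%E by apply: le_measure => //; rewrite inE.
rewrite N0 lebesgue_measure_itv/= lte_fin ab lee_fin; lra.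
Qed.

End good_times.

Section momentum_equation.
Variables (R : realType) (d : nat) (T : R).
Local Notation mu := (torus_measure R d).
Local Notation leb := (@lebesgue_measure R).
Local Notation X := (measurableTypeR R).
Local Notation Q := (leb \x mu)%E.
Hypothesis T0 : 0 < T.
Variables (u : X -> 'rV[R]_d -> R) (w G : 'I_d -> X -> 'rV[R]_d -> R) (u0 : 'rV[R]_d -> R).
Hypotheses (hu : slab mu T u) (hw : forall j, slab mu T (w j)) (hG : forall j, slab mu T (G j))
  (hu0 : L2 mu u0).
Hypothesis wd : {ae leb, forall t : X, 0 < t < T -> forall j, weak_derivative (u t) (w j t) j}.
Hypothesis weak : forall eta e, time_test T eta -> bounded_smooth e ->
  \int[Q]_z (u z.1 z.2 * ('D_1 eta z.1 * e z.2) +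
     (- \sum_j G j z.1 z.2 * 'D_(delta_mx 0 j) e z.2) * eta z.1)
  + (\int[mu]_x (u0 x * e x)) * eta 0 = 0.

Local Notation e n k := (@mode R d n k).
Let force e s x := - \sum_j G j s x * 'D_(delta_mx 0 j) e x.
Let g n (k : freq R d n) (s : X) := \int[mu]_x force (e n k) s x.
Let al n (k : freq R d n) t := \int[mu]_x (u0 x * e n k x) + prim (g k) t.

Let force_intg e : bounded_smooth e -> Q.-integrable setT (EFin \o (fun z : X * 'rV[R]_d => force e z.1 z.2)).
Proof.
move=> he; apply: intgN; apply: intg_sum => j.
have [_ _ /(_ (delta_mx 0 j))[M eM]] := he.
have me := bounded_smooth_derive_measurable (delta_mx 0 j) he.
apply: (le_intg (fun z => M * `|G j z.1 z.2|)).
- by apply: measurable_funM; [exact: slab_measurable (hG j)|exact: (measurableT_comp me measurable_snd)].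
- by move=> z; rewrite normrM mulrC ler_wpM2r.
- by apply: intgZ; apply: intg_norm; exact: slab_intg (hG j).
Qed.

Let force_supp e t x : ~~ (0 < t < T) -> force e t x = 0.
Proof.
by move=> tT; rewrite /force big1 ?oppr0// => j _; rewrite (slab_supp (hG j))// mul0r.
Qed.

Let g_intg n (k : freq R d n) : leb.-integrable setT (EFin \o g k).
Proof.
exact: (@intg_Rintegral1 _ _ X _ R leb mu (force (e n k)) (force_intg (mode_smooth k))).
Qed.

Let g_supp n (k : freq R d n) s : ~~ (0 < s < T) -> g k s = 0.
Proof.
move=> sT; rewrite /g; under eq_Rintegral do rewrite force_supp//.
by rewrite /Rintegral integral0.
Qed.

Let g_supp' n (k : freq R d n) s : ~~ (0 <= s <= T) -> g k s = 0.
Proof.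
by move=> sT; apply: g_supp; apply: contra sT => /andP[s0 sT]; rewrite !ltW.
Qed.

Let prim_g0 n (k : freq R d n) t : t <= 0 -> prim (g k) t = 0.
Proof.
by move=> t0; apply: prim_eq0 => s st; apply: g_supp; rewrite negb_and -leNgt (le_trans st).
Qed.

Lemma coefficient_ae : {ae leb, forall t : X, forall n (k : freq R d n), 0 < t < T ->
  \int[mu]_x (u t x * e n k x) = al k t}.
Proof.
apply/ae_foralln => n; apply: filter_forall => k.
have he : bounded_smooth (e n k) by exact: mode_smooth.
have [_ [M eM] _] := he; have me := bounded_smooth_measurable he.
apply: (@weak_coefficient R _ _ mu T u (force (e n k)) (e n k) M _ hu me eM (force_intg he)) => //.
- by move=> t y tT; exact: force_supp.
- by move=> eta c0 c1; exact: weak.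
Qed.

Let r n s := \sum_(k : freq R d n) @weight R d n k * (g k s * al k s).
Let q s := \sum_j \int[mu]_x (G j s x * w j s x).
Let Qn n t := \sum_(k : freq R d n) @weight R d n k * al k t ^+ 2.
Let N t := \int[mu]_x (u0 x ^+ 2) - 2 * prim q t.

Let sq n (k : freq R d n) := primitive_sqr (\int[mu]_x (u0 x * e n k x)) (g_intg k) (ltW T0) (@g_supp' n k).

Let r_intg n : leb.-integrable setT (EFin \o (r n : X -> R)).
Proof. by apply: intg_sum => k; apply: intgZ; have [] := sq k. Qed.

Let q_intg : leb.-integrable setT (EFin \o (q : X -> R)).
Proof.
apply: intg_sum => j.
exact: (@intg_Rintegral1 _ _ X _ R leb mu (fun s x => G j s x * w j s x) (slab_mul_intg (hG j) (hw j))).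
Qed.

Let Qn_prim n t : 0 <= t -> Qn n t = Qn n 0 + 2 * prim (r n) t.
Proof.
move=> t0; apply/eqP; rewrite addrC -subr_eq; apply/eqP.
rewrite /Qn -sumrB /r prim_sum; last by move=> k; apply: intgZ; have [] := sq k.
rewrite mulr_sumr; apply: eq_bigr => k _; have [ik /(_ t t0) h] := sq k.
rewrite -mulrBr h [X in _ - X](prim_eq0 (t := 0)) ?subr0 ?primZ//; first by rewrite mulrCA.
by move=> s s0; rewrite g_supp ?mul0r// negb_and -leNgt s0.
Qed.

Let Pn n v := kernel_mean mu (@torus_kernel R d n) v.
Let mK n := markov_torus_kernel R d n.

Let r_ae n : {ae leb, forall s : X, r n s = - \sum_j \int[mu]_x (G j s x * Pn n (w j s) x)}.
Proof.
move: coefficient_ae wd; apply: filterS2 => s cs ws.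
have [sT|sT] := boolP (0 < s < T); last first.
  rewrite /r big1 => [|k _]; last by rewrite g_supp ?mul0r ?mulr0.
  rewrite big1 ?oppr0// => j _; under eq_Rintegral do rewrite (slab_supp (hG j))// mul0r.
  by rewrite /Rintegral integral0.
have iGD k j : mu.-integrable setT (EFin \o (fun x => G j s x * 'D_(delta_mx 0 j) (e n k) x)).
  apply: bounded_smooth_derive_mul_intg; [exact: slab_intgt (hG j)|exact: mode_smooth].
(* at a good time the coefficients [al k] are those of [u s] *)
transitivity (- \sum_(k : freq R d n) \sum_j @weight R d n k * (\int[mu]_x (u s x * e n k x)) *
    (\int[mu]_x (G j s x * 'D_(delta_mx 0 j) (e n k) x))).
  rewrite -sumrN; apply: eq_bigr => k _; rewrite -(cs n k sT) /g /force.
  rewrite RintegralN; last exact: intg_sum.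
  by rewrite Rintegral_sum// -mulr_sumr; ring.
rewrite exchange_big/=; congr (- _); apply: eq_bigr => j _.
exact: (expansion_divergence (modeP R d n) (ws sT j) (slab_intgt s (hG j))).
Qed.

Let rho n := \int[leb]_s `|r n s + q s|.

Let pair_mean n s j : `|\int[mu]_x (G j s x * Pn n (w j s) x)| <=
  \int[mu]_x (G j s x ^+ 2) + \int[mu]_x (w j s x ^+ 2).
Proof.
have hg := slab_L2t (hG j) s; have hws := slab_L2t (hw j) s.
have hP : L2 mu (Pn n (w j s)) := kernel_mean_L2 (mK n) hws.
have [mg ig2] := hg; have [mP iP2] := hP.
have iD := intgD ig2 iP2.
apply: (@le_trans _ _ (\int[mu]_x (G j s x ^+ 2 + Pn n (w j s) x ^+ 2))).
  apply: (le_trans (Rintegral_le_abs (L2_mul hg hP))).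
  apply: le_Rintegral => //; first by apply: intg_norm; exact: L2_mul.
  move=> x _; rewrite normrM -[G j s x ^+ 2]real_normK ?num_real// -[Pn n _ x ^+ 2]real_normK ?num_real//.
  by have := sqr_ge0 (`|G j s x| - `|Pn n (w j s) x|); have := normr_ge0 (G j s x); have := normr_ge0 (Pn n (w j s) x); nra.
by rewrite RintegralD// lerD2l; exact: (kernel_mean_contraction (mK n) hws).
Qed.

Let pair_q s j : `|\int[mu]_x (G j s x * w j s x)| <=
  \int[mu]_x (G j s x ^+ 2) + \int[mu]_x (w j s x ^+ 2).
Proof.
have hg := slab_L2t (hG j) s; have hws := slab_L2t (hw j) s.
have [mg ig2] := hg; have [mP iP2] := hws.
rewrite -RintegralD//; apply: (le_trans (Rintegral_le_abs (L2_mul hg hws))).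
apply: le_Rintegral => //; [by apply: intg_norm; exact: L2_mul|exact: intgD|].
move=> x _; rewrite normrM -[G j s x ^+ 2]real_normK ?num_real// -[w j s x ^+ 2]real_normK ?num_real//.
by have := sqr_ge0 (`|G j s x| - `|w j s x|); have := normr_ge0 (G j s x); have := normr_ge0 (w j s x); nra.
Qed.

Let mean_cvg (v h : 'rV[R]_d -> R) : L2 mu h -> L2 mu v ->
  \int[mu]_x (h x * Pn n v x) @[n --> \oo] --> \int[mu]_x (h x * v x).
Proof.
move=> hh hv; apply/cvgrPdist_le => eps eps0.
have hI : 0 <= \int[mu]_x (h x ^+ 2) by apply: Rintegral_ge0 => x _; exact: sqr_ge0.
have e1 : 0 < eps ^+ 2 / (\int[mu]_x (h x ^+ 2) + 1) by rewrite divr_gt0 ?exprn_gt0// ltr_wpDl.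
apply: filterS (torus_energy_vanishes hv e1) => n En.
have hP : L2 mu (Pn n v) := kernel_mean_L2 (mK n) hv.
rewrite -RintegralB//; [|exact: L2_mul..].
have -> : \int[mu]_x (h x * v x - h x * Pn n v x) = \int[mu]_x (h x * (v x - Pn n v x)).
  by apply: eq_Rintegral => x _; rewrite mulrBr.
rewrite -(@ler_pXn2r _ 2)// ?nnegrE ?normr_ge0 ?(ltW eps0)// real_normK ?num_real//.
apply: (le_trans (cauchy_schwarz hh (L2B hv hP))).
have dn : \int[mu]_x ((v x - Pn n v x) ^+ 2) <= eps ^+ 2 / (\int[mu]_x (h x ^+ 2) + 1).
  rewrite -lee_fin; apply: le_trans En; apply: le_trans (kernel_mean_sub_energy (mK n) hv).
  rewrite lee_fin le_eqVlt; apply/orP; left; apply/eqP/eq_Rintegral => x _.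
  by rewrite -sqrrN opprB.
apply: (le_trans (ler_wpM2l hI dn)); rewrite mulrCA ler_piMr ?sqr_ge0//.
by rewrite ler_pdivrMr ?ltr_wpDl// mul1r; lra.
Qed.

(** The rates converge pointwise in time because [P_n w] tends to [w] in L^2,
    and they are dominated by the squared norms of [G] and [w]. *)
Lemma rho_vanishes : rho n @[n --> \oo] --> 0.
Proof.
have -> : (0 : R) = \int[leb]_s (0 : R) by rewrite /Rintegral integral0.
pose D s := \sum_j 2 * (\int[mu]_x (G j s x ^+ 2) + \int[mu]_x (w j s x ^+ 2)).
have iD : leb.-integrable setT (EFin \o (D : X -> R)).
  apply: intg_sum => j; apply: intgZ; apply: intgD.
    have [_ h2] := slab_L2 (hG j).
    exact: (@intg_Rintegral1 _ _ X _ R leb mu (fun s x => G j s x ^+ 2) h2).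
  have [_ h2] := slab_L2 (hw j).
  exact: (@intg_Rintegral1 _ _ X _ R leb mu (fun s x => w j s x ^+ 2) h2).
apply: (Rdominated_cvg (g := D)) => //.
- by move=> n; apply: measurableT_comp => //; apply: measurable_funD;
    [exact: intg_measurable (r_intg n)|exact: intg_measurable q_intg].
- have : {ae leb, forall s : X, forall n, r n s = - \sum_j \int[mu]_x (G j s x * Pn n (w j s) x)}.
    by apply/ae_foralln => n; exact: r_ae.
  apply: filterS => s rs.
  rewrite -[X in _ --> X](@normr0 _ R); apply: cvg_norm; rewrite -[X in _ --> X](addNr (q s)).
  under eq_fun do rewrite rs.
  apply: cvgD; last exact: cvg_cst.
  apply: cvgN; rewrite /q.
  elim: (index_enum _) => [|j js IH].
    by under eq_fun do rewrite big_nil; rewrite big_nil; exact: cvg_cst.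
  under eq_fun do rewrite big_cons; rewrite big_cons; apply: cvgD => //.
  by apply: mean_cvg; [exact: slab_L2t (hG j) s|exact: slab_L2t (hw j) s].
- move=> n; apply: filterS (r_ae n) => s ->.
  rewrite normr_id addrC /q -sumrB; apply: (le_trans (ler_norm_sum _ _ _)).
  apply: ler_sum => j _; apply: (le_trans (ler_normB _ _)).
  by have := pair_mean n s j; have := pair_q s j; lra.
Qed.

Let err n := `|Qn n 0 - \int[mu]_x (u0 x ^+ 2)| + 2 * rho n.

Let err_ge0 n : 0 <= err n.
Proof. by rewrite addr_ge0// mulr_ge0//; apply: Rintegral_ge0. Qed.

Let Qn0 n : Qn n 0 = \int[mu]_x (u0 x * Pn n u0 x).
Proof.
rewrite -(expansion_quadratic (modeP R d n) hu0); apply: eq_bigr => k _.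
by rewrite /al prim_g0 ?addr0.
Qed.

Lemma err_vanishes : err n @[n --> \oo] --> 0.
Proof.
rewrite -(addr0 (0 : R)); apply: cvgD; last first.
  by rewrite -(mulr0 2); apply: cvgM; [exact: cvg_cst|exact: rho_vanishes].
rewrite -[X in _ --> X](@normr0 _ R); apply: cvg_norm.
rewrite -[X in _ --> X](_ : \int[mu]_x (u0 x * u0 x) - \int[mu]_x (u0 x ^+ 2) = 0); last first.
  by apply/eqP; rewrite subr_eq0; apply/eqP/eq_Rintegral => x _; rewrite expr2.
apply: cvgB; last exact: cvg_cst.
under eq_fun do rewrite Qn0; exact: mean_cvg.
Qed.

(** The approximate kinetic energy [Qn] and the expected one [N] have densities
    that differ by [rho n] in L^1, which bounds the error at every time. *)
Lemma energy_error n t : 0 <= t -> `|Qn n t - N t| <= err n.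
Proof.
move=> t0; rewrite Qn_prim// /N.
have -> : Qn n 0 + 2 * prim (r n) t - (\int[mu]_x (u0 x ^+ 2) - 2 * prim q t) =
    (Qn n 0 - \int[mu]_x (u0 x ^+ 2)) + 2 * prim (fun s => r n s + q s) t.
  by rewrite primD//; ring.
apply: (le_trans (ler_normD _ _)); rewrite lerD2l normrM ger0_norm// ler_wpM2l//.
have irq := intgD (r_intg n) q_intg.
apply: (le_trans (Rintegral_le_abs (indicator_intg t irq))).
apply: le_Rintegral => //; [by apply: intg_norm; exact: indicator_intg|exact: intg_norm|].
by move=> s _; rewrite normrM; case: (s <= t); rewrite ?normr1 ?normr0 ?mul1r ?mul0r.
Qed.

Let un n t x := \sum_(k : freq R d n) @weight R d n k * al k t * e n k x.

(** At a time where all coefficients are given by their primitives, [Qn n t] is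
    [<u, P_n u>]; its limit is both [|u|^2] and [N t]. The distance from the
    approximation [un n t = P_n u] to [u] is then at most [2 (|u|^2 - Qn n t)]. *)
Lemma good_time : {ae leb, forall t : X, 0 < t < T ->
  \int[mu]_x (u t x ^+ 2) = N t /\
  forall n, \int[mu]_x ((un n t x - u t x) ^+ 2) <= 2 * err n}.
Proof.
apply: filterS coefficient_ae => t ct tT.
have t0 : 0 <= t by have /andP[/ltW] := tT.
have hut := slab_L2t hu t; have iut := slab_intgt t hu.
have Qt n : Qn n t = \int[mu]_x (u t x * Pn n (u t) x).
  rewrite -(expansion_quadratic (modeP R d n) hut); apply: eq_bigr => k _.
  by rewrite (ct n k tT).
have Nt : \int[mu]_x (u t x ^+ 2) = N t.
  have c1 : Qn n t @[n --> \oo] --> \int[mu]_x (u t x * u t x).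
    by under eq_fun do rewrite Qt; exact: mean_cvg.
  have c2 : Qn n t @[n --> \oo] --> N t.
    apply/cvgrPdist_le => eps eps0.
    have /cvgrPdist_le/(_ _ eps0) := err_vanishes; apply: filterS => n.
    rewrite sub0r normrN ger0_norm// => h; rewrite distrC.
    exact: le_trans (energy_error n t0) h.
  rewrite -(cvg_unique (@Rhausdorff R) c1 c2).
  by apply: eq_Rintegral => x _; rewrite expr2.
split=> // n.
have -> : \int[mu]_x ((un n t x - u t x) ^+ 2) = \int[mu]_x ((Pn n (u t) x - u t x) ^+ 2).
  apply: eq_Rintegral => x _; congr ((_ - _) ^+ 2).
  rewrite /Pn (kernel_mean_expansion (modeP R d n) iut); apply: eq_bigr => k _.
  by rewrite (ct n k tT).
rewrite -lee_fin; apply: (le_trans (kernel_mean_sub_energy (mK n) hut)).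
rewrite (kernel_energyE (mK n) hut) lee_fin ler_wpM2l// Nt -Qt.
by apply: le_trans (energy_error n t0); rewrite distrC ler_norm.
Qed.

(** The coefficients are continuous in time and the modes are bounded. *)
Lemma un_uniform n t eps : 0 < eps -> exists2 dl : R, 0 < dl &
  forall s, `|t - s| < dl -> forall x, `|un n t x - un n s x| <= eps.
Proof.
move=> eps0.
have bnd (k : freq R d n) : exists M, forall x, `|e n k x| <= M by case: (mode_smooth k).
pose M k := projT1 (cid (bnd k)).
have eM k x : `|e n k x| <= M k by exact: (projT2 (cid (bnd k))).
pose D s := \sum_(k : freq R d n) `|weight k| * `|al k t - al k s| * M k.
have cD : D s @[s --> t] --> 0.
  have -> : (0 : R) = D t by rewrite /D big1// => k _; rewrite subrr normr0 mulr0 mul0r.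
  rewrite /D; elim: (index_enum _) => [|k ks IH].
    by under eq_fun do rewrite big_nil; rewrite big_nil; exact: cvg_cst.
  under eq_fun do rewrite big_cons; rewrite big_cons; apply: cvgD => //.
  apply: cvgM; last exact: cvg_cst.
  apply: cvgM; first exact: cvg_cst.
  apply: cvg_norm; apply: cvgB; first exact: cvg_cst.
  apply: cvgD; first exact: cvg_cst.
  exact: (prim_continuous (g_intg k)).
have /cvgrPdist_le/(_ _ eps0)/nbhs_ballP[dl dl0 h] := cD.
exists dl => // s ts x; have /= := h s; rewrite -ball_normE /= => /(_ ts).
rewrite sub0r normrN => Ds; apply: le_trans (le_trans (ler_norm _) Ds).
rewrite /un -sumrB; apply: (le_trans (ler_norm_sum _ _ _)); apply: ler_sum => k _.
by rewrite -mulrBl -mulrBr !normrM ler_wpM2l// mulr_ge0.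
Qed.

Lemma un_smooth n t : bounded_smooth (un n t).
Proof. by apply: bounded_smooth_sum => k; apply: bounded_smoothZ; exact: mode_smooth. Qed.

End momentum_equation.

(** * Representatives continuous in time *)

Section fast_cauchy.
Context d (Y : measurableType d) (R : realType) (mu : probability Y R).

Lemma L1_le_L2 (f : Y -> R) (c : R) : 0 <= c -> L2 mu f ->
  \int[mu]_x (f x ^+ 2) <= c ^+ 2 -> \int[mu]_x `|f x| <= c.
Proof.
move=> c0 hf fc; have [mf f2] := hf.
have hn : L2 mu (fun x => `|f x|).
  by apply: (le_L2 _ _ hf) => [|x]; [exact: measurableT_comp|rewrite normr_id].
have h1 : L2 mu (cst 1 : Y -> R) by apply: (@bounded_L2 _ _ _ mu _ 1) => // x; rewrite normr1.
have := cauchy_schwarz_sqrt hn h1.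
have -> : \int[mu]_x (`|f x| * cst 1 x) = \int[mu]_x `|f x|.
  by apply: eq_Rintegral => x _; rewrite /= mulr1.
have -> : \int[mu]_x (cst 1 x ^+ 2) = 1 :> R.
  rewrite -[RHS](Rintegral_prob_cst mu 1); apply: eq_Rintegral => x _.
  by rewrite /= expr1n.
rewrite sqrtr1 mulr1 => h; apply: (le_trans h).
rewrite -[leRHS]ger0_norm// -sqrtr_sqr ler_wsqrtr//; apply: le_trans fc.
by rewrite le_eqVlt; apply/orP; left; apply/eqP/eq_Rintegral => x _; rewrite real_normK ?num_real.
Qed.

Lemma half_sum n : \sum_(0 <= k < n) (2^-1 : R) ^+ k <= 2.
Proof.
suff -> : \sum_(0 <= k < n) (2^-1 : R) ^+ k = 2 - 2 * 2^-1 ^+ n.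
  by rewrite lerBlDr lerDl mulr_ge0// exprn_ge0// invr_ge0.
elim: n => [|n IH]; first by rewrite big_geq// expr0; ring.
by rewrite big_nat_recr//= IH exprS; field.
Qed.

(** The sum of the absolute increments is integrable, hence finite almost
    everywhere. *)
Lemma fast_cauchy (f : nat -> Y -> R) : (forall k, L2 mu (f k)) ->
  (forall k, \int[mu]_x ((f k.+1 x - f k x) ^+ 2) <= (2^-1 ^+ k) ^+ 2) ->
  {ae mu, forall x, cvgn (f ^~ x)}.
Proof.
move=> hf fk; pose dl k x := `|f k.+1 x - f k x|.
have hd k : L2 mu (fun x => f k.+1 x - f k x) by exact: L2B.
have idl k : mu.-integrable setT (EFin \o dl k) by apply: intg_norm; exact: L2_intg.
have mdl k : measurable_fun setT (fun x => (dl k x)%:E).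
  by apply/measurable_EFinP; exact: intg_measurable (idl k).
have dl0 k x : (0 <= (dl k x)%:E)%E by rewrite lee_fin /dl.
pose S x := (\sum_(k <oo) (dl k x)%:E)%E.
have mS : measurable_fun setT S by apply: ge0_emeasurable_sum => // k x _.
have S0 x : (0 <= S x)%E by apply: nneseries_ge0 => k _ _.
have iS : (\int[mu]_x S x < +oo)%E.
  rewrite /S integral_nneseries//.
  apply: (@le_lt_trans _ _ 2%:E); last exact: ltry.
  apply: lime_le; first by apply: is_cvg_nneseries => k _ _; apply: integral_ge0.
  apply: nearW => n.
  apply: (@le_trans _ _ (\sum_(0 <= k < n) (2^-1 ^+ k)%:E)%E).
    apply: lee_sum => k _; rewrite -EFin_Rintegral// lee_fin.
    by apply: L1_le_L2 => //; exact: exprn_ge0.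
  by rewrite sumEFin lee_fin half_sum.
have Sfin : {ae mu, forall x, S x \is a fin_num}.
  have : mu.-integrable setT S.
    apply/integrableP; split=> //; apply: le_lt_trans iS.
    by rewrite le_eqVlt; apply/orP; left; apply/eqP; apply: eq_integral => x _; rewrite gee0_abs.
  move=> /(integrable_ae measurableT); apply: filterS => x; exact.
apply: filterS Sfin => x Sx.
have cv : cvgn (series (telescope (f ^~ x))).
  apply: normed_cvg; apply: nondecreasing_is_cvgn.
    apply: nondecreasing_series => k _ _; exact: normr_ge0.
  exists (fine (S x)) => _ [n _ <-].
  rewrite -lee_fin fineK// /series/= -sumEFin.
  exact: nneseries_lim_ge.
have -> : f ^~ x = (fun n => f 0%N x + series (telescope (f ^~ x)) n).
  by apply/funext => n; rewrite -(eq_sum_telescope (f ^~ x)).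
by apply: is_cvgD => //; exact: is_cvg_cst.
Qed.

End fast_cauchy.

Section representative.
Context d (Y : measurableType d) (R : realType) (mu : probability Y R).
Local Notation leb := (@lebesgue_measure R).
Local Notation X := (measurableTypeR R).
Variables (T : R) (un : nat -> R -> Y -> R) (u : X -> Y -> R) (err : nat -> R).
Hypothesis T0 : 0 < T.
Hypothesis un_L2 : forall n t, L2 mu (un n t).
Hypothesis u_L2 : forall t, L2 mu (u t).
Hypothesis un_uniform : forall n t eps, 0 < eps -> exists2 dl : R, 0 < dl &
  forall s, `|t - s| < dl -> forall x, `|un n t x - un n s x| <= eps.
Hypothesis err0 : err n @[n --> \oo] --> 0.
Hypothesis good : {ae leb, forall t : X, 0 < t < T -> forall n,
  \int[mu]_x ((un n t x - u t x) ^+ 2) <= 2 * err n}.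

Let sqr_sum2 (a b : R) : (a + b) ^+ 2 <= 2 * (a ^+ 2 + b ^+ 2).
Proof. by have := sqr_ge0 (a - b); nra. Qed.

Let int_sum2 (f g : Y -> R) : L2 mu f -> L2 mu g ->
  \int[mu]_x ((f x + g x) ^+ 2) <= 2 * (\int[mu]_x (f x ^+ 2) + \int[mu]_x (g x ^+ 2)).
Proof.
move=> hf hg; have [_ if2] := hf; have [_ ig2] := hg; have [_ ifg] := L2D hf hg.
rewrite -RintegralD// -RintegralZl//; last exact: intgD.
by apply: le_Rintegral => //; apply: intgZ; exact: intgD.
Qed.

Let int_tri (f g h : Y -> R) (a b : R) : L2 mu f -> L2 mu g -> L2 mu h ->
  \int[mu]_x ((f x - g x) ^+ 2) <= a -> \int[mu]_x ((g x - h x) ^+ 2) <= b ->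
  \int[mu]_x ((f x - h x) ^+ 2) <= 2 * (a + b).
Proof.
move=> hf hg hh ha hb.
have -> : \int[mu]_x ((f x - h x) ^+ 2) = \int[mu]_x (((f x - g x) + (g x - h x)) ^+ 2).
  by apply: eq_Rintegral => x _; congr (_ ^+ 2); ring.
apply: (le_trans (int_sum2 (L2B hf hg) (L2B hg hh))).
by rewrite ler_wpM2l// lerD.
Qed.

Let int_sym (f g : Y -> R) : \int[mu]_x ((f x - g x) ^+ 2) = \int[mu]_x ((g x - f x) ^+ 2).
Proof. by apply: eq_Rintegral => x _; rewrite -sqrrN opprB. Qed.

Let un_close n t eps : 0 < eps -> exists2 dl : R, 0 < dl &
  forall s, `|t - s| < dl -> \int[mu]_x ((un n t x - un n s x) ^+ 2) <= eps.
Proof.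
move=> eps0; have e1 : 0 < Num.min 1 eps by rewrite lt_min ltr01 eps0.
have [dl dl0 h] := un_uniform n t e1; exists dl => // s ts.
have i2 : L2 mu (fun x => un n t x - un n s x) by exact: L2B.
rewrite -[leRHS](Rintegral_prob_cst mu); apply: le_Rintegral => //; first by case: i2.
  exact: finite_measure_integrable_cst.
move=> x _; rewrite -[leLHS]real_normK ?num_real//.
have := h s ts x; rewrite le_min => /andP[x1 x2].
by apply: le_trans x2; rewrite expr2 ler_piMr.
Qed.

Let un_cauchy n m t : 0 <= t <= T ->
  \int[mu]_x ((un n t x - un m t x) ^+ 2) <= 16 * (err n + err m).
Proof.
move=> tT; apply/ler_addgt0Pr => e e0; have e8 : 0 < e / 8 by rewrite divr_gt0.
have [d1 d10 h1] := un_close n t e8; have [d2 d20 h2] := un_close m t e8.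
have d0 : 0 < Num.min d1 d2 by rewrite lt_min d10.
have [s [sT + gs]] := ae_dense good T0 tT d0.
rewrite distrC lt_min => /andP[s1 s2].
have {}gs := gs sT.
(* compare both approximations with [u] at a nearby good time [s] *)
have c1 := int_tri (un_L2 n t) (un_L2 n s) (u_L2 s) (h1 s s1) (gs n).
have := h2 s s2; rewrite int_sym => h2'.
have := gs m; rewrite int_sym => g2.
have c2 := int_tri (u_L2 s) (un_L2 m s) (un_L2 m t) g2 h2'.
have := int_tri (un_L2 n t) (u_L2 s) (un_L2 m t) c1 c2.
have x1 : 0 <= err n by have := gs n; have : 0 <= \int[mu]_x ((un n s x - u s x) ^+ 2) by [apply: Rintegral_ge0 => x _; exact: sqr_ge0]; lra.
have x2 : 0 <= err m by have := gs m; have : 0 <= \int[mu]_x ((un m s x - u s x) ^+ 2) by [apply: Rintegral_ge0 => x _; exact: sqr_ge0]; lra.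
by lra.
Qed.

(* [un_cauchy] turns 1/32 into the rate of [v_cauchy]: [16 (1/32 + 1/32) = 1] *)
Let index_exists k : exists n, err n <= (2^-1 ^+ k) ^+ 2 / 32.
Proof.
have e0 : 0 < (2^-1 ^+ k) ^+ 2 / 32 :> R by rewrite divr_gt0// !exprn_gt0// invr_gt0.
have /cvgrPdist_le/(_ _ e0)[n _ /(_ n (leqnn n))] := err0.
by rewrite /= sub0r normrN => h; exists n; apply: le_trans h; exact: ler_norm.
Qed.

Let phi k := projT1 (cid (index_exists k)).
Let phiP k : err (phi k) <= (2^-1 ^+ k) ^+ 2 / 32.
Proof. exact: (projT2 (cid (index_exists k))). Qed.

Let v k t x := un (phi k) t x.
Let uc (t : R) (x : Y) : R := fine (limn_esup (fun k => (v k t x)%:E)).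

Let half_mono k m : (k <= m)%N -> (2^-1 ^+ m : R) ^+ 2 <= (2^-1 ^+ k) ^+ 2.
Proof.
move=> km; rewrite lerXn2r ?nnegrE ?exprn_ge0 ?invr_ge0//.
by rewrite ler_wiXn2l// ?invr_ge0// invf_le1// ler1n.
Qed.

Let v_cauchy k m t : 0 <= t <= T -> (k <= m)%N ->
  \int[mu]_x ((v m t x - v k t x) ^+ 2) <= (2^-1 ^+ k) ^+ 2.
Proof.
move=> tT km; apply: (le_trans (un_cauchy _ _ tT)).
have := phiP k; have := phiP m; have := half_mono km; lra.
Qed.

Let uc_measurable t : measurable_fun setT (uc t).
Proof.
apply: measurableT_comp => //.
apply: (measurable_fun_limn_esup (f := fun k x => (v k t x)%:E)) => k.
by apply/measurable_EFinP; case: (un_L2 (phi k) t).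
Qed.

Let uc_lim t : 0 <= t <= T -> {ae mu, forall x, v k t x @[k --> \oo] --> uc t x}.
Proof.
move=> tT; have := @fast_cauchy _ _ _ mu (fun k => v k t) (fun k => un_L2 (phi k) t)
  (fun k => v_cauchy tT (leqnSn k)).
apply: filterS => x /cvg_ex[l hl].
suff -> : uc t x = l by [].
have hl' : (v k t x)%:E @[k --> \oo] --> l%:E by apply: cvg_EFin => //; exact: nearW.
by rewrite /uc; have [_ ->] := cvg_limn_einf_sup hl'.
Qed.

Let uc_close k t : 0 <= t <= T -> L2 mu (fun x => uc t x - v k t x) /\
  \int[mu]_x ((uc t x - v k t x) ^+ 2) <= (2^-1 ^+ k) ^+ 2.
Proof.
move=> tT; have mv k' : measurable_fun setT (v k' t) by case: (un_L2 (phi k') t).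
have md : measurable_fun setT (fun x => uc t x - v k t x) by exact: measurable_funB.
have md2 : measurable_fun setT (fun x => (uc t x - v k t x) ^+ 2) by exact: measurable_funX.
have h : (\int[mu]_x ((uc t x - v k t x) ^+ 2)%:E <= ((2^-1 ^+ k) ^+ 2)%:E)%E.
  apply: (@fatou_bound _ _ R mu (fun m x => ((v (m + k)%N t x - v k t x) ^+ 2)%:E)).
  - by move=> m; apply/measurable_EFinP/measurable_funX; exact: measurable_funB.
  - by move=> m x; rewrite lee_fin sqr_ge0.
  - exact/measurable_EFinP.
  - apply: filterS (uc_lim tT) => x hx; apply: cvg_EFin; first exact: nearW.
    have hx' : v (m + k)%N t x @[m --> \oo] --> uc t x by rewrite (cvg_shiftn k (fun m => v m t x)).
    under eq_fun do rewrite expr2.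
    rewrite expr2; apply: cvgM; apply: cvgB => //; exact: cvg_cst.
  - move=> m; rewrite -EFin_Rintegral; last by have [] := L2B (un_L2 (phi (m + k)%N) t) (un_L2 (phi k) t).
    by rewrite lee_fin; apply: v_cauchy => //; exact: leq_addl.
have i2 : mu.-integrable setT (EFin \o (fun x => (uc t x - v k t x) ^+ 2)).
  by apply/intg_ge0P => // [x|]; [exact: sqr_ge0|exact: le_lt_trans h (ltry _)].
by split; [split|rewrite -lee_fin EFin_Rintegral].
Qed.

Let uc_L2 t : 0 <= t <= T -> L2 mu (uc t).
Proof.
move=> tT; have [h _] := uc_close 0 tT; have := L2D h (un_L2 (phi 0%N) t).
by congr (L2 mu _); apply/funext => x; rewrite subrK.
Qed.

Let half_small e : 0 < e -> exists k, (2^-1 ^+ k : R) ^+ 2 <= e.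
Proof.
move=> e0; have h : `|2^-1 : R| < 1 by rewrite ger0_norm ?invr_ge0// invf_lt1// ltr1n.
have /cvgrPdist_le/(_ _ e0)[k _ /(_ k (leqnn k))] := cvg_geometric 1 h.
rewrite /= sub0r normrN mul1r ger0_norm ?exprn_ge0 ?invr_ge0// => hk.
exists k; apply: le_trans hk; rewrite expr2 ler_piMr ?exprn_ge0 ?invr_ge0//.
by rewrite exprn_ile1 ?invr_ge0// invf_le1// ler1n.
Qed.

(** The approximations are continuous in time with values in L^2 and uniformly
    close to [u] at a dense set of times, hence uniformly Cauchy at all times; a
    fast subsequence converges almost everywhere, to a measurable limit. *)
Lemma L2_representative : exists uc : R -> Y -> R,
  [/\ forall t, 0 <= t <= T -> L2 mu (uc t),
      forall t e, 0 <= t <= T -> 0 < e -> exists2 dl : R, 0 < dl &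
        forall s, 0 <= s <= T -> `|t - s| < dl -> \int[mu]_x ((uc s x - uc t x) ^+ 2) <= e &
      {ae leb, forall t : X, 0 < t < T -> {ae mu, forall x, uc t x = u t x}}].
Proof.
exists uc; split; first exact: uc_L2.
- move=> t e tT e0; have e16 : 0 < e / 16 by rewrite divr_gt0.
  have [k hk] := half_small e16.
  have [dl dl0 h] := un_close (phi k) t e16; exists dl => // s sT ts.
  have [_ c1] := uc_close k tT; have [_ c2] := uc_close k sT.
  have c3 := h s ts; rewrite int_sym in c3.
  have t1 := int_tri (uc_L2 sT) (un_L2 _ s) (un_L2 _ t) c2 c3.
  rewrite int_sym in c1.
  have := int_tri (uc_L2 sT) (un_L2 _ t) (uc_L2 tT) t1 c1; lra.
- apply: filterS good => t gt tT; have tT' : 0 <= t <= T.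
    by have /andP[/ltW -> /ltW ->] := tT.
  have hd := L2B (uc_L2 tT') (u_L2 t).
  have z : \int[mu]_x ((uc t x - u t x) ^+ 2) = 0.
    apply/eqP; rewrite eq_le; apply/andP; split; last first.
      by apply: Rintegral_ge0 => x _; exact: sqr_ge0.
    apply/ler_addgt0Pr => e e0; rewrite add0r.
    have e4 : 0 < e / 4 by rewrite divr_gt0.
    have [k hk] := half_small e4; have [_ c1] := uc_close k tT'.
    have := int_tri (uc_L2 tT') (un_L2 _ t) (u_L2 t) c1 (gt tT (phi k)).
    have := phiP k; lra.
  have [mf f2] := hd.
  have := Rintegral_eq0_ae (measurable_funX 2 mf) (fun x => sqr_ge0 _) f2 z.
  by apply: filterS => x /eqP; rewrite sqrf_eq0 subr_eq0 => /eqP.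
Qed.

End representative.

(** * Matrix-valued square integrable functions *)

Section matrix_norm.
Variables (R : realType) (m n : nat).
Implicit Types A B : 'M[R]_(m, n).

Lemma mxdotE A B : mxdot A B = \sum_i \sum_j A i j * B i j.
Proof.
rewrite /mxdot /mxtrace; apply: eq_bigr => i _; rewrite mxE.
by apply: eq_bigr => j _; rewrite mxE.
Qed.

Lemma mxdotZdelta A (c : R) i j : mxdot A (c *: delta_mx i j) = A i j * c.
Proof.
rewrite mxdotE (bigD1 i)//= [X in _ + X]big1 ?addr0 => [|i' i'i]; last first.
  by apply: big1 => j' _; rewrite !mxE (negbTE i'i)/= !mulr0.
rewrite (bigD1 j)//= big1 ?addr0 => [|j' j'j]; first by rewrite !mxE !eqxx mulr1.
by rewrite !mxE (negbTE j'j) andbF !mulr0.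
Qed.

Lemma mxnorm_sqr A : mxnorm A ^+ 2 = \sum_i \sum_j A i j ^+ 2.
Proof.
rewrite /mxnorm sqr_sqrtr mxdotE.
  by apply: eq_bigr => i _; apply: eq_bigr => j _; rewrite expr2.
by apply: sumr_ge0 => i _; apply: sumr_ge0 => j _; rewrite -expr2 sqr_ge0.
Qed.

Lemma mxnorm_ge0 A : 0 <= mxnorm A.
Proof. exact: sqrtr_ge0. Qed.

Lemma entry_sqr_le A i j : A i j ^+ 2 <= mxnorm A ^+ 2.
Proof.
rewrite mxnorm_sqr (bigD1 i)//= (bigD1 j)//= -addrA lerDl addr_ge0//.
  by apply: sumr_ge0 => k _; exact: sqr_ge0.
by apply: sumr_ge0 => k _; apply: sumr_ge0 => l _; exact: sqr_ge0.
Qed.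

Lemma measurable_mxnorm d (T : measurableType d) (D : set T) (u : T -> 'M[R]_(m, n)) :
  measurable D -> measurable_fun D u -> measurable_fun D (fun x => mxnorm (u x)).
Proof.
move=> mD /(measurable_fun_mxP _ mD) h.
apply: (measurableT_comp (continuous_measurable1 (@sqrt_continuous R))).
under eq_fun do rewrite mxdotE.
apply: measurable_sum => i; apply: measurable_sum => j.
by apply: measurable_funM; exact: h.
Qed.

End matrix_norm.

Section Lp_entries.
Variables (R : realType) (d m n : nat).
Local Notation mu := (torus_measure R d).
Implicit Types u : 'rV[R]_d -> 'M[R]_(m, n).

Definition entries_L2 u : Prop := forall i j, L2 mu (fun x => u x i j).

Lemma entries_measurable u : (forall i j, measurable_fun setT (fun x => u x i j)) -> measurable_fun setT u.
Proof. by move=> h; apply/measurable_fun_mxP. Qed.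

Lemma entries_L2_measurable u : entries_L2 u -> measurable_fun setT u.
Proof. by move=> h; apply: entries_measurable => i j; case: (h i j). Qed.

Lemma entries_L2_norm_intg u : entries_L2 u ->
  mu.-integrable setT (EFin \o (fun x => mxnorm (u x) ^+ 2)) /\
  \int[mu]_x (mxnorm (u x) ^+ 2) = \sum_i \sum_j \int[mu]_x (u x i j ^+ 2).
Proof.
move=> h; under eq_fun do rewrite mxnorm_sqr.
have hij i j : mu.-integrable setT (EFin \o (fun x => u x i j ^+ 2)) by case: (h i j).
split; first by apply: intg_sum => i; exact: intg_sum.
rewrite Rintegral_sum => [|i]; last exact: intg_sum.
by apply: eq_bigr => i _; rewrite Rintegral_sum.
Qed.

Lemma entries_L2P u : measurable_fun setT u ->
  entries_L2 u <-> (\int[mu]_x (mxnorm (u x) ^+ 2)%:E < +oo)%E.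
Proof.
move=> mu_; have mn2 : measurable_fun setT (fun x => mxnorm (u x) ^+ 2).
  by apply: measurable_funX; exact: measurable_mxnorm.
split=> [h|h].
  by have [/intg_ge0P i2 _] := entries_L2_norm_intg h; apply: i2 => // x; exact: sqr_ge0.
have i2 : mu.-integrable setT (EFin \o (fun x => mxnorm (u x) ^+ 2)).
  by apply/intg_ge0P => // x; exact: sqr_ge0.
move=> i j; have mij : measurable_fun setT (fun x => u x i j).
  exact: ((measurable_fun_mxP u measurableT).1 mu_ i j).
split=> //; apply: le_intg i2; first exact: measurable_funX.
by move=> x; rewrite ger0_norm ?sqr_ge0// entry_sqr_le.
Qed.

Lemma Lp_normE (q : R) u : (Lp_norm q u = (\int[mu]_x (mxnorm (u x) `^ q)%:E) `^ q^-1)%E.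
Proof.
rewrite /Lp_norm unlock; congr (_ `^ _)%E; apply: eq_integral => x _ /=.
by rewrite ger0_norm ?mxnorm_ge0.
Qed.

Lemma Lp_norm2E u : entries_L2 u ->
  (Lp_norm 2 u = (Num.sqrt (\sum_i \sum_j \int[mu]_x (u x i j ^+ 2)))%:E)%E.
Proof.
move=> h; have [i2 e] := entries_L2_norm_intg h; rewrite -e Lp_normE.
have -> : (\int[mu]_x (mxnorm (u x) `^ 2)%:E = \int[mu]_x (mxnorm (u x) ^+ 2)%:E)%E.
  by apply: eq_integral => x _; rewrite -(powR_mulrn 2) ?mxnorm_ge0.
rewrite -EFin_Rintegral// poweR_EFin powR12_sqrt//.
by apply: Rintegral_ge0 => x _; exact: sqr_ge0.
Qed.

Lemma Lp2P u : Lp 2 u <-> entries_L2 u.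
Proof.
split=> [[mu_ h]|h]; last by split; [exact: entries_L2_measurable|rewrite Lp_norm2E// ltry].
apply/(entries_L2P mu_); move: h; rewrite Lp_normE => h.
have -> : (\int[mu]_x (mxnorm (u x) ^+ 2)%:E = \int[mu]_x (mxnorm (u x) `^ 2)%:E)%E.
  by apply: eq_integral => x _; rewrite -(powR_mulrn 2) ?mxnorm_ge0.
have := poweR_lty 2 h; rewrite -poweRrM mulVf// poweRe1//.
by apply: integral_ge0 => x _; rewrite lee_fin powR_ge0.
Qed.

Lemma Lp_pow_intg (q : R) u : 0 < q -> Lp q u ->
  mu.-integrable setT (EFin \o (fun x => mxnorm (u x) `^ q)).
Proof.
move=> q0 [mu_]; rewrite Lp_normE => h.
have mn := measurable_mxnorm measurableT mu_.
apply/intg_ge0P; first exact: (measurableT_comp (measurable_powR q) mn).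
  by move=> x; exact: powR_ge0.
have := poweR_lty q h; rewrite -poweRrM mulVf ?gt_eqF// poweRe1//.
by apply: integral_ge0 => x _; rewrite lee_fin powR_ge0.
Qed.

End Lp_entries.

Section continuous_in_L2.
Variables (R : realType) (d m n : nat) (T : R).
Local Notation mu := (torus_measure R d).
Implicit Types f : R -> 'rV[R]_d -> 'M[R]_(m, n).

Definition entries_C_L2 f : Prop :=
  (forall t, 0 <= t <= T -> entries_L2 (f t)) /\
  forall t e, 0 <= t <= T -> 0 < e -> exists2 dl : R, 0 < dl &
    forall s, 0 <= s <= T -> `|t - s| < dl -> forall i j,
      \int[mu]_x ((f s x i j - f t x i j) ^+ 2) <= e.

Let entries_L2B (u w : 'rV[R]_d -> 'M[R]_(m, n)) : entries_L2 u -> entries_L2 w ->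
  entries_L2 (fun x => u x - w x).
Proof.
move=> hu hw i j; have := L2B (hu i j) (hw i j).
by congr (L2 mu _); apply/funext => x; rewrite !mxE.
Qed.

Let int_ge0 (u : 'rV[R]_d -> R) : 0 <= \int[mu]_x (u x ^+ 2).
Proof. by apply: Rintegral_ge0 => x _; exact: sqr_ge0. Qed.

(** Each entry of a matrix is bounded by its norm, and the squared norm is the
    sum of the squared entries. *)
Lemma C_L2P f : C_L2 T f <-> entries_C_L2 f.
Proof.
have itvE (t : R) : (t \in `[0, T]) = (0 <= t <= T) by rewrite in_itv.
pose D s t := \sum_i \sum_j \int[mu]_x ((f s x i j - f t x i j) ^+ 2).
have D0 s t : 0 <= D s t by apply: sumr_ge0 => i _; apply: sumr_ge0 => j _; exact: int_ge0.
have DE s t : entries_L2 (f s) -> entries_L2 (f t) ->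
    (Lp_norm 2 (fun x => f s x - f t x)%R = (Num.sqrt (D s t))%:E)%E.
  move=> hs ht; rewrite Lp_norm2E; last exact: entries_L2B.
  congr (Num.sqrt _)%:E; apply: eq_bigr => i _; apply: eq_bigr => j _.
  by apply: eq_Rintegral => x _; rewrite !mxE.
split=> -[h1 h2].
  have h1' t : 0 <= t <= T -> entries_L2 (f t) by move=> tT; apply/Lp2P/h1; rewrite itvE.
  split=> // t e tT e0; have /fine_cvgP[_] := h2 t (etrans (itvE t) tT).
  have se0 : 0 < Num.sqrt e by rewrite sqrtr_gt0.
  move=> /cvgrPdist_le/(_ _ se0); rewrite near_withinE => /nbhs_ballP[dl dl0 h].
  exists dl => // s sT ts i j; have := h s; rewrite -ball_normE /= itvE => /(_ ts sT).
  rewrite sub0r normrN (DE _ _ (h1' s sT) (h1' t tT)) /= ger0_norm ?sqrtr_ge0// (ler_sqrt _ (ltW e0)).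
  apply: le_trans; rewrite /D (bigD1 i)//= (bigD1 j)//= -addrA lerDl addr_ge0//.
    by apply: sumr_ge0 => k _; exact: int_ge0.
  by apply: sumr_ge0 => k _; apply: sumr_ge0 => l _; exact: int_ge0.
split=> t; rewrite itvE => tT; first exact/Lp2P/h1.
apply/fine_cvgP; split.
  rewrite near_withinE; apply: nearW => s; rewrite /= itvE => sT.
  by rewrite DE//; exact: h1.
apply/cvgrPdist_le => e e0; rewrite near_withinE.
pose K := (m * n).+1%:R : R; have K0 : 0 < K by rewrite ltr0n.
have e1 : 0 < e ^+ 2 / K by rewrite divr_gt0// exprn_gt0.
have [dl dl0 h] := h2 t _ tT e1.
apply/nbhs_ballP; exists dl => // s; rewrite -ball_normE /= => ts; rewrite /= itvE => sT.
rewrite sub0r normrN DE /=; [|exact: h1..].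
rewrite ger0_norm ?sqrtr_ge0// -[leRHS](ger0_norm (ltW e0)) -sqrtr_sqr ler_wsqrtr//.
apply: (@le_trans _ _ (\sum_(i < m) \sum_(j < n) (e ^+ 2 / K))).
  by apply: ler_sum => i _; apply: ler_sum => j _; exact: h.
rewrite !big_const_ord !iter_addr_0 -mulrnA -mulr_natr mulrAC ler_pdivrMr// ler_wpM2l ?sqr_ge0//.
by rewrite ler_nat mulnC ltnW.
Qed.

End continuous_in_L2.

(** * Integrability of the stress *)

Section stress_bound.
Variables (R : realType) (d : nat).
Local Notation mu := (torus_measure R d).
Local Notation leb := (@lebesgue_measure R).
Local Notation X := (measurableTypeR R).

Lemma sum_power_le (I : finType) (a : I -> R) k : (forall i, 0 <= a i) ->
  (\sum_i a i) ^+ k <= #|I|%:R ^+ k * (1 + \sum_i a i ^+ k).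
Proof.
move=> a0; have S0 : 0 <= \sum_i a i ^+ k by apply: sumr_ge0 => i _; exact: exprn_ge0.
case: (pickP (fun _ : I => true)) => [i0 _|noI]; last first.
  rewrite big1 => [|i _]; last by have := noI i.
  case: k S0 => [|k] S0; first by rewrite !expr0 mul1r lerDl.
  by rewrite expr0n/= mulr_ge0// ?exprn_ge0// addr_ge0.
have [i1 _ i1max] := arg_maxP a (erefl (xpredT i0)).
have h : \sum_i a i <= #|I|%:R * a i1.
  rewrite mulr_natl -sumr_const; apply: ler_sum => i _; exact: i1max.
apply: (@le_trans _ _ ((#|I|%:R * a i1) ^+ k)).
  by rewrite lerXn2r// nnegrE ?mulr_ge0// sumr_ge0.
rewrite exprMn ler_wpM2l ?exprn_ge0//; apply: (@le_trans _ _ (\sum_i a i ^+ k)); last by rewrite lerDr.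
by rewrite (bigD1 i1)//= lerDl; apply: sumr_ge0 => i _; exact: exprn_ge0.
Qed.

Lemma powR_le_natural (x q : R) (m : nat) : 0 <= x -> 0 <= q <= m%:R -> x `^ q <= 1 + x ^+ m.
Proof.
move=> x0 /andP[q0 qm]; have [x1|x1] := leP x 1.
  apply: (@le_trans _ _ 1); last by rewrite lerDl exprn_ge0.
  have : x `^ q <= 1 `^ q by apply: ge0_ler_powR => //; rewrite nnegrE.
  by rewrite powR1.
apply: (@le_trans _ _ (x ^+ m)); last by rewrite lerDr.
by rewrite -powR_mulrn//; apply: ler_powR => //; exact: ltW.
Qed.

(** The real exponent [p - 1] is replaced by a natural one, for which the norm
    can be expanded in the entries. *)
Lemma stress_growth (p : R) (W : 'M[R]_d -> R) (m : nat) : 1 <= p -> p - 1 <= m%:R -> A3 p W ->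
  exists2 K : R, 0 <= K & forall A : 'M[R]_d,
    mxnorm (stress W A) ^+ 2 <= K * (1 + \sum_i \sum_j (A i j ^+ m) ^+ 2).
Proof.
move=> p1 pm [C C0 hC]; pose N : R := #|{: 'I_d * 'I_d}|%:R ^+ m.
have N0 : 0 <= N by exact: exprn_ge0.
exists (8 * C ^+ 2 * (1 + N)); first by rewrite mulr_ge0 ?addr_ge0// mulr_ge0// sqr_ge0.
move=> A; have [_ h] := hC A.
have h2 : mxnorm (stress W A) <= C * (2 + mxnorm A ^+ m).
  apply: (le_trans h); rewrite ler_wpM2l ?(ltW C0)//.
  have := @powR_le_natural (mxnorm A) (p - 1) m (mxnorm_ge0 A).
  by move=> /(_ _)/wrap[|]; [rewrite subr_ge0 p1|lra].
have y0 : 0 <= mxnorm A ^+ m by rewrite exprn_ge0// mxnorm_ge0.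
have h3 : mxnorm (stress W A) ^+ 2 <= C ^+ 2 * (2 + mxnorm A ^+ m) ^+ 2.
  rewrite -exprMn lerXn2r ?nnegrE ?mxnorm_ge0//.
  by rewrite mulr_ge0 ?(ltW C0)// addr_ge0.
apply: (le_trans h3).
pose S := \sum_i \sum_j (A i j ^+ m) ^+ 2; have S0 : 0 <= S.
  by apply: sumr_ge0 => i _; apply: sumr_ge0 => j _; exact: sqr_ge0.
have h4 : (mxnorm A ^+ m) ^+ 2 <= N * (1 + S).
  rewrite -exprM mulnC exprM mxnorm_sqr pair_big/=.
  apply: (le_trans (sum_power_le _ _)) => [k|]; first exact: sqr_ge0.
  rewrite ler_wpM2l// lerD2l /S pair_big/= le_eqVlt; apply/orP; left; apply/eqP.
  by apply: eq_bigr => k _; rewrite -!exprM mulnC.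
have h5 : (2 + mxnorm A ^+ m) ^+ 2 <= 8 + 2 * (mxnorm A ^+ m) ^+ 2.
  by have := sqr_ge0 (2 - mxnorm A ^+ m); nra.
rewrite -/S (_ : 8 * C ^+ 2 * (1 + N) * (1 + S) = C ^+ 2 * (8 * ((1 + N) * (1 + S)))); last by ring.
rewrite ler_wpM2l ?sqr_ge0//.
have NS : 0 <= N * S by rewrite mulr_ge0.
by rewrite mulrDl !mulrDr !mul1r mulr1 in h4 *; lra.
Qed.

Lemma H1_entries (M : R) (F : 'rV[R]_d -> 'M[R]_d) : H1_le M F ->
  exists D : 'I_d -> 'rV[R]_d -> 'M[R]_d,
  [/\ entries_L2 F, forall j, entries_L2 (D j),
      forall i k, \int[mu]_x (F x i k ^+ 2) <= (`|M| + 1) ^+ 2,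
      forall j i k, \int[mu]_x (D j x i k ^+ 2) <= (`|M| + 1) ^+ 2 &
      forall j i k, weak_derivative (fun x => F x i k) (fun x => D j x i k) j].
Proof.
move=> [mF [D [mD [iF iD wk] hM]]]; exists D.
pose tot x := mxnorm (F x) ^+ 2 + \sum_(j < d) mxnorm (D j x) ^+ 2.
have mtot : measurable_fun setT tot.
  apply: measurable_funD; first by apply: measurable_funX; exact: measurable_mxnorm.
  by apply: measurable_sum => j; apply: measurable_funX; exact: measurable_mxnorm.
have sum0 x : 0 <= \sum_(j < d) mxnorm (D j x) ^+ 2 by apply: sumr_ge0 => j _; exact: sqr_ge0.
have tot0 x : 0 <= tot x by rewrite addr_ge0// sqr_ge0.
have itot : mu.-integrable setT (EFin \o tot).
  by apply/intg_ge0P => //; exact: le_lt_trans hM (ltry _).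
have totM : \int[mu]_x tot x <= M by rewrite -lee_fin EFin_Rintegral.
have M2 : M <= (`|M| + 1) ^+ 2 by have := ler_norm M; have := normr_ge0 M; nra.
have small (g : 'rV[R]_d -> R) : measurable_fun setT g -> (forall x, g x ^+ 2 <= tot x) ->
    L2 mu g /\ \int[mu]_x (g x ^+ 2) <= (`|M| + 1) ^+ 2.
  move=> mg gt; have hg : L2 mu g.
    split=> //; apply: le_intg itot; first exact: measurable_funX.
    by move=> x; rewrite ger0_norm ?sqr_ge0.
  split=> //; apply: le_trans M2; apply: le_trans totM.
  by apply: le_Rintegral => //; case: hg.
have eF i k : L2 mu (fun x => F x i k) /\ \int[mu]_x (F x i k ^+ 2) <= (`|M| + 1) ^+ 2.
  apply: small; first exact: ((measurable_fun_mxP F measurableT).1 mF i k).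
  by move=> x; apply: (le_trans (entry_sqr_le _ i k)); rewrite lerDl.
have eD j i k : L2 mu (fun x => D j x i k) /\ \int[mu]_x (D j x i k ^+ 2) <= (`|M| + 1) ^+ 2.
  apply: small; first exact: ((measurable_fun_mxP (D j) measurableT).1 (mD j) i k).
  move=> x; apply: (le_trans (entry_sqr_le _ i k)).
  rewrite /tot (bigD1 j)//= addrCA lerDl addr_ge0 ?sqr_ge0//.
  by apply: sumr_ge0 => l _; exact: sqr_ge0.
split.
- by move=> i k; case: (eF i k).
- by move=> j i k; case: (eD j i k).
- by move=> i k; case: (eF i k).
- by move=> j i k; case: (eD j i k).
- move=> j i k; split; [exact: iF|exact: iD|].
  by move=> phi hphi; exact: wk.
Qed.

Lemma stress_continuous (W : 'M[R]_d -> R) i j : A1 W -> continuous (fun A => stress W A i j).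
Proof.
move=> [_ /(_ (delta_mx i j))[_ [c _]]].
suff -> : (fun A => stress W A i j) = 'D_(delta_mx i j) W by [].
by apply/funext => A; rewrite mxE.
Qed.

Lemma measurable_stress d' (Y : measurableType d') (D : set Y) (W : 'M[R]_d -> R) (F : Y -> 'M[R]_d) i j :
  A1 W -> measurable_fun D F -> measurable_fun D (fun y => stress W (F y) i j).
Proof.
move=> hW mF; exact: (measurableT_comp (continuous_measurable_mx (stress_continuous (i := i) (j := j) hW)) mF).
Qed.

(** The growth condition reduces the stress to the moments of the entries of
    [F]; this is where the relation between [d] and [p] enters, through [m]. *)
Lemma stress_integral_bound (p M : R) (W : 'M[R]_d -> R) (m : nat) :
  1 <= p -> p - 1 <= m%:R -> A1 W -> A3 p W -> moment_bounded R d m ->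
  exists C : R, forall F, H1_le M F ->
    (\int[mu]_x (mxnorm (stress W (F x)) ^+ 2)%:E <= C%:E)%E.
Proof.
move=> p1 pm hA1 hA3 mb; have [K K0 hK] := stress_growth p1 pm hA3.
have M1 : 0 <= `|M| + 1 by rewrite addr_ge0.
have [C hC] := moment_bound_weak mb M1.
exists (K * (1 + \sum_(i < d) \sum_(j < d) C)) => F hF.
have [D [eF eD bF bD wF]] := H1_entries hF.
have mom i j : (\int[mu]_x ((F x i j ^+ m) ^+ 2)%:E <= C%:E)%E.
  exact: (hC (fun x => F x i j) (fun k x => D k x i j) (eF i j) (fun k => eD k i j)
    (fun k => wF k i j) (bF i j) (fun k => bD k i j)).
have mFij i j : measurable_fun setT (fun x => F x i j) by case: (eF i j).
have mFm i j : measurable_fun setT (fun x => (F x i j ^+ m) ^+ 2).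
  by apply: measurable_funX; exact: measurable_funX.
have iF i j : mu.-integrable setT (EFin \o (fun x => (F x i j ^+ m) ^+ 2)).
  by apply/intg_ge0P => // [x|]; [exact: sqr_ge0|exact: le_lt_trans (mom i j) (ltry _)].
have i1 : mu.-integrable setT (EFin \o (cst 1 : 'rV[R]_d -> R)) by exact: finite_measure_integrable_cst.
have iS : mu.-integrable setT (EFin \o (fun x => \sum_i \sum_j (F x i j ^+ m) ^+ 2)).
  by apply: intg_sum => i; exact: intg_sum.
have iR : mu.-integrable setT (EFin \o (fun x => K * (1 + \sum_i \sum_j (F x i j ^+ m) ^+ 2))).
  by apply: intgZ; exact: intgD.
apply: (@le_trans _ _ (\int[mu]_x (K * (1 + \sum_i \sum_j (F x i j ^+ m) ^+ 2))%:E)%E).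
  apply: ge0_le_integral => //.
  - by move=> x _; rewrite lee_fin sqr_ge0.
  - apply/measurable_EFinP/measurable_funX/measurable_mxnorm => //.
    apply/measurable_fun_mxP => // i j; apply: measurable_stress => //.
    exact: entries_L2_measurable.
  - exact: measurable_int iR.
  - by move=> x _; rewrite lee_fin.
rewrite -EFin_Rintegral// lee_fin RintegralZl//; last exact: intgD.
rewrite ler_wpM2l// RintegralD// Rintegral_prob_cst lerD2l.
rewrite Rintegral_sum => [|i]; last exact: intg_sum.
apply: ler_sum => i _; rewrite Rintegral_sum//; apply: ler_sum => j _.
by rewrite -lee_fin EFin_Rintegral.
Qed.

End stress_bound.

(** * Componentwise form of the weak formulation *)

Section versions.
Context (R : realType) d (Y : measurableType d) (mu : probability Y R) (T : R).
Local Notation leb := (@lebesgue_measure R).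
Local Notation X := (measurableTypeR R).
Local Notation Q := (leb \x mu)%E.
Local Notation cyl := (`]0, T[%classic `*` setT : set (X * Y)).
Implicit Types f g h : X -> Y -> R.

Definition slab_cut h (t : X) (y : Y) : R := if (0 < t < T)%R then h t y else 0.

Lemma cut_ge0 h : (forall t y, 0 <= h t y) -> forall t y, 0 <= slab_cut h t y.
Proof. by move=> h0 t y; rewrite /slab_cut; case: ifP. Qed.

Lemma measurable_cyl : measurable cyl.
Proof. by apply: measurableX => //; exact: measurable_itv. Qed.

Lemma cut_patch h : (fun z : X * Y => slab_cut h z.1 z.2) = (fun z : X * Y => h z.1 z.2) \_ cyl.
Proof.
apply/funext => -[t y]; rewrite patchE /slab_cut /=; case: ifPn => ht; case: ifPn => //.
  by move/negP; case; apply/mem_set; split => //=; rewrite in_itv.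
by move/set_mem => [/=]; rewrite in_itv/= (negbTE ht).
Qed.

Lemma measurable_cut h : measurable_fun cyl (fun z : X * Y => h z.1 z.2) ->
  measurable_fun setT (fun z : X * Y => slab_cut h z.1 z.2).
Proof. by move=> mh; rewrite cut_patch; exact: ((measurable_restrictT _ measurable_cyl).1 mh). Qed.

Lemma cut_integral h : (\int[leb]_(t in `]0%R, T[) \int[mu]_y (h t y)%:E =
  \int[leb]_t \int[mu]_y (slab_cut h t y)%:E)%E.
Proof.
rewrite integral_mkcond; apply: eq_integral => t _.
rewrite patchE mem_setE in_itv/= /slab_cut; case: ifP => // _.
by rewrite integral0.
Qed.

Lemma measurable_cut_integral h : measurable_fun cyl (fun z : X * Y => h z.1 z.2) ->
  (forall t y, 0 <= slab_cut h t y) ->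
  measurable_fun setT (fun t => \int[mu]_y (slab_cut h t y)%:E)%E.
Proof.
move=> mh h0.
apply: (@measurable_fun_fubini_tonelli_F _ _ X Y R mu (fun z : X * Y => (slab_cut h z.1 z.2)%:E)).
  by apply/measurable_EFinP; exact: measurable_cut.
by move=> z; rewrite lee_fin.
Qed.

Lemma cyl_integral_le h g : measurable_fun cyl (fun z : X * Y => h z.1 z.2) ->
  measurable_fun cyl (fun z : X * Y => g z.1 z.2) ->
  (forall t y, 0 <= h t y <= g t y) ->
  (\int[leb]_(t in `]0%R, T[) \int[mu]_y (g t y)%:E < +oo)%E ->
  (\int[leb]_(t in `]0%R, T[) \int[mu]_y (h t y)%:E < +oo)%E.
Proof.
move=> mh mg hg; rewrite !cut_integral; apply: le_lt_trans.
have h0 t y : 0 <= slab_cut h t y <= slab_cut g t y by rewrite /slab_cut; case: ifP => // _; rewrite lexx.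
have ch0 t y : 0 <= slab_cut h t y by have /andP[] := h0 t y.
have cg0 t y : 0 <= slab_cut g t y by have /andP[a b] := h0 t y; exact: le_trans b.
apply: ge0_le_integral => //.
- by move=> t _; apply: integral_ge0 => y _; rewrite lee_fin.
- exact: measurable_cut_integral.
- exact: measurable_cut_integral.
move=> t _; apply: ge0_le_integral => //.
- by move=> y _; rewrite lee_fin.
- by apply/measurable_EFinP; exact: (measurable_fun_pair2 t (measurable_cut mh)).
- by apply/measurable_EFinP; exact: (measurable_fun_pair2 t (measurable_cut mg)).
- by move=> y _; rewrite lee_fin; have /andP[] := h0 t y.
Qed.

Lemma cyl_integral_ae_bounded h (K : R) : measurable_fun cyl (fun z : X * Y => h z.1 z.2) ->
  (forall t y, 0 <= h t y) ->
  {ae leb, forall t : X, 0 < t < T -> (\int[mu]_y (h t y)%:E <= K%:E)%E} ->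
  (\int[leb]_(t in `]0%R, T[) \int[mu]_y (h t y)%:E < +oo)%E.
Proof.
move=> mh h0 hK; rewrite cut_integral.
have ch0 := cut_ge0 h0.
have iK : leb.-integrable setT (EFin \o (fun t : X => `|K| * (0 < t < T)%R%:R)).
  by apply: intgZ; exact: slab_indicator_intg.
apply: (@le_lt_trans _ _ (\int[leb]_t (`|K| * (0 < t < T)%R%:R)%:E)%E); last first.
  have /intg_ge0P := iK; apply; first exact: intg_measurable iK.
  by move=> t; rewrite mulr_ge0.
apply: ae_ge0_le_integral => //.
- by move=> t _; apply: integral_ge0 => y _; rewrite lee_fin.
- exact: measurable_cut_integral.
- exact: measurable_int iK.
- apply: filterS hK => t ht _; rewrite /slab_cut; have [tT|tT] := boolP (0 < t < T).
    by rewrite mulr1; apply: (le_trans (ht tT)); rewrite lee_fin ler_norm.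
  by rewrite integral0 mulr0.
Qed.

(** Agreement is recorded both on almost every time slice and on the product,
    for use in iterated and in double integrals. *)
Definition version g h : Prop :=
  [/\ slab mu T g,
    {ae leb, forall t : X, 0 < t < T -> {ae mu, forall y, g t y = h t y}} &
    {ae Q, forall z : X * Y, 0 < z.1 < T -> g z.1 z.2 = h z.1 z.2}].

Lemma version_exists h g : measurable_fun cyl (fun z : X * Y => h z.1 z.2) ->
  measurable_fun cyl (fun z : X * Y => g z.1 z.2) ->
  (forall t y, h t y ^+ 2 <= g t y) ->
  (\int[leb]_(t in `]0%R, T[) \int[mu]_y (g t y)%:E < +oo)%E ->
  exists u, version u h.
Proof.
move=> mh mg hg fin; have [|u [su a1 a2]] := @tame R _ Y mu T h mh; last by exists u.
apply: cyl_integral_le fin => //; first exact: measurable_funX.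
by move=> t y; rewrite sqr_ge0 hg.
Qed.

Lemma cyl_Rintegral (H K : X * Y -> R) : measurable_fun cyl H -> measurable_fun setT K ->
  (forall z, ~~ (0 < z.1 < T) -> K z = 0) ->
  {ae Q, forall z : X * Y, 0 < z.1 < T -> K z = H z} ->
  \int[Q]_(z in cyl) H z = \int[Q]_z K z.
Proof.
move=> mH mK K0 KH; rewrite Rintegral_mkcond; apply: ae_eq_Rintegral => //.
  exact: ((measurable_restrictT _ measurable_cyl).1 mH).
apply: filterS KH => z hz; rewrite patchE; case: ifPn => [/set_mem [/=]|].
  by rewrite in_itv/= => /hz.
move=> zc; rewrite K0//; apply: contra zc => zT; apply/mem_set; split => //=.
Qed.

End versions.

Section weak_solution_data.
Variables (R : realType) (d : nat) (p T : R) (W : 'M[R]_d -> R).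
Variables (v0 : 'rV[R]_d -> 'cV[R]_d) (F0 : 'rV[R]_d -> 'M[R]_d).
Variables (v : R -> 'rV[R]_d -> 'cV[R]_d) (Dv F : R -> 'rV[R]_d -> 'M[R]_d).
Local Notation mu := (torus_measure R d).
Local Notation leb := (@lebesgue_measure R).
Local Notation X := (measurableTypeR R).
Local Notation V := ('rV[R]_d).
Local Notation Q := (leb \x mu)%E.
Local Notation cyl := (`]0, T[%classic `*` setT : set (X * V)).
Hypotheses (T0 : 0 < T) (p2 : 2 <= p) (W1 : A1 W) (W3 : A3 p W).
Hypothesis sol : weak_solution W p T v0 F0 v Dv F.
Hypothesis F_H1 : Linf_H1 T F.
Hypothesis dp : (d = 2%N /\ 2 <= p) \/ (d = 3%N /\ 2 <= p <= 4).

Lemma measurable_entry_cyl m n (f : R -> V -> 'M[R]_(m, n)) i j : cyl_measurable T f ->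
  measurable_fun cyl (fun z : X * V => f z.1 z.2 i j).
Proof.
have mcyl := @measurable_cyl R _ V T.
by move=> mf; exact: ((measurable_fun_mxP _ mcyl).1 mf i j).
Qed.

Lemma measurable_norm_cyl m n (f : R -> V -> 'M[R]_(m, n)) : cyl_measurable T f ->
  measurable_fun cyl (fun z : X * V => mxnorm (f z.1 z.2) ^+ 2).
Proof.
move=> mf; apply: measurable_funX; apply: measurable_mxnorm => //.
exact: measurable_cyl.
Qed.

Lemma velocity_versions :
  (exists u : 'I_d -> X -> V -> R, forall i, version mu T (u i) (fun t x => v t x i 0)) /\
  (exists w : 'I_d -> 'I_d -> X -> V -> R, forall i j, version mu T (w i j) (fun t x => Dv t x i j)).
Proof.
have [mv mD _ fin] := ws_v_L2H1 sol.
have mg : measurable_fun cyl (fun z : X * V => mxnorm (v z.1 z.2) ^+ 2 + mxnorm (Dv z.1 z.2) ^+ 2).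
  by apply: measurable_funD; exact: measurable_norm_cyl.
have vsn (h : R -> V -> R) : measurable_fun cyl (fun z : X * V => h z.1 z.2) ->
    (forall t x, h t x ^+ 2 <= mxnorm (v t x) ^+ 2 + mxnorm (Dv t x) ^+ 2) -> exists g, version mu T g h.
  by move=> mh hg; apply: (version_exists mh mg hg fin).
have hu i : exists g, version mu T g (fun t x => v t x i 0).
  apply: vsn; first exact: measurable_entry_cyl.
  by move=> t x; apply: (le_trans (entry_sqr_le _ i 0)); rewrite lerDl sqr_ge0.
have hw ij : exists g, version mu T g (fun t x => Dv t x ij.1 ij.2).
  apply: vsn; first exact: measurable_entry_cyl.
  by move=> t x; apply: (le_trans (entry_sqr_le _ ij.1 ij.2)); rewrite lerDr sqr_ge0.
split.
  by exists (fun i => projT1 (cid (hu i))) => i; exact: (projT2 (cid (hu i))).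
by exists (fun i j => projT1 (cid (hw (i, j)))) => i j; exact: (projT2 (cid (hw (i, j)))).
Qed.

Let ae_X (P : R -> Prop) : {ae leb, forall t, t \in `]0, T[ -> P t} ->
  {ae leb, forall t : X, 0 < t < T -> P t}.
Proof.
move=> h; have h' : {ae leb, forall t : X, (t : R) \in `]0, T[ -> P t} := h.
by apply: filterS h' => t ht tT; apply: ht; rewrite in_itv.
Qed.

(** In the plane every moment is bounded; in space the sixth one is, which is
    why [p - 1 <= 3] is required. *)
Lemma dimension_moment : exists m : nat, p - 1 <= m%:R /\ moment_bounded R d m.
Proof.
case: dp => [[-> _]|[-> /andP[_ p4]]].
  exists (Num.bound `|p|); split; last exact: moment_bounded2.
  by have := archi_boundP (normr_ge0 p); have := ler_norm p; lra.
by exists 3%N; split; [lra|exact: moment_bounded3].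
Qed.

Lemma strain_versions :
  (exists f : 'I_d -> 'I_d -> X -> V -> R, forall i j, version mu T (f i j) (fun t x => F t x i j)) /\
  (exists s : 'I_d -> 'I_d -> X -> V -> R, forall i j, version mu T (s i j) (fun t x => stress W (F t x) i j)).
Proof.
have [mF [M /ae_X hM]] := F_H1.
have mS : cyl_measurable T (fun t x => stress W (F t x)).
  have mcyl := @measurable_cyl R _ V T.
  by apply/(measurable_fun_mxP _ mcyl) => i j; exact: measurable_stress.
have hf ij : exists g, version mu T g (fun t x => F t x ij.1 ij.2).
  move: ij => [i j] /=.
  apply: (@version_exists _ _ _ _ _ _ (fun t x => mxnorm (F t x) ^+ 2)).
  + exact: measurable_entry_cyl.
  + exact: measurable_norm_cyl.
  + by move=> t x; exact: entry_sqr_le.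
  + apply: (@cyl_integral_ae_bounded _ _ _ _ _ _ M); first exact: measurable_norm_cyl.
      by move=> t x; exact: sqr_ge0.
    apply: filterS hM => t h tT; have [mFt [D [mDt _ hMt]]] := h tT.
    apply: le_trans hMt; apply: ge0_le_integral => //.
    * by move=> x _; rewrite lee_fin sqr_ge0.
    * by apply/measurable_EFinP/measurable_funX; exact: measurable_mxnorm.
    * apply/measurable_EFinP; apply: measurable_funD; first by apply: measurable_funX; exact: measurable_mxnorm.
      by apply: measurable_sum => k; apply: measurable_funX; exact: measurable_mxnorm.
    * by move=> x _; rewrite lee_fin lerDl; apply: sumr_ge0 => k _; exact: sqr_ge0.
have hs ij : exists g, version mu T g (fun t x => stress W (F t x) ij.1 ij.2).
  move: ij => [i j] /=.
  have [m [pm mb]] := dimension_moment.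
  have p1 : 1 <= p by apply: le_trans p2; rewrite ler1n.
  have [C hC] := stress_integral_bound M p1 pm W1 W3 mb.
  apply: (@version_exists _ _ _ _ _ _ (fun t x => mxnorm (stress W (F t x)) ^+ 2)).
  + exact: (@measurable_entry_cyl _ _ (fun t x => stress W (F t x)) i j mS).
  + exact: (@measurable_norm_cyl _ _ (fun t x => stress W (F t x)) mS).
  + by move=> t x; exact: entry_sqr_le.
  + apply: (@cyl_integral_ae_bounded _ _ _ _ _ _ C);
      first exact: (@measurable_norm_cyl _ _ (fun t x => stress W (F t x)) mS).
      by move=> t x; exact: sqr_ge0.
    by apply: filterS hM => t h tT; exact: hC (h tT).
split.
  by exists (fun i j => projT1 (cid (hf (i, j)))) => i j; exact: (projT2 (cid (hf (i, j)))).
by exists (fun i j => projT1 (cid (hs (i, j)))) => i j; exact: (projT2 (cid (hs (i, j)))).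
Qed.

Section with_versions.
Variables (u : 'I_d -> X -> V -> R) (w f s : 'I_d -> 'I_d -> X -> V -> R).
Hypotheses (hu : forall i, version mu T (u i) (fun t x => v t x i 0))
  (hw : forall i j, version mu T (w i j) (fun t x => Dv t x i j))
  (hf : forall i j, version mu T (f i j) (fun t x => F t x i j))
  (hs : forall i j, version mu T (s i j) (fun t x => stress W (F t x) i j)).
Hypotheses (hv0 : entries_L2 v0) (hF0 : entries_L2 F0).

Let mcont (g : R -> R) : continuous g -> measurable_fun setT (fun z : X * V => g z.1).
Proof. by move=> cg; exact: (measurableT_comp (continuous_measurable1 cg) measurable_fst). Qed.

Let msp (g : V -> R) : measurable_fun setT g -> measurable_fun setT (fun z : X * V => g z.2).
Proof. by move=> mg; exact: (measurableT_comp mg measurable_snd). Qed.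

Lemma strain_tested i j eta e : time_test T eta -> bounded_smooth e ->
  \int[Q]_z (f i j z.1 z.2 * ('D_1 eta z.1 * e z.2) + w i j z.1 z.2 * e z.2 * eta z.1)
  + (\int[mu]_x (F0 x i j * e x)) * eta 0 = 0.
Proof.
move=> [ceta eta0] he; have [sf _ qf] := hf i j; have [sw _ qw] := hw i j.
have me := msp (bounded_smooth_measurable he).
have meta := mcont (ceta 0%N).
have mdeta : measurable_fun setT (fun z : X * V => 'D_1 eta z.1).
  have [_ /(_ 1)[_ cD]] := ceta 1%N.
  exact: (mcont cD).
have [mF _] := F_H1; have [_ mD _ _] := ws_v_L2H1 sol.
have tst := product_test_function (delta_mx i j : 'M[R]_d) ceta he eta0.
rewrite -[RHS](ws_strain sol tst); congr (_ + _); last first.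
  rewrite -RintegralZr; [|by []|by apply: bounded_smooth_mul_intg => //; exact: L2_intg (hF0 i j)].
  apply: eq_Rintegral => x _; rewrite /product_test mxdotZdelta /=.
  by rewrite -mulrA [e x * _]mulrC.
have eH : (fun z : R * V => mxdot (F z.1 z.2) (dt (product_test eta e (delta_mx i j)) z) +
    mxdot (Dv z.1 z.2) (product_test eta e (delta_mx i j) z)) =
    (fun z => F z.1 z.2 i j * ('D_1 eta z.1 * e z.2) + Dv z.1 z.2 i j * (eta z.1 * e z.2)).
  by apply/funext => z; rewrite dt_product_test// !mxdotZdelta.
rewrite eH; symmetry; apply: cyl_Rintegral.
- apply: measurable_funD; apply: measurable_funM.
  + exact: measurable_entry_cyl.
  + by apply: measurable_funTS; exact: measurable_funM.
  + exact: measurable_entry_cyl.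
  + by apply: measurable_funTS; exact: measurable_funM.
- apply: measurable_funD; apply: measurable_funM => //.
  + exact: slab_measurable sf.
  + exact: measurable_funM.
  + by apply: measurable_funM => //; exact: slab_measurable sw.
- by move=> z zT; rewrite (slab_supp sf)// (slab_supp sw)// !mul0r addr0.
- by move: qf qw; apply: filterS2 => z h1 h2 zT; rewrite h1// h2//; ring.
Qed.

Lemma momentum_tested i eta e : time_test T eta -> bounded_smooth e ->
  \int[Q]_z (u i z.1 z.2 * ('D_1 eta z.1 * e z.2) +
     (- \sum_j (s i j z.1 z.2 + w i j z.1 z.2) * 'D_(delta_mx 0 j) e z.2) * eta z.1)
  + (\int[mu]_x (v0 x i 0 * e x)) * eta 0 = 0.
Proof.
move=> [ceta eta0] he; have [su _ qu] := hu i.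
have me := msp (bounded_smooth_measurable he).
have meta := mcont (ceta 0%N).
have mdeta : measurable_fun setT (fun z : X * V => 'D_1 eta z.1).
  have [_ /(_ 1)[_ cD]] := ceta 1%N.
  exact: (mcont cD).
have mde j : measurable_fun setT (fun z : X * V => 'D_(delta_mx 0 j) e z.2).
  exact: msp (bounded_smooth_derive_measurable (delta_mx 0 j) he).
have [mF _] := F_H1; have [mv mD _ _] := ws_v_L2H1 sol.
have mS j : measurable_fun cyl (fun z : X * V => stress W (F z.1 z.2) i j).
  exact: measurable_stress.
have tst := product_test_function (delta_mx i 0 : 'cV[R]_d) ceta he eta0.
rewrite -[RHS](ws_momentum sol tst); congr (_ + _); last first.
  rewrite -RintegralZr; [|by []|by apply: bounded_smooth_mul_intg => //; exact: L2_intg (hv0 i 0)].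
  apply: eq_Rintegral => x _; rewrite /product_test mxdotZdelta /=.
  by rewrite -mulrA [e x * _]mulrC.
have gradE (A : 'M[R]_d) z : mxdot A (grad (product_test eta e (delta_mx i 0 : 'cV[R]_d)) z) =
    \sum_j A i j * (eta z.1 * 'D_(delta_mx 0 j) e z.2).
  rewrite mxdotE (bigD1 i)//= [X in _ + X]big1 ?addr0 => [|k ki]; last first.
    apply: big1 => j _; rewrite mxE derive_product_test// !mxE (negbTE ki)/=.
    by rewrite !mulr0.
  by apply: eq_bigr => j _; rewrite mxE derive_product_test// !mxE !eqxx mul0r mul0r add0r mulr1.
have eH : (fun z : R * V => mxdot (v z.1 z.2) (dt (product_test eta e (delta_mx i 0)) z) -
    mxdot (stress W (F z.1 z.2)) (grad (product_test eta e (delta_mx i 0)) z) -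
    mxdot (Dv z.1 z.2) (grad (product_test eta e (delta_mx i 0)) z)) =
    (fun z => v z.1 z.2 i 0 * ('D_1 eta z.1 * e z.2) -
       (\sum_j (stress W (F z.1 z.2) i j + Dv z.1 z.2 i j) * 'D_(delta_mx 0 j) e z.2) * eta z.1).
  apply/funext => z; rewrite dt_product_test// mxdotZdelta !gradE -addrA; congr (_ + _).
  rewrite -opprD; congr (- _); rewrite -big_split/= mulr_suml; apply: eq_bigr => j _; ring.
rewrite eH; symmetry; apply: cyl_Rintegral.
- apply: measurable_funB; apply: measurable_funM.
  + exact: measurable_entry_cyl.
  + by apply: measurable_funTS; exact: measurable_funM.
  + apply: measurable_sum => j; apply: measurable_funM; last exact: measurable_funTS.
    by apply: measurable_funD => //; exact: measurable_entry_cyl.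
  + exact: measurable_funTS.
- apply: measurable_funD; apply: measurable_funM => //.
  + exact: slab_measurable su.
  + exact: measurable_funM.
  + apply: measurableT_comp => //; apply: measurable_sum => j; apply: measurable_funM => //.
    have [ss _ _] := hs i j; have [sw _ _] := hw i j.
    by apply: measurable_funD; [exact: slab_measurable ss|exact: slab_measurable sw].
- move=> z zT; rewrite (slab_supp su)// big1 ?oppr0 ?mul0r ?addr0// => j _.
  have [ss _ _] := hs i j; have [sw _ _] := hw i j.
  by rewrite (slab_supp ss)// (slab_supp sw)// addr0 mul0r.
- have qsw : {ae Q, forall z : X * V, forall j, 0 < z.1 < T ->
      s i j z.1 z.2 + w i j z.1 z.2 = stress W (F z.1 z.2) i j + Dv z.1 z.2 i j}.
    apply: filter_forall => j; have [_ _ q1] := hs i j; have [_ _ q2] := hw i j.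
    by move: q1 q2; apply: filterS2 => z h1 h2 zT; rewrite h1// h2.
  move: qu qsw; apply: filterS2 => z h1 h2 zT; rewrite h1// mulNr; congr (_ - _ * _).
  by apply: eq_bigr => j _; rewrite h2.
Qed.

End with_versions.
End weak_solution_data.

(** * The energy balance *)

Section primitive_ae.
Variable R : realType.
Local Notation leb := (@lebesgue_measure R).
Local Notation X := (measurableTypeR R).

Lemma prim_ae_eq (a b : X -> R) t : leb.-integrable setT (EFin \o a) ->
  leb.-integrable setT (EFin \o b) -> {ae leb, forall s : X, a s = b s} -> prim a t = prim b t.
Proof.
move=> ia ib ab; apply: ae_eq_Rintegral.
- exact: intg_measurable (indicator_intg t ia).
- exact: intg_measurable (indicator_intg t ib).
- by apply: filterS ab => s ->.
Qed.

(** Both sides are continuous in time, the left one by Cauchy-Schwarz, and the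
    times at which they agree are dense. *)
Lemma square_norm_extend d (Y : measurableType d) (mu : probability Y R) (T : R)
    (g : R -> Y -> R) (N : R -> R) : 0 < T ->
  (forall t, 0 <= t <= T -> L2 mu (g t)) ->
  (forall t e, 0 <= t <= T -> 0 < e -> exists2 dl : R, 0 < dl &
    forall s, 0 <= s <= T -> `|t - s| < dl -> \int[mu]_x ((g s x - g t x) ^+ 2) <= e) ->
  continuous N ->
  {ae leb, forall t : X, 0 < t < T -> \int[mu]_x (g t x ^+ 2) = N t} ->
  forall t, 0 <= t <= T -> \int[mu]_x (g t x ^+ 2) = N t.
Proof.
move=> T0 gL2 gc cN ae t tT; apply/eqP; rewrite -subr_eq0 -normr_le0.
apply/ler_addgt0Pr => eps eps0; rewrite add0r.
have e4 : 0 < eps / 4 by rewrite divr_gt0.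
set I := \int[mu]_x (g t x ^+ 2).
have I0 : 0 <= I by apply: Rintegral_ge0 => x _; exact: sqr_ge0.
pose e := Num.min (eps / 4) ((eps / 4) ^+ 2 / (I + 1)).
have e0 : 0 < e by rewrite lt_min e4 divr_gt0 ?exprn_gt0// ltr_wpDl.
have [d1 d10 h1] := gc t e tT e0.
have [d2 /= d20 h2] : exists2 d2 : R, 0 < d2 & forall s, `|t - s| < d2 -> `|N t - N s| <= eps / 4.
  have /cvgrPdist_le/(_ _ e4)/nbhs_ballP[d2 d20 h] := cN t.
  by exists d2 => // s ts; apply: h; rewrite -ball_normE.
have d0 : 0 < Num.min d1 d2 by rewrite lt_min d10.
have [s [sT + hs]] := ae_dense ae T0 tT d0.
rewrite distrC lt_min => /andP[s1 s2].
have sT' : 0 <= s <= T by have /andP[/ltW -> /ltW ->] := sT.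
have D := h1 s sT' s1; have ND := h2 s s2.
have ht := gL2 t tT; have hs' := gL2 s sT'; have hd := L2B hs' ht.
have [_ it2] := ht; have [_ id2] := hd.
have De : \int[mu]_x ((g s x - g t x) ^+ 2) <= eps / 4 by apply: le_trans D _; rewrite ge_min lexx.
have cross : `|\int[mu]_x (g t x * (g s x - g t x))| <= eps / 4.
  rewrite -(@ler_pXn2r _ 2)// ?nnegrE ?normr_ge0 ?(ltW e4)// real_normK ?num_real//.
  apply: (le_trans (cauchy_schwarz ht hd)); apply: (le_trans (ler_wpM2l I0 D)).
  apply: (@le_trans _ _ (I * ((eps / 4) ^+ 2 / (I + 1)))).
    by apply: (ler_wpM2l I0); rewrite ge_min lexx orbT.
  rewrite mulrCA ler_piMr ?sqr_ge0// ler_pdivrMr ?ltr_wpDl// mul1r; lra.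
have D0 : 0 <= \int[mu]_x ((g s x - g t x) ^+ 2) by apply: Rintegral_ge0 => x _; exact: sqr_ge0.
have ex : \int[mu]_x (g s x ^+ 2) = I + (2 * \int[mu]_x (g t x * (g s x - g t x)) +
    \int[mu]_x ((g s x - g t x) ^+ 2)).
  have icr := L2_mul ht hd.
  rewrite -RintegralZl// -RintegralD//; last exact: intgZ.
  rewrite -RintegralD//; last by apply: intgD => //; exact: intgZ.
  by apply: eq_Rintegral => x _; ring.
have := hs sT; rewrite ex => eN.
move: cross ND; rewrite !ler_norml => /andP[c1 c2] /andP[n1 n2].
by apply/andP; split; lra.
Qed.

Lemma ae_slices_intg d (Y : measurableType d) (mu : probability Y R) (h k : X -> Y -> R) :
  measurable_fun setT (fun z : X * Y => h z.1 z.2) ->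
  (leb \x mu)%E.-integrable setT (EFin \o (fun z : X * Y => k z.1 z.2)) ->
  {ae leb, forall t : X, {ae mu, forall y, h t y = k t y}} ->
  (leb \x mu)%E.-integrable setT (EFin \o (fun z : X * Y => h z.1 z.2)).
Proof.
move=> mh ik hk; have mk := intg_measurable ik.
have mabs (g : X -> Y -> R) : measurable_fun setT (fun z : X * Y => g z.1 z.2) ->
    measurable_fun setT (fun t => \int[mu]_y `|g t y|%:E)%E.
  move=> mg; apply: (@measurable_fun_fubini_tonelli_F _ _ X Y R mu (fun z : X * Y => `|g z.1 z.2|%:E)).
    by apply/measurable_EFinP; exact: measurableT_comp.
  by move=> z; rewrite lee_fin.
apply/(@intg_prodP _ _ X Y R leb mu h mh).
have /(@intg_prodP _ _ X Y R leb mu k mk) := ik.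
apply: le_lt_trans; rewrite le_eqVlt; apply/orP; left; apply/eqP.
apply: ae_eq_integral => //; [exact: mabs|exact: mabs|].
apply: filterS hk => t ht _; apply: ae_eq_integral => //.
- by apply/measurable_EFinP; apply: measurableT_comp => //; exact: (measurable_fun_pair2 t mh).
- by apply/measurable_EFinP; apply: measurableT_comp => //; exact: (measurable_fun_pair2 t mk).
- by apply: filterS ht => y ->.
Qed.

End primitive_ae.

Section energy_balance.
Variables (R : realType) (d : nat) (p T : R) (W : 'M[R]_d -> R).
Variables (v0 : 'rV[R]_d -> 'cV[R]_d) (F0 : 'rV[R]_d -> 'M[R]_d).
Variables (v : R -> 'rV[R]_d -> 'cV[R]_d) (Dv F : R -> 'rV[R]_d -> 'M[R]_d).
Local Notation mu := (torus_measure R d).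
Local Notation leb := (@lebesgue_measure R).
Local Notation X := (measurableTypeR R).
Local Notation V := ('rV[R]_d).
Local Notation Q := (leb \x mu)%E.
Hypotheses (T0 : 0 < T) (p2 : 2 <= p) (W1 : A1 W) (W3 : A3 p W).
Hypothesis sol : weak_solution W p T v0 F0 v Dv F.
Hypothesis F_H1 : Linf_H1 T F.
Hypotheses (hv0 : entries_L2 v0) (hF0 : entries_L2 F0) (F0p : Lp p F0).
Variables (u : 'I_d -> X -> V -> R) (w f s : 'I_d -> 'I_d -> X -> V -> R).
Hypotheses (hu : forall i, version mu T (u i) (fun t x => v t x i 0))
  (hw : forall i j, version mu T (w i j) (fun t x => Dv t x i j))
  (hf : forall i j, version mu T (f i j) (fun t x => F t x i j))
  (hs : forall i j, version mu T (s i j) (fun t x => stress W (F t x) i j)).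

Let sw i j : slab mu T (w i j). Proof. by case: (hw i j). Qed.
Let ss i j : slab mu T (s i j). Proof. by case: (hs i j). Qed.
Let su i : slab mu T (u i). Proof. by case: (hu i). Qed.

(** Defined at all times and all points, hence a candidate for the continuous
    representative of the strain. *)
Definition strain_path (t : R) (x : V) : 'M[R]_d := \matrix_(i, j) (F0 x i j + prim (w i j ^~ x) t).
Local Notation Fc := strain_path.

Lemma strain_path_ae : {ae leb, forall t : X, 0 < t < T -> {ae mu, forall x, Fc t x = F t x}}.
Proof.
have h : {ae leb, forall t : X, forall i j, 0 < t < T -> {ae mu, forall x, F t x i j = F0 x i j + prim (w i j ^~ x) t}}.
  apply: filter_forall => i; apply: filter_forall => j; have [sf af _] := hf i j.
  have := weak_time_derivative T0 sf (sw i j) (hF0 i j)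
    (fun eta e => strain_tested sol F_H1 hw hf hF0 i j (eta := eta) (e := e)).
  move: af; apply: filterS2 => t a1 a2 tT.
  by move: (a1 tT) (a2 tT); apply: filterS2 => x <-.
apply: filterS h => t h tT.
have : {ae mu, forall x, forall i j, F t x i j = F0 x i j + prim (w i j ^~ x) t}.
  by apply: filter_forall => i; apply: filter_forall => j; exact: h.
by apply: filterS => x hx; apply/matrixP => i j; rewrite mxE hx.
Qed.

Lemma strain_path_L2 t i j : L2 mu (fun x => Fc t x i j).
Proof.
have := L2D (hF0 i j) (prim_L2_0 t (sw i j)).
by congr (L2 mu _); apply/funext => x; rewrite mxE.
Qed.

(** Time primitives of square integrable functions are Hoelder continuous of
    order 1/2 with values in L^2. *)
Lemma strain_path_C_L2 : entries_C_L2 T Fc.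
Proof.
split=> [t _ i j|t e tT e0]; first exact: strain_path_L2.
(* a bound common to all entries, so that one modulus serves them all *)
pose K := \sum_i \sum_j \int[Q]_z (w i j z.1 z.2 ^+ 2).
have wK0 i j : 0 <= \int[Q]_z (w i j z.1 z.2 ^+ 2) by apply: Rintegral_ge0 => z _; exact: sqr_ge0.
have K0 : 0 <= K by apply: sumr_ge0 => i _; apply: sumr_ge0.
have wK i j : \int[Q]_z (w i j z.1 z.2 ^+ 2) <= K.
  rewrite /K (bigD1 i)//= (bigD1 j)//= -addrA lerDl addr_ge0//; first exact: sumr_ge0.
  by apply: sumr_ge0 => k _; exact: sumr_ge0.
exists (e / (K + 1)) => [|r rT tr i j]; first by rewrite divr_gt0// ltr_wpDl.
have key a b : a <= b -> b - a < e / (K + 1) ->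
    \int[mu]_x ((prim (w i j ^~ x) b - prim (w i j ^~ x) a) ^+ 2) <= e.
  move=> ab bad; have [_ h] := prim_L2 (sw i j) ab; apply: (le_trans h).
  have := ltW bad; rewrite ler_pdivlMr ?ltr_wpDl// => h2; apply: le_trans h2.
  by rewrite ler_wpM2l ?subr_ge0//; apply: (le_trans (wK i j)); rewrite lerDl.
have [rt|/ltW tr'] := leP r t.
  have -> : \int[mu]_x ((Fc r x i j - Fc t x i j) ^+ 2) =
      \int[mu]_x ((prim (w i j ^~ x) t - prim (w i j ^~ x) r) ^+ 2).
    by apply: eq_Rintegral => x _; rewrite !mxE -sqrrN; congr (_ ^+ 2); ring.
  by apply: key => //; rewrite -[ltLHS]ger0_norm ?subr_ge0.
have -> : \int[mu]_x ((Fc r x i j - Fc t x i j) ^+ 2) =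
    \int[mu]_x ((prim (w i j ^~ x) r - prim (w i j ^~ x) t) ^+ 2).
  by apply: eq_Rintegral => x _; rewrite !mxE; congr (_ ^+ 2); ring.
by apply: key => //; rewrite -[ltLHS]ger0_norm ?subr_ge0// distrC.
Qed.

Let flux i j (t : X) (x : V) := s i j t x + w i j t x.
Let hflux i j : slab mu T (flux i j). Proof. exact: slabD. Qed.
Let q i (t : X) := \sum_j \int[mu]_x (flux i j t x * w i j t x).

Let weak_der i : {ae leb, forall t : X, 0 < t < T -> forall j, weak_derivative (u i t) (w i j t) j}.
Proof.
have [_ _ grd _] := ws_v_L2H1 sol.
have {}grd : {ae leb, forall t : X, (t : R) \in `]0, T[ -> vec_weak_gradient (v t) (Dv t)} := grd.
have aw : {ae leb, forall t : X, forall j, 0 < t < T -> {ae mu, forall x, w i j t x = Dv t x i j}}.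
  by apply: filter_forall => j; case: (hw i j).
have [_ au _] := hu i.
move: grd au aw; apply: filterS3 => t g1 a1 a2 tT j.
have [iv iD wk] : vec_weak_gradient (v t) (Dv t) by apply: g1; rewrite in_itv.
have mu_ : measurable_fun setT (u i t) by case: (slab_L2t (su i) t).
have mw_ : measurable_fun setT (w i j t) by case: (slab_L2t (sw i j) t).
have mv : measurable_fun setT (fun x => v t x i 0) := intg_measurable (iv i 0).
have mD : measurable_fun setT (fun x => Dv t x i j).
  by have := intg_measurable (iD j i 0); under eq_fun do rewrite mxE.
split; [exact: slab_intgt (su i)|exact: slab_intgt (sw i j)|].
move=> phi hphi; have := wk phi j i 0 hphi.
have cphi : continuous phi by exact: Ck_continuous (hphi.1 0%N).
have cdphi : continuous ('D_(delta_mx 0 j) phi) by have [/(_ 1%N)[_ /(_ (delta_mx 0 j))[_ c]] _] := hphi.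
have mphi := continuous_measurable_mx cphi; have mdphi := continuous_measurable_mx cdphi.
move=> e; rewrite (ae_eq_Rintegral (g := fun x => v t x i 0 * 'D_(delta_mx 0 j) phi x)); last 3 first.
- exact: measurable_funM.
- exact: measurable_funM.
- by apply: filterS (a1 tT) => x ->.
rewrite e; congr (- _); apply: ae_eq_Rintegral.
- by under eq_fun do rewrite mxE; exact: measurable_funM.
- exact: measurable_funM.
- by apply: filterS (a2 j tT) => x ->; rewrite mxE.
Qed.

Let tested i eta e (te : time_test T eta) (he : bounded_smooth e) :=
  momentum_tested W1 sol F_H1 hu hw hs hv0 i te he.

Lemma kinetic_energy_ae i : {ae leb, forall t : X, 0 < t < T ->
  \int[mu]_x (u i t x ^+ 2) = \int[mu]_x (v0 x i 0 ^+ 2) - 2 * prim (q i) t}.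
Proof.
have := good_time T0 (su i) (sw i) (hflux i) (hv0 i 0) (weak_der i) (@tested i).
by apply: filterS => t h tT; case: (h tT).
Qed.

Lemma velocity_representative i : exists uc : R -> V -> R,
  [/\ forall t, 0 <= t <= T -> L2 mu (uc t),
      forall t e, 0 <= t <= T -> 0 < e -> exists2 dl : R, 0 < dl &
        forall s, 0 <= s <= T -> `|t - s| < dl -> \int[mu]_x ((uc s x - uc t x) ^+ 2) <= e &
      {ae leb, forall t : X, 0 < t < T -> {ae mu, forall x, uc t x = u i t x}}].
Proof.
have good := good_time T0 (su i) (sw i) (hflux i) (hv0 i 0) (weak_der i) (@tested i).
have err0 := err_vanishes T0 (su i) (sw i) (hflux i) (hv0 i 0) (weak_der i) (@tested i).
have unif n t eps := @un_uniform R d T (flux i) (fun x => v0 x i 0) (hflux i) n t eps.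
apply: (L2_representative T0 _ _ unif err0).
- by move=> n t; apply: bounded_smooth_L2; exact: un_smooth.
- by move=> t; exact: slab_L2t (su i) t.
- by apply: filterS good => t h tT; case: (h tT).
Qed.

Let sol_Fc_ae : {ae leb, forall t : X, forall i j, 0 < t < T -> {ae mu, forall x, stress W (Fc t x) i j = s i j t x}}.
Proof.
have hst : {ae leb, forall t : X, forall i j, 0 < t < T -> {ae mu, forall x, s i j t x = stress W (F t x) i j}}.
  by apply: filter_forall => i; apply: filter_forall => j; case: (hs i j).
move: strain_path_ae hst; apply: filterS2 => t h1 h2 i j tT.
by move: (h1 tT) (h2 i j tT); apply: filterS2 => x -> ->.
Qed.

Lemma measurable_strain_path : measurable_fun setT (fun z : X * V => Fc z.1 z.2).
Proof.
apply/measurable_fun_mxP => // i j; under eq_fun do rewrite mxE.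
apply: measurable_funD; last exact: measurable_prim (sw i j).
have [mF0 _] := hF0 i j; exact: (measurableT_comp mF0 measurable_snd).
Qed.

Let power i j (t : X) x := w i j t x * stress W (Fc t x) i j.

Let power_ae i j : {ae leb, forall t : X, {ae mu, forall x, power i j t x = w i j t x * s i j t x}}.
Proof.
move: sol_Fc_ae; apply: filterS => t h; have [tT|tT] := boolP (0 < t < T).
  by move: (h i j tT); apply: filterS => x e; rewrite /power e.
by apply: aeW => x; rewrite /power (slab_supp (sw i j))// !mul0r.
Qed.

Let measurable_power i j : measurable_fun setT (fun z : X * V => power i j z.1 z.2).
Proof.
apply: measurable_funM; first exact: slab_measurable (sw i j).
exact: (measurable_stress i j W1 measurable_strain_path).
Qed.

Let power_intg i j : Q.-integrable setT (EFin \o (fun z : X * V => power i j z.1 z.2)).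
Proof. exact: ae_slices_intg (measurable_power i j) (slab_mul_intg (sw i j) (ss i j)) (power_ae i j). Qed.

Let W_intg0 : mu.-integrable setT (EFin \o (fun x => W (F0 x))).
Proof.
have [C C0 hC] := W3; have p0 : 0 < p by apply: lt_le_trans p2.
apply: (le_intg (fun x => C * (1 + mxnorm (F0 x) `^ p))).
- exact: (measurableT_comp (continuous_measurable_mx (W1.1)) (entries_L2_measurable hF0)).
- by move=> x; case: (hC (F0 x)).
- apply: intgZ; apply: intgD; last exact: Lp_pow_intg.
  exact: finite_measure_integrable_cst.
Qed.

Definition stress_power (t : X) := \sum_i \sum_j \int[mu]_x (w i j t x * s i j t x).

(** At each point the strain moves along an absolutely continuous curve, along
    which the chain rule for [W] applies. *)
Lemma stored_energy_pointwise t x : 0 <= t ->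
  W (Fc t x) = W (F0 x) + prim (fun r => \sum_i \sum_j power i j r x) t.
Proof.
move=> t0.
pose E (k : 'I_d * 'I_d) : 'M[R]_d := delta_mx k.1 k.2.
pose DG (k : 'I_d * 'I_d) (A : 'M[R]_d) := stress W A k.1 k.2.
have dG k A : is_derive A (E k) W (DG k A).
  by apply: DeriveDef; [exact: (W1.2 (E k)).1|rewrite /DG mxE].
have cDG k : continuous (DG k) by exact: stress_continuous.
pose B (k : 'I_d * 'I_d) : X -> R := w k.1 k.2 ^~ x.
have iB k : leb.-integrable setT (EFin \o B k) by exact: slab_intgY (sw k.1 k.2).
have gamE r : \sum_k prim (B k) r *: E k + F0 x = Fc r x.
  apply/matrixP => i j; rewrite !mxE addrC; congr (_ + _).
  rewrite summxE (bigD1 (i, j))//= !mxE !eqxx mulr1 big1 ?addr0// => -[k l] kl.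
  rewrite !mxE; case: eqP => [e1|]; rewrite ?mulr0//; case: eqP => [e2|]; rewrite ?mulr0//.
  by move: kl; rewrite e1 e2 eqxx.
have B0 k r : ~~ (0 <= r <= T) -> B k r = 0.
  move=> rT; apply: (slab_supp (sw k.1 k.2)); apply: contra rT => /andP[a b].
  by rewrite (ltW a) (ltW b).
have iBD := @chain_rule_intg R 'M[R]_d _ E DG cDG (F0 x) B T iB (ltW T0) B0.
have Fc0 : Fc 0 x = F0 x by apply/matrixP => i j; rewrite !mxE (prim0 _ (sw i j))// addr0.
have := @chain_rule R 'M[R]_d _ E W DG dG cDG (F0 x) B t iB iBD t0.
rewrite !gamE Fc0.
have -> : (fun r : X => \sum_k B k r * DG k (\sum_k0 prim (B k0) r *: E k0 + F0 x)) =
    (fun r => \sum_i \sum_j power i j r x).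
  by apply/funext => r; rewrite gamE pair_bigA.
rewrite [prim _ 0]prim_eq0 ?subr0 => [<-|r r0]; first by rewrite addrC subrK.
apply: big1 => i _; apply: big1 => j _; rewrite /power (slab_supp (sw i j)) ?mul0r//.
by rewrite negb_and -leNgt r0.
Qed.

Lemma stress_power_intg : leb.-integrable setT (EFin \o stress_power).
Proof.
apply: intg_sum => i; apply: intg_sum => j.
exact: (@intg_Rintegral1 _ _ X V R leb mu (fun t x => w i j t x * s i j t x) (slab_mul_intg (sw i j) (ss i j))).
Qed.

Lemma stored_energy_balance t : 0 <= t ->
  mu.-integrable setT (EFin \o (fun x => W (Fc t x))) /\
  \int[mu]_x W (Fc t x) = \int[mu]_x W (F0 x) + prim stress_power t.
Proof.
move=> t0.
have iP : Q.-integrable setT (EFin \o (fun z : X * V => \sum_i \sum_j power i j z.1 z.2)).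
  by apply: intg_sum => i; apply: intg_sum => j; exact: power_intg.
have ip := @prim_intg R _ V mu (fun r x => \sum_i \sum_j power i j r x) iP t.
have -> : (fun x => W (Fc t x)) = (fun x => W (F0 x) + prim (fun r => \sum_i \sum_j power i j r x) t).
  by apply/funext => x; exact: stored_energy_pointwise.
split; first exact: intgD.
rewrite RintegralD//; congr (_ + _).
rewrite (@prim_swap R _ V mu (fun r x => \sum_i \sum_j power i j r x) iP t).
apply: prim_ae_eq; [|exact: stress_power_intg|].
  exact: (@intg_Rintegral1 _ _ X V R leb mu (fun r x => \sum_i \sum_j power i j r x) iP).
have pa : {ae leb, forall r : X, forall i j, mu.-integrable setT (EFin \o power i j r) /\
    {ae mu, forall x, power i j r x = w i j r x * s i j r x}}.
  apply: filter_forall => i; apply: filter_forall => j.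
  by move: (@ae_intg1 _ _ X V R leb mu _ (power_intg i j)) (power_ae i j); apply: filterS2.
apply: filterS pa => r pr.
rewrite Rintegral_sum => [|i]; last by apply: intg_sum => j; case: (pr i j).
apply: eq_bigr => i _; rewrite Rintegral_sum => [|j]; last by case: (pr i j).
apply: eq_bigr => j _; have [ipr apr] := pr i j.
apply: ae_eq_Rintegral => //; first exact: intg_measurable ipr.
by apply: measurable_funM; [case: (slab_L2t (sw i j) r)|case: (slab_L2t (ss i j) r)].
Qed.

Definition dissipation_rate (t : X) := \sum_i \sum_j \int[mu]_x (w i j t x ^+ 2).

Lemma dissipation_rate_intg : leb.-integrable setT (EFin \o dissipation_rate).
Proof.
apply: intg_sum => i; apply: intg_sum => j.
exact: (@intg_Rintegral1 _ _ X V R leb mu (fun t x => w i j t x ^+ 2) (slab_L2 (sw i j)).2).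
Qed.

Lemma dissipationE t : 0 <= t <= T -> dissipation Dv t = (prim dissipation_rate t)%:E.
Proof.
move=> /andP[t0 tT]; have [_ mD _ _] := ws_v_L2H1 sol.
pose h (r : X) x := mxnorm (Dv r x) ^+ 2.
have mh : measurable_fun (`]0, t[%classic `*` setT) (fun z : X * V => h z.1 z.2).
  apply: measurable_funS (measurable_norm_cyl mD); first exact: measurable_cyl.
  move=> z [/= z1 z2]; split => //=; move: z1; rewrite !in_itv/= => /andP[-> z1].
  exact: lt_le_trans z1 tT.
have h0 : forall r x, 0 <= slab_cut t h r x := cut_ge0 t (fun r x => sqr_ge0 (mxnorm (Dv r x))).
have iR := indicator_intg t dissipation_rate_intg.
rewrite /dissipation (cut_integral mu t h) /prim EFin_Rintegral//.
apply: ae_eq_integral => //.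
- exact: measurable_cut_integral.
- exact: measurable_int iR.
have aw : {ae leb, forall r : X, forall i j, 0 < r < T -> {ae mu, forall x, w i j r x = Dv r x i j}}.
  by apply: filter_forall => i; apply: filter_forall => j; case: (hw i j).
move: (ae_neq t) aw; apply: filterS2 => r rt aw _.
have [rt'|rt'] := boolP (0 < r < t).
  have /andP[r0 r_t] := rt'; rewrite (ltW r_t) mul1r.
  have rT : 0 < r < T by rewrite r0 (lt_le_trans r_t).
  have iw i j : mu.-integrable setT (EFin \o (fun x => w i j r x ^+ 2)) := (slab_L2t (sw i j) r).2.
  have isw : mu.-integrable setT (EFin \o (fun x => \sum_i \sum_j w i j r x ^+ 2)).
    by apply: intg_sum => i; exact: intg_sum.
  have -> : dissipation_rate r = \int[mu]_x \sum_i \sum_j w i j r x ^+ 2.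
    rewrite Rintegral_sum => [|i]; last exact: intg_sum.
    by apply: eq_bigr => i _; rewrite Rintegral_sum.
  rewrite EFin_Rintegral//; apply: ae_eq_integral => //.
  - by apply/measurable_EFinP; exact: (measurable_fun_pair2 r (measurable_cut mh)).
  - exact: measurable_int isw.
  have awx : {ae mu, forall x, forall i j, w i j r x = Dv r x i j}.
    by apply: filter_forall => i; apply: filter_forall => j; exact: aw.
  apply: filterS awx => x ex _; rewrite /slab_cut rt' /h mxnorm_sqr.
  by congr EFin; apply: eq_bigr => i _; apply: eq_bigr => j _; rewrite ex.
have -> : (\int[mu]_y (slab_cut t h r y)%:E = 0)%E by rewrite /slab_cut (negbTE rt') integral0.
have [r0|r0] := leP r 0.
  rewrite /dissipation_rate big1 ?mulr0// => i _; apply: big1 => j _.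
  under eq_Rintegral do rewrite (slab_supp (sw i j)) ?expr0n//= -?leNgt ?negb_and -?leNgt ?r0//.
  by rewrite /Rintegral integral0.
move: rt'; rewrite r0/= -leNgt le_eqVlt eq_sym (negbTE rt)/= => tr.
by rewrite leNgt tr mul0r.
Qed.

Let q_intg i : leb.-integrable setT (EFin \o q i).
Proof.
apply: intg_sum => j.
exact: (@intg_Rintegral1 _ _ X V R leb mu (fun t x => flux i j t x * w i j t x) (slab_mul_intg (hflux i j) (sw i j))).
Qed.

Lemma kinetic_energy_balance vc : entries_C_L2 T vc ->
  {ae leb, forall t : X, 0 < t < T -> {ae mu, forall x, vc t x = v t x}} ->
  forall t, 0 <= t <= T -> forall i,
    \int[mu]_x (vc t x i 0 ^+ 2) = \int[mu]_x (v0 x i 0 ^+ 2) - 2 * prim (q i) t.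
Proof.
move=> [vL2 vcont] av t tT i.
apply: (@square_norm_extend R _ V mu T (fun r x => vc r x i 0)
  (fun r => \int[mu]_x (v0 x i 0 ^+ 2) - 2 * prim (q i) r)) => //.
- by move=> r rT; exact: vL2.
- move=> r e rT e0; have [dl dl0 h] := vcont r e rT e0; exists dl => // r' r'T rr'.
  exact: h.
- move=> r; apply: cvgB; first exact: cvg_cst.
  by apply: cvgM; [exact: cvg_cst|exact: (prim_continuous (q_intg i))].
have [_ au _] := hu i.
move: av au (kinetic_energy_ae i); apply: filterS3 => r a1 a2 a3 rT.
rewrite -(a3 rT); apply: ae_eq_Rintegral.
- have /andP[r0 r1] := rT; have rT' : 0 <= r <= T by rewrite (ltW r0) (ltW r1).
  by apply: measurable_funX; case: (vL2 r rT' i 0).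
- by apply: measurable_funX; case: (slab_L2t (su i) r).
- by move: (a1 rT) (a2 rT); apply: filterS2 => x -> ->.
Qed.

(** The square norm of the difference of two continuous representatives is
    continuous and vanishes almost everywhere in time. *)
Lemma strain_unique F' : entries_C_L2 T F' ->
  {ae leb, forall t : X, 0 < t < T -> {ae mu, forall x, F' t x = F t x}} ->
  forall t, 0 <= t <= T -> {ae mu, forall x, F' t x = Fc t x}.
Proof.
move=> [FL2 Fcont] aF t tT; have [cL2 ccont] := strain_path_C_L2.
pose g i j r x := F' r x i j - Fc r x i j.
have gL2 i j r : 0 <= r <= T -> L2 mu (g i j r) by move=> rT; exact: L2B (FL2 r rT i j) (cL2 r rT i j).
have g0 i j : \int[mu]_x (g i j t x ^+ 2) = 0.
  apply: (@square_norm_extend R _ V mu T (g i j) (cst 0)) => //.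
  - exact: gL2.
  - move=> r e rT e0; have e4 : 0 < e / 4 by rewrite divr_gt0.
    have [d1 d10 h1] := Fcont r _ rT e4; have [d2 d20 h2] := ccont r _ rT e4.
    exists (Num.min d1 d2) => [|r' r'T]; first by rewrite lt_min d10.
    rewrite lt_min => /andP[rr1 rr2].
    have hA := L2B (FL2 r' r'T i j) (FL2 r rT i j).
    have hB := L2B (cL2 r' r'T i j) (cL2 r rT i j).
    have iA := intgZ 2 hA.2; have iB := intgZ 2 hB.2.
    apply: (@le_trans _ _ (\int[mu]_x (2 * (F' r' x i j - F' r x i j) ^+ 2 + 2 * (Fc r' x i j - Fc r x i j) ^+ 2))).
      apply: le_Rintegral => //.
      + exact: (L2B (gL2 i j r' r'T) (gL2 i j r rT)).2.
      + exact: intgD.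
      + move=> x _; rewrite /g; set a := F' r' x i j - F' r x i j; set b := Fc r' x i j - Fc r x i j.
        rewrite (_ : _ - _ - (_ - _) = a - b); last by rewrite /a /b; ring.
        by have := sqr_ge0 (a + b); nra.
    rewrite RintegralD// (RintegralZl 2 measurableT hA.2) (RintegralZl 2 measurableT hB.2).
    have := h1 r' r'T rr1 i j; have := h2 r' r'T rr2 i j; lra.
  - move=> r; exact: cvg_cst.
  - move: aF strain_path_ae; apply: filterS2 => r a1 a2 rT.
    have /andP[r0 r1] := rT; have rT' : 0 <= r <= T by rewrite (ltW r0) (ltW r1).
    have -> : (cst 0 : R -> R) r = \int[mu]_x 0 by rewrite Rintegral_prob_cst.
    apply: ae_eq_Rintegral => //; first by apply: measurable_funX; case: (gL2 i j r rT').
    by move: (a1 rT) (a2 rT); apply: filterS2 => x e1 e2; rewrite /g e1 e2 subrr expr0n.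
have : {ae mu, forall x, forall i j, F' t x i j = Fc t x i j}.
  apply: filter_forall => i; apply: filter_forall => j.
  have [mg ig] := gL2 i j t tT.
  have := Rintegral_eq0_ae (measurable_funX 2 mg) (fun x => sqr_ge0 (g i j t x)) ig (g0 i j).
  by apply: filterS => x /eqP; rewrite sqrf_eq0 subr_eq0 => /eqP.
by apply: filterS => x hx; apply/matrixP.
Qed.

Lemma energyE v' F' : entries_L2 v' -> mu.-integrable setT (EFin \o (fun x => W (F' x))) ->
  energy W v' F' = (2^-1 * \sum_i \int[mu]_x (v' x i 0 ^+ 2) + \int[mu]_x W (F' x))%:E.
Proof.
move=> hv' iW; have [i2 e2] := entries_L2_norm_intg hv'.
have i2' := intgZ 2^-1 i2.
have -> : \sum_i \int[mu]_x (v' x i 0 ^+ 2) = \int[mu]_x (mxnorm (v' x) ^+ 2).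
  by rewrite e2; apply: eq_bigr => i _; rewrite big_ord1.
rewrite -(RintegralZl _ _ i2)// -RintegralD// EFin_Rintegral; last exact: intgD.
by apply: eq_integral => x _; rewrite mulrC.
Qed.

(** The stress works against the kinetic energy exactly as much as it adds to
    the stored energy, so that only the viscous dissipation remains. *)
Lemma energy_balance vc F' : entries_C_L2 T vc -> entries_C_L2 T F' ->
  {ae leb, forall t : X, 0 < t < T -> {ae mu, forall x, vc t x = v t x}} ->
  {ae leb, forall t : X, 0 < t < T -> {ae mu, forall x, F' t x = F t x}} ->
  forall t, 0 <= t <= T -> (energy W (vc t) (F' t) + dissipation Dv t = energy W v0 F0)%E.
Proof.
move=> cv cF av aF t tT; have /andP[t0 _] := tT.
have [iWc eWc] := stored_energy_balance t0.
have FF' := strain_unique cF aF tT.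
have mWF' : measurable_fun setT (fun x => W (F' t x)).
  exact: (measurableT_comp (continuous_measurable_mx W1.1) (entries_L2_measurable (cF.1 t tT))).
have WFF' : {ae mu, forall x, W (F' t x) = W (Fc t x)} by apply: filterS FF' => x ->.
have WFF'' : {ae mu, forall x, W (Fc t x) = W (F' t x)} by apply: filterS FF' => x ->.
have iWF' := ae_eq_intg mWF' WFF'' iWc.
rewrite (energyE (cv.1 t tT) iWF') (energyE hv0 W_intg0) dissipationE//.
rewrite (ae_eq_Rintegral mWF' (intg_measurable iWc) WFF') eWc.
have -> : \sum_i \int[mu]_x (vc t x i 0 ^+ 2) =
    \sum_i \int[mu]_x (v0 x i 0 ^+ 2) - 2 * (prim stress_power t + prim dissipation_rate t).
  under eq_bigr do rewrite (kinetic_energy_balance cv av tT).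
  rewrite sumrB -mulr_sumr -prim_sum; last exact: q_intg.
  rewrite -primD; [|exact: stress_power_intg|exact: dissipation_rate_intg].
  congr (_ - 2 * prim _ t); apply/funext => r.
  rewrite /stress_power /dissipation_rate -big_split/=; apply: eq_bigr => i _.
  rewrite -big_split/=; apply: eq_bigr => j _.
  rewrite -RintegralD//; last 2 first.
  - exact: L2_mul (slab_L2t (sw i j) r) (slab_L2t (ss i j) r).
  - exact: (slab_L2t (sw i j) r).2.
  by apply: eq_Rintegral => x _; rewrite /flux; ring.
by rewrite -EFinD; congr EFin; field.
Qed.

Lemma representatives_exist : exists vc Fc',
  [/\ entries_C_L2 T vc, entries_C_L2 T Fc',
    {ae leb, forall t : X, 0 < t < T -> {ae mu, forall x, vc t x = v t x}} &
    {ae leb, forall t : X, 0 < t < T -> {ae mu, forall x, Fc' t x = F t x}}].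
Proof.
pose uc i := projT1 (cid (velocity_representative i)).
have huc i : _ := projT2 (cid (velocity_representative i)).
exists (fun t x => \col_i uc i t x), Fc; split.
- split=> [t tT i j|t e tT e0].
    by have [h _ _] := huc i; under eq_fun do rewrite mxE; exact: h.
  have dl_ i : exists2 dl : R, 0 < dl & forall r, 0 <= r <= T -> `|t - r| < dl ->
      \int[mu]_x ((uc i r x - uc i t x) ^+ 2) <= e by have [_ h _] := huc i; exact: h.
  pose dl i := projT1 (cid2 (dl_ i)).
  exists (\big[Num.min/1]_i dl i) => [|r rT tr i j].
    apply: (big_ind (fun y => 0 < y)) => // [a b a0 b0|i _]; first by rewrite lt_min a0.
    by rewrite /dl; case: (cid2 _).
  under eq_Rintegral do rewrite !mxE.
  have [h1 h2] : 0 < dl i /\ (forall r, 0 <= r <= T -> `|t - r| < dl i ->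
      \int[mu]_x ((uc i r x - uc i t x) ^+ 2) <= e) by rewrite /dl; case: (cid2 _).
  by apply: h2 => //; apply: (lt_le_trans tr); exact: bigmin_le_cond.
- exact: strain_path_C_L2.
- have : {ae leb, forall t : X, forall i, 0 < t < T -> {ae mu, forall x, uc i t x = v t x i 0}}.
    apply: filter_forall => i; have [_ _ h] := huc i; have [_ au _] := hu i.
    move: h au; apply: filterS2 => t a1 a2 tT.
    by move: (a1 tT) (a2 tT); apply: filterS2 => x e1 e2; rewrite /uc e1 e2.
  apply: filterS => t h tT.
  have : {ae mu, forall x, forall i, uc i t x = v t x i 0} by apply: filter_forall => i; exact: h.
  by apply: filterS => x hx; apply/matrixP => i j; rewrite mxE hx ord1.
- exact: strain_path_ae.
Qed.

End energy_balance.

Theorem theorem2p5 (R : realType) (d : nat) (p T : R) (W : 'M[R]_d -> R)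
    (v0 : 'rV[R]_d -> 'cV[R]_d) (F0 : 'rV[R]_d -> 'M[R]_d)
    (v : R -> 'rV[R]_d -> 'cV[R]_d) (Dv F : R -> 'rV[R]_d -> 'M[R]_d)
    (T_gt0 : 0 < T) (p_ge2 : 2 <= p)
    (W_A1 : A1 W) (W_A2 : A2 p W) (W_A3 : A3 p W)
    (v0_L2 : Lp 2 v0) (F0_H1 : H1 F0) (F0_Lp : Lp p F0)
    (vF_sol : weak_solution W p T v0 F0 v Dv F)
    (F_LinfH1 : Linf_H1 T F)
    (dp : (d = 2%N /\ 2 <= p) \/ (d = 3%N /\ 2 <= p <= 4)) :
  (exists vc Fc, continuous_representative T v vc /\
                 continuous_representative T F Fc) /\
  (forall vc Fc, continuous_representative T v vc ->
                 continuous_representative T F Fc ->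
   forall t, t \in `[0, T] ->
     (energy W (vc t) (Fc t) + dissipation Dv t = energy W v0 F0)%E).
Proof.
have entries_v0 : entries_L2 v0 by apply/Lp2P.
have entries_F0 : entries_L2 F0 by have [M /H1_entries[D []]] := F0_H1.
have [[u hu] [w hw]] := velocity_versions vF_sol.
have [[f hf] [s hs]] := strain_versions p_ge2 W_A1 W_A3 F_LinfH1 dp.
have repP m n (g gc : R -> 'rV[R]_d -> 'M[R]_(m, n)) : continuous_representative T g gc <->
    entries_C_L2 T gc /\ {ae lebesgue_measure, forall t : measurableTypeR R, 0 < t < T ->
      {ae torus_measure R d, forall x, gc t x = g t x}}.
  by split=> -[/C_L2P h1 h2]; split.
split.
  have [vc [Fc [c1 c2 a1 a2]]] := representatives_exist T_gt0 W_A1 vF_sol F_LinfH1 entries_v0 entries_F0 hu hw hf hs.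
  by exists vc, Fc; split; apply/repP.
move=> vc Fc /repP[cv av] /repP[cF aF] t; rewrite in_itv/= => tT.
exact: (energy_balance T_gt0 p_ge2 W_A1 W_A3 vF_sol F_LinfH1 entries_v0 entries_F0 F0_Lp hu hw hf hs cv cF av aF tT).
Qed.
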